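(* Let $0<r<R<\infty$. (I) There exists a constant $c\in(0,1)$ such that for any $\varepsilon>0$ there exists a positive integer $V$ such that if $\nu>V$ then the positive zeros $x_{\nu,k}$ of $\mathfrak{f}_\nu$ satisfy $$x_{\nu,k}=F(\nu,k-\tau_{\nu,k})+R_{\nu,k},\qquad( * )$$ where $$\tau_{\nu,k}=\begin{cases}0,&\text{if } rx_{\nu,k}\ge\nu+\nu^{1/3+\varepsilon},\\ \psi_1(z_{\nu,k}),&\text{if }\nu-\nu^{1/3+\varepsilon}<rx_{\nu,k}<\nu+\nu^{1/3+\varepsilon},\\ 1/4,&\text{if } rx_{\nu,k}\le\nu-\nu^{1/3+\varepsilon},\end{cases}$$ with $z_{\nu,k}$ determined by $rx_{\nu,k}=\nu+z_{\nu,k}\nu^{1/3}$, and $$R_{\nu,k}=\begin{cases}O\left((\nu+k)^{-1}\right),&\text{if } rx_{\nu,k}\ge(1+c)\nu,\\ O\left(\nu^{1/2}\left(k-\frac{G(r)}{r}\nu\right)^{-3/2}\right),&\text{if }\nu+\nu^{1/3+\varepsilon}\le rx_{\nu,k}<(1+c)\nu,\\ O\left(\nu^{-2/3+3\varepsilon}\right),&\text{if }\nu-\nu^{1/3+\varepsilon}<rx_{\nu,k}<\nu+\nu^{1/3+\varepsilon},\\ O\left(\nu^{1/3}k^{-4/3}\right),&\text{if } rx_{\nu,k}\le\nu-\nu^{1/3+\varepsilon}.\end{cases}$$ If $0\le\nu\le V$, there exists a positive integer $K$ such that if $k>K$ then $( * )$ holds with $\tau_{\nu,k}=0$ and $R_{\nu,k}=O\left((\nu+k)^{-1}\right)$.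 (II) Let $\delta\in\mathbb{R}$. There exists a constant $c\in(0,1)$ such that for any $\varepsilon>0$ there exists an integer $V>|\delta|$ such that if $\nu>V$ then the positive zeros $x''_{\nu,k}$ of $\mathfrak{h}_{\nu,\delta}$ satisfy $$x''_{\nu,k}=F(\nu,k+\widetilde\tau_{\nu,k})+\widetilde R_{\nu,k},\qquad( ** )$$ where $$\widetilde\tau_{\nu,k}=\begin{cases}0,&\text{if } rx''_{\nu,k}\ge\nu+\nu^{1/3+\varepsilon},\\ \psi_2(z''_{\nu,k}),&\text{if }\nu-\nu^{1/3+\varepsilon}<rx''_{\nu,k}<\nu+\nu^{1/3+\varepsilon},\\ 1/4,&\text{if } rx''_{\nu,k}\le\nu-\nu^{1/3+\varepsilon},\end{cases}$$ with $z''_{\nu,k}$ determined by $rx''_{\nu,k}=\nu+z''_{\nu,k}\nu^{1/3}$, and $$\widetilde R_{\nu,k}=\begin{cases}O\left((\nu+k)^{-1}\right),&\text{if } rx''_{\nu,k}\ge(1+c)\nu,\\ O\left(\nu^{1/2}\left(k-\frac{G(r)}{r}\nu\right)^{-3/2}\right),&\text{if }\nu+\nu^{1/3+\varepsilon}\le rx''_{\nu,k}<(1+c)\nu,\\ O\left(\nu^{-2/3+3\varepsilon}\right),&\text{if }\nu-\nu^{1/3+\varepsilon}<rx''_{\nu,k}<\nu+\nu^{1/3+\varepsilon},\\ O\left(\frac{\nu^{1/3}}{(k+1)^{4/3}}+\frac{\nu^{-1/3-\varepsilon/2}}{(k+1)^{1/3}}\right),&\text{if } rx''_{\nu,k}\le\nu-\nu^{1/3+\varepsilon}.\end{cases}$$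 If $|\delta|\le\nu\le V$, there exists a positive integer $K$ such that if $k>K$ then $( ** )$ holds with $\widetilde\tau_{\nu,k}=0$ and $\widetilde R_{\nu,k}=O\left((\nu+k)^{-1}\right)$.
   Context: $J_\nu,Y_\nu$ are Bessel functions of the first and second kind of real order $\nu\ge0$. For $x>0$, $$\mathfrak{f}_\nu(x):=J_\nu(Rx)Y_\nu(rx)-J_\nu(rx)Y_\nu(Rx),$$ and, with $j_\nu(x)=x^{-\delta}J_\nu(x)$, $y_\nu(x)=x^{-\delta}Y_\nu(x)$ and $\nu\ge|\delta|$, $$\mathfrak{h}_{\nu,\delta}(x):=j_\nu'(Rx)y_\nu'(rx)-j_\nu'(rx)y_\nu'(Rx).$$ All positive zeros are simple and listed in increasing order: those of $\mathfrak{f}_\nu$ as $x_{\nu,k}$, $k=1,2,\dots$; those of $\mathfrak{h}_{\nu,\delta}$ as $x''_{\nu,k}$, with $k$ beginning with $0$ if $\nu>|\delta|$ and with $1$ if $\nu=|\delta|$. Let $g(x)=\left(\sqrt{1-x^2}-x\arccos x\right)/\pi$ on $[0,1]$, and $G(x)=Rg(x/R)-rg(x/r)$ for $0\le x\le r$, $G(x)=Rg(x/R)$ for $r\le x\le R$. $F:[0,\infty)\times[0,\infty)\setminus\{(0,0)\}\to\mathbb{R}$ is the function homogeneous of degree $1$ with $F\equiv1$ on the graph of $G$ (the Minkowski functional of the graph of $G$). The functions $\psi_1,\psi_2:\mathbb{R}\to(0,1/4)$ are strictly decreasing $C^1$ functions with $\psi_i(0)=1/12$, $\psi_i(-\infty)=1/4$,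 $\psi_i(+\infty)=0$, given as follows. With $\mathrm{Ai},\mathrm{Bi}$ the Airy functions, let $\beta_1,\beta_2:\mathbb{R}\to\mathbb{R}$ be the continuous functions such that $\pi\beta_1(z)$ is an argument of the complex number $(\mathrm{Ai}+i\,\mathrm{Bi})(-2^{1/3}z)$ with $\beta_1(0)=1/3$, and $\pi\beta_2(z)$ is an argument of $(\mathrm{Ai}'+i\,\mathrm{Bi}')(-2^{1/3}z)$ with $\beta_2(0)=2/3$. Then, with $z_+=\max\{z,0\}$, $$\psi_1(z)=\beta_1(z)+\tfrac{2\sqrt2}{3\pi}z_+^{3/2}-\tfrac14,\qquad \psi_2(z)=-\beta_2(z)-\tfrac{2\sqrt2}{3\pi}z_+^{3/2}+\tfrac34.$$ Implicit constants are independent of $\nu$ and $k$ (they may depend on $r,R,\delta,c,\varepsilon$). *)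

(* Defs.v *)
From Stdlib Require Export Reals Factorial.
From Coquelicot Require Export Coquelicot.
Open Scope R_scope.

(** * Special functions

    [Rpower a s] is the real power only for [0 < a]; every use below and in the
    theorem has a positive base, on the range where it matters. *)

(** Reciprocal Gamma function by Gauss's product
    [1/Gamma(z) = lim z(z+1)...(z+n) / (n! n^z)], valid for every real [z]
    (it vanishes at the poles 0, -1, -2, ... of Gamma). *)
Definition rGamma (z : R) : R :=
  real (Lim_seq (fun n : nat =>
    prod_f_R0 (fun i : nat => z + INR i) n / (INR (fact n) * Rpower (INR n) z))).

(** [J_nu(x) = (x/2)^nu sum_m (-1)^m (x/2)^(2m) / (m! Gamma(m+nu+1))], for real
    [nu] of any sign and [0 < x]. *)
Definition besselJ (nu x : R) : R :=
  Rpower (x / 2) nu *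
  PSeries (fun m : nat => (-1) ^ m * rGamma (INR m + nu + 1) / INR (fact m))
          ((x / 2) ^ 2).

Definition besselY_quot (nu x : R) : R :=
  (besselJ nu x * cos (nu * PI) - besselJ (- nu) x) / sin (nu * PI).

(** The quotient is meaningless exactly when [nu] is an integer, i.e. when
    [sin (nu * PI) = 0]; there Y_nu is its limit as the order tends to [nu]. *)
Definition besselY (nu x : R) : R :=
  if Req_EM_T (sin (nu * PI)) 0
  then real (Lim (fun mu : R => besselY_quot mu x) nu)
  else besselY_quot nu x.

(** Coefficients of the two Maclaurin solutions of [w'' = x w]:
    [sum_k airy_coef0 k x^(3k)] has initial data (1, 0) and
    [sum_k airy_coef1 k x^(3k+1)] has initial data (0, 1). *)
Fixpoint airy_coef0 (k : nat) : R :=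
  match k with
  | O => 1
  | S j => airy_coef0 j / ((3 * INR (S j) - 1) * (3 * INR (S j)))
  end.

Fixpoint airy_coef1 (k : nat) : R :=
  match k with
  | O => 1
  | S j => airy_coef1 j / ((3 * INR (S j)) * (3 * INR (S j) + 1))
  end.

Definition airy_solution (w0 w1 x : R) : R :=
  w0 * PSeries airy_coef0 (x ^ 3) + w1 * (x * PSeries airy_coef1 (x ^ 3)).

(** Standard initial values: [Ai(0) = 3^(-2/3)/Gamma(2/3)],
    [Ai'(0) = -3^(-1/3)/Gamma(1/3)], [Bi(0) = 3^(-1/6)/Gamma(2/3)],
    [Bi'(0) = 3^(1/6)/Gamma(1/3)]. *)
Definition Ai (x : R) : R :=
  airy_solution (Rpower 3 (- (2/3)) * rGamma (2/3))
                (- (Rpower 3 (- (1/3)) * rGamma (1/3))) x.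

Definition Bi (x : R) : R :=
  airy_solution (Rpower 3 (- (1/6)) * rGamma (2/3))
                (Rpower 3 (1/6) * rGamma (1/3)) x.

(** * Cross-products of Bessel functions and their zeros *)

Definition frak_f (r R' nu x : R) : R :=
  besselJ nu (R' * x) * besselY nu (r * x)
  - besselJ nu (r * x) * besselY nu (R' * x).

Definition small_j (nu delta x : R) : R := Rpower x (- delta) * besselJ nu x.
Definition small_y (nu delta x : R) : R := Rpower x (- delta) * besselY nu x.

Definition frak_h (r R' nu delta x : R) : R :=
  Derive (small_j nu delta) (R' * x) * Derive (small_y nu delta) (r * x)
  - Derive (small_j nu delta) (r * x) * Derive (small_y nu delta) (R' * x).

(** [x k0 < x (k0+1) < ...] is the complete list of the positive zeros of [f];
    the values [x k] with [k < k0] are irrelevant. *)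
Definition lists_positive_zeros (f : R -> R) (k0 : nat) (x : nat -> R) : Prop :=
  (forall k : nat, (k0 <= k)%nat -> 0 < x k /\ f (x k) = 0 /\ x k < x (S k)) /\
  (forall t : R, 0 < t -> f t = 0 -> exists k : nat, (k0 <= k)%nat /\ x k = t).

Definition h_first_index (nu delta : R) : nat :=
  if Req_EM_T nu (Rabs delta) then 1%nat else 0%nat.

(** * The functions G and F *)

Definition g (x : R) : R := (sqrt (1 - x ^ 2) - x * acos x) / PI.

(** Meaningful for [0 <= x <= R']. *)
Definition G (r R' x : R) : R :=
  if Rle_dec x r then R' * g (x / R') - r * g (x / r) else R' * g (x / R').

Definition graph_G (r R' u v : R) : Prop := 0 <= u <= R' /\ v = G r R' u.

(** [inf { t > 0 : (u, v) in t A }]. *)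
Definition minkowski_functional (A : R -> R -> Prop) (u v : R) : R :=
  real (Glb_Rbar (fun t : R => 0 < t /\ A (u / t) (v / t))).

(** [G] is decreasing with [G 0 > 0 = G R'], so every ray of the closed first
    quadrant meets the graph exactly once and [F] is the degree-1 homogeneous
    function equal to 1 on the graph. *)
Definition F (r R' u v : R) : R := minkowski_functional (graph_G r R') u v.

(** * The functions psi_1 and psi_2 *)

Definition is_argument (theta : R) (w : C) : Prop :=
  Re w = Cmod w * cos theta /\ Im w = Cmod w * sin theta.

(** [PI * beta] is a continuous determination of the argument of [w]. *)
Definition continuous_argument (w : R -> C) (b0 : R) (beta : R -> R) : Prop :=
  (forall z : R, continuous beta z) /\ beta 0 = b0 /\
  (forall z : R, is_argument (PI * beta z) (w z)).

Definition is_beta1 : (R -> R) -> Prop :=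
  continuous_argument
    (fun z => (Ai (- Rpower 2 (1/3) * z), Bi (- Rpower 2 (1/3) * z))) (1/3).

Definition is_beta2 : (R -> R) -> Prop :=
  continuous_argument
    (fun z => (Derive Ai (- Rpower 2 (1/3) * z),
               Derive Bi (- Rpower 2 (1/3) * z))) (2/3).

(** [max(z,0)^(3/2)]; not written with [Rpower], whose value at base 0 is 1. *)
Definition pos_pow_3_2 (z : R) : R := Rmax z 0 * sqrt (Rmax z 0).

Definition psi1 (beta1 : R -> R) (z : R) : R :=
  beta1 z + 2 * sqrt 2 / (3 * PI) * pos_pow_3_2 z - 1/4.

Definition psi2 (beta2 : R -> R) (z : R) : R :=
  - beta2 z - 2 * sqrt 2 / (3 * PI) * pos_pow_3_2 z + 3/4.

(** tau_{nu,k} (for [psi = psi1]) and its tilde analogue (for [psi = psi2]) at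
    the zero [x]; the argument of [psi] is the [z] with [r x = nu + z nu^(1/3)]. *)
Definition tau (psi : R -> R) (r nu eps x : R) : R :=
  if Rle_dec (nu + Rpower nu (1/3 + eps)) (r * x) then 0
  else if Rle_dec (r * x) (nu - Rpower nu (1/3 + eps)) then 1/4
  else psi ((r * x - nu) / Rpower nu (1/3)).

(* Main.v *)
Require Import Defs.
From Stdlib Require Import Reals Lra Lia Psatz ZArith Ranalysis5.
From Coquelicot Require Import Coquelicot.
Open Scope R_scope.

(** In the variable [t = ln x] the Bessel equation becomes [u'' + (e^(2t) - nu^2) u = 0]. The Prüfer angle of
    the solution that satisfies the boundary condition at [ln (r x)] increases at every multiple of [PI], so its value
    at [ln (R' x)] counts the zeros of the cross-product: it equals [k PI] (up to the boundary angle) exactly at the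
    [k]-th zero. A shear that fixes the multiples of [PI] turns Prüfer angles into WKB angles, which grow like the
    phase [PI x g(nu/x)] up to an error governed by a signed correction term. Hence, writing [HH x] for
    [PI] times the difference of these phases at [R' x] and [r x] (only the first one below the turning point),
    [HH x_k = k PI + T + error]:
    - if [r x] is right of the turning point [nu], both ends are in the WKB zone and [T = 0];
    - if [r x] is within [nu^(1/3+eps)] of [nu], the equation is compared with the Airy equation [w'' = - y w] at the
      scale [nu^(1/3)], and [T] is read off the Airy connection formula, that is, off [beta_1] or [beta_2];
    - if [r x] is left of that window, the solution is dominated by the recessive one [J_nu] from the turning point on,
      whose WKB phase is [PI/4].
    Since [F(nu, .)] inverts [HH / PI], lower bounds for the slope of [HH] turn the phase errors into the stated bounds. *)

(** Logarithmic time is chosen because [q = e^(2t) - nu^2] increases there: an energy argument then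
    shows that the phase difference increases whenever it is a multiple of [PI], although it need
    not be monotone in between. Angles are real numbers, never classes modulo [PI], so the index [k]
    is exact. The connection constants are found without integral representations. As the order
    grows, the asymptotic phase of [J_nu] tends to that of the recessive Airy solution. The
    recurrence in the order turns the direction at infinity by a quarter turn, which carries this
    constant to every order above [-1], and the elementary order [1/2] gives its value [PI/4]. The
    orders [-1/3] and [1/3] are the Airy series themselves; with the recessive solution this makes
    three known directions, and projective linearity yields all the others. That the Gamma values in
    [Ai] select the recessive solution is read off the coefficients of the power series. The slope
    of [HH] degenerates at [nu / R']; it is therefore bounded below in terms of [HH] itself. *)

Ltac pos :=
  first [assumption | lra | pos_step]
with pos_step :=
  lazymatch goal with
  | |- _ /\ _ => split; pos
  | |- _ <> 0 => apply Rgt_not_eq; unfold Rgt; pos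
  | |- 0 < _ * _ => apply Rmult_lt_0_compat; pos
  | |- 0 < _/_ => apply Rdiv_lt_0_compat; pos
  | |- 0 < / _ => apply Rinv_0_lt_compat; pos
  | |- 0 < exp _ => apply exp_pos
  | |- 0 < Rpower _ _ => apply exp_pos
  | |- 0 < sqrt _ => apply sqrt_lt_R0; pos
  | |- 0 < _^_ => apply pow_lt; pos
  | |- 0 < INR _ => apply lt_0_INR; lia
  | |- 0 < _ + _ => first [apply Rplus_lt_0_compat; pos | apply Rplus_lt_le_0_compat; pos | apply Rplus_le_lt_0_compat; pos]
  | |- 0 <= _^2 => apply pow2_ge_0
  | |- 0 <= Rabs _ => apply Rabs_pos
  | |- 0 <= sqrt _ => apply sqrt_pos
  | |- 0 <= INR _ => apply pos_INR
  | |- 0 <= ?a * ?a => apply Rle_0_sqr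
  | |- 0 <= _ * _ => apply Rmult_le_pos; pos
  | |- 0 <= _/_ => apply Rmult_le_pos; pos
  | |- 0 <= / _ => left; pos
  | |- 0 <= exp _ => left; pos
  | |- 0 <= Rpower _ _ => left; pos
  | |- 0 <= _^_ => apply pow_le; pos
  | |- 0 <= _ + _ => apply Rplus_le_le_0_compat; pos
  | |- ?a * _ <= ?a * _ => apply Rmult_le_compat_l; pos
  | |- _ * ?a <= _ * ?a => apply Rmult_le_compat_r; pos
  | |- _ * _ <= _ * _ => apply Rmult_le_compat; pos
  | |- _ / ?a <= _ / ?a => apply Rmult_le_compat_r; pos
  | |- ?a/_ <= ?a/_ => apply Rmult_le_compat_l; pos
  | |- / _ <= / _ => apply Rinv_le_contravar; pos
  | |- _ ^ ?n <= _ ^ ?n => apply pow_incr; pos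
  | |- sqrt _ <= sqrt _ => apply sqrt_le_1_alt; pos
  | |- Rpower _ ?a <= Rpower _ ?a => apply Rle_Rpower_l; pos
  | |- Rpower ?a _ <= Rpower ?a _ => apply Rle_Rpower; pos
  | |- Rabs ?a <= ?a => apply Req_le, Rabs_pos_eq; pos
  | |- Rabs _ <= _ => apply Rabs_le; pos
  | |- Rabs _ < _ => apply Rabs_def1; pos
  | |- Rabs ?a = ?a => apply Rabs_pos_eq; pos
  | |- _ + _ <= _ + _ => apply Rplus_le_compat; pos
  | |- ?a * _ < ?a * _ => apply Rmult_lt_compat_l; pos
  | |- _ * ?a < _ * ?a => apply Rmult_lt_compat_r; pos
  | |- _ / ?a < _ / ?a => apply Rmult_lt_compat_r; pos
  | |- / _ < / _ => apply Rinv_lt_contravar; pos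
  | |- sqrt _ < sqrt _ => apply sqrt_lt_1_alt; pos
  | |- exp _ < exp _ => apply exp_increasing; pos
  | |- ln _ < ln _ => apply ln_increasing; pos
  end.

Ltac unfold_lets := repeat match goal with |- context [?x] => is_var x; progress unfold x end.

Ltac abs_hyps := repeat match goal with
  | H : Rabs _ <= _ |- _ => apply Rabs_le_between in H
  | H : Rabs _ < _ |- _ => apply Rabs_def2 in H
  end.

Ltac obv :=
  first
  [ pos
  | reflexivity
  | progress intros; auto; obv
  | lazymatch goal with |- @eq R _ _ => first [ring | field; repeat split; pos] end
  | lia
  | solve [auto]
  | abs_hyps; pos
  | progress unfold_lets; obv
  | nra ].

Notation ok := (ltac:(obv)) (only parsing).
Tactic Notation "have" ident(h) ":" lconstr(T) := assert (h : T) by obv.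
Tactic Notation "have" ident(h) ":" lconstr(T) "by" tactic3(t) := assert (h : T) by t.
Tactic Notation "have" ident(h) ":=" lconstr(t) := assert (h := t).
Tactic Notation "have" ":" lconstr(T) := assert T by obv.
Tactic Notation "have" ":" lconstr(T) "by" tactic3(t) := assert T by t.
Tactic Notation "turn" constr(a) "into" constr(b) := replace a with b by obv.
Tactic Notation "turn" constr(a) "into" constr(b) "in" hyp_list(h) := replace a with b in h by obv.
Tactic Notation "turn" constr(a) "into" constr(b) "in" "*" := replace a with b in * by obv.
Tactic Notation "turn" constr(a) "into" constr(b) "at" integer(h) := replace a with b at h by obv.

(** * Elementary calculus, differential inequalities and angles *)

Lemma is_derive_eq (f : R -> R) (t l l' : R) : is_derive f t l -> l = l' -> is_derive f t l'.
Proof. intros H E; rewrite <- E; exact H. Qed.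

Ltac Rring := match goal with |- ?a = ?b => change (@eq R a b) end; ring.

Ltac Rfield := match goal with |- ?a = ?b => change (@eq R a b) end; field.

Ltac splits := repeat match goal with |- _ /\ _ => split end.

Ltac derive_subst :=
  repeat match goal with
  | |- context [Derive ?g ?t] =>
      match goal with
      | H : is_derive _ t ?l |- _ =>
          replace (Derive g t) with l by (symmetry; apply is_derive_unique; exact H)
      end
  end.

Ltac derive_tac :=
  eapply is_derive_eq; [auto_derive; [splits; try (eexists; eassumption)|reflexivity]|derive_subst].

Lemma is_derive_ct (f : R -> R) t l : is_derive f t l -> continuity_pt f t.
Proof.
  intros H. apply continuity_pt_filterlim.
  apply (ex_derive_continuous (K := R_AbsRing) (V := R_NormedModule)). now exists l.
Qed.

Lemma deriv_mvt (f : R -> R) a b : a <= b ->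
  (forall t, a <= t <= b -> ex_derive f t) ->
  exists c, a <= c <= b /\ f b - f a = Derive f c * (b - a).
Proof.
  intros Hab H.
  destruct (MVT_gen f a b (Derive f)) as [c [Hc E]].
  - intros x Hx. apply Derive_correct, H.
    rewrite Rmin_left, Rmax_right in Hx; lra.
  - intros x Hx. rewrite Rmin_left, Rmax_right in Hx by lra.
    destruct (H x) as [l Hl]; [lra|]. eapply is_derive_ct, Hl.
  - rewrite Rmin_left, Rmax_right in Hc by lra. exists c; split; auto.
Qed.

Lemma deriv_nonneg_le (f : R -> R) a b : a <= b ->
  (forall t, a <= t <= b -> exists l, is_derive f t l /\ 0 <= l) -> f a <= f b.
Proof.
  intros Hab H.
  destruct (deriv_mvt f a b Hab) as [c [Hc E]].
  - intros t Ht; destruct (H t Ht) as [l [Hl _]]; now exists l.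
  - destruct (H c Hc) as [l [Hl P]]. rewrite (is_derive_unique _ _ _ Hl) in E. nra.
Qed.

Lemma deriv_zero_const (f : R -> R) : (forall t, is_derive f t 0) -> forall x y, f x = f y.
Proof.
  assert (G : forall x y, x <= y -> (forall t, is_derive f t 0) -> f x = f y).
  { intros x y Hxy H. apply Rle_antisym.
    - apply deriv_nonneg_le; auto. intros; exists 0; split; auto; lra.
    - assert (- f x <= - f y); [|lra].
      apply (deriv_nonneg_le (fun t => - f t)); auto.
      intros; exists (-0); split; [|lra]. apply (is_derive_opp f); auto. }
  intros H x y; destruct (Rle_dec x y); [obv|symmetry; apply G; auto; lra].
Qed.

Lemma deriv_pos_lt (f : R -> R) a b : a < b ->
  (forall t, a <= t <= b -> exists l, is_derive f t l /\ 0 < l) -> f a < f b.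
Proof.
  intros Hab H.
  destruct (deriv_mvt f a b) as [c [Hc E]]; [lra| |].
  - intros t Ht; destruct (H t Ht) as [l [Hl _]]; now exists l.
  - destruct (H c Hc) as [l [Hl P]]. rewrite (is_derive_unique _ _ _ Hl) in E. nra.
Qed.

Lemma is_derive_sqr_neg_part x : is_derive (fun y => (Rmin y 0)^2) x (2 * Rmin x 0).
Proof.
  destruct (Rtotal_order x 0) as [H | [H | H]].
  - apply is_derive_ext_loc with (f := fun y => y^2).
    + apply (locally_interval _ x m_infty 0); simpl; auto.
      intros y _ Hy; simpl. rewrite Rmin_left by lra; ring.
    + rewrite Rmin_left by lra. eapply is_derive_eq; [auto_derive; [pos|reflexivity]|ring].
  - subst. apply is_derive_Reals. intros eps He. exists (mkposreal eps He).
    intros h Hh Hlt; simpl in Hlt. rewrite Rplus_0_l, (Rmin_left 0 0) by lra.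
    turn ((Rmin h 0^2 - 0^2)/h - 2 * 0) into (Rmin h 0^2/h).
    unfold Rmin; destruct (Rle_dec h 0).
    + turn (h^2/h) into h. auto.
    + turn (0^2/h) into 0. rewrite Rabs_R0; auto.
  - apply is_derive_ext_loc with (f := fun y => 0).
    + apply (locally_interval _ x 0 p_infty); simpl; auto.
      intros y Hy _; simpl. simpl in Hy. rewrite Rmin_right by lra; ring.
    + rewrite Rmin_right by lra. rewrite Rmult_0_r. apply (is_derive_const 0 x).
Qed.

(** The square of the negative part of [g] is differentiable even where [g] vanishes, and its
    derivative is nonpositive; it starts at 0, so it stays 0. No first exit time has to be
    chosen. *)
Lemma nonneg_barrier (g : R -> R) a b : a <= b -> 0 <= g a ->
  (forall t, a <= t <= b -> exists l, is_derive g t l /\ (g t < 0 -> 0 <= l)) -> 0 <= g b.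
Proof.
  intros Hab H0 H.
  destruct (Rle_dec 0 (g b)); auto. exfalso.
  assert (K : - (Rmin (g a) 0)^2 <= - (Rmin (g b) 0)^2).
  { apply (deriv_nonneg_le (fun t => - (Rmin (g t) 0)^2)); auto.
    intros t Ht. destruct (H t Ht) as [l [Hl P]].
    exists (- (l * (2 * Rmin (g t) 0))). split.
    - apply (is_derive_opp (fun t => (Rmin (g t) 0)^2)).
      apply (is_derive_comp (fun y => Rmin y 0^2) g); auto. apply is_derive_sqr_neg_part.
    - destruct (Rlt_dec (g t) 0) as [h|h].
      + rewrite Rmin_left by lra. nra.
      + rewrite Rmin_right by lra. lra. }
  rewrite (Rmin_right (g a)), (Rmin_left (g b)) in K by lra. nra.
Qed.

(* One-sided Gronwall: the differential inequality is only needed where [D] is positive. *)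
Lemma gronwall (D D' K k E e : R -> R) a b : a <= b ->
  (forall t, a <= t <= b -> is_derive D t (D' t) /\ is_derive K t (k t) /\ is_derive E t (e t)
     /\ 0 <= k t /\ 0 <= e t /\ (0 < D t -> D' t <= e t + k t * D t)) ->
  D b <= exp (K b - K a) * (Rmax (D a) 0 + (E b - E a)).
Proof.
  intros Hab H.
  set (M := Rmax (D a) 0).
  have HM : D a <= M /\ 0 <= M by (unfold M; split; [apply Rmax_l|apply Rmax_r]).
  assert (mon : forall t, a <= t <= b -> K a <= K t /\ E a <= E t).
  { intros t Ht; split; apply deriv_nonneg_le; try lra; intros s Hs;
      destruct (H s) as (h1 & h2 & h3 & h4 & h5 & _); try lra; eauto. }
  (* Integrating factor as a barrier: where this expression is negative, [D] is positive, which is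
     exactly where the differential inequality is available. *)
  assert (G : 0 <= M + (E b - E a) - D b * exp (- (K b - K a))).
  { apply (nonneg_barrier (fun t => M + (E t - E a) - D t * exp (- (K t - K a))) a b Hab).
    - turn (- (K a - K a)) into 0. rewrite exp_0. lra.
    - intros t Ht. destruct (H t Ht) as (h1 & h2 & h3 & h4 & h5 & h6).
      exists (e t - (D' t - k t * D t) * exp (- (K t - K a))). split.
      + eapply is_derive_eq.
        * auto_derive; [|reflexivity]. splits; eexists; eauto.
        * derive_subst. unfold Rminus. ring.
      + intros Hneg. destruct (mon t Ht).
        assert (X : 0 < exp (- (K t - K a)) <= 1).
        { split; [pos|]. rewrite <- exp_0.
          destruct (Req_dec (K t) (K a)) as [e1|e1]; [right; f_equal; lra|left; apply exp_increasing; lra]. }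
        obv. }
  assert (X : exp (K b - K a) * exp (- (K b - K a)) = 1).
  { rewrite <- exp_plus. rewrite <- exp_0. f_equal; ring. }
  have Y := exp_pos (K b - K a).
  replace (D b) with (exp (K b - K a) * (D b * exp (- (K b - K a)))) by (rewrite <- (Rmult_1_l (D b)) at 2; rewrite <- X; ring).
  obv.
Qed.

Lemma gronwall_abs (D D' K k E e : R -> R) a b : a <= b ->
  (forall t, a <= t <= b -> is_derive D t (D' t) /\ is_derive K t (k t) /\ is_derive E t (e t)
     /\ 0 <= k t /\ 0 <= e t /\ (0 < D t -> D' t <= e t + k t * D t)
     /\ (D t < 0 -> - D' t <= e t + k t * - D t)) ->
  Rabs (D b) <= exp (K b - K a) * (Rabs (D a) + (E b - E a)).
Proof.
  intros Hab H.
  have A1 := gronwall D D' K k E e a b Hab.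
  have A2 := gronwall (fun t => - D t) (fun t => - D' t) K k E e a b Hab.
  have B1 := A1 ltac:(intros t Ht; destruct (H t Ht) as (h1&h2&h3&h4&h5&h6&h7); splits; auto).
  assert (B2 : - D b <= exp (K b - K a) * (Rmax (- D a) 0 + (E b - E a))).
  { apply A2. intros t Ht; destruct (H t Ht) as (h1&h2&h3&h4&h5&h6&h7).
    splits; auto; [apply (is_derive_opp D); auto|pos]. }
  have Y := exp_pos (K b - K a).
  have C1 : Rmax (D a) 0 <= Rabs (D a) by (apply Rmax_lub; [apply Rle_abs|pos]).
  have C2 : Rmax (- D a) 0 <= Rabs (D a) by (apply Rmax_lub; [rewrite <- Rabs_Ropp; apply Rle_abs|pos]).
  apply Rabs_le. split; nra.
Qed.

Lemma sin_le_abs x : Rabs (sin x) <= Rabs x.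
Proof.
  assert (P : forall x, 0 <= x -> Rabs (sin x) <= x).
  { intros y Hy. assert (sin y <= y).
    { destruct Hy as [Hy|Hy]; [left; now apply sin_lt_x|subst; rewrite sin_0; lra]. }
    destruct (Rle_dec y PI).
    - rewrite Rabs_pos_eq; auto. apply sin_ge_0; auto.
    - have h := SIN_bound y. have h2 := PI2_1. obv. }
  destruct (Rle_dec 0 x).
  - rewrite (Rabs_pos_eq x); auto.
  - rewrite (Rabs_left x) by lra. rewrite <- Rabs_Ropp, <- sin_neg. apply P; lra.
Qed.

Lemma sin2_sub x y : sin x^2 - sin y^2 = sin (x + y) * sin (x - y).
Proof.
  rewrite sin_plus, sin_minus.
  have h := sin2_cos2 x. have h' := sin2_cos2 y. unfold Rsqr in *.
  turn (cos x) into (cos x).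
  obv.
Qed.

Lemma cs1 x : cos x^2 = 1 - sin x^2.
Proof. have h := sin2_cos2 x; unfold Rsqr in h; lra. Qed.

Lemma sin2_sub_le x y : Rabs (sin x^2 - sin y^2) <= Rabs (x - y).
Proof.
  rewrite sin2_sub, Rabs_mult.
  have h := sin_le_abs (x - y). have h2 := Rabs_pos (sin (x - y)).
  have : Rabs (sin (x + y)) <= 1 by (apply Rabs_le; apply SIN_bound). nra.
Qed.

Lemma angle_unique x y : Rabs (x - y) < 2 * PI -> sin x = sin y -> cos x = cos y -> x = y.
Proof.
  intros H hs hc. apply Rabs_lt_between in H.
  assert (C : cos (x - y) = 1).
  { rewrite cos_minus, hs, hc. have h := sin2_cos2 y; unfold Rsqr in h; lra. }
  turn (x - y) into (2 * ((x - y)/2)) in C.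
  rewrite cos_2a_sin in C. set (z := (x - y)/2) in *.
  have S0 : sin z = 0.
  have : -PI < z < PI.
  destruct (Rtotal_order z 0) as [h|[h|h]].
  - have : sin (- z) > 0 by (apply sin_gt_0; lra). rewrite sin_neg in *; lra.
  - unfold z in h; lra.
  - have : sin z > 0 by (apply sin_gt_0; lra). lra.
Qed.

Lemma sin_plus_kPI x (k : Z) : sin (x + IZR k * PI) = cos (IZR k * PI) * sin x.
Proof. rewrite sin_plus. rewrite (sin_eq_0_1 (IZR k * PI)); [ring|now exists k]. Qed.
Lemma cos_plus_kPI x (k : Z) : cos (x + IZR k * PI) = cos (IZR k * PI) * cos x.
Proof. rewrite cos_plus. rewrite (sin_eq_0_1 (IZR k * PI)); [ring|now exists k]. Qed.
Lemma cos_kPI_sq (k : Z) : cos (IZR k * PI)^2 = 1.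
Proof. rewrite cs1. rewrite (sin_eq_0_1 (IZR k * PI)); [ring|now exists k]. Qed.

Lemma floor_exists (x : R) : exists k : Z, IZR k * PI <= x < (IZR k + 1) * PI.
Proof.
  destruct (archimed (x/PI)) as [h1 h2]. have P := PI_RGT_0.
  exists (up (x/PI) - 1)%Z. rewrite minus_IZR.
  have E : x = x/PI * PI.
  obv.
Qed.

(** * Lifted shears *)

(* [Sh a b x] is the angle, within [PI] of [x], of the image of the vector
   [(sin x, cos x)] under [(s, c) |-> (s, a c + b s)]. *)
Definition Shc a b x := a * cos x + b * sin x.
Definition Shn a b x := sin x^2 + Shc a b x^2.
Definition Sh a b x :=
  x + 2 * atan (sin x * (cos x - Shc a b x)/(sqrt (Shn a b x) + (sin x^2 + Shc a b x * cos x))).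

Lemma Shn_lower a b x : 0 < a -> a^2/(1 + a^2 + b^2) <= Shn a b x.
Proof.
  intros Ha. unfold Shn, Shc. have h := cs1 x.
  set (s := sin x) in *; set (c := cos x) in *.
  have : 0 < 1 + a^2 + b^2.
  apply Rmult_le_reg_r with (1 + a^2 + b^2); auto.
  unfold Rdiv; rewrite Rmult_assoc, Rinv_l, Rmult_1_r by lra.
  (* the trace of the Gram matrix bounds its larger eigenvalue *)
  have h1 : s^2 + c^2 = 1.
  assert (a^2 * (s^2 + c^2) <= (s^2 + (a * c + b * s)^2) * ((1 + a^2 + b^2))).
  { have X : (s^2 + (a * c + b * s)^2) * (1 + a^2 + b^2) * (s^2 + c^2) - a^2 * (s^2 + c^2) * (s^2 + c^2)
      = (s^2 + (a * c + b * s)^2)^2 + (a * b * c^2 + (1 + b^2 - a^2) * s * c - a * b * s^2)^2 .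
    rewrite h1 in *. have h3 := pow2_ge_0 (s^2 + (a * c + b * s)^2).
    have h4 := pow2_ge_0 (a * b * c^2 + (1 + b^2 - a^2) * s * c - a * b * s^2). lra. }
  obv.
Qed.

Lemma Shn_pos a b x : 0 < a -> 0 < Shn a b x.
Proof.
  intros Ha. eapply Rlt_le_trans; [|now apply Shn_lower].
  obv.
Qed.

(** The half-angle formula [tan (turn/2) = cross/(norm + dot)] behind [Sh] fails only if a vector is
    sent to a negative multiple of itself. The shear keeps the sine component, so this could only
    happen at sine 0, where the cosine component is multiplied by [a > 0]. *)
Lemma Sh_den_pos a b x : 0 < a -> 0 < sqrt (Shn a b x) + (sin x^2 + Shc a b x * cos x).
Proof.
  intros Ha. have P := Shn_pos a b x Ha. have Q := sqrt_lt_R0 _ P.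
  have Q2 := sqrt_sqrt _ (Rlt_le _ _ P).
  set (n := sqrt (Shn a b x)) in *. have h := cs1 x.
  unfold Shn in *. set (c := Shc a b x) in *. set (s := sin x) in *. set (c0 := cos x) in *.
  assert (D : n * n - (s^2 + c * c0)^2 = s^2 * (c0 - c)^2).
  { rewrite Q2. turn (s^2 + c^2 - (s^2 + c * c0)^2) into (s^2*(1 - s^2) + c^2 * (1 - c0^2) - 2 * s^2 * c * c0).
    obv. }
  destruct (Rlt_dec 0 (s^2 + c * c0)); [lra|].
  destruct (Req_dec s 0) as [e|e].
  - exfalso. apply n0. have E : c = a * c0 by (unfold c, Shc; fold s c0; rewrite e; ring).
    rewrite E, e. rewrite e in h. nra.
  - destruct (Req_dec c0 c) as [e2|e2].
    + exfalso. apply n0. rewrite <- e2. nra.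
    + obv.
Qed.

Lemma sincos_2atan z : sin (2 * atan z) = 2 * z/(1 + z^2) /\ cos (2 * atan z) = (1 - z^2)/(1 + z^2).
Proof.
  have P : 0 < 1 + z² by (unfold Rsqr; nra).
  have Q := sqrt_lt_R0 _ P. have Q2 := sqrt_sqrt _ (Rlt_le _ _ P).
  rewrite sin_2a, cos_2a, sin_atan, cos_atan. unfold Rsqr in *. set (n := sqrt (1 + z * z)) in *.
  turn (1 + z^2) into (n * n). split; field; lra.
Qed.

Lemma Sh_dir a b x : 0 < a ->
  sin x = sqrt (Shn a b x) * sin (Sh a b x) /\ Shc a b x = sqrt (Shn a b x) * cos (Sh a b x).
Proof.
  intros Ha. have P := Shn_pos a b x Ha. have Q := sqrt_lt_R0 _ P.
  have Q2 := sqrt_sqrt _ (Rlt_le _ _ P). have Dp := Sh_den_pos a b x Ha.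
  have h := cs1 x. unfold Sh. rewrite sin_plus, cos_plus.
  set (c := Shc a b x) in *. set (n := sqrt (Shn a b x)) in *. unfold Shn in Q2; fold c in Q2.
  set (s := sin x) in *; set (c0 := cos x) in *. set (d := s^2 + c * c0) in *.
  set (z := s * (c0 - c)/(n + d)).
  destruct (sincos_2atan z) as [E1 E2]. rewrite E1, E2.
  assert (D : (s * (c0 - c))^2 = n * n - d^2).
  { rewrite Q2. unfold d. turn (s^2 + c^2 - (s^2 + c * c0)^2) into (s^2*(1 - s^2) + c^2 * (1 - c0^2) - 2 * s^2 * c * c0).
    obv. }
  assert (Z2 : 1 + z^2 = 2 * n/(n + d)).
  { unfold z. turn (1 + (s * (c0 - c)/(n + d))^2) into (((n + d)^2 + (s * (c0 - c))^2)/(n + d)^2).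
    rewrite D. field. lra. }
  assert (S2 : 2 * z/(1 + z^2) = s * (c0 - c)/n).
  { rewrite Z2. obv. }
  assert (C2 : (1 - z^2)/(1 + z^2) = d/n).
  { turn (1 - z^2) into (2 - (1 + z^2)). rewrite Z2. field. lra. }
  rewrite S2, C2. unfold d. split.
  - field_simplify; [|lra]. turn (c0^2) into (1 - s^2). ring.
  - field_simplify; [|lra]. turn (c0^2) into (1 - s^2). ring.
Qed.

Lemma Sh_near a b x : Rabs (Sh a b x - x) < PI.
Proof.
  unfold Sh. match goal with |- Rabs (_ + 2 * atan ?z - _) < _ => have h := atan_bound z end.
  obv.
Qed.

Lemma Sh_shift a b x (k : Z) : Sh a b (x + IZR k * PI) = Sh a b x + IZR k * PI.
Proof.
  unfold Sh, Shn, Shc. rewrite sin_plus_kPI, cos_plus_kPI. have h := cos_kPI_sq k.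
  set (e := cos (IZR k * PI)) in *.
  turn ((e * sin x)^2) into (e^2 * sin x^2).
  turn ((a * (e * cos x) + b * (e * sin x))^2) into (e^2 * (a * cos x + b * sin x)^2).
  turn ((a * (e * cos x) + b * (e * sin x)) * (e * cos x)) into (e^2 * ((a * cos x + b * sin x) * cos x)).
  replace (e * sin x * (e * cos x - (a * (e * cos x) + b * (e * sin x)))) with
    (e^2 * (sin x * (cos x - (a * cos x + b * sin x)))) by ring.
  rewrite h, !Rmult_1_l. ring.
Qed.

Lemma Sh_0 a b : Sh a b 0 = 0.
Proof. unfold Sh. rewrite sin_0, Rmult_0_l. unfold Rdiv; rewrite Rmult_0_l, atan_0; ring. Qed.

Lemma Sh_kPI a b (k : Z) : Sh a b (IZR k * PI) = IZR k * PI.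
Proof. rewrite <- (Rplus_0_l (IZR k * PI)), Sh_shift, Sh_0; ring. Qed.

Lemma Sh_range a b x (k : Z) : 0 < a -> IZR k * PI <= x <= (IZR k + 1) * PI ->
  IZR k * PI <= Sh a b x <= (IZR k + 1) * PI.
Proof.
  intros Ha Hx.
  assert (G : forall y, 0 <= y <= PI -> 0 <= Sh a b y <= PI).
  { intros y Hy. destruct (Sh_dir a b y Ha) as [E _].
    have N := Sh_near a b y. apply Rabs_lt_between in N.
    have Q := sqrt_lt_R0 _ (Shn_pos a b y Ha). have s0 := sin_ge_0 y (proj1 Hy) (proj2 Hy).
    have S : 0 <= sin (Sh a b y).
    split; apply Rnot_lt_le; intro.
    - have : sin (- Sh a b y) > 0 by (apply sin_gt_0; lra). rewrite sin_neg in *; lra.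
    - have : sin (Sh a b y) < 0 by (apply sin_lt_0; lra). lra. }
  specialize (G (x - IZR k * PI) ok).
  turn x into (x - IZR k * PI + IZR k * PI). rewrite Sh_shift. lra.
Qed.

(** Both sides give the direction of the image under the product of the two matrices, and both stay
    between the consecutive multiples of [PI] that enclose [x]; hence they agree as real numbers. *)
Lemma Sh_comp a1 b1 a2 b2 x : 0 < a1 -> 0 < a2 ->
  Sh a2 b2 (Sh a1 b1 x) = Sh (a2 * a1) (a2 * b1 + b2) x.
Proof.
  intros H1 H2. have H12 : 0 < a2 * a1.
  destruct (floor_exists x) as [k Hk]. have P := PI_RGT_0.
  have R1 := Sh_range a1 b1 x k H1 ok.
  have R2 := Sh_range a2 b2 _ k H2 R1.
  have R3 := Sh_range (a2 * a1) (a2 * b1 + b2) x k H12 ok.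
  destruct (Sh_dir a1 b1 x H1) as [E1 E1']. destruct (Sh_dir a2 b2 (Sh a1 b1 x) H2) as [E2 E2'].
  destruct (Sh_dir (a2 * a1) (a2 * b1 + b2) x H12) as [E3 E3'].
  have P1 := Shn_pos a1 b1 x H1. have P2 := Shn_pos a2 b2 (Sh a1 b1 x) H2.
  have P3 := Shn_pos (a2 * a1) (a2 * b1 + b2) x H12.
  set (m1 := sqrt (Shn a1 b1 x)) in *. set (m2 := sqrt (Shn a2 b2 (Sh a1 b1 x))) in *.
  have Q1 : 0 < m1. have Q2 : 0 < m2.
  assert (E4 : Shc (a2 * a1) (a2 * b1 + b2) x = m1 * Shc a2 b2 (Sh a1 b1 x)).
  { unfold Shc at 2. rewrite Rmult_plus_distr_l. turn (m1 * (a2 * cos (Sh a1 b1 x))) into (a2 * (m1 * cos (Sh a1 b1 x))).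
    rewrite <- E1'. turn (m1 * (b2 * sin (Sh a1 b1 x))) into (b2 * (m1 * sin (Sh a1 b1 x))). rewrite <- E1.
    unfold Shc. ring. }
  assert (E5 : sqrt (Shn (a2 * a1) (a2 * b1 + b2) x) = m1 * m2).
  { apply sqrt_lem_1; [lra|nra|]. unfold Shn at 1. rewrite E4. rewrite E1, E2.
    turn (m1 * m2 * (m1 * m2)) into (m1 * m1 * (m2 * m2)). unfold m2 at 1 2.
    rewrite sqrt_sqrt by lra. unfold Shn. obv. }
  rewrite E5 in *. rewrite E1 in E3. rewrite E2 in E3. rewrite E4, E2' in E3'.
  apply angle_unique.
  - apply Rabs_def1; lra.
  - apply Rmult_eq_reg_l with (m1 * m2); [|nra]. rewrite <- E3. ring.
  - apply Rmult_eq_reg_l with (m1 * m2); [|nra]. obv.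
Qed.

Lemma Sh_1 x : Sh 1 0 x = x.
Proof. unfold Sh, Shc. turn (cos x - (1 * cos x + 0 * sin x)) into 0.
  rewrite Rmult_0_r. unfold Rdiv; rewrite Rmult_0_l, atan_0; ring. Qed.

Lemma Sh_inv a b x : 0 < a -> Sh a b (Sh (/ a) (- b/a) x) = x.
Proof.
  intros Ha. rewrite Sh_comp; auto; [|pos].
  turn (a * / a) into 1. turn (a * (- b/a) + b) into 0. apply Sh_1.
Qed.

(** The formula with [atan] is used for differentiability only. The value of the derivative comes
    from differentiating the identity that the image vector is parallel to [(sin, cos)] of the new
    angle. *)
Lemma Sh_derive (a b x : R -> R) (a' b' x' t : R) : 0 < a t ->
  is_derive a t a' -> is_derive b t b' -> is_derive x t x' ->
  is_derive (fun t => Sh (a t) (b t) (x t)) t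
    ((a t * x' - sin (x t) * cos (x t) * a' - sin (x t)^2 * b')/Shn (a t) (b t) (x t)).
Proof.
  intros Ha h1 h2 h3.
  have P := Shn_pos (a t) (b t) (x t) Ha. have Q := sqrt_lt_R0 _ P.
  assert (La : locally t (fun s => 0 < a s)).
  { have C := is_derive_ct _ _ _ h1. apply continuity_pt_filterlim in C.
    apply (C (fun y => 0 < y)). apply (locally_interval _ (a t) 0 p_infty); simpl; auto. }
  assert (Ex : ex_derive (fun t => Sh (a t) (b t) (x t)) t).
  { unfold Sh, Shn, Shc. have Dp := Sh_den_pos (a t) (b t) (x t) Ha.
    unfold Shn, Shc in *. auto_derive. splits; try (eexists; eassumption).
    - exact P.
    - obv. }
  destruct Ex as [e0 He0]. assert (exists e : R, is_derive (fun t => Sh (a t) (b t) (x t)) t e) as [e He] by (now exists e0). clear e0 He0.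
  set (s := fun t => sin (x t)). set (c := fun t => Shc (a t) (b t) (x t)).
  set (et := fun t => Sh (a t) (b t) (x t)) in *.
  assert (Z : is_derive (fun t => s t * cos (et t) - c t * sin (et t)) t 0).
  { apply is_derive_ext_loc with (f := fun _ => 0); [|apply (is_derive_const 0 t)].
    revert La; apply filter_imp; intros y Hy. unfold s, c, et.
    destruct (Sh_dir (a y) (b y) (x y) Hy) as [E1 E2]. obv. }
  assert (Z2 : is_derive (fun t => s t * cos (et t) - c t * sin (et t)) t
     (cos (x t) * x' * cos (et t) - s t * sin (et t) * e
      - (a' * cos (x t) - a t * sin (x t) * x' + b' * sin (x t) + b t * cos (x t) * x') * sin (et t) - c t * cos (et t) * e)).
  { unfold s, c, Shc. eapply is_derive_eq.
    - auto_derive; [|reflexivity]. splits; try (eexists; eassumption).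
    - derive_subst. ring. }
  have Eq := is_derive_unique _ _ _ Z2. rewrite (is_derive_unique _ _ _ Z) in Eq.
  destruct (Sh_dir (a t) (b t) (x t) Ha) as [E1 E2].
  eapply is_derive_eq; [exact He|].
  apply Rmult_eq_reg_r with (Shn (a t) (b t) (x t)); [|lra].
  unfold Rdiv; rewrite Rmult_assoc, Rinv_l, Rmult_1_r by lra.
  set (n := sqrt (Shn (a t) (b t) (x t))) in *.
  have Q2 : n * n = Shn (a t) (b t) (x t) by (apply sqrt_sqrt; lra).
  fold (et t) in E1, E2. fold (s t) in E1. fold (c t) in E2.
  assert (En : e * n * n = cos (x t) * x' * c t - (a' * cos (x t) - a t * sin (x t) * x' + b' * sin (x t) + b t * cos (x t) * x') * s t).
  { rewrite E2 at 1. rewrite E1 at 1.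
    have cc := cs1 (et t).
    assert (e * n = cos (x t) * x' * cos (et t) - (a' * cos (x t) - a t * sin (x t) * x' + b' * sin (x t) + b t * cos (x t) * x') * sin (et t)).
    { rewrite E1 in Eq at 1. rewrite E2 in Eq at 1.
      replace (e * n) with (e * n * (sin (et t)^2 + cos (et t)^2)) by (rewrite cc; ring).
      obv. }
    obv. }
  rewrite <- Q2, <- Rmult_assoc, En. unfold c, s, Shc. have cc := cs1 (x t).
  transitivity (x' * a t * (cos (x t)^2 + sin (x t)^2) - a' * cos (x t) * sin (x t) - b' * sin (x t)^2); [ring|].
  rewrite cc. ring.
Qed.

(** * Prüfer angles *)

Definition prufer (q al : R -> R) :=
  forall t, is_derive al t (cos (al t)^2 + q t * sin (al t)^2).

Definition sol (q u u1 : R -> R) :=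
  forall t, is_derive u t (u1 t) /\ is_derive u1 t (- q t * u t).

Lemma prufer_shift q al (k : Z) : prufer q al -> prufer q (fun t => al t + IZR k * PI).
Proof.
  intros H t. rewrite sin_plus_kPI, cos_plus_kPI.
  have h := H t. eapply is_derive_eq.
  - apply (is_derive_plus al (fun _ => IZR k * PI)); [exact h|apply is_derive_const].
  - rewrite plus_zero_r. have E := cos_kPI_sq k. set (e := cos (IZR k * PI)) in *.
    transitivity (e^2 * cos (al t)^2 + q t * (e^2 * sin (al t)^2)); [rewrite E; Rring|pos].
Qed.

(** The form that Gronwall's inequality needs: the first term is the forcing by the change of
    coefficient, the second is Lipschitz in [x - y]. *)
Lemma prufer_diff q1 q2 x y :
  cos x^2 + q1 * sin x^2 - (cos y^2 + q2 * sin y^2)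
  = (q1 - q2) * sin x^2 + (q2 - 1) * (sin (x + y) * sin (x - y)).
Proof. rewrite <- sin2_sub, !cs1. ring. Qed.

Lemma prufer_le q1 q2 al be a b M : prufer q1 al -> prufer q2 be -> a <= b ->
  (forall t, a <= t <= b -> q1 t <= q2 t /\ Rabs (q2 t - 1) <= M) ->
  al a <= be a -> al b <= be b.
Proof.
  intros H1 H2 Hab Hq H0.
  have HM : 0 <= M by (destruct (Hq a) as [_ h]; [lra|]; eapply Rle_trans; [apply Rabs_pos|exact h]).
  have G := gronwall (fun t => al t - be t)
     (fun t => cos (al t)^2 + q1 t * sin (al t)^2 - (cos (be t)^2 + q2 t * sin (be t)^2))
     (fun t => M * t) (fun _ => M) (fun _ => 0) (fun _ => 0) a b Hab.
  cbv beta in G. rewrite Rmax_right in G by lra.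
  assert (K : al b - be b <= exp (M * b - M * a) * (0 + (0 - 0))); [|lra].
  apply G. intros t Ht. destruct (Hq t Ht) as [h1 h2]. cbv beta. splits; try lra.
  - apply (is_derive_minus al be); auto.
  - derive_tac; Rring.
  - apply (is_derive_const 0 t).
  - cbv beta. intros D. rewrite prufer_diff.
    assert (Rabs (sin (al t + be t) * sin (al t - be t)) <= al t - be t).
    { rewrite <- sin2_sub. eapply Rle_trans; [apply sin2_sub_le|pos]. }
    assert (Rabs ((q2 t - 1) * (sin (al t + be t) * sin (al t - be t))) <= M * (al t - be t)).
    { rewrite Rabs_mult. obv. }
    apply Rabs_le_between in H3. nra.
Qed.

Lemma polar x y : 0 < x^2 + y^2 -> exists th,
  x = sqrt (x^2 + y^2) * sin th /\ y = sqrt (x^2 + y^2) * cos th.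
Proof.
  intros P. have Q := sqrt_lt_R0 _ P. have Q2 := sqrt_sqrt _ (Rlt_le _ _ P).
  set (n := sqrt (x^2 + y^2)) in *.
  assert (B : -1 <= y/n <= 1).
  { split; apply Rmult_le_reg_r with n; auto; unfold Rdiv; rewrite Rmult_assoc, Rinv_l; nra. }
  have C := cos_acos _ B. have S := cs1 (acos (y/n)). rewrite C in S.
  have S0 : 0 <= sin (acos (y/n)) by (apply sin_ge_0; apply acos_bound).
  assert (X : (n * sin (acos (y/n)))^2 = x^2).
  { turn ((n * sin (acos (y/n)))^2) into (n * n * sin (acos (y/n))^2).
    turn (sin (acos (y/n))^2) into (1 - (y/n)^2).
    turn (n * n * (1 - (y/n)^2)) into (n * n - y^2). lra. }
  have Y : n * (y/n) = y.
  have N : 0 <= n * sin (acos (y/n)).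
  destruct (Rle_dec 0 x).
  - exists (acos (y/n)). rewrite C. split; [|lra]. nra.
  - exists (- acos (y/n)). rewrite cos_neg, sin_neg, C. obv.
Qed.

(** The angle is the integral of the angular velocity. It follows the vector because the components
    of the normalized vector along and across the direction [th] have derivative 0. *)
Lemma lift (a b a1 b1 : R -> R) t0 th0 :
  (forall t, is_derive a t (a1 t) /\ is_derive b t (b1 t)
     /\ continuous a1 t /\ continuous b1 t /\ 0 < a t^2 + b t^2) ->
  a t0 = sqrt (a t0^2 + b t0^2) * sin th0 ->
  b t0 = sqrt (a t0^2 + b t0^2) * cos th0 ->
  exists th, th t0 = th0 /\ forall t,
    is_derive th t ((a1 t * b t - a t * b1 t)/(a t^2 + b t^2)) /\
    a t = sqrt (a t^2 + b t^2) * sin (th t) /\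
    b t = sqrt (a t^2 + b t^2) * cos (th t).
Proof.
  intros H S0 C0.
  set (f := fun t => (a1 t * b t - a t * b1 t)/(a t^2 + b t^2)).
  assert (Cf : forall t, continuous f t).
  { intros t. destruct (H t) as (h1 & h2 & h3 & h4 & h5).
    apply is_derive_ct in h1. apply is_derive_ct in h2.
    apply continuity_pt_filterlim in h3. apply continuity_pt_filterlim in h4.
    apply continuity_pt_filterlim. apply continuity_pt_div.
    - apply continuity_pt_minus; apply continuity_pt_mult; auto.
    - apply continuity_pt_plus; simpl; repeat apply continuity_pt_mult; auto;
        apply continuity_pt_const; intros ? ?; auto.
    - lra. }
  set (th := fun t => th0 + RInt f t0 t).
  assert (Dth : forall t, is_derive th t (f t)).
  { intros t. eapply is_derive_eq.
    - apply (is_derive_plus (fun _ => th0) (fun t => RInt f t0 t)); [apply is_derive_const|].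
      apply (is_derive_RInt f (fun t => RInt f t0 t) t0 t); auto.
      apply filter_forall. intros s. apply (RInt_correct (V := R_CompleteNormedModule)), (ex_RInt_continuous (V := R_CompleteNormedModule)). auto.
    - rewrite plus_zero_l. auto. }
  exists th. have T0 : th t0 = th0 by (unfold th; rewrite RInt_point; unfold zero; simpl; ring).
  split; auto.
  set (n := fun t => sqrt (a t^2 + b t^2)).
  have Pn : forall t, 0 < n t by (intros t; apply sqrt_lt_R0, (H t)).
  assert (Qn : forall t, n t * n t = a t^2 + b t^2).
  { intros t; apply sqrt_sqrt. obv. }
  assert (Dn : forall t, is_derive n t ((a t * a1 t + b t * b1 t)/n t)).
  { intros t. destruct (H t) as (h1 & h2 & _ & _ & h5). unfold n. derive_tac; auto.
    turn (a t * (a t * 1) + b t * (b t * 1)) into (a t^2 + b t^2). obv. }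
  assert (E1 : forall t, (a t * cos (th t) - b t * sin (th t))/n t = 0).
  { assert (Z : (a t0 * cos (th t0) - b t0 * sin (th t0))/n t0 = 0).
    { rewrite T0. obv. }
    intros t; rewrite <- Z. apply (deriv_zero_const (fun t => (a t * cos (th t) - b t * sin (th t))/n t)).
    clear t; intros t. destruct (H t) as (h1 & h2 & _ & _ & h5). have h3 := Dth t. have h4 := Dn t.
    have h6 := Pn t. derive_tac; try lra. unfold f.
    rewrite <- Qn.
    transitivity ((n t * n t * (a1 t * cos (th t) - b1 t * sin (th t))
       - (a1 t * b t - a t * b1 t) * (a t * sin (th t) + b t * cos (th t))
       - (a t * cos (th t) - b t * sin (th t)) * (a t * a1 t + b t * b1 t))/n t^3); [obv|].
    rewrite Qn. obv. }
  assert (E2 : forall t, (a t * sin (th t) + b t * cos (th t))/n t = 1).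
  { assert (Z : (a t0 * sin (th t0) + b t0 * cos (th t0))/n t0 = 1).
    { have h6 := Pn t0. rewrite T0. apply Rmult_eq_reg_r with (n t0); [|lra]. unfold Rdiv. rewrite Rmult_assoc, Rinv_l by lra.
      fold (n t0) in S0, C0. rewrite S0, C0.
      transitivity (n t0 * (sin th0^2 + cos th0^2)); [ring|rewrite cs1; ring]. }
    intros t; rewrite <- Z. apply (deriv_zero_const (fun t => (a t * sin (th t) + b t * cos (th t))/n t)).
    clear t; intros t. destruct (H t) as (h1 & h2 & _ & _ & h5). have h3 := Dth t. have h4 := Dn t.
    have h6 := Pn t. derive_tac; try lra.
    unfold f. rewrite <- Qn.
    transitivity ((n t * n t * (a1 t * sin (th t) + b1 t * cos (th t))
       + (a1 t * b t - a t * b1 t) * (a t * cos (th t) - b t * sin (th t))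
       - (a t * sin (th t) + b t * cos (th t)) * (a t * a1 t + b t * b1 t))/n t^3); [obv|].
    rewrite Qn. obv. }
  intros t; split; [obv|]. fold (n t).
  have h6 := Pn t. have e1 := E1 t. have e2 := E2 t.
  assert (e1' : a t * cos (th t) - b t * sin (th t) = 0).
  { apply Rmult_eq_reg_r with (/ n t); [|pos]. obv. }
  assert (e2' : a t * sin (th t) + b t * cos (th t) = n t).
  { apply Rmult_eq_reg_r with (/ n t); [|pos]. rewrite Rinv_r by lra. exact e2. }
  rewrite <- e2'. have c := cs1 (th t).
  split.
  - transitivity (a t * (sin (th t)^2 + cos (th t)^2) - cos (th t) * (a t * cos (th t) - b t * sin (th t))); [|ring].
    rewrite e1', c; ring.
  - transitivity (b t * (sin (th t)^2 + cos (th t)^2) + sin (th t) * (a t * cos (th t) - b t * sin (th t))); [|ring].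
    rewrite e1', c; ring.
Qed.

Lemma sol_comb q u u1 v v1 a b : sol q u u1 -> sol q v v1 ->
  sol q (fun t => a * u t + b * v t) (fun t => a * u1 t + b * v1 t).
Proof.
  intros Hu Hv t. destruct (Hu t) as [h1 h2], (Hv t) as [h3 h4].
  split; derive_tac; Rring.
Qed.

Lemma sol_wronskian q u u1 v v1 : sol q u u1 -> sol q v v1 ->
  forall s t, u s * v1 s - u1 s * v s = u t * v1 t - u1 t * v t.
Proof.
  intros Hu Hv. apply (deriv_zero_const (fun t => u t * v1 t - u1 t * v t)).
  intros t. destruct (Hu t) as [h1 h2], (Hv t) as [h3 h4]. derive_tac; Rring.
Qed.

Lemma sol_continuous q u u1 t : (forall t, continuous q t) -> sol q u u1 ->
  continuous u1 t /\ continuous (fun t => - q t * u t) t.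
Proof.
  intros Hq Hu. destruct (Hu t) as [h1 h2]. apply is_derive_ct in h1. apply is_derive_ct in h2.
  split; apply continuity_pt_filterlim; auto.
  apply continuity_pt_mult; auto. apply continuity_pt_opp, continuity_pt_filterlim, Hq.
Qed.

Lemma sol_prufer q u u1 t0 th0 : (forall t, continuous q t) -> sol q u u1 ->
  (forall t, 0 < u t^2 + u1 t^2) ->
  u t0 = sqrt (u t0^2 + u1 t0^2) * sin th0 -> u1 t0 = sqrt (u t0^2 + u1 t0^2) * cos th0 ->
  exists al, al t0 = th0 /\ prufer q al /\ forall t,
    u t = sqrt (u t^2 + u1 t^2) * sin (al t) /\ u1 t = sqrt (u t^2 + u1 t^2) * cos (al t).
Proof.
  intros Hq Hu Hp S C.
  destruct (lift u u1 u1 (fun t => - q t * u t) t0 th0) as [al [A0 A]]; auto.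
  { intros t. destruct (Hu t), (sol_continuous q u u1 t Hq Hu). auto. }
  exists al. splits; auto; [|intros; apply A].
  intros t. destruct (A t) as (h1 & h2 & h3). eapply is_derive_eq; [exact h1|].
  have P := sqrt_lt_R0 _ (Hp t). have Q := sqrt_sqrt _ (Rlt_le _ _ (Hp t)).
  rewrite <- Q. set (n := sqrt (u t^2 + u1 t^2)) in *. rewrite h2, h3. field. lra.
Qed.

(** * The WKB angle *)

(** The Liouville transform: for [v = q^(1/4) u] and [d xi = sqrt q dt], the vector [(v, dv/d xi)]
    is [q^(1/4)] times [(u, wkb_a u' + wkb_b u)]. So [wkb] is the Prüfer angle of [v] in the
    variable [xi], and [wkb_rho] is the perturbation in its equation [v'' + (1 + rho) v = 0]. *)
Definition wkb_a (q : R -> R) t := / sqrt (q t).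
Definition wkb_b (q q1 : R -> R) t := q1 t/(4 * q t * sqrt (q t)).
Definition wkb q q1 (al : R -> R) t := Sh (wkb_a q t) (wkb_b q q1 t) (al t).
Definition wkb_rho (q q1 q2 : R -> R) t := 5 * q1 t^2/(16 * q t^3) - q2 t/(4 * q t^2).

Lemma wkb_derive (q q1 q2 al : R -> R) t : prufer q al ->
  0 < q t -> is_derive q t (q1 t) -> is_derive q1 t (q2 t) ->
  is_derive (wkb q q1 al) t
    (sqrt (q t) * (1 + wkb_rho q q1 q2 t * sin (wkb q q1 al t)^2)).
Proof.
  intros Hal Hp h1 h2. have Pw := sqrt_lt_R0 _ Hp. have Qw := sqrt_sqrt _ (Rlt_le _ _ Hp).
  set (w := sqrt (q t)) in *.
  assert (Da : is_derive (wkb_a q) t (- q1 t/(2 * q t * w))).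
  { unfold wkb_a. derive_tac; auto; fold w; try lra.
    rewrite <- Qw. Rfield. lra. }
  assert (Db : is_derive (wkb_b q q1) t (q2 t/(4 * q t * w) - 3 * q1 t^2/(8 * q t^2 * w))).
  { unfold wkb_b. derive_tac; auto; fold w; try nra. rewrite <- Qw. Rfield. lra. }
  have Pa : 0 < wkb_a q t by (unfold wkb_a; fold w; apply Rinv_0_lt_compat; auto).
  eapply is_derive_eq; [apply (Sh_derive (wkb_a q) (wkb_b q q1) al); eauto|].
  destruct (Sh_dir (wkb_a q t) (wkb_b q q1 t) (al t) Pa) as [E1 E2].
  have PN := Shn_pos (wkb_a q t) (wkb_b q q1 t) (al t) Pa.
  have QN := sqrt_sqrt _ (Rlt_le _ _ PN). have PN2 := sqrt_lt_R0 _ PN.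
  fold (wkb q q1 al t) in E1. set (n := sqrt (Shn (wkb_a q t) (wkb_b q q1 t) (al t))) in *.
  have E : sin (wkb q q1 al t) = sin (al t)/n by (rewrite E1 at 1; field; lra).
  rewrite E. rewrite <- QN.
  transitivity (w * (n * n + wkb_rho q q1 q2 t * sin (al t)^2)/(n * n)); [|obv].
  f_equal. rewrite QN. unfold Shn, Shc, wkb_a, wkb_b, wkb_rho. fold w. rewrite <- Qw.
  obv.
Qed.

(** The angle has velocity [1 + rho sin^2] in [xi]. With [rho >= 0] it gains at least [xi], and at
    most [xi] plus the integral of [rho], for which [- B] is an antiderivative. *)
Lemma wkb_growth (q q1 q2 al xi B : R -> R) a b : prufer q al -> a <= b ->
  (forall t, a <= t <= b -> 0 < q t /\ is_derive q t (q1 t) /\ is_derive q1 t (q2 t)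
    /\ is_derive xi t (sqrt (q t)) /\ is_derive B t (- wkb_rho q q1 q2 t * sqrt (q t))
    /\ 0 <= wkb_rho q q1 q2 t) ->
  xi b - xi a <= wkb q q1 al b - wkb q q1 al a <= xi b - xi a + (B a - B b).
Proof.
  intros Hal Hab H. split.
  - assert (wkb q q1 al a - xi a <= wkb q q1 al b - xi b); [|lra].
    apply (deriv_nonneg_le (fun t => wkb q q1 al t - xi t)); auto.
    intros t Ht. destruct (H t Ht) as (h1 & h2 & h3 & h4 & h5 & h6).
    eexists; split; [apply (is_derive_minus (wkb q q1 al) xi); [apply (wkb_derive q q1 q2); auto|exact h4]|].
    have s := pow2_ge_0 (sin (wkb q q1 al t)). have p := sqrt_pos (q t).
    unfold minus, plus, opp; simpl. simpl in s.
    have : 0 <= wkb_rho q q1 q2 t * (sin (wkb q q1 al t) * (sin (wkb q q1 al t) * 1)). nra.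
  - assert (xi a - B a - wkb q q1 al a <= xi b - B b - wkb q q1 al b); [|lra].
    apply (deriv_nonneg_le (fun t => xi t - B t - wkb q q1 al t)); auto.
    intros t Ht. destruct (H t Ht) as (h1 & h2 & h3 & h4 & h5 & h6).
    eexists; split; [apply (is_derive_minus (fun t => xi t - B t) (wkb q q1 al)); [apply (is_derive_minus xi B); eauto|apply (wkb_derive q q1 q2); auto]|].
    have s := SIN_bound (wkb q q1 al t). have p := sqrt_pos (q t).
    unfold minus, plus, opp; simpl.
    set (sn := sin (wkb q q1 al t)) in *. have : 0 <= 1 - sn * (sn * 1).
    have : 0 <= wkb_rho q q1 q2 t * (1 - sn * (sn * 1)). nra.
Qed.

(** * Pairs of solutions *)

Definition sys (q q1 u u1 v v1 : R -> R) W := sol q u u1 /\ sol q v v1 /\ 0 < W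
  /\ (forall t, u t * v1 t - u1 t * v t = W) /\ (forall t, is_derive q t (q1 t)).

Definition sysP (u v : R -> R) t := u t^2 + v t^2.
Definition sysQ (u u1 v v1 : R -> R) t := u t * u1 t + v t * v1 t.

Definition phase (u v : R -> R) W (th : R -> R) := forall t, is_derive th t (W/sysP u v t)
  /\ v t = sqrt (sysP u v t) * sin (th t) /\ u t = sqrt (sysP u v t) * cos (th t).

(* [angle c] is a Prüfer angle of [v cos c - u sin c]. *)
Definition angle u u1 v v1 W th c t :=
  Sh (W/sysP u v t) (sysQ u u1 v v1 t/sysP u v t) (th t - c).

(* The [c] for which [angle c] takes the value [A] at [t]. *)
Definition phaseA u u1 v v1 W th A t :=
  th t - Sh (sysP u v t/W) (- sysQ u u1 v v1 t/W) A.

Lemma sysP_pos q q1 u u1 v v1 W t : sys q q1 u u1 v v1 W -> 0 < sysP u v t.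
Proof.
  intros (_ & _ & HW & H & _). specialize (H t). unfold sysP.
  have : 0 <= u t^2.
  destruct (Req_dec (u t) 0) as [e|e].
  - destruct (Req_dec (v t) 0) as [e2|e2].
    + rewrite e, e2 in H. lra.
    + have : 0 < v t^2. lra.
  - obv.
Qed.

Lemma phase_exists q q1 u u1 v v1 W t0 th0 : sys q q1 u u1 v v1 W ->
  v t0 = sqrt (sysP u v t0) * sin th0 -> u t0 = sqrt (sysP u v t0) * cos th0 ->
  exists th, th t0 = th0 /\ phase u v W th.
Proof.
  intros H S C. have HP := fun t => sysP_pos _ _ _ _ _ _ _ t H.
  destruct H as (Hu & Hv & HW & Hw & Hq).
  have E : forall t, v t^2 + u t^2 = sysP u v t by (intros; unfold sysP; ring).
  have Cq : forall t, continuous q t by (intros t; apply continuity_pt_filterlim; eapply is_derive_ct, Hq).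
  destruct (lift v u v1 u1 t0 th0) as [th [T0 T]].
  - intros t. destruct (Hu t), (Hv t), (sol_continuous q u u1 t Cq Hu), (sol_continuous q v v1 t Cq Hv).
    splits; auto. rewrite E; auto.
  - now rewrite E.
  - now rewrite E.
  - exists th; split; auto. intros t. destruct (T t) as (h1 & h2 & h3). rewrite !E in *. splits; auto.
    eapply is_derive_eq; [exact h1|]. rewrite <- (Hw t). obv.
Qed.

Lemma angle_prufer q q1 u u1 v v1 W th c : sys q q1 u u1 v v1 W -> phase u v W th ->
  prufer q (angle u u1 v v1 W th c).
Proof.
  intros H Hth t. have HP := sysP_pos _ _ _ _ _ _ _ t H.
  destruct H as (Hu & Hv & HW & Hw & Hq). specialize (Hw t).
  destruct (Hu t) as [u1' u2'], (Hv t) as [v1' v2']. destruct (Hth t) as (T & _ & _).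
  set (P := sysP u v t) in *. set (Q := sysQ u u1 v v1 t). set (S := u1 t^2 + v1 t^2).
  (* Lagrange's identity for the vectors [(u, v)] and [(u1, v1)]; it eliminates [S] at the end. *)
  have HS : P * S = W^2 + Q^2 by (unfold P, S, Q, sysP, sysQ; rewrite <- Hw; ring).
  have DP : is_derive (sysP u v) t (2 * Q) by (unfold sysP; derive_tac; unfold Q, sysQ; Rring).
  have DQ : is_derive (sysQ u u1 v v1) t (S - q t * P) by (unfold sysQ; derive_tac; unfold S, P, sysP; Rring).
  assert (Da : is_derive (fun t => W/sysP u v t) t (- 2 * W * Q/P^2)).
  { derive_tac; fold P; try lra. Rfield; lra. }
  assert (Db : is_derive (fun t => sysQ u u1 v v1 t/sysP u v t) t ((S - q t * P)/P - 2 * Q^2/P^2)).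
  { derive_tac; fold P; try lra. obv. }
  assert (Dx : is_derive (fun t => th t - c) t (W/P)).
  { derive_tac. obv. }
  have Pa : 0 < W/P.
  eapply is_derive_eq; [apply (Sh_derive (fun t => W/sysP u v t) (fun t => sysQ u u1 v v1 t/sysP u v t) (fun t => th t - c)); eauto|].
  cbv beta. unfold angle. fold P Q. set (x := th t - c).
  destruct (Sh_dir (W/P) (Q/P) x Pa) as [E1 E2].
  have PN := Shn_pos (W/P) (Q/P) x Pa.
  have QN := sqrt_sqrt _ (Rlt_le _ _ PN). have PN2 := sqrt_lt_R0 _ PN.
  set (n := sqrt (Shn (W/P) (Q/P) x)) in *.
  have F1 : sin (Sh (W/P) (Q/P) x) = sin x/n by (rewrite E1 at 1; field; lra).
  have F2 : cos (Sh (W/P) (Q/P) x) = Shc (W/P) (Q/P) x/n by (rewrite E2 at 1; field; lra).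
  rewrite F1, F2, <- QN.
  transitivity ((Shc (W/P) (Q/P) x^2 + q t * sin x^2)/(n * n)); [|obv].
  f_equal. unfold Shc. replace S with ((W^2 + Q^2)/P) by (rewrite <- HS; field; lra).
  replace ((W/P * cos x + Q/P * sin x)^2) with
    ((W/P)^2 * cos x^2 + 2 * (W/P) * (Q/P) * sin x * cos x + (Q/P)^2 * sin x^2) by ring.
  rewrite cs1. field. lra.
Qed.

Lemma angle_phaseA q q1 u u1 v v1 W th A t : sys q q1 u u1 v v1 W ->
  angle u u1 v v1 W th (phaseA u u1 v v1 W th A t) t = A.
Proof.
  intros H. have HP := sysP_pos _ _ _ _ _ _ _ t H. destruct H as (_ & _ & HW & _).
  unfold angle, phaseA. set (P := sysP u v t) in *. set (Q := sysQ u u1 v v1 t).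
  turn (th t - (th t - Sh (P/W) (- Q/W) A)) into (Sh (P/W) (- Q/W) A).
  turn (P/W) into (/ (W/P)).
  turn (- Q/W) into (- (Q/P)/(W/P)).
  apply Sh_inv. obv.
Qed.

Lemma angle_shift u u1 v v1 W th c (k : Z) t :
  angle u u1 v v1 W th (c - IZR k * PI) t = angle u u1 v v1 W th c t + IZR k * PI.
Proof.
  unfold angle. turn (th t - (c - IZR k * PI)) into (th t - c + IZR k * PI).
  apply Sh_shift.
Qed.

(** The solution [v cos c - u sin c] meets the boundary condition at [t], with squared amplitude
    [n2]. When [t] moves, its Prüfer angle leaves [A] at the rate [cos A^2 + q sin A^2], and the
    mixing phase [c] must compensate, a unit of [c] being worth [W/n2]. The sign of the derivative
    is thus that of [cos A^2 + q sin A^2]. *)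
Lemma phaseA_derive q q1 u u1 v v1 W th A t : sys q q1 u u1 v v1 W -> phase u v W th ->
  let c := phaseA u u1 v v1 W th A t in
  exists n2, 0 < n2 /\ v t * cos c - u t * sin c = sqrt n2 * sin A /\
  v1 t * cos c - u1 t * sin c = sqrt n2 * cos A /\
  is_derive (phaseA u u1 v v1 W th A) t (n2 * (cos A^2 + q t * sin A^2)/W).
Proof.
  intros H Hth c. have HP := sysP_pos _ _ _ _ _ _ _ t H.
  destruct H as (Hu & Hv & HW & Hw & Hq). specialize (Hw t).
  destruct (Hu t) as [u1' u2'], (Hv t) as [v1' v2']. destruct (Hth t) as (T & Tv & Tu).
  set (P := sysP u v t) in *. set (Q := sysQ u u1 v v1 t). set (S := u1 t^2 + v1 t^2).
  have HS : P * S = W^2 + Q^2 by (unfold P, S, Q, sysP, sysQ; rewrite <- Hw; ring).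
  have DP : is_derive (sysP u v) t (2 * Q) by (unfold sysP; derive_tac; unfold Q, sysQ; Rring).
  have DQ : is_derive (sysQ u u1 v v1) t (S - q t * P) by (unfold sysQ; derive_tac; unfold S, P, sysP; Rring).
  have Da : is_derive (fun t => sysP u v t/W) t (2 * Q/W) by (derive_tac; try lra; Rfield; lra).
  have Db : is_derive (fun t => - sysQ u u1 v v1 t/W) t (- (S - q t * P)/W) by (derive_tac; try lra; Rfield; lra).
  have Pa : 0 < P/W.
  have DA : is_derive (fun _ : R => A) t 0 by (apply (is_derive_const A t)).
  have DSh := Sh_derive (fun t => sysP u v t/W) (fun t => - sysQ u u1 v v1 t/W) (fun _ => A) _ _ _ t Pa Da Db DA.
  cbv beta in DSh.
  destruct (Sh_dir (P/W) (- Q/W) A Pa) as [E1 E2].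
  have PN := Shn_pos (P/W) (- Q/W) A Pa.
  have PN2 := sqrt_lt_R0 _ PN.
  set (N := Shn (P/W) (- Q/W) A) in *.
  set (x := Sh (P/W) (- Q/W) A) in *.
  have Ec : c = th t - x.
  have SQ : sqrt (P/N) = sqrt P/sqrt N by (apply sqrt_div_alt; lra).
  assert (V1 : v1 t = (Q * v t + W * u t)/P).
  { apply Rmult_eq_reg_r with P; [|lra]. unfold Rdiv; rewrite Rmult_assoc, Rinv_l, Rmult_1_r by lra.
    rewrite <- Hw. unfold P, Q, sysP, sysQ. ring. }
  assert (U1 : u1 t = (Q * u t - W * v t)/P).
  { apply Rmult_eq_reg_r with P; [|lra]. unfold Rdiv; rewrite Rmult_assoc, Rinv_l, Rmult_1_r by lra.
    rewrite <- Hw. unfold P, Q, sysP, sysQ. ring. }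
  assert (X1 : v t * cos c - u t * sin c = sqrt P * sin x).
  { rewrite Tv, Tu. turn x into (th t - c). rewrite sin_minus. ring. }
  assert (X2 : u t * cos c + v t * sin c = sqrt P * cos x).
  { rewrite Tv, Tu. turn x into (th t - c). rewrite cos_minus. ring. }
  exists (P/N). rewrite SQ. splits.
  - apply Rdiv_lt_0_compat; lra.
  - rewrite X1, E1. field. lra.
  - rewrite V1, U1.
    transitivity ((Q * (v t * cos c - u t * sin c) + W * (u t * cos c + v t * sin c))/P); [pos|].
    rewrite X1, X2. have E3 : cos A = W/P * (Shc (P/W) (- Q/W) A + Q/W * sin A) by (unfold Shc; field; lra).
    rewrite E3, E2, E1. field. lra.
  - eapply is_derive_eq; [apply (is_derive_minus th); [exact T|exact DSh]|].
    unfold minus, plus, opp; simpl.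
    assert (EN : W^2 * N = P * (P * cos A^2 - 2 * Q * sin A * cos A + S * sin A^2)).
    { transitivity (P * P * cos A^2 - 2 * P * Q * sin A * cos A + P * S * sin A^2); [|ring].
      rewrite HS. unfold N, Shn, Shc. field. lra. }
    apply Rmult_eq_reg_r with (W * W * N * P); [|pos].
    transitivity (W * (W^2 * N) + P * W * (2 * Q * sin A * cos A - S * sin A^2 + q t * P * sin A^2)); [obv|].
    rewrite EN. field. lra.
Qed.

Lemma Sh_lt a b x y : 0 < a -> x < y -> Sh a b x < Sh a b y.
Proof.
  intros Ha Hxy. apply (deriv_pos_lt (Sh a b)); auto.
  intros t _. eexists; split.
  - apply (Sh_derive (fun _ => a) (fun _ => b) (fun t => t) 0 0 1 t Ha).
    + apply (is_derive_const a t).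
    + apply (is_derive_const b t).
    + apply (is_derive_id t).
  - have P := Shn_pos a b t Ha. obv.
Qed.

Lemma Sh_le a b x y : 0 < a -> x <= y -> Sh a b x <= Sh a b y.
Proof. intros Ha [H|H]; [left; now apply Sh_lt|subst; lra]. Qed.

(** For the constant coefficient [w^2] the rescaled angle turns uniformly at rate [w], so a gain of
    [PI] takes the time [PI/w]. This flow serves as the upper comparison for small arguments. *)
Lemma prufer_const w t0 A : 0 < w -> exists be, prufer (fun _ => w^2) be /\ be t0 = A /\
  forall t, w * (t - t0) < PI -> be t < A + PI.
Proof.
  intros Hw. set (s0 := Sh (/ w) (- 0/w) A).
  exists (fun t => Sh w 0 (w * (t - t0) + s0)). splits.
  - intros t. set (x := w * (t - t0) + s0).
    eapply is_derive_eq.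
    + apply (Sh_derive (fun _ => w) (fun _ => 0) (fun t => w * (t - t0) + s0) 0 0 w t Hw).
      * apply (is_derive_const w t).
      * apply (is_derive_const 0 t).
      * derive_tac; Rring.
    + cbv beta. fold x. destruct (Sh_dir w 0 x Hw) as [E1 E2].
      have P := Shn_pos w 0 x Hw. have P2 := sqrt_lt_R0 _ P.
      have QN := sqrt_sqrt _ (Rlt_le _ _ P). set (n := sqrt (Shn w 0 x)) in *.
      have F1 : sin (Sh w 0 x) = sin x/n by (rewrite E1 at 1; field; lra).
      have F2 : cos (Sh w 0 x) = Shc w 0 x/n by (rewrite E2 at 1; field; lra).
      rewrite F1, F2, <- QN. transitivity (w^2/(n * n)); [pos|].
      transitivity ((w^2 * cos x^2 + w^2 * sin x^2)/(n * n)); [rewrite cs1; field; lra|].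
      unfold Shc; field; lra.
  - unfold s0. turn (w * (t0 - t0) + Sh (/ w) (- 0/w) A) into (Sh (/ w) (- 0/w) A).
    now apply Sh_inv.
  - intros t Ht. apply Rlt_le_trans with (Sh w 0 (s0 + IZR 1 * PI)).
    + apply Sh_lt; auto. lra.
    + rewrite Sh_shift. unfold s0. rewrite Sh_inv by auto. lra.
Qed.

(** * Indexing of zeros by the phase *)

Lemma deriv_pos_local f x l : is_derive f x l -> 0 < l -> exists eta, 0 < eta /\
  forall y, Rabs (y - x) < eta -> (y < x -> f y < f x) /\ (x < y -> f x < f y).
Proof.
  intros H Hl. apply is_derive_Reals in H. destruct (H (l/2) ok) as [d Hd].
  exists d. split; [apply d|]. intros y Hy.
  assert (G : y <> x -> 0 < (f y - f x)/(y - x)).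
  { intros N. specialize (Hd (y - x) ok Hy). turn (x + (y - x)) into y in Hd.
    obv. }
  have E : y <> x -> f y - f x = (f y - f x)/(y - x) * (y - x).
  obv.
Qed.

Lemma no_cross (phi : R -> R) a b m y1 y2 :
  (forall x, a < x < b -> continuity_pt phi x) ->
  (forall x, a < x < b -> phi x <> m) ->
  a < y1 < b -> a < y2 < b -> phi y1 < m -> phi y2 < m.
Proof.
  intros C N H1 H2 L.
  destruct (Rlt_dec (phi y2) m) as [h|h]; auto. exfalso.
  have : phi y2 <> m. have : y1 <> y2 by (intro; subst; lra).
  destruct (Rlt_dec y1 y2).
  - destruct (Ranalysis5.IVT_interv (fun x => phi x - m) y1 y2) as [z [Hz E]]; try lra.
    + intros w Hw. apply continuity_pt_minus; [apply C; lra|apply continuity_pt_const; intros ? ?; auto].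
    + apply (N z); lra.
  - destruct (Ranalysis5.IVT_interv (fun x => - (phi x - m)) y2 y1) as [z [Hz E]]; try lra.
    + intros w Hw. apply continuity_pt_opp, continuity_pt_minus; [apply C; lra|apply continuity_pt_const; intros ? ?; auto].
    + apply (N z); lra.
Qed.

Lemma no_cross_above (phi : R -> R) a b m y1 y2 :
  (forall x, a < x < b -> continuity_pt phi x) ->
  (forall x, a < x < b -> phi x <> m) ->
  a < y1 < b -> a < y2 < b -> m < phi y1 -> m < phi y2.
Proof.
  intros C N H1 H2 L.
  assert (- phi y2 < - m); [|lra].
  apply (no_cross (fun x => - phi x) a b (- m) y1 y2); auto; try lra.
  - intros. apply continuity_pt_opp; auto.
  - intros x Hx E. apply (N x Hx). lra.
Qed.

Lemma kPI_between (k j : Z) : IZR k * PI <= IZR j * PI <= (IZR k + 1) * PI -> j = k \/ j = (k + 1)%Z.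
Proof.
  intros [h1 h2]. have P := PI_RGT_0. rewrite <- plus_IZR in h2.
  apply Rmult_le_reg_r in h1; auto. apply Rmult_le_reg_r in h2; auto.
  apply le_IZR in h1. apply le_IZR in h2. lia.
Qed.

(** Without multiples of [PI] on the open interval, [phi] stays in one period and must end on one of
    its two ends. The lower end is excluded because [phi] increases into [b]. *)
Lemma next_zero_phase (phi : R -> R) a b (m : Z) y :
  (forall x, a < x <= b -> continuity_pt phi x) ->
  (forall x (j : Z), a < x < b -> phi x <> IZR j * PI) ->
  a < y < b -> IZR m * PI < phi y < (IZR m + 1) * PI ->
  (exists j, phi b = IZR j * PI) ->
  (exists eta, 0 < eta /\ forall z, Rabs (z - b) < eta -> z < b -> phi z < phi b) ->
  phi b = (IZR m + 1) * PI.
Proof.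
  intros C N Hy Hm [j Hj] [eta [He Hinc]].
  assert (In : forall x, a < x < b -> IZR m * PI < phi x < (IZR m + 1) * PI).
  { intros x Hx. split.
    - apply (no_cross_above phi a b (IZR m * PI) y x); auto; try lra. intros; apply C; lra.
    - rewrite <- plus_IZR. apply (no_cross phi a b (IZR (m + 1) * PI) y x); auto; try lra.
      intros; apply C; lra. rewrite plus_IZR; lra. }
  have Cb : continuity_pt phi b by (apply C; lra).
  assert (near : forall d, 0 < d -> exists x, a < x < b /\ Rabs (x - b) < eta /\ Rabs (phi x - phi b) < d).
  { intros d Hd. destruct (Cb d Hd) as [al [Hal Hc]]. unfold dist in Hc; simpl in Hc; unfold R_dist in Hc.
    set (x := b - Rmin (Rmin al eta) (b - a)/2).
    have Q : 0 < Rmin (Rmin al eta) (b - a) by (repeat apply Rmin_pos; lra).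
    have Q1 := Rmin_l (Rmin al eta) (b - a). have Q2 := Rmin_r (Rmin al eta) (b - a).
    have Q3 := Rmin_l al eta. have Q4 := Rmin_r al eta.
    exists x. splits.
    - unfold x; lra.
    - unfold x; lra.
    - apply Rabs_def1; unfold x; lra.
    - apply Hc. split; [split; [obv|obv]|]. obv. }
  assert (B : IZR m * PI <= phi b <= (IZR m + 1) * PI).
  { split; apply Rnot_lt_le; intro h.
    - destruct (near (IZR m * PI - phi b) ok) as (x & hx & _ & hd). destruct (In x hx).
      apply Rabs_lt_between in hd. lra.
    - destruct (near (phi b - (IZR m + 1) * PI) ok) as (x & hx & _ & hd). destruct (In x hx).
      obv. }
  rewrite Hj in B. destruct (kPI_between _ _ B) as [e|e]; subst j; rewrite Hj, ?plus_IZR; auto.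
  exfalso. destruct (near 1 ok) as (x & hx & h1 & _). destruct (In x hx).
  have h2 := Hinc x h1 ok. lra.
Qed.

(** Monotonicity of [phi] is replaced by its increase at each multiple of [PI]: a multiple once
    passed cannot be met again from above. The range near 0 fixes where the count starts. *)
Lemma zeros_index (phi f : R -> R) (k0 : nat) (x : nat -> R) :
  (forall y, 0 < y -> exists l, is_derive phi y l /\ forall j : Z, phi y = IZR j * PI -> 0 < l) ->
  (forall y, 0 < y -> (f y = 0 <-> exists j : Z, phi y = IZR j * PI)) ->
  (exists e, 0 < e /\ forall y, 0 < y <= e -> (INR k0 - 1) * PI < phi y < INR k0 * PI) ->
  lists_positive_zeros f k0 x ->
  forall k, (k0 <= k)%nat -> phi (x k) = INR k * PI.
Proof.
  intros D ZE [e [He Hs]] [L1 L2].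
  assert (C : forall y, 0 < y -> continuity_pt phi y).
  { intros y Hy; destruct (D y Hy) as [l [Hl _]]. eapply is_derive_ct, Hl. }
  assert (mono : forall k j, (k0 <= k)%nat -> (k <= j)%nat -> x k <= x j).
  { intros k j Hk Hkj. induction Hkj; [lra|]. destruct (L1 m ok) as (_ & _ & h). lra. }
  assert (nz1 : forall y, 0 < y < x k0 -> f y <> 0).
  { intros y Hy E. destruct (L2 y ok E) as [k [Hk Ek]]. have h := mono k0 k ok Hk. lra. }
  assert (nz2 : forall k y, (k0 <= k)%nat -> x k < y < x (S k) -> f y <> 0).
  { intros k y Hk Hy E. destruct (L1 k Hk) as (hp & _ & _). destruct (L2 y ok E) as [j [Hj Ej]].
    destruct (Nat.le_gt_cases j k).
    - have h := mono j k Hj H. lra.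
    - have h := mono (S k) j ok ok. lra. }
  assert (loc : forall k, (k0 <= k)%nat -> exists eta, 0 < eta /\ forall y, Rabs (y - x k) < eta ->
     (y < x k -> phi y < phi (x k)) /\ (x k < y -> phi (x k) < phi y)).
  { intros k Hk. destruct (L1 k Hk) as (h1 & h2 & _). apply ZE in h2; auto. destruct h2 as [j Ej].
    destruct (D (x k) h1) as [l [Hl Pl]]. eapply deriv_pos_local; eauto. }
  intros k Hk. induction Hk as [|k Hk IH].
  - destruct (L1 k0 ok) as (h1 & h2 & _).
    (* The period is indexed by an integer, not a natural number: for [k0 = 0] the phase starts in
       [(- PI, 0)]. *)
    replace (INR k0 * PI) with ((IZR (Z.of_nat k0 - 1) + 1) * PI) by (rewrite minus_IZR, <- INR_IZR_INZ; ring).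
    apply (next_zero_phase phi 0 (x k0) (Z.of_nat k0 - 1) (Rmin e (x k0/2))).
    + intros; apply C; lra.
    + intros y j Hy E. apply (nz1 y Hy). apply ZE; [lra|]. exists j; auto.
    + split; [apply Rmin_pos; lra|]. have h := Rmin_r e (x k0/2). lra.
    + rewrite minus_IZR, <- INR_IZR_INZ. turn (INR k0 - 1 + 1) into (INR k0).
      apply Hs. split; [apply Rmin_pos; lra|apply Rmin_l].
    + apply ZE; auto.
    + destruct (loc k0 ok) as [eta [h3 h4]]. exists eta; split; auto. intros z hz. apply h4; auto.
  - destruct (L1 k Hk) as (h1 & h2 & h3). destruct (L1 (S k) ok) as (h4 & h5 & _).
    destruct (loc k Hk) as [eta [h6 h7]].
    rewrite S_INR. rewrite INR_IZR_INZ in IH |- *.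
    have Q : 0 < Rmin eta (x (S k) - x k) by (apply Rmin_pos; lra).
    have Q1 := Rmin_l eta (x (S k) - x k). have Q2 := Rmin_r eta (x (S k) - x k).
    assert (NZ : forall z (j : Z), x k < z < x (S k) -> phi z <> IZR j * PI).
    { intros z j Hz E. apply (nz2 k z Hk Hz). apply ZE; [lra|]. exists j; auto. }
    (* just to the right of [x k] the phase has entered the next period *)
    assert (Y : exists y, x k < y < x (S k) /\ IZR (Z.of_nat k) * PI < phi y < (IZR (Z.of_nat k) + 1) * PI).
    { have Ck := C (x k) h1. destruct (Ck PI PI_RGT_0) as [al [Hal Hc]].
      unfold dist in Hc; simpl in Hc; unfold R_dist in Hc.
      set (z := x k + Rmin al (Rmin eta (x (S k) - x k))/2).
      have R0 : 0 < Rmin al (Rmin eta (x (S k) - x k)) by (apply Rmin_pos; lra).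
      have R1 := Rmin_l al (Rmin eta (x (S k) - x k)). have R2 := Rmin_r al (Rmin eta (x (S k) - x k)).
      exists z. split; [obv|].
      have h8 : phi (x k) < phi z by (apply h7; [apply Rabs_def1|]; unfold z; lra).
      assert (h9 : Rabs (phi z - phi (x k)) < PI).
      { apply Hc. split; [split; [obv|obv]|obv]. }
      obv. }
    destruct Y as [y' [Hy1 Hy2]].
    apply (next_zero_phase phi (x k) (x (S k)) (Z.of_nat k) y'); auto.
    + intros; apply C; lra.
    + apply ZE; auto.
    + destruct (loc (S k) ok) as [eta' [h8 h9]]. exists eta'; split; auto. intros z hz. apply h9; auto.
Qed.

(** The boundary forms [(a t, b t)] of the two solutions are a multiple of [(cos c, sin c)] with [c]
    the value of [phaseA] at [t], so the cross-product is a multiple of the sine of the difference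
    of two phases. The multiple is nonzero because [W] is. *)
Lemma cross_zero q q1 u u1 v v1 W th A t0 t1 : sys q q1 u u1 v v1 W -> phase u v W th ->
  let a t := u t * cos A - u1 t * sin A in let b t := v t * cos A - v1 t * sin A in
  a t1 * b t0 - a t0 * b t1 = 0 <->
  exists k : Z, phaseA u u1 v v1 W th A t1 - phaseA u u1 v v1 W th A t0 = IZR k * PI.
Proof.
  intros H Hth a b.
  assert (M : forall t, let c := phaseA u u1 v v1 W th A t in exists m, m <> 0 /\ a t = m * cos c /\ b t = m * sin c).
  { intros t c. destruct (phaseA_derive q q1 u u1 v v1 W th A t H Hth) as (n2 & Hn & E1 & E2 & _).
    fold c in E1, E2. exists (a t * cos c + b t * sin c).
    assert (Z : b t * cos c - a t * sin c = 0).
    { unfold a, b. transitivity ((v t * cos c - u t * sin c) * cos A - (v1 t * cos c - u1 t * sin c) * sin A); [ring|].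
      rewrite E1, E2. ring. }
    have cc := cs1 c.
    assert (Ea : a t = (a t * cos c + b t * sin c) * cos c).
    { transitivity (a t * (cos c^2 + sin c^2) + sin c * (b t * cos c - a t * sin c)); [rewrite Z, cc; ring|ring]. }
    assert (Eb : b t = (a t * cos c + b t * sin c) * sin c).
    { transitivity (b t * (cos c^2 + sin c^2) - cos c * (b t * cos c - a t * sin c)); [rewrite Z, cc; ring|ring]. }
    splits; auto. intros E. rewrite E, Rmult_0_l in Ea, Eb.
    destruct H as (_ & _ & HW & Hw & _). specialize (Hw t). unfold a in Ea; unfold b in Eb.
    assert (W * cos A = 0).
    { rewrite <- Hw. transitivity ((u t * cos A - u1 t * sin A) * v1 t - u1 t * (v t * cos A - v1 t * sin A)); [ring|].
      rewrite Ea, Eb; ring. }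
    assert (W * sin A = 0).
    { rewrite <- Hw. transitivity (- (v t * cos A - v1 t * sin A) * u t + v t * (u t * cos A - u1 t * sin A)); [ring|].
      rewrite Ea, Eb; ring. }
    have c2 := cs1 A. obv. }
  destruct (M t0) as (m0 & N0 & A0 & B0). destruct (M t1) as (m1 & N1 & A1 & B1).
  set (c0 := phaseA u u1 v v1 W th A t0) in *. set (c1 := phaseA u u1 v v1 W th A t1) in *.
  assert (E : a t1 * b t0 - a t0 * b t1 = - (m0 * m1) * sin (c1 - c0)).
  { rewrite A0, A1, B0, B1, sin_minus. ring. }
  rewrite E. split.
  - intros Z. have : m0 * m1 <> 0.
    apply sin_eq_0_0. apply Rmult_integral in Z. destruct Z; auto. lra.
  - intros Z. rewrite (sin_eq_0_1 _ Z). ring.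
Qed.

(* For [C = v cos c - u sin c] the quantity [C'^2 + q C^2] increases when [q] does, and it is
   [W] times the derivative of the phase wherever [C] satisfies the boundary condition. *)
Lemma phaseA_growth q q1 u u1 v v1 W th A t0 t1 (k : Z) : sys q q1 u u1 v v1 W -> phase u v W th ->
  (forall t, 0 < q1 t) -> t0 < t1 ->
  phaseA u u1 v v1 W th A t1 = phaseA u u1 v v1 W th A t0 + IZR k * PI ->
  exists d0 d1, is_derive (phaseA u u1 v v1 W th A) t0 d0 /\ is_derive (phaseA u u1 v v1 W th A) t1 d1 /\ d0 < d1.
Proof.
  intros H Hth Hq1 Ht Ek.
  destruct (phaseA_derive q q1 u u1 v v1 W th A t0 H Hth) as (n0 & Hn0 & E1 & E2 & D0).
  destruct (phaseA_derive q q1 u u1 v v1 W th A t1 H Hth) as (n1 & Hn1 & F1 & F2 & D1).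
  exists (n0 * (cos A^2 + q t0 * sin A^2)/W), (n1 * (cos A^2 + q t1 * sin A^2)/W).
  splits; auto. rewrite Ek in F1, F2. set (c := phaseA u u1 v v1 W th A t0) in *.
  destruct H as (Hu & Hv & HW & Hw & Hq).
  set (C := fun t => v t * cos c - u t * sin c). set (C1 := fun t => v1 t * cos c - u1 t * sin c).
  set (E := fun t => C1 t^2 + q t * C t^2).
  rewrite sin_plus_kPI, cos_plus_kPI in F1, F2. set (e := cos (IZR k * PI)) in *. have ee := cos_kPI_sq k : e^2 = 1.
  assert (X0 : n0 * (cos A^2 + q t0 * sin A^2) = E t0).
  { unfold E, C, C1. rewrite E1, E2. have h := sqrt_sqrt n0 (Rlt_le _ _ Hn0).
    obv. }
  assert (X1 : n1 * (cos A^2 + q t1 * sin A^2) = E t1).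
  { have G1 : e * C t1 = sqrt n1 * sin A by (rewrite <- F1; unfold C; ring).
    have G2 : e * C1 t1 = sqrt n1 * cos A by (rewrite <- F2; unfold C1; ring).
    have h := sqrt_sqrt n1 (Rlt_le _ _ Hn1).
    transitivity ((e * C1 t1)^2 + q t1 * (e * C t1)^2).
    - rewrite G1, G2. transitivity (sqrt n1 * sqrt n1 * (cos A^2 + q t1 * sin A^2)); [obv|ring].
    - unfold E. transitivity (e^2 * (C1 t1^2 + q t1 * C t1^2)); [ring|rewrite ee; ring]. }
  rewrite X0, X1.
  assert (DC : forall t, is_derive C t (C1 t)).
  { intros t. destruct (Hu t) as [a1 a2], (Hv t) as [a3 a4]. unfold C, C1. derive_tac. Rring. }
  assert (DC1 : forall t, is_derive C1 t (- q t * C t)).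
  { intros t. destruct (Hu t) as [a1 a2], (Hv t) as [a3 a4]. unfold C, C1. derive_tac. Rring. }
  assert (DE : forall t, is_derive E t (q1 t * C t^2)).
  { intros t. have a1 := DC t. have a2 := DC1 t. have a3 := Hq t. unfold E. derive_tac. Rring. }
  assert (ME : forall a b, a <= b -> E a <= E b).
  { intros a b Hab. apply deriv_nonneg_le; auto. intros t _. eexists; split; [apply DE|].
    apply Rmult_le_pos; [left; apply Hq1|pos]. }
  (* Strictness: if the energy did not grow, [C] would vanish on an interval together with [C1],
     contradicting the Wronskian. *)
  assert (E t0 < E t1).
  { destruct (Rlt_dec (E t0) (E t1)); auto. exfalso.
    assert (Z : forall t, t0 < t < t1 -> C t = 0).
    { intros t Htt.
      assert (Dz : is_derive E t 0).
      { apply is_derive_ext_loc with (f := fun _ => E t0); [|apply (is_derive_const (E t0) t)].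
        apply (locally_interval _ t t0 t1); simpl; try lra.
        intros y h1 h2. have h3 := ME t0 y ok. have h4 := ME y t1 ok. lra. }
      have Eq := is_derive_unique _ _ _ (DE t). rewrite (is_derive_unique _ _ _ Dz) in Eq.
      have hq := Hq1 t. destruct (Req_dec (C t) 0); auto.
      have : 0 < C t^2. nra. }
    set (t := (t0 + t1)/2). have Ct : C t = 0 by (apply Z; unfold t; lra).
    assert (C1t : C1 t = 0).
    { assert (Dz : is_derive C t 0).
      { apply is_derive_ext_loc with (f := fun _ => 0); [|apply (is_derive_const 0 t)].
        apply (locally_interval _ t t0 t1); simpl; try (unfold t; lra).
        intros y h1 h2. symmetry; apply Z; auto. }
      rewrite <- (is_derive_unique _ _ _ (DC t)). apply is_derive_unique, Dz. }
    specialize (Hw t). unfold C in Ct; unfold C1 in C1t.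
    assert (W * cos c = 0).
    { rewrite <- Hw. transitivity (u t * (v1 t * cos c - u1 t * sin c) - u1 t * (v t * cos c - u t * sin c)); [ring|].
      rewrite Ct, C1t; ring. }
    assert (W * sin c = 0).
    { rewrite <- Hw. transitivity (v t * (v1 t * cos c - u1 t * sin c) - v1 t * (v t * cos c - u t * sin c)); [ring|].
      rewrite Ct, C1t; ring. }
    have c2 := cs1 c. obv. }
  obv.
Qed.

(** As functions of [y] both [ln (R' y)] and [ln (r y)] have derivative [1/y], so the phase
    difference has derivative [(d1 - d0)/y], which [phaseA_growth] makes positive at every multiple
    of [PI]. The [k]-th zero is then where the difference is [k PI], and [c] is the common mixing
    phase at the inner end. *)
Lemma zeros_angle q q1 u u1 v v1 W th A (r R' : R) f k0 x : sys q q1 u u1 v v1 W -> phase u v W th ->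
  (forall t, 0 < q1 t) -> 0 < r < R' ->
  (forall y, 0 < y -> (f y = 0 <->
     (u (ln (R' * y)) * cos A - u1 (ln (R' * y)) * sin A) * (v (ln (r * y)) * cos A - v1 (ln (r * y)) * sin A)
     - (u (ln (r * y)) * cos A - u1 (ln (r * y)) * sin A) * (v (ln (R' * y)) * cos A - v1 (ln (R' * y)) * sin A) = 0)) ->
  (exists e, 0 < e /\ forall y, 0 < y <= e -> (INR k0 - 1) * PI <
      phaseA u u1 v v1 W th A (ln (R' * y)) - phaseA u u1 v v1 W th A (ln (r * y)) < INR k0 * PI) ->
  lists_positive_zeros f k0 x ->
  forall k, (k0 <= k)%nat -> exists c,
    angle u u1 v v1 W th c (ln (r * x k)) = A /\ angle u u1 v v1 W th c (ln (R' * x k)) = A + INR k * PI.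
Proof.
  intros H Hth Hq1 Hr Hf Hs HL k Hk.
  set (pA := phaseA u u1 v v1 W th A) in *.
  have Hlt : forall y, 0 < y -> ln (r * y) < ln (R' * y).
  have I := zeros_index (fun y => pA (ln (R' * y)) - pA (ln (r * y))) f k0 x.
  cbv beta in I. assert (E : pA (ln (R' * x k)) - pA (ln (r * x k)) = INR k * PI).
  { apply I; auto.
    - intros y Hy.
      destruct (phaseA_derive q q1 u u1 v v1 W th A (ln (R' * y)) H Hth) as (n1 & _ & _ & _ & D1).
      destruct (phaseA_derive q q1 u u1 v v1 W th A (ln (r * y)) H Hth) as (n0 & _ & _ & _ & D0).
      fold pA in D0, D1.
      have L1 : is_derive (fun y => ln (R' * y)) y (/ y) by (derive_tac; [nra|obv]).
      have L0 : is_derive (fun y => ln (r * y)) y (/ y) by (derive_tac; [nra|obv]).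
      have C1 := is_derive_comp pA _ y _ _ D1 L1. have C0 := is_derive_comp pA _ y _ _ D0 L0.
      eexists; split; [apply (is_derive_minus _ _ y _ _ C1 C0)|].
      intros j Ej. destruct (phaseA_growth q q1 u u1 v v1 W th A _ _ j H Hth Hq1 (Hlt y Hy)) as (d0 & d1 & G0 & G1 & G).
      + fold pA. lra.
      + fold pA in G0, G1. rewrite <- (is_derive_unique _ _ _ G0), <- (is_derive_unique _ _ _ G1) in G.
        rewrite (is_derive_unique _ _ _ D0), (is_derive_unique _ _ _ D1) in G.
        unfold minus, plus, opp, scal; simpl. unfold mult; simpl.
        have : 0 < / y. simpl in G. nra.
    - intros y Hy. rewrite (Hf y Hy). apply (cross_zero q q1 u u1 v v1 W th A (ln (r * y)) (ln (R' * y)) H Hth). }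
  exists (pA (ln (r * x k))). split; [now apply (angle_phaseA q q1)|].
  rewrite INR_IZR_INZ in E |- *.
  turn (pA (ln (r * x k))) into (pA (ln (R' * x k)) - IZR (Z.of_nat k) * PI).
  rewrite angle_shift. f_equal. now apply (angle_phaseA q q1).
Qed.

(** The positive sign of the derivative gives the lower bound. A difference of [PI] or more would
    mean that the Prüfer angle gains [PI], which the faster constant-coefficient flow does not do in
    this time. *)
Lemma phaseA_small_pos q q1 u u1 v v1 W th A t0 t1 w : sys q q1 u u1 v v1 W -> phase u v W th ->
  t0 < t1 -> 0 < w -> w * (t1 - t0) < PI ->
  (forall t, t0 <= t <= t1 -> q t <= w^2 /\ 0 < cos A^2 + q t * sin A^2) ->
  0 < phaseA u u1 v v1 W th A t1 - phaseA u u1 v v1 W th A t0 < PI.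
Proof.
  intros H Hth Ht Hw Hwl Hq. split.
  - assert (phaseA u u1 v v1 W th A t0 < phaseA u u1 v v1 W th A t1); [|lra].
    apply deriv_pos_lt; auto. intros t Htt.
    destruct (phaseA_derive q q1 u u1 v v1 W th A t H Hth) as (n & Hn & _ & _ & D).
    eexists; split; [exact D|]. destruct (Hq t Htt) as [_ h]. destruct H as (_ & _ & HW & _).
    apply Rdiv_lt_0_compat; auto. now apply Rmult_lt_0_compat.
  - set (c := phaseA u u1 v v1 W th A t0).
    destruct (prufer_const w t0 A Hw) as (be & Hb & B0 & B1).
    assert (G : angle u u1 v v1 W th c t1 <= be t1).
    { apply (prufer_le q (fun _ => w^2) _ be t0 t1 (Rabs (w^2 - 1))); auto; try lra.
      - now apply (angle_prufer q q1).
      - intros t Htt; split; [now apply Hq|lra].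
      - rewrite B0. unfold c. rewrite (angle_phaseA q q1); auto; lra. }
    specialize (B1 t1 Hwl).
    have HP := sysP_pos _ _ _ _ _ _ _ t1 H. have HW : 0 < W by apply H.
    destruct (Rlt_dec (phaseA u u1 v v1 W th A t1 - c) PI) as [h|h]; auto. exfalso.
    assert (X : A <= angle u u1 v v1 W th (c + IZR 1 * PI) t1).
    { rewrite <- (angle_phaseA q q1 u u1 v v1 W th A t1 H) at 1. unfold angle at 1 2.
      apply Sh_le; [pos|lra]. }
    replace (angle u u1 v v1 W th c t1) with (angle u u1 v v1 W th (c + IZR 1 * PI - IZR 1 * PI) t1) in G by (f_equal; ring).
    rewrite angle_shift in G. lra.
Qed.

(** This is the start of the count for [nu > |delta|]: near [x = 0] the phase difference is
    negative, and its return to 0 is the zero with index 0. It stays above [- PI] because [th]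
    increases and a sheared angle of [A] lies in [(0, PI)]. *)
Lemma phaseA_small_neg q q1 u u1 v v1 W th A t0 t1 : sys q q1 u u1 v v1 W -> phase u v W th ->
  t0 < t1 -> 0 < A < PI ->
  (forall t, t0 <= t <= t1 -> cos A^2 + q t * sin A^2 < 0) ->
  - PI < phaseA u u1 v v1 W th A t1 - phaseA u u1 v v1 W th A t0 < 0.
Proof.
  intros H Hth Ht HA Hq. have HW : 0 < W by apply H. split.
  - set (c := phaseA u u1 v v1 W th A t0).
    have HP := fun t => sysP_pos _ _ _ _ _ _ _ t H.
    assert (c < th t0).
    { apply Rnot_le_lt; intro h.
      assert (X : angle u u1 v v1 W th c t0 <= Sh (W/sysP u v t0) (sysQ u u1 v v1 t0/sysP u v t0) 0).
      { apply Sh_le; [apply Rdiv_lt_0_compat; auto|lra]. }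
      unfold c in X at 1. rewrite (angle_phaseA q q1), Sh_0 in X; auto. lra. }
    assert (th t0 <= th t1).
    { apply deriv_nonneg_le; [lra|]. intros t _. destruct (Hth t) as (T & _). eexists; split; [exact T|].
      left; apply Rdiv_lt_0_compat; auto. }
    assert (th t1 - PI < phaseA u u1 v v1 W th A t1); [|pos].
    unfold phaseA.
    assert (Sh (sysP u v t1/W) (- sysQ u u1 v v1 t1/W) A < Sh (sysP u v t1/W) (- sysQ u u1 v v1 t1/W) (IZR 1 * PI)).
    { apply Sh_lt; [apply Rdiv_lt_0_compat; auto|lra]. }
    rewrite Sh_kPI in H2. lra.
  - assert (- phaseA u u1 v v1 W th A t0 < - phaseA u u1 v v1 W th A t1); [|lra].
    apply (deriv_pos_lt (fun t => - phaseA u u1 v v1 W th A t)); auto. intros t Htt.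
    destruct (phaseA_derive q q1 u u1 v v1 W th A t H Hth) as (n & Hn & _ & _ & D).
    eexists; split; [apply (is_derive_opp (phaseA u u1 v v1 W th A)); exact D|]. specialize (Hq t Htt).
    unfold opp; simpl.
    assert (0 < n * - (cos A^2 + q t * sin A^2)/W).
    { obv. }
    obv.
Qed.

(** * The Bessel equation in logarithmic time *)

Definition bq nu t := exp (2 * t) - nu^2.
Definition bq1 t := 2 * exp (2 * t).
(** With [x = e^t] this is [sqrt (x^2 - nu^2)], and [Xi] of it is the Debye phase [sqrt (x^2 - nu^2)
    - nu arccos (nu/x) = PI x g(nu/x)]. Left of the turning point [sqrt] of a negative number is 0,
    which makes [bxi] vanish there. *)
Definition bs nu t := sqrt (bq nu t).
Definition Xi nu s := s - nu * atan (s/nu).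
Definition bxi nu t := Xi nu (bs nu t).
(** The integral from [t] to infinity of the WKB correction [rho sqrt q], in closed form. *)
Definition bB nu t := / (4 * bs nu t) + 5 * nu^2/(12 * bs nu t^3).

Lemma bq_derive nu t : is_derive (bq nu) t (bq1 t).
Proof. unfold bq, bq1. derive_tac. Rring. Qed.
Lemma bq1_derive t : is_derive bq1 t (4 * exp (2 * t)).
Proof. unfold bq1. derive_tac. Rring. Qed.
Lemma bq1_pos t : 0 < bq1 t.
Proof. unfold bq1. obv. Qed.

Lemma bs_pos nu t : 0 < bq nu t -> 0 < bs nu t.
Proof. apply sqrt_lt_R0. Qed.
Lemma bs_sq nu t : 0 < bq nu t -> bs nu t * bs nu t = bq nu t.
Proof. intros; apply sqrt_sqrt; lra. Qed.
Lemma bs_exp nu t : 0 < bq nu t -> exp (2 * t) = bs nu t * bs nu t + nu^2.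
Proof. intros; rewrite bs_sq; auto. unfold bq; ring. Qed.

Lemma bs_derive nu t : 0 < bq nu t -> is_derive (bs nu) t ((bs nu t^2 + nu^2)/bs nu t).
Proof.
  intros H. have D := bq_derive nu t. unfold bs at 1. derive_tac; auto.
  fold (bs nu t). have P := bs_pos _ _ H. unfold bq1. rewrite (bs_exp nu t H). Rfield; lra.
Qed.

Lemma Xi_derive nu s : 0 <= nu -> 0 < s -> is_derive (Xi nu) s (s^2/(s^2 + nu^2)).
Proof.
  intros Hn Hs. destruct Hn as [Hn|Hn].
  - unfold Xi. derive_tac; try lra. unfold Rsqr. Rfield. split; nra.
  - subst nu. apply is_derive_ext with (f := fun s => s).
    + intros t. unfold Xi. now rewrite Rmult_0_l, Rminus_0_r.
    + eapply is_derive_eq; [apply (is_derive_id s)|]. change (@one R_AbsRing) with 1. Rfield. nra.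
Qed.

Lemma bxi_derive nu t : 0 <= nu -> 0 < bq nu t -> is_derive (bxi nu) t (bs nu t).
Proof.
  intros Hn H. have P := bs_pos _ _ H. unfold bxi.
  eapply is_derive_eq; [apply (is_derive_comp (Xi nu) (bs nu)); [now apply Xi_derive|now apply bs_derive]|].
  unfold scal; simpl; unfold mult; simpl. obv.
Qed.

Lemma brho_eq nu t : 0 < bq nu t -> wkb_rho (bq nu) bq1 (fun t => 4 * exp (2 * t)) t
  = (bs nu t^2 + nu^2) * (bs nu t^2 + 5 * nu^2)/(4 * bs nu t^6).
Proof.
  intros H. have P := bs_pos _ _ H. unfold wkb_rho, bq1. rewrite (bs_exp nu t H), <- (bs_sq nu t H).
  field. lra.
Qed.

Lemma brho_nonneg nu t : 0 < bq nu t -> 0 <= wkb_rho (bq nu) bq1 (fun t => 4 * exp (2 * t)) t.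
Proof.
  intros H. have P := bs_pos _ _ H. rewrite brho_eq by auto.
  obv.
Qed.

Lemma bB_derive nu t : 0 < bq nu t -> is_derive (bB nu) t
  (- wkb_rho (bq nu) bq1 (fun t => 4 * exp (2 * t)) t * sqrt (bq nu t)).
Proof.
  intros H. have P := bs_pos _ _ H. have D := bs_derive nu t H. unfold bB.
  have P3 : 0 < bs nu t^3.
  rewrite brho_eq by auto. fold (bs nu t). derive_tac; try lra. Rfield; lra.
Qed.

Lemma bq_mono nu a b : a <= b -> bq nu a <= bq nu b.
Proof.
  intros [H|H]; [|subst; lra]. unfold bq. have : exp (2 * a) < exp (2 * b). lra.
Qed.

Definition bwkb nu al := wkb (bq nu) bq1 al.

Lemma bwkb_derive nu al t : prufer (bq nu) al -> 0 < bq nu t ->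
  is_derive (bwkb nu al) t
    (bs nu t * (1 + (bs nu t^2 + nu^2) * (bs nu t^2 + 5 * nu^2)/(4 * bs nu t^6) * sin (bwkb nu al t)^2)).
Proof.
  intros Ha H. rewrite <- brho_eq by auto. apply wkb_derive; auto using bq_derive, bq1_derive.
Qed.

Lemma bwkb_growth nu al a b : 0 <= nu -> prufer (bq nu) al -> 0 < bq nu a -> a <= b ->
  bxi nu b - bxi nu a <= bwkb nu al b - bwkb nu al a <= bxi nu b - bxi nu a + (bB nu a - bB nu b).
Proof.
  intros Hn Ha Hq Hab. apply (wkb_growth (bq nu) bq1 (fun t => 4 * exp (2 * t))); auto.
  intros t Ht. have : 0 < bq nu t by (have h := bq_mono nu a t ok; lra).
  splits; auto using bq_derive, bq1_derive, bB_derive, brho_nonneg. now apply bxi_derive.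
Qed.

Lemma bB_pos nu t : 0 < bq nu t -> 0 < bB nu t.
Proof.
  intros H. have P := bs_pos _ _ H. unfold bB.
  pos.
Qed.

(** * Boundary conditions *)

(* [d] is the prescribed value of [u'/u] at the boundary; Dirichlet conditions are [A = 0]. *)
Definition bcond A d := (A = 0 /\ d = 0) \/ (0 < A < PI /\ cos A = d * sin A).

Lemma arccot_exists d : exists A, bcond A d /\ 0 < A < PI /\ cos A = d * sin A.
Proof.
  exists (PI/2 - atan d). have h := atan_bound d.
  have P : 0 < 1 + d² by (unfold Rsqr; nra). have Q := sqrt_lt_R0 _ P.
  assert (E : 0 < PI/2 - atan d < PI /\ cos (PI/2 - atan d) = d * sin (PI/2 - atan d)).
  { split; [lra|]. rewrite cos_shift, sin_shift, sin_atan, cos_atan. field. lra. }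
  split; auto. right; auto.
Qed.

Lemma x_cos_le_sin x : 0 <= x <= PI -> x * cos x <= sin x.
Proof.
  intros H. assert (G : sin 0 - 0 * cos 0 <= sin x - x * cos x).
  { apply (deriv_nonneg_le (fun x => sin x - x * cos x)); [lra|].
    intros t Ht. exists (t * sin t). split; [derive_tac; Rring|].
    apply Rmult_le_pos; [lra|apply sin_ge_0; lra]. }
  rewrite sin_0 in G. lra.
Qed.

Lemma angle_near_half e z : 0 < e < PI -> cos e = z * sin e -> Rabs (e - PI/2) <= Rabs z.
Proof.
  intros He E.
  assert (G : forall e z, 0 < e <= PI/2 -> cos e = z * sin e -> PI/2 - e <= z).
  { clear. intros e z He E. have h := x_cos_le_sin (PI/2 - e) ok.
    rewrite cos_shift, sin_shift, E in h. have : 0 < sin e by (apply sin_gt_0; lra).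
    obv. }
  destruct (Rle_dec e (PI/2)).
  - have h := G e z ok E. rewrite Rabs_left1 by lra. have h2 := Rle_abs z. lra.
  - have h := G (PI - e) (- z) ok. rewrite Rtrigo_facts.cos_pi_minus, sin_PI_x in h.
    specialize (h ok). rewrite Rabs_pos_eq by lra. rewrite <- Rabs_Ropp. have h2 := Rle_abs (- z). lra.
Qed.

(** On cotangents the shear acts as the affine map [d -> a d + b], and an angle in [(0, PI)] is no
    farther from [PI/2] than its cotangent is from 0. *)
Lemma Sh_near_half a b A d : 0 < a -> 0 < A < PI -> cos A = d * sin A ->
  Rabs (Sh a b A - PI/2) <= Rabs (a * d + b).
Proof.
  intros Ha HA E. destruct (Sh_dir a b A Ha) as [E1 E2].
  have P := sqrt_lt_R0 _ (Shn_pos a b A Ha). set (n := sqrt (Shn a b A)) in *.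
  apply angle_near_half.
  - have h := Sh_kPI a b 1. rewrite Rmult_1_l in h.
    have h0 := Sh_lt a b 0 A Ha ok. have h1 := Sh_lt a b A PI Ha ok.
    rewrite Sh_0 in h0. rewrite h in h1. lra.
  - apply Rmult_eq_reg_l with n; [|lra]. rewrite <- E2.
    turn (n * ((a * d + b) * sin (Sh a b A))) into ((a * d + b) * (n * sin (Sh a b A))).
    rewrite <- E1. unfold Shc. obv.
Qed.

Lemma bcond_Sh_diff a1 b1 a2 b2 A d : 0 < a1 -> 0 < a2 -> bcond A d ->
  Rabs (Sh a1 b1 A - Sh a2 b2 A) <= Rabs (a1 * d + b1) + Rabs (a2 * d + b2).
Proof.
  intros H1 H2 [[e1 e2]|[h1 h2]].
  - subst. rewrite !Sh_0. rewrite Rminus_0_r, Rabs_R0. have h := Rabs_pos (a1 * 0 + b1). have h' := Rabs_pos (a2 * 0 + b2). lra.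
  - have G1 := Sh_near_half a1 b1 A d H1 h1 h2. have G2 := Sh_near_half a2 b2 A d H2 h1 h2.
    obv.
Qed.

Lemma bwkb_bc nu t d : 0 < bq nu t ->
  0 < wkb_a (bq nu) t /\
  wkb_a (bq nu) t * d + wkb_b (bq nu) bq1 t = d/bs nu t + / (2 * bs nu t) + nu^2/(2 * bs nu t^3).
Proof.
  intros H. have P := bs_pos _ _ H. unfold wkb_a, wkb_b. fold (bs nu t). split; [pos|].
  unfold bq1. rewrite (bs_exp nu t H), <- (bs_sq nu t H). field. lra.
Qed.

Lemma bwkb_bc_le nu t d : 0 < bq nu t ->
  Rabs (wkb_a (bq nu) t * d + wkb_b (bq nu) bq1 t) <= (1 + Rabs d) * (/ bs nu t + nu^2/bs nu t^3).
Proof.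
  intros H. have P := bs_pos _ _ H. destruct (bwkb_bc nu t d H) as [_ E]. rewrite E.
  have : 0 < / bs nu t.
  have : 0 <= nu^2/bs nu t^3.
  have hd := Rabs_pos d.
  replace (d/bs nu t + / (2 * bs nu t) + nu^2/(2 * bs nu t^3)) with
    (d * / bs nu t + (/ bs nu t/2 + nu^2/bs nu t^3/2)) by obv.
  eapply Rle_trans; [apply Rabs_triang|]. rewrite Rabs_mult, (Rabs_pos_eq (/ bs nu t)) by lra.
  rewrite (Rabs_pos_eq (_ + _)) by lra. nra.
Qed.

Lemma bs_mono nu a b : 0 < bq nu a -> a <= b -> bs nu a <= bs nu b.
Proof. intros H Hab. apply sqrt_le_1_alt. now apply bq_mono. Qed.

(** A common size for the shift of the boundary angle under the WKB shear and for the remaining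
    correction [bB]. The first term dominates far from the turning point, the second close to it. *)
Definition wkb_size nu t := / bs nu t + nu^2/bs nu t^3.

Lemma wkb_size_mono nu a b : 0 < bq nu a -> a <= b -> 0 < wkb_size nu b <= wkb_size nu a.
Proof.
  intros H Hab. have P := bs_pos _ _ H. have M := bs_mono nu a b H Hab. unfold wkb_size.
  have : 0 < / bs nu b.
  have : 0 < bs nu b^3. have : 0 < bs nu a^3.
  have n := pow2_ge_0 nu.
  have : 0 <= nu^2/bs nu b^3.
  split; [lra|]. apply Rplus_le_compat.
  - now apply Rinv_le_contravar.
  - obv.
Qed.

Lemma bB_le_size nu t : 0 < bq nu t -> bB nu t <= wkb_size nu t.
Proof.
  intros H. have P := bs_pos _ _ H. unfold bB, wkb_size.
  have : 0 < / bs nu t.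
  have : 0 < bs nu t^3. have n := pow2_ge_0 nu.
  have : 0 <= nu^2/bs nu t^3.
  turn (/ (4 * bs nu t) + 5 * nu^2/(12 * bs nu t^3)) into (/ bs nu t/4 + 5/12 * (nu^2/bs nu t^3)).
  lra.
Qed.

(** Each end contributes [1 + |d|] through its boundary angle and the correction integral
    contributes 1: together [3 + 2 |d|], all measured at the inner end because [wkb_size]
    decreases. *)
Lemma wkb_region nu al A d t0 t1 k : 0 <= nu -> prufer (bq nu) al -> bcond A d ->
  0 < bq nu t0 -> t0 <= t1 -> al t0 = A -> al t1 = A + INR k * PI ->
  Rabs (INR k * PI - (bxi nu t1 - bxi nu t0)) <= (3 + 2 * Rabs d) * wkb_size nu t0.
Proof.
  intros Hn Hal Hb Hq Ht E0 E1.
  have G := bwkb_growth nu al t0 t1 Hn Hal Hq Ht.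
  have Hq1 : 0 < bq nu t1 by (have h := bq_mono nu t0 t1 Ht; lra).
  unfold bwkb, wkb in G. rewrite E0, E1, INR_IZR_INZ, Sh_shift, <- INR_IZR_INZ in G.
  destruct (bwkb_bc nu t0 d Hq) as [a0 _]. destruct (bwkb_bc nu t1 d Hq1) as [a1 _].
  have D := bcond_Sh_diff _ (wkb_b (bq nu) bq1 t1) _ (wkb_b (bq nu) bq1 t0) A d a1 a0 Hb.
  have F0 := bwkb_bc_le nu t0 d Hq. have F1 := bwkb_bc_le nu t1 d Hq1.
  fold (wkb_size nu t0) in F0. fold (wkb_size nu t1) in F1.
  have M := wkb_size_mono nu t0 t1 Hq Ht. have hd := Rabs_pos d.
  have B0 := bB_le_size nu t0 Hq. have B1 := bB_pos nu t1 Hq1.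
  have : (1 + Rabs d) * wkb_size nu t1 <= (1 + Rabs d) * wkb_size nu t0.
  apply Rabs_le_between in D. pos.
Qed.

(** * The transition region: comparison with the Airy equation *)

Definition aq (y : R) := y.
Definition awkb (b : R -> R) := wkb aq (fun _ => 1) b.

Lemma awkb_derive b y : prufer aq b -> 0 < y ->
  is_derive (awkb b) y (sqrt y * (1 + 5/(16 * y^3) * sin (awkb b y)^2)).
Proof.
  intros Hb Hy. eapply is_derive_eq.
  - apply (wkb_derive aq (fun _ => 1) (fun _ => 0)); auto.
    + apply (is_derive_id y).
    + apply (is_derive_const 1 y).
  - unfold wkb_rho, aq. fold aq. fold (awkb b y). field. lra.
Qed.

(** Langer's variable: the point [y] at which the Airy phase [(2/3) y^(3/2)] equals [xi]. *)
Definition yh xi := Rpower (3/2 * xi) (2/3).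

Lemma yh_spec xi : 0 < xi -> 0 < yh xi /\ 2/3 * (yh xi * sqrt (yh xi)) = xi.
Proof.
  intros H. have P : 0 < yh xi by apply exp_pos. split; auto.
  assert (E : sqrt (yh xi) = Rpower (3/2 * xi) (1/3)).
  { rewrite <- Rpower_sqrt by auto. unfold yh. rewrite Rpower_mult. f_equal; field. }
  rewrite E. unfold yh. rewrite <- Rpower_plus. turn (2/3 + 1/3) into 1.
  rewrite Rpower_1; lra.
Qed.

Lemma yh_derive xi : 0 < xi -> is_derive yh xi (/ sqrt (yh xi)).
Proof.
  intros H. have S := yh_spec xi H. destruct S as [P E].
  have Y : yh xi = exp (2/3 * ln (3/2 * xi)).
  unfold yh at 1. unfold Rpower. derive_tac; [lra|].
  transitivity (2/3/xi * yh xi); [rewrite Y; Rfield; lra|].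
  set (y := yh xi) in *. rewrite <- E. obv.
Qed.

Lemma atan_cubic x : 0 < x -> x^3/(3 * (1 + x^2)) <= x - atan x <= x^3/3.
Proof.
  intros Hx.
  assert (A : 0 - atan 0 - 0^3/(3 * (1 + 0^2)) <= x - atan x - x^3/(3 * (1 + x^2))).
  { apply (deriv_nonneg_le (fun x => x - atan x - x^3/(3 * (1 + x^2)))); [lra|].
    intros t Ht. exists (2 * t^4/(3 * (1 + t^2)^2)). split.
    - derive_tac; [nra|]. Rfield; splits; nra.
    - obv. }
  assert (B : 0^3/3 - (0 - atan 0) <= x^3/3 - (x - atan x)).
  { apply (deriv_nonneg_le (fun x => x^3/3 - (x - atan x))); [lra|].
    intros t Ht. exists (t^4/(1 + t^2)). split.
    - derive_tac. Rfield. nra.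
    - obv. }
  rewrite atan_0 in *. obv.
Qed.

Lemma Xi_cubic nu s : 0 < nu -> 0 < s ->
  s^3/(3 * (nu^2 + s^2)) <= Xi nu s <= s^3/(3 * nu^2).
Proof.
  intros Hn Hs. have h := atan_cubic (s/nu) ok.
  have E : Xi nu s = nu * (s/nu - atan (s/nu)) by (unfold Xi; field; lra).
  rewrite E. split.
  - turn (s^3/(3 * (nu^2 + s^2))) into (nu * ((s/nu)^3/(3 * (1 + (s/nu)^2)))).
    apply Rmult_le_compat_l; lra.
  - turn (s^3/(3 * nu^2)) into (nu * ((s/nu)^3/3)).
    obv.
Qed.

Lemma Xi_pos nu s : 0 < nu -> 0 < s -> 0 < Xi nu s.
Proof.
  intros Hn Hs. eapply Rlt_le_trans; [|apply Xi_cubic; auto].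
  obv.
Qed.

(** The second term is the Airy correction [5/(16 y^3)] at [y = yh (Xi nu s)]. Both terms have
    leading part [5 nu^4/(4 s^6)]; what is left integrates in [t] to [(3/2)/s], a far smaller
    quantity near the turning point. *)
Lemma rho_diff nu s : 0 < nu -> 0 < s ->
  Rabs ((s^2 + nu^2) * (s^2 + 5 * nu^2)/(4 * s^6) - 5/(36 * Xi nu s^2))
  <= 3/2 * ((s^2 + nu^2)/s^4).
Proof.
  intros Hn Hs. have C := Xi_cubic nu s Hn Hs. have P := Xi_pos nu s Hn Hs.
  set (X := Xi nu s) in *.
  have s2 : 0 < s^2.
  assert (L : 5 * nu^4/(4 * s^6) <= 5/(36 * X^2)).
  { turn (5 * nu^4/(4 * s^6)) into (5/36 * / ((s^3/(3 * nu^2))^2)).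
    turn (5/(36 * X^2)) into (5/36 * / X^2).
    obv. }
  assert (U : 5/(36 * X^2) <= 5 * (nu^2 + s^2)^2/(4 * s^6)).
  { turn (5 * (nu^2 + s^2)^2/(4 * s^6)) into (5/36 * / ((s^3/(3 * (nu^2 + s^2)))^2)).
    turn (5/(36 * X^2)) into (5/36 * / X^2).
    obv. }
  set (T := 5/(36 * X^2)) in *.
  turn (3/2 * ((s^2 + nu^2)/s^4)) into ((6 * s^4 + 6 * nu^2 * s^2)/(4 * s^6)).
  have I : forall a b, a <= b -> a/(4 * s^6) <= b/(4 * s^6).
  apply Rabs_le. split.
  - have h := I ((nu^2 + s^2)^2 * 5 - (s^2 + nu^2) * (s^2 + 5 * nu^2)) (6 * s^4 + 6 * nu^2 * s^2) ok.
    replace (((nu^2 + s^2)^2 * 5 - (s^2 + nu^2) * (s^2 + 5 * nu^2))/(4 * s^6)) with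
      (5 * (nu^2 + s^2)^2/(4 * s^6) - (s^2 + nu^2) * (s^2 + 5 * nu^2)/(4 * s^6)) in h by pos. lra.
  - obv.
Qed.

Lemma bxi_pos nu t : 0 < nu -> 0 < bq nu t -> 0 < bxi nu t.
Proof. intros; apply Xi_pos; auto using bs_pos. Qed.

(* At equal [xi] the correction terms of the Bessel and Airy WKB equations agree to leading order. *)
Lemma transition_right nu al b t0 t1 : 0 < nu -> prufer (bq nu) al -> prufer aq b ->
  0 < bq nu t0 -> t0 <= t1 ->
  Rabs (bwkb nu al t1 - awkb b (yh (bxi nu t1)))
  <= exp (/ bxi nu t0) * (Rabs (bwkb nu al t0 - awkb b (yh (bxi nu t0))) + 3/2/bs nu t0).
Proof.
  intros Hn Ha Hb Hq Ht.
  have Hqt : forall t, t0 <= t -> 0 < bq nu t by (intros t h; have h' := bq_mono nu t0 t h; lra).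
  (* The rate and the forcing have the antiderivatives [- (5/36)/xi] and [- (3/2)/s]. Both are
     bounded at infinity, so the estimate is uniform in [t1]. *)
  have G := gronwall_abs (fun t => bwkb nu al t - awkb b (yh (bxi nu t)))
    (fun t => bs nu t * (1 + (bs nu t^2 + nu^2) * (bs nu t^2 + 5 * nu^2)/(4 * bs nu t^6) * sin (bwkb nu al t)^2)
       - bs nu t * (1 + 5/(36 * bxi nu t^2) * sin (awkb b (yh (bxi nu t)))^2))
    (fun t => - (5/36/bxi nu t)) (fun t => bs nu t * (5/(36 * bxi nu t^2)))
    (fun t => - (3/2/bs nu t)) (fun t => bs nu t * (3/2 * ((bs nu t^2 + nu^2)/bs nu t^4))) t0 t1 Ht.
  cbv beta in G.
  have X0 := bxi_pos nu t0 Hn Hq. have X1 := bxi_pos nu t1 Hn (Hqt t1 Ht).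
  have S0 := bs_pos nu t0 Hq. have S1 := bs_pos nu t1 (Hqt t1 Ht).
  have i0 := Rinv_0_lt_compat _ X0. have i1 := Rinv_0_lt_compat _ X1. have i2 := Rinv_0_lt_compat _ S1.
  eapply Rle_trans; [apply G|].
  - intros t [h1 h2]. have Q := Hqt t h1. have X := bxi_pos nu t Hn Q. have S := bs_pos nu t Q.
    have Dxi := bxi_derive nu t ok Q. have Ds := bs_derive nu t Q.
    destruct (yh_spec _ X) as [Y1 Y2]. have Y3 := sqrt_lt_R0 _ Y1. have Y4 := sqrt_sqrt _ (Rlt_le _ _ Y1).
    have x2 : 0 < bxi nu t^2.
    have R1 : 0 < 5/(36 * bxi nu t^2).
    have RD := rho_diff nu (bs nu t) Hn S. fold (bxi nu t) in RD.
    set (rB := (bs nu t^2 + nu^2) * (bs nu t^2 + 5 * nu^2)/(4 * bs nu t^6)) in *.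
    set (rA := 5/(36 * bxi nu t^2)) in *.
    set (e0 := 3/2 * ((bs nu t^2 + nu^2)/bs nu t^4)) in *.
    assert (EA : 5/(16 * yh (bxi nu t)^3) = rA).
    { unfold rA. rewrite <- Y2 at 2. rewrite <- Y4 at 1. set (w := sqrt (yh (bxi nu t))) in *. rewrite <- Y4. field. lra. }
    assert (main : forall x y, x - y <> 0 -> (bs nu t * (1 + rB * sin x^2) - bs nu t * (1 + rA * sin y^2))
       <= bs nu t * e0 + bs nu t * rA * Rabs (x - y)).
    { intros x y _. have s2 := sin2_sub_le x y.
      replace (bs nu t * (1 + rB * sin x^2) - bs nu t * (1 + rA * sin y^2)) with
        (bs nu t * ((rB - rA) * sin x^2 + rA * (sin x^2 - sin y^2))) by ring.
      rewrite Rmult_assoc, <- Rmult_plus_distr_l. apply Rmult_le_compat_l; [lra|].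
      have B := SIN_bound x. have B2 : 0 <= sin x^2 <= 1.
      apply Rabs_le_between in RD. apply Rabs_le_between in s2. obv. }
    splits.
    + apply (is_derive_minus (bwkb nu al) (fun t => awkb b (yh (bxi nu t)))); [now apply bwkb_derive|].
      eapply is_derive_eq; [apply (is_derive_comp (awkb b) (fun t => yh (bxi nu t)));
        [now apply awkb_derive|apply (is_derive_comp yh (bxi nu)); [now apply yh_derive|exact Dxi]]|].
      rewrite EA. unfold scal; simpl; unfold mult; simpl. Rfield; lra.
    + derive_tac; try lra. unfold rA. Rfield; lra.
    + derive_tac; try lra. unfold e0. Rfield; lra.
    + nra.
    + have : 0 <= e0. nra.
    + intros h. eapply Rle_trans; [apply main; lra|]. rewrite Rabs_pos_eq; lra.
    + intros h.
      have s2 := sin2_sub_le (awkb b (yh (bxi nu t))) (bwkb nu al t).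
      rewrite (Rabs_pos_eq (awkb b (yh (bxi nu t)) - bwkb nu al t)) in s2 by lra.
      set (x := bwkb nu al t) in *. set (y := awkb b (yh (bxi nu t))) in *.
      replace (- (bs nu t * (1 + rB * sin x^2) - bs nu t * (1 + rA * sin y^2))) with
        (bs nu t * ((rA - rB) * sin x^2 + rA * (sin y^2 - sin x^2))) by ring.
      rewrite Rmult_assoc, <- Rmult_plus_distr_l. apply Rmult_le_compat_l; [lra|].
      have B := SIN_bound x. have B2 : 0 <= sin x^2 <= 1.
      apply Rabs_le_between in RD. apply Rabs_le_between in s2. apply Rplus_le_compat; nra.
  - apply Rmult_le_compat.
    + left; apply exp_pos.
    + have h := Rabs_pos (bwkb nu al t0 - awkb b (yh (bxi nu t0))).
      have M := bs_mono nu t0 t1 Hq Ht. have : / bs nu t1 <= / bs nu t0.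
      nra.
    + have L : - (5/36/bxi nu t1) - - (5/36/bxi nu t0) <= / bxi nu t0.
      destruct L as [L|L]; [left; now apply exp_increasing|pos].
    + obv.
Qed.

(** The Bessel coefficient near the turning point after scaling: for [t = ln nu + y/N] and
    [N^3 = 2 nu^2] one has [bq nu t = N^2 kq N y], and [kq N y] is [y] up to [O(y^2/N)]. *)
Definition kq N y := N/2 * (exp (2 * y/N) - 1).

Lemma exp_le_quadratic x : Rabs x <= 1/2 -> 1 + x <= exp x <= 1 + x + 2 * x^2.
Proof.
  intros H. apply Rabs_le_between in H. split; [apply exp_ineq1_le|].
  have h := exp_ineq1_le (- x).
  have E : exp x * exp (- x) = 1 by (rewrite <- exp_plus, Rplus_opp_r, exp_0; auto).
  obv.
Qed.

Lemma kq_bounds N y : 0 < N -> Rabs y <= N/4 -> y <= kq N y <= y + 4 * y^2/N.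
Proof.
  intros HN Hy. have h := exp_le_quadratic (2 * y/N).
  assert (E : Rabs (2 * y/N) <= 1/2).
  { turn (2 * y/N) into (y * (2/N)). rewrite Rabs_mult, (Rabs_pos_eq (2/N)).
    - apply Rmult_le_reg_r with (N/2); [lra|]. field_simplify; lra.
    - obv. }
  unfold kq. split.
  - turn y into (N/2 * (2 * y/N)) at 1. apply Rmult_le_compat_l; lra.
  - turn (y + 4 * y^2/N) into (N/2 * (2 * y/N + 2 * (2 * y/N)^2)).
    obv.
Qed.

Lemma kq_mono N a b : 0 < N -> a <= b -> kq N a <= kq N b.
Proof.
  intros HN [H|H]; [|subst; lra]. unfold kq. apply Rmult_le_compat_l; [lra|].
  assert (exp (2 * a/N) < exp (2 * b/N)); [|lra]. obv.
Qed.

Lemma kq_neg N y : 0 < N -> y <= 0 -> kq N y <= 0.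
Proof.
  intros HN Hy. have h := kq_mono N y 0 HN Hy. unfold kq in h at 2.
  turn (2 * 0/N) into 0 in h. rewrite exp_0 in h. lra.
Qed.

Lemma prufer_scaled nu N al : 0 < nu -> 0 < N -> N^3 = 2 * nu^2 -> prufer (bq nu) al ->
  prufer (kq N) (fun y => Sh (/ N) 0 (al (ln nu + y/N))).
Proof.
  intros Hn HN E H y. set (t := ln nu + y/N).
  assert (D : is_derive (fun y => al (ln nu + y/N)) y ((cos (al t)^2 + bq nu t * sin (al t)^2)/N)).
  { eapply is_derive_eq.
    - apply (is_derive_comp al (fun y => ln nu + y/N)); [apply H|].
      apply (is_derive_eq _ y (/ N + 0) (/ N)); [|ring]. derive_tac. Rfield; lra.
    - unfold scal; simpl; unfold mult; simpl. obv. }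
  have iN := Rinv_0_lt_compat _ HN.
  eapply is_derive_eq.
  - apply (Sh_derive (fun _ => / N) (fun _ => 0) (fun y => al (ln nu + y/N)) 0 0 ((cos (al t)^2 + bq nu t * sin (al t)^2)/N) y iN).
    + apply (is_derive_const (/ N) y).
    + apply (is_derive_const 0 y).
    + exact D.
  - cbv beta. fold t. set (x := al t). destruct (Sh_dir (/ N) 0 x iN) as [E1 E2].
    have P := Shn_pos (/ N) 0 x iN. have P2 := sqrt_lt_R0 _ P.
    have QN := sqrt_sqrt _ (Rlt_le _ _ P). set (n := sqrt (Shn (/ N) 0 x)) in *.
    have F1 : sin (Sh (/ N) 0 x) = sin x/n by (rewrite E1 at 1; field; lra).
    have F2 : cos (Sh (/ N) 0 x) = Shc (/ N) 0 x/n by (rewrite E2 at 1; field; lra).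
    rewrite F1, F2, <- QN. unfold Shc.
    assert (B : bq nu t = N^2 * kq N y).
    { unfold bq, kq, t. turn (2 * (ln nu + y/N)) into (ln nu + ln nu + 2 * y/N).
      rewrite !exp_plus, exp_ln by auto.
      transitivity (nu^2 * (exp (2 * y/N) - 1)); [ring|].
      turn (nu^2) into (N^3/2). field. }
    rewrite B. field. lra.
Qed.

Lemma prufer_nonneg q al a b M : prufer q al -> a <= b ->
  (forall t, a <= t <= b -> Rabs (q t) <= M) -> 0 <= al a -> 0 <= al b.
Proof.
  intros H Hab HM H0.
  have M0 : 0 <= M by (eapply Rle_trans; [apply Rabs_pos|apply (HM a); lra]).
  have G := gronwall (fun t => - al t) (fun t => - (cos (al t)^2 + q t * sin (al t)^2))
    (fun t => M * t) (fun _ => M) (fun _ => 0) (fun _ => 0) a b Hab.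
  cbv beta in G. rewrite Rmax_right in G by lra.
  assert (K : - al b <= exp (M * b - M * a) * (0 + (0 - 0))); [|lra].
  apply G. intros t Ht. splits; try lra.
  - apply (is_derive_opp al), H.
  - derive_tac; Rring.
  - apply (is_derive_const 0 t).
  - intros D. have h := HM t Ht. apply Rabs_le_between in h.
    have s := sin_le_abs (al t). rewrite (Rabs_left (al t)) in s by lra.
    have B := SIN_bound (al t). apply Rabs_le_between in s.
    have : 0 <= sin (al t)^2 <= - al t.
    obv.
Qed.

Lemma sin_sq_le x : sin x^2 <= x^2.
Proof. rewrite <- !Rsqr_pow2. apply Rsqr_le_abs_1, sin_le_abs. Qed.

(** For [q <= 0] the velocity at [PI/2 + u] is at most [sin u^2 <= u^2]. While [u <= 2 s] the excess
    grows by at most [4 s^2 (b - a) <= s], so a small overshoot at most doubles. *)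
Lemma prufer_le_half q al a b s : prufer q al -> a <= b -> 0 <= s -> 4 * s * (b - a) <= 1 ->
  (forall t, a <= t <= b -> q t <= 0) -> al a <= PI/2 + s -> al b <= PI/2 + 2 * s.
Proof.
  intros H Hab Hs Hl Hq H0.
  set (be := fun t => PI/2 + s + 4 * s^2 * (t - a)).
  have G := gronwall (fun t => al t - be t) (fun t => cos (al t)^2 + q t * sin (al t)^2 - 4 * s^2)
    (fun t => 1 * t) (fun _ => 1) (fun _ => 0) (fun _ => 0) a b Hab.
  cbv beta in G. rewrite Rmax_right in G by obv.
  assert (K : al b - be b <= exp (1 * b - 1 * a) * (0 + (0 - 0))).
  { apply G. intros t Ht. splits; try lra.
    - apply (is_derive_minus al be); [obv|]. unfold be. derive_tac. Rring.
    - derive_tac; Rring.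
    - apply (is_derive_const 0 t).
    - intros D. assert (c1 : cos (al t)^2 - cos (be t)^2 <= al t - be t).
      { rewrite !cs1. have h := sin2_sub_le (al t) (be t).
        rewrite (Rabs_pos_eq (al t - be t)) in h by lra. obv. }
      assert (c2 : cos (be t)^2 <= 4 * s^2).
      { set (u := be t - PI/2). turn (be t) into (PI/2 + u).
        have h := sin_sq_le u. rewrite cos_plus, cos_PI2, sin_PI2.
        have : 0 <= u <= 2 * s. nra. }
      specialize (Hq t Ht). nra. }
  unfold be in K. nra.
Qed.

Lemma deriv_bound (f f' : R -> R) a b M : a <= b ->
  (forall t, a <= t <= b -> is_derive f t (f' t) /\ Rabs (f' t) <= M) -> Rabs (f b - f a) <= M * (b - a).
Proof.
  intros Hab H. destruct (deriv_mvt f a b Hab) as [c [Hc E]].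
  - intros t Ht. eexists; apply H; auto.
  - destruct (H c Hc) as [D B]. rewrite E, (is_derive_unique _ _ _ D), Rabs_mult, (Rabs_pos_eq (b - a)) by lra.
    obv.
Qed.

Lemma is_derive_linear (c t : R) : is_derive (fun t => c * t) t c.
Proof. derive_tac. Rring. Qed.

Lemma prufer_rate q x : Rabs (cos x^2 + q * sin x^2) <= 1 + Rabs q.
Proof.
  rewrite cs1. have B := SIN_bound x. have : 0 <= sin x^2 <= 1.
  eapply Rle_trans; [apply Rabs_triang|]. rewrite Rabs_mult.
  rewrite (Rabs_pos_eq (sin x^2)), (Rabs_pos_eq (1 - sin x^2)) by lra. have h := Rabs_pos q. nra.
Qed.

Lemma ln_bounds x : -1/2 <= x -> x - 2 * x^2 <= ln (1 + x) <= x.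
Proof.
  intros Hx. split.
  - have h := exp_ineq1_le (- ln (1 + x)). rewrite exp_Ropp, exp_ln in h by lra.
    assert (x - 2 * x^2 <= 1 - / (1 + x)); [|lra].
    apply Rmult_le_reg_r with (1 + x); [lra|]. turn ((1 - / (1 + x)) * (1 + x)) into x. nra.
  - have h := exp_ineq1_le (ln (1 + x)). rewrite exp_ln in h by lra. lra.
Qed.

(** The threshold [100 + 144 d^2] makes [sqrt N] exceed both 10 and [12 |d|], which keeps the
    overshoot [|d|/N] harmless along a stretch of length [Y]. *)
Lemma N_facts N Y d : 100 + 144 * d^2 <= N -> 1 <= Y -> Y^2 <= N ->
  10 <= sqrt N /\ sqrt N * sqrt N = N /\ Y <= sqrt N /\ 12 * Rabs d <= sqrt N /\ Y * Rabs d <= N/12 /\ Rabs d <= N/12.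
Proof.
  intros HN HY HY2.
  have S := sqrt_sqrt N ok. have P := sqrt_pos N.
  have DD : Rabs d^2 = d^2 by (rewrite <- !Rsqr_pow2; symmetry; apply Rsqr_abs).
  obv.
Qed.

(* For [y <= 0] the two angles stay in [0, pi/2] (up to [s]), where the flow does not expand. *)
Lemma transition_left d N Y w a b A0 A : 100 + 144 * d^2 <= N -> 1 <= Y -> Y^2 <= N ->
  - Y <= w <= 1 -> prufer (kq N) a -> prufer aq b ->
  a (N * ln (1 + w/N)) = A0 -> b w = A ->
  0 <= A0 <= PI/2 + Rabs d/N -> 0 <= A <= PI/2 -> Rabs (A0 - A) <= Rabs d/N ->
  Rabs (a 1 - b 1) <= exp 1 * (exp (4 * Rabs d) * (Rabs d/N + 84 * (Y^3/N)) + 4/N).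
Proof.
  intros HN HY HY2 Hw Ha Hb Ea Eb HA0 HA HAA.
  destruct (N_facts N Y d HN HY HY2) as (F1 & F2 & F3 & F4 & F5 & F6).
  have D := Rabs_pos d. have HNp : 100 <= N.
  set (y0 := N * ln (1 + w/N)) in *. set (s := Rabs d/N) in *.
  have iN : 0 < / N.
  have Hs : 0 <= s.
  have sN : s * N = Rabs d.
  have YN : 10 * Y <= N.
  assert (wN : -1/10 <= w/N <= 1/10).
  { have h : w/N * N = w. obv. }
  have L := ln_bounds (w/N) ok.
  have w2 : 0 <= w^2 <= Y^2.
  assert (y0w : w - 2 * Y^2/N <= y0 <= w).
  { unfold y0. split.
    - apply Rle_trans with (N * (w/N - 2 * (w/N)^2)); [|pos].
      turn (N * (w/N - 2 * (w/N)^2)) into (w - 2 * w^2 * / N).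
      unfold Rdiv. nra.
    - turn w into (N * (w/N)) at 2. obv. }
  have YYN : Y^2/N <= 1 by (apply Rmult_le_reg_r with N; [lra|]; unfold Rdiv; rewrite Rmult_assoc, Rinv_l; lra).
  have Y2N : 2 * Y^2/N <= 2.
  have Y3 : Y <= Y^2 <= Y^3.
  have kb : forall y, Rabs y <= N/4 -> y <= kq N y <= y + 4 * y^2/N by (intros; apply kq_bounds; auto; lra).
  (* The two angles start at slightly different abscissas, [y0] and [w]. Their distance is at most
     [2 Y^2/N] and the angle moves at speed at most [40 Y]. *)
  assert (Sw : Rabs (a w - A0) <= 80 * (Y^3/N)).
  { rewrite <- Ea. eapply Rle_trans.
    - apply (deriv_bound a (fun t => cos (a t)^2 + kq N t * sin (a t)^2) y0 w (40 * Y)); [lra|].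
      intros t Ht. split; [obv|]. eapply Rle_trans; [apply prufer_rate|].
      have tb0 : Rabs t <= Y + 2.
      have tb : Rabs t <= 3 * Y.
      have h := kb t ok. have t2 : t^2 <= 9 * Y^2 by (apply Rabs_le_between in tb; nra).
      assert (4 * t^2/N <= 36 * Y).
      { apply Rle_trans with (36 * (Y^2/N)); [obv|]. nra. }
      apply Rabs_le_between in tb.
      have : Rabs (kq N t) <= 39 * Y. lra.
    - obv. }
  have Dw : Rabs (a w - b w) <= s + 80 * (Y^3/N).
  set (w' := Rmax w 0). have Hw' : w <= w' <= 1 /\ 0 <= w' by (unfold w', Rmax; destruct (Rle_dec w 0); lra).
  have YYY : 0 <= Y^3/N.
  assert (Dw' : Rabs (a w' - b w') <= exp (4 * Rabs d) * (s + 84 * (Y^3/N))).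
  { have E1 : 1 <= exp (4 * Rabs d) by (have h := exp_ineq1_le (4 * Rabs d); lra).
    unfold w', Rmax; destruct (Rle_dec w 0) as [Hw0|Hw0]; [|nra].
    assert (kM : forall t, y0 <= t <= 0 -> Rabs (kq N t) <= 3 * Y).
    { intros t Ht. have h := kq_neg N t ok ok.
      have h2 := kb t ok. obv. }
    assert (ra : forall t, y0 <= t <= 0 -> 0 <= a t <= PI/2 + 2 * s).
    { intros t Ht. split.
      - apply (prufer_nonneg (kq N) a y0 t (3 * Y)); auto; try lra. intros; apply kM; lra.
      - apply (prufer_le_half (kq N) a y0 t s); auto; try lra.
        + assert (s * Y <= 1/12). { apply Rmult_le_reg_r with N; [lra|]. obv. }
          have : t - y0 <= 3 * Y. nra.
        + intros x Hx. apply kq_neg; lra. }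
    assert (rb : forall t, w <= t <= 0 -> 0 <= b t <= PI/2).
    { intros t Ht. split.
      - apply (prufer_nonneg aq b w t Y); auto; try lra. intros x Hx; unfold aq. apply Rabs_le; lra.
      - assert (b t <= PI/2 + 2 * 0); [|lra].
        apply (prufer_le_half aq b w t 0); auto; try lra. intros x Hx. unfold aq; lra. }
    assert (s12 : s <= 1/12). { apply Rmult_le_reg_r with N; [lra|]. lra. }
    have PI3 := PI2_3_2.
    (* In the first quadrant the sines of [x + y] and [x - y] have the same sign while [t - 1] is
       negative: the difference contracts. Only the overshoot [2 s] beyond [PI/2] can spoil this, at
       the rate [4 s Y]. *)
    assert (main : forall t x y, w <= t <= 0 -> 0 <= x - y -> x - y <= PI -> x + y <= PI + 2 * s -> 0 <= x + y ->
       (t - 1) * (sin (x + y) * sin (x - y)) <= 4 * s * Y * (x - y)).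
    { intros t x y Ht h1 h2 h3 h4.
      assert (S1 : - (2 * s) <= sin (x + y)).
      { destruct (Rle_dec (x + y) PI); [have h := sin_ge_0 (x + y) h4 r; lra|].
        turn (x + y) into ((x + y - PI) + PI). rewrite neg_sin.
        have h := sin_le_abs (x + y - PI). rewrite (Rabs_pos_eq (x + y - PI)) in h by lra.
        obv. }
      assert (S2 : 0 <= sin (x - y) <= x - y).
      { split; [apply sin_ge_0; lra|]. have h := sin_le_abs (x - y). rewrite (Rabs_pos_eq (x - y)) in h by lra.
        obv. }
      have T : 0 <= 1 - t <= 2 * Y.
      turn ((t - 1) * (sin (x + y) * sin (x - y))) into ((1 - t) * (- sin (x + y)) * sin (x - y)).
      assert ((1 - t) * (- sin (x + y)) <= 2 * Y * (2 * s)).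
      { apply Rle_trans with ((1 - t) * (2 * s)); [pos|pos]. }
      have : 0 <= 2 * Y * (2 * s). nra. }
    (* Over a stretch of length at most [Y] the rate sums to [4 s Y^2 <= 4 |d|], because [Y^2 <= N]
       and [s N = |d|]; the forcing [4 Y^2/N] sums to [4 Y^3/N] and turns 80 into 84. *)
    have G := gronwall_abs (fun t => a t - b t)
      (fun t => cos (a t)^2 + kq N t * sin (a t)^2 - (cos (b t)^2 + aq t * sin (b t)^2))
      (fun t => 4 * s * Y * t) (fun _ => 4 * s * Y) (fun t => 4 * (Y^2/N) * t) (fun _ => 4 * (Y^2/N)) w 0 Hw0.
    cbv beta in G. eapply Rle_trans; [apply G|].
    - intros t Ht. have Ra := ra t ok. have Rb := rb t Ht.
      have K := kb t ok.
      assert (t2 : 4 * t^2/N <= 4 * (Y^2/N)).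
      { unfold Rdiv. rewrite Rmult_assoc. apply Rmult_le_compat_l; [lra|]. apply Rmult_le_compat_r; nra. }
      have B := SIN_bound (a t). have B2 : 0 <= sin (a t)^2 <= 1.
      splits.
      + apply (is_derive_minus a b); auto.
      + apply is_derive_linear.
      + apply is_derive_linear.
      + nra.
      + nra.
      + intros h. rewrite prufer_diff. apply Rplus_le_compat; [unfold aq; nra|]. unfold aq. apply main; lra.
      + intros h. rewrite prufer_diff.
        have m := main t (b t) (a t) Ht ok ok ok ok.
        replace (sin (b t - a t)) with (- sin (a t - b t)) in m by (rewrite <- sin_neg; f_equal; ring).
        rewrite (Rplus_comm (b t)) in m. unfold aq.
        have : 0 <= (kq N t - t) * sin (a t)^2. nra.
    - apply Rmult_le_compat.
      + left; apply exp_pos.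
      + have h := Rabs_pos (a w - b w). nra.
      + assert (X : 4 * s * Y * 0 - 4 * s * Y * w <= 4 * Rabs d).
        { have : s * Y * - w <= s * Y * Y.
          have : s * Y * Y <= Rabs d.
          nra. }
        destruct X as [X|X]; [left; now apply exp_increasing|right; now rewrite X].
      + assert (4 * (Y^2/N) * 0 - 4 * (Y^2/N) * w <= 4 * (Y^3/N)); [|lra].
        obv. }
  have G := gronwall_abs (fun t => a t - b t)
      (fun t => cos (a t)^2 + kq N t * sin (a t)^2 - (cos (b t)^2 + aq t * sin (b t)^2))
      (fun t => 1 * t) (fun _ => 1) (fun t => 4/N * t) (fun _ => 4/N) w' 1 ok.
  cbv beta in G. have N4 : 0 < 4/N.
  eapply Rle_trans; [apply G|].
  - intros t Ht. have K := kb t ok.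
    assert (t2 : 4 * t^2/N <= 4/N).
    { unfold Rdiv. apply Rmult_le_compat_r; nra. }
    have B := SIN_bound (a t). have B2 : 0 <= sin (a t)^2 <= 1.
    assert (P : Rabs ((aq t - 1) * (sin (a t + b t) * sin (a t - b t))) <= Rabs (a t - b t)).
    { rewrite <- sin2_sub, Rabs_mult. have h := sin2_sub_le (a t) (b t).
      have : Rabs (aq t - 1) <= 1 by (unfold aq; apply Rabs_le; lra).
      have h2 := Rabs_pos (sin (a t)^2 - sin (b t)^2). obv. }
    splits; try lra.
    + apply (is_derive_minus a b); auto.
    + apply is_derive_linear.
    + apply is_derive_linear.
    + intros h. rewrite prufer_diff. rewrite (Rabs_pos_eq (a t - b t)) in P by lra. apply Rabs_le_between in P.
      apply Rplus_le_compat; [unfold aq; nra|lra].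
    + intros h. rewrite prufer_diff. rewrite (Rabs_left (a t - b t)) in P by lra. apply Rabs_le_between in P.
      have : 0 <= (kq N t - aq t) * sin (a t)^2 by (unfold aq; apply Rmult_le_pos; lra). lra.
  - apply Rmult_le_compat.
    + left; apply exp_pos.
    + have h := Rabs_pos (a w' - b w'). nra.
    + have X : 1 * 1 - 1 * w' <= 1.
      destruct X as [X|X]; [left; now apply exp_increasing|right; now rewrite X].
    + nra.
Qed.

Lemma atan_lip x y : Rabs (atan x - atan y) <= Rabs (x - y).
Proof.
  assert (G : forall x y, x <= y -> Rabs (atan y - atan x) <= Rabs (y - x)).
  { clear. intros x y H. rewrite (Rabs_pos_eq (y - x)) by lra. rewrite <- (Rmult_1_l (y - x)).
    apply (deriv_bound atan (fun t => / (1 + t^2))); auto. intros t _. split.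
    - derive_tac. unfold Rsqr. Rfield. nra.
    - have : 0 <= t^2.
      have : 0 < / (1 + t^2). rewrite Rabs_pos_eq by lra.
      rewrite <- Rinv_1. obv. }
  destruct (Rle_dec x y).
  - rewrite <- (Rabs_Ropp (atan x - atan y)), <- (Rabs_Ropp (x - y)), !Ropp_minus_distr. auto.
  - apply G; lra.
Qed.

Lemma arccot_unique A z : 0 < A < PI -> cos A = z * sin A -> A = PI/2 - atan z.
Proof.
  intros HA E. set (A' := PI/2 - atan z). have h := atan_bound z.
  have P : 0 < 1 + z² by (unfold Rsqr; nra). have Q := sqrt_lt_R0 _ P.
  have E' : cos A' = z * sin A' by (unfold A'; rewrite cos_shift, sin_shift, sin_atan, cos_atan; field; lra).
  have S : sin (A - A') = 0 by (rewrite sin_minus, E, E'; ring).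
  have B : - PI < A - A' < PI.
  destruct (Rtotal_order (A - A') 0) as [h1|[h1|h1]].
  - have : 0 < sin (- (A - A')) by (apply sin_gt_0; lra). rewrite sin_neg in *; lra.
  - lra.
  - have : 0 < sin (A - A') by (apply sin_gt_0; lra). lra.
Qed.

Lemma near_half_diff A1 A2 z1 z2 : 0 < A1 < PI -> 0 < A2 < PI ->
  cos A1 = z1 * sin A1 -> cos A2 = z2 * sin A2 -> Rabs (A1 - A2) <= Rabs (z1 - z2).
Proof.
  intros h1 h2 e1 e2. rewrite (arccot_unique A1 z1 h1 e1), (arccot_unique A2 z2 h2 e2).
  turn (PI/2 - atan z1 - (PI/2 - atan z2)) into (- (atan z1 - atan z2)).
  rewrite Rabs_Ropp. apply atan_lip.
Qed.

Lemma Sh_cot a b A d : 0 < a -> 0 < A < PI -> cos A = d * sin A ->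
  0 < Sh a b A < PI /\ cos (Sh a b A) = (a * d + b) * sin (Sh a b A).
Proof.
  intros Ha HA E. destruct (Sh_dir a b A Ha) as [E1 E2].
  have P := sqrt_lt_R0 _ (Shn_pos a b A Ha). set (n := sqrt (Shn a b A)) in *. split.
  - have h := Sh_kPI a b 1. rewrite Rmult_1_l in h.
    have h0 := Sh_lt a b 0 A Ha ok. have h1 := Sh_lt a b A PI Ha ok.
    rewrite Sh_0 in h0. rewrite h in h1. lra.
  - apply Rmult_eq_reg_l with n; [|lra]. rewrite <- E2.
    turn (n * ((a * d + b) * sin (Sh a b A))) into ((a * d + b) * (n * sin (Sh a b A))).
    rewrite <- E1. unfold Shc. obv.
Qed.

(** Differentiate along the segment between the two parameter sets. The constant is the reciprocal
    of the lower bound [a^2/(1 + a^2 + b^2) >= 1/9], attained at [a = 1/2], [|b| = 1]. *)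
Lemma Sh_lip a1 b1 x1 a2 b2 x2 : 1/2 <= a1 <= 1 -> 1/2 <= a2 <= 1 -> Rabs b1 <= 1 -> Rabs b2 <= 1 ->
  Rabs (Sh a1 b1 x1 - Sh a2 b2 x2) <= 9 * (Rabs (a1 - a2) + Rabs (b1 - b2) + Rabs (x1 - x2)).
Proof.
  intros Ha1 Ha2 Hb1 Hb2. apply Rabs_le_between in Hb1. apply Rabs_le_between in Hb2.
  set (a := fun t => a2 + t * (a1 - a2)). set (b := fun t => b2 + t * (b1 - b2)). set (x := fun t => x2 + t * (x1 - x2)).
  have G := deriv_bound (fun t => Sh (a t) (b t) (x t))
    (fun t => (a t * (x1 - x2) - sin (x t) * cos (x t) * (a1 - a2) - sin (x t)^2 * (b1 - b2))/Shn (a t) (b t) (x t))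
    0 1 (9 * (Rabs (a1 - a2) + Rabs (b1 - b2) + Rabs (x1 - x2))) ok.
  cbv beta in G.
  turn (a 1) into a1 in G. turn (b 1) into b1 in G.
  turn (x 1) into x1 in G. turn (a 0) into a2 in G.
  turn (b 0) into b2 in G. turn (x 0) into x2 in G.
  rewrite Rminus_0_r, Rmult_1_r in G.
  apply G. intros t Ht.
  have At : 1/2 <= a t <= 1.
  have Bt : -1 <= b t <= 1. split.
  - apply (Sh_derive a b x); [lra|unfold a|unfold b|unfold x]; derive_tac; Rring.
  - have N := Shn_lower (a t) (b t) (x t) ok.
    assert (N2 : 1/9 <= Shn (a t) (b t) (x t)).
    { eapply Rle_trans; [|exact N]. apply Rmult_le_reg_r with (1 + a t^2 + b t^2); [nra|].
      unfold Rdiv at 2. rewrite Rmult_assoc, Rinv_l by nra. nra. }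
    set (n := Shn (a t) (b t) (x t)) in *.
    unfold Rdiv. rewrite Rabs_mult, (Rabs_pos_eq (/ n)) by pos.
    have I : / n <= 9 by (turn 9 into (/ (1/9)); apply Rinv_le_contravar; lra).
    have I0 : 0 < / n.
    have S := SIN_bound (x t). have C := COS_bound (x t).
    assert (U : Rabs (a t * (x1 - x2) - sin (x t) * cos (x t) * (a1 - a2) - sin (x t)^2 * (b1 - b2))
      <= Rabs (a1 - a2) + Rabs (b1 - b2) + Rabs (x1 - x2)).
    { unfold Rminus at 1. eapply Rle_trans; [apply Rabs_triang|]. rewrite Rabs_Ropp.
      unfold Rminus at 1. eapply Rle_trans; [apply Rplus_le_compat_r, Rabs_triang|]. rewrite Rabs_Ropp, !Rabs_mult.
      have : Rabs (a t) <= 1. have : Rabs (sin (x t)) <= 1.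
      have : Rabs (cos (x t)) <= 1.
      have : Rabs (sin (x t)^2) <= 1 by (apply Rabs_le; nra).
      have p1 := Rabs_pos (a1 - a2). have p2 := Rabs_pos (b1 - b2). have p3 := Rabs_pos (x1 - x2).
      have p4 := Rabs_pos (sin (x t)). have p5 := Rabs_pos (cos (x t)).
      have : Rabs (sin (x t)) * Rabs (cos (x t)) <= 1.
      obv. }
    set (V := Rabs (a1 - a2) + Rabs (b1 - b2) + Rabs (x1 - x2)) in *.
    have h := Rabs_pos (a t * (x1 - x2) - sin (x t) * cos (x t) * (a1 - a2) - sin (x t)^2 * (b1 - b2)). nra.
Qed.

Lemma cube_lt x y : 0 <= x -> x < y -> x^3 < y^3.
Proof. intros Hx Hy. have : x^2 <= y^2.
  have : 0 < y^2.
  obv. Qed.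

(** * The WKB quantities at the edge of the transition window *)

(** The time at which [e^t = nu (1 + w/N)]. With [N = (2 nu^2)^(1/3)] and [w = 2^(1/3) z] this is
    [e^t = nu + z nu^(1/3)], the scale of the theorem. *)
Definition wtime nu N w := ln (nu * (1 + w/N)).
Definition wk N w := w + w^2/(2 * N).

Section Wtime.
Context (nu N w : R) (Hnu : 0 < nu) (HN : 100 <= N) (HE : N^3 = 2 * nu^2) (Hw : 1 <= w) (Hw2 : w^2 <= N).

Let k := wk N w.
Let t := wtime nu N w.

Lemma wtime_ratio : 0 < w/N <= 1/10.
Proof.
  split; [pos|]. apply Rmult_le_reg_r with N; [lra|].
  unfold Rdiv at 1. rewrite Rmult_assoc, Rinv_l by lra. nra.
Qed.

Lemma wtime_bounds : w <= k <= 21/20 * w.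
Proof.
  have h := wtime_ratio. unfold k, wk. turn (w^2/(2 * N)) into (w * (w/N)/2). nra.
Qed.

Lemma wtime_bq : bq nu t = N^2 * k.
Proof.
  have h := wtime_ratio. unfold bq, t, wtime, k, wk.
  turn (2 * ln (nu * (1 + w/N))) into (ln (nu * (1 + w/N)) + ln (nu * (1 + w/N))).
  rewrite exp_plus, exp_ln by nra.
  transitivity (nu^2 * (2 * w/N + w^2/N^2)); [obv|].
  turn (nu^2) into (N^3/2). field; lra.
Qed.

Lemma wtime_bs : bs nu t = N * sqrt k.
Proof.
  have h := wtime_bounds. unfold bs. rewrite wtime_bq. rewrite sqrt_mult by nra.
  rewrite sqrt_pow2 by lra. auto.
Qed.

Lemma wtime_q_pos : 0 < bq nu t.
Proof. have h := wtime_bounds. rewrite wtime_bq. obv. Qed.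

Lemma wtime_wkb_b : wkb_b (bq nu) bq1 t = (1 + w/N)^2/(4 * (k * sqrt k)) /\
  Rabs (wkb_b (bq nu) bq1 t - 1/(4 * (w * sqrt w))) <= / N.
Proof.
  have h := wtime_ratio. have h2 := wtime_bounds.
  have sk : 0 < sqrt k. have kk := sqrt_sqrt k ok.
  have sw : 1 <= sqrt w by (rewrite <- sqrt_1; apply sqrt_le_1_alt; lra). have ww := sqrt_sqrt w ok.
  assert (E : wkb_b (bq nu) bq1 t = (1 + w/N)^2/(4 * (k * sqrt k))).
  { unfold wkb_b, bq1. fold (bs nu t). rewrite wtime_bs, wtime_bq.
    unfold t, wtime. turn (2 * ln (nu * (1 + w/N))) into (ln (nu * (1 + w/N)) + ln (nu * (1 + w/N))).
    rewrite exp_plus, exp_ln by nra.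
    transitivity (nu^2 * 2 * (1 + w/N)^2/(4 * N^3 * (k * sqrt k))); [obv|].
    turn (nu^2 * 2) into (N^3). field; lra. }
  split; auto. rewrite E.
  set (e := w/N) in *. have Ek : k = w * (1 + e/2) by (unfold k, wk, e; field; lra).
  set (r := sqrt (1 + e/2)). have rr : r * r = 1 + e/2 by (apply sqrt_sqrt; lra).
  have r1 : 1 <= r by (unfold r; rewrite <- sqrt_1 at 1; apply sqrt_le_1_alt; lra).
  have r2 : r <= 1 + e/2.
  have Sk : sqrt k = sqrt w * r by (rewrite Ek; unfold r; apply sqrt_mult; lra).
  rewrite Sk, Ek.
  replace ((1 + e)^2/(4 * (w * (1 + e/2) * (sqrt w * r))) - 1/(4 * (w * sqrt w))) with
    (/ (w * sqrt w) * (((1 + e)^2 - (1 + e/2) * r)/(4 * ((1 + e/2) * r)))) by obv.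
  have q1 : 1 <= (1 + e/2) * r <= (1 + e/2)^2.
  assert (Q : 0 <= ((1 + e)^2 - (1 + e/2) * r)/(4 * ((1 + e/2) * r)) <= e).
  { split.
    - apply Rmult_le_pos; [nra|pos].
    - apply Rmult_le_reg_r with (4 * ((1 + e/2) * r)); [lra|]. unfold Rdiv at 1.
      rewrite Rmult_assoc, Rinv_l by lra. nra. }
  have w1 : 0 < / (w * sqrt w).
  rewrite Rabs_pos_eq by pos.
  apply Rle_trans with (/ (w * sqrt w) * e); [pos|].
  turn (/ (w * sqrt w) * e) into (/ sqrt w * / N).
  rewrite <- (Rmult_1_l (/ N)) at 2. apply Rmult_le_compat_r; [pos|].
  rewrite <- Rinv_1. obv.
Qed.

Lemma wtime_yh : 2/3 * w <= yh (bxi nu t) <= 21/20 * w /\ Rabs (yh (bxi nu t) - w) <= 2 * w^2/N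
  /\ 1/3 <= bxi nu t.
Proof.
  have h := wtime_ratio. have h2 := wtime_bounds. have Q := wtime_q_pos.
  have X := bxi_pos nu t Hnu Q. destruct (yh_spec _ X) as [Y E]. set (y := yh (bxi nu t)) in *.
  have C := Xi_cubic nu (bs nu t) Hnu (bs_pos nu t Q). fold (bxi nu t) in C.
  rewrite wtime_bs in C. have sk : 0 < sqrt k. have kk := sqrt_sqrt k ok.
  have sy : 0 < sqrt y. have yy := sqrt_sqrt y (Rlt_le _ _ Y).
  set (z := 1 + w/N) in *.
  assert (Nk : nu^2 + (N * sqrt k)^2 = nu^2 * z^2).
  { turn ((N * sqrt k)^2) into (N^2 * (sqrt k * sqrt k)). rewrite kk.
    unfold k, wk, z. turn (nu^2) into (N^3/2). field; lra. }
  rewrite Nk in C.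
  replace ((N * sqrt k)^3/(3 * nu^2)) with (2/3 * (sqrt k)^3) in C.
  2: { turn (nu^2) into (N^3/2). field; lra. }
  replace ((N * sqrt k)^3/(3 * (nu^2 * z^2))) with (2/3 * (sqrt k^3/z^2)) in C.
  2: { turn (nu^2) into (N^3/2). obv. }
  rewrite <- E in C.
  assert (Up : sqrt y <= sqrt k).
  { apply Rnot_lt_le; intro c. have : sqrt k^3 < sqrt y^3 by (apply cube_lt; lra).
    obv. }
  assert (Lo : sqrt k/z <= sqrt y).
  { have z1 : 1 <= z.
    apply Rnot_lt_le; intro c.
    have q : 0 < sqrt k/z.
    have : sqrt y^3 < (sqrt k/z)^3 by (apply cube_lt; lra).
    turn (y * sqrt y) into (sqrt y^3) in C.
    assert ((sqrt k/z)^3 <= sqrt k^3/z^2); [|lra].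
    turn ((sqrt k/z)^3) into (sqrt k^3/z^2 * / z).
    rewrite <- (Rmult_1_r (sqrt k^3/z^2)) at 2. apply Rmult_le_compat_l.
    - apply Rmult_le_pos; [pos|pos].
    - rewrite <- Rinv_1. obv. }
  have Yk : y <= k.
  assert (ky : k/z^2 <= y).
  { have z1 : 1 <= z. have q : 0 < sqrt k/z.
    rewrite <- yy, <- kk. obv. }
  assert (kz : w * (1 - 2 * (w/N)) <= k/z^2).
  { unfold k, wk, z. turn (w + w^2/(2 * N)) into (w * (1 + (w/N)/2)).
    set (e := w/N) in *. apply Rmult_le_reg_r with ((1 + e)^2); [nra|].
    turn (w * (1 + e/2)/(1 + e)^2 * (1 + e)^2) into (w * (1 + e/2)).
    rewrite Rmult_assoc. apply Rmult_le_compat_l; [lra|]. nra. }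
  have kw : k <= w + 2 * w * (w/N) by (unfold k, wk; turn (w^2/(2 * N)) into (w * (w/N)/2); nra).
  have W2 : 2 * w^2/N = 2 * w * (w/N).
  splits.
  - nra.
  - lra.
  - rewrite W2. apply Rabs_le. split; nra.
  - have y23 : 2/3 <= y. obv.
Qed.

Lemma wtime_awkb b : prufer aq b ->
  Rabs (awkb b (yh (bxi nu t)) - awkb b w) <= 6 * (w^3/N).
Proof.
  intros Hb. destruct wtime_yh as ((y1 & y2) & y3 & _). have h := wtime_ratio. set (y := yh (bxi nu t)) in *.
  assert (B : forall t0, 2/3 * w <= t0 <= 21/20 * w ->
    is_derive (awkb b) t0 (sqrt t0 * (1 + 5/(16 * t0^3) * sin (awkb b t0)^2)) /\
    Rabs (sqrt t0 * (1 + 5/(16 * t0^3) * sin (awkb b t0)^2)) <= 3 * w).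
  { intros s Hs. split; [apply awkb_derive; auto; lra|].
    have S := SIN_bound (awkb b s). have S2 : 0 <= sin (awkb b s)^2 <= 1.
    assert (q : 0 <= sqrt s <= 21/20 * w).
    { split; [pos|]. apply Rsqr_incr_0_var; [|lra]. unfold Rsqr. rewrite sqrt_sqrt by lra. nra. }
    have c : (2/3)^3 <= s^3.
    assert (c2 : 0 < 5/(16 * s^3) <= 3/2).
    { split; [pos|]. apply Rmult_le_reg_r with (16 * s^3); [lra|].
      unfold Rdiv at 1. rewrite Rmult_assoc, Rinv_l by lra. lra. }
    have c3 : 0 <= 5/(16 * s^3) * sin (awkb b s)^2 <= 3/2.
    rewrite Rabs_pos_eq by nra. nra. }
  assert (K : Rabs (awkb b y - awkb b w) <= 3 * w * Rabs (y - w)).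
  { destruct (Rle_dec w y).
    - rewrite (Rabs_pos_eq (y - w)) by lra.
      apply (deriv_bound (awkb b) (fun t0 => sqrt t0 * (1 + 5/(16 * t0^3) * sin (awkb b t0)^2))); auto.
      intros; apply B; lra.
    - rewrite (Rabs_left (y - w)) by lra. rewrite <- Rabs_Ropp, !Ropp_minus_distr.
      apply (deriv_bound (awkb b) (fun t0 => sqrt t0 * (1 + 5/(16 * t0^3) * sin (awkb b t0)^2))); [lra|].
      intros; apply B; lra. }
  obv.
Qed.
End Wtime.

(* Bessel boundary angle [A0] and its Airy limit [A]: Dirichlet, or [u' = d u] against Neumann. *)
Definition tcond A0 A d := (A0 = 0 /\ A = 0 /\ d = 0) \/ (0 < A0 < PI /\ cos A0 = d * sin A0 /\ A = PI/2).

Lemma Rabs_triang3 x y z : Rabs (x - z) <= Rabs (x - y) + Rabs (y - z).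
Proof. turn (x - z) into ((x - y) + (y - z)). apply Rabs_triang. Qed.

Lemma awkb_at b y : awkb b y = Sh (/ sqrt y) (1/(4 * y * sqrt y)) (b y).
Proof. reflexivity. Qed.

Section Transition.
Context (d nu N Y w : R) (al b : R -> R) (A0 A t1 : R).
Context (HN : 100 + 144 * d^2 <= N) (Hnu : 0 < nu) (HE : N^3 = 2 * nu^2)
  (HY : 1 <= Y) (HY2 : Y^2 <= N) (Hw : - Y <= w <= Y)
  (Ha : prufer (bq nu) al) (Hb : prufer aq b) (Ea : al (wtime nu N w) = A0) (Eb : b w = A)
  (T0 : wtime nu N w <= t1) (T1 : wtime nu N 1 <= t1).

Lemma Y3N : 1/N <= Y^3/N.
Proof.
  have : 0 <= d^2.
  apply Rmult_le_compat_r; [pos|]. obv.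
Qed.

(** Once the angles agree at some [w0 >= 1] they agree from there on: the phase is at least [1/3]
    there, so the Gronwall factor is at most [exp 3]. The 8 collects 6 for replacing [w0] by the
    Langer variable and 2 for the forcing. *)
Lemma transition_from w0 Z : 1 <= w0 <= Y -> wtime nu N w0 <= t1 ->
  Rabs (bwkb nu al (wtime nu N w0) - awkb b w0) <= Z * (Y^3/N) ->
  Rabs (bwkb nu al t1 - awkb b (yh (bxi nu t1))) <= exp 3 * ((Z + 8) * (Y^3/N)).
Proof.
  intros Hw0 Ht HZ. have D2 := pow2_ge_0 d. have N1 : 100 <= N.
  have W2 : w0^2 <= N. have y3 := Y3N.
  have Q := wtime_q_pos nu N w0 Hnu N1 HE (proj1 Hw0) W2.
  have G := transition_right nu al b _ t1 Hnu Ha Hb Q Ht.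
  destruct (wtime_yh nu N w0 Hnu N1 HE (proj1 Hw0) W2) as (_ & _ & X).
  have AW := wtime_awkb nu N w0 Hnu N1 HE (proj1 Hw0) W2 b Hb.
  have S := wtime_bs nu N w0 Hnu N1 HE (proj1 Hw0) W2.
  destruct (wtime_bounds N w0 N1 (proj1 Hw0) W2) as [k1 k2].
  have sk : 1 <= sqrt (wk N w0) by (rewrite <- sqrt_1; apply sqrt_le_1_alt; lra).
  assert (is : 3/2/bs nu (wtime nu N w0) <= 2 * (1/N)).
  { rewrite S. unfold Rdiv. rewrite Rinv_mult. have : 0 < / N.
    have : / sqrt (wk N w0) <= 1 by (rewrite <- Rinv_1; apply Rinv_le_contravar; lra).
    obv. }
  assert (ex : exp (/ bxi nu (wtime nu N w0)) <= exp 3).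
  { have h : / bxi nu (wtime nu N w0) <= 3 by (turn 3 into (/ (1/3)); apply Rinv_le_contravar; lra).
    destruct h as [h|h]; [left; now apply exp_increasing|rewrite h; lra]. }
  have w3 : w0^3/N <= Y^3/N.
  eapply Rle_trans; [apply G|]. apply Rmult_le_compat; auto.
  - left; apply exp_pos.
  - have h := Rabs_pos (bwkb nu al (wtime nu N w0) - awkb b (yh (bxi nu (wtime nu N w0)))).
    assert (0 < 3/2/bs nu (wtime nu N w0)); [|lra]. apply Rdiv_lt_0_compat; [lra|]. now apply bs_pos.
  - have h := Rabs_triang3 (bwkb nu al (wtime nu N w0)) (awkb b w0) (awkb b (yh (bxi nu (wtime nu N w0)))).
    rewrite <- (Rabs_Ropp (awkb b w0 - _)), Ropp_minus_distr in h. lra.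
Qed.

Definition transition_const := exp 1 * (exp (4 * Rabs d) * (Rabs d + 84) + 4).

Lemma transition_ge1 : tcond A0 A d -> 1 <= w -> Rabs (bwkb nu al t1 - awkb b (yh (bxi nu t1))) <= exp 3 * ((Rabs d + 1 + 8) * (Y^3/N)).
Proof.
  intros HC Hw1. have D2 := pow2_ge_0 d. have N1 : 100 <= N.
  have W2 : w^2 <= N. have y3 := Y3N.
  have Q := wtime_q_pos nu N w Hnu N1 HE Hw1 W2.
  apply (transition_from w); [lra|auto|].
  destruct (bwkb_bc nu (wtime nu N w) d Q) as [a0 _].
  have S := wtime_bs nu N w Hnu N1 HE Hw1 W2. destruct (wtime_bounds N w N1 Hw1 W2) as [k1 k2].
  destruct (wtime_wkb_b nu N w Hnu N1 HE Hw1 W2) as [_ B].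
  have sk : 1 <= sqrt (wk N w) by (rewrite <- sqrt_1; apply sqrt_le_1_alt; lra).
  have dd := Rabs_pos d. unfold bwkb, wkb. rewrite Ea, awkb_at, Eb.
  destruct HC as [(e1 & e2 & e3)|(e1 & e2 & e3)].
  - rewrite e1, e2, !Sh_0, Rminus_0_r, Rabs_R0. have : 0 < 1/N. nra.
  - have sw : 0 < sqrt w.
    destruct (Sh_cot _ (wkb_b (bq nu) bq1 (wtime nu N w)) A0 d a0 e1 e2) as [g1 g2].
    destruct (Sh_cot (/ sqrt w) (1/(4 * w * sqrt w)) A 0 ok) as [g3 g4].
    { obv. }
    { rewrite e3, cos_PI2. ring. }
    eapply Rle_trans; [apply (near_half_diff _ _ _ _ g1 g3 g2 g4)|].
    have iN : 0 < / N.
    assert (aN : 0 < wkb_a (bq nu) (wtime nu N w) <= / N).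
    { split; auto. unfold wkb_a. fold (bs nu (wtime nu N w)). rewrite S. apply Rinv_le_contravar; [lra|nra]. }
    turn (wkb_a (bq nu) (wtime nu N w) * d + wkb_b (bq nu) bq1 (wtime nu N w) - (/ sqrt w * 0 + 1/(4 * w * sqrt w)))
      into (wkb_a (bq nu) (wtime nu N w) * d + (wkb_b (bq nu) bq1 (wtime nu N w) - 1/(4 * (w * sqrt w)))).
    eapply Rle_trans; [apply Rabs_triang|]. rewrite Rabs_mult, (Rabs_pos_eq (wkb_a _ _)) by lra.
    obv.
Qed.

Lemma tcond_scaled : tcond A0 A d ->
  0 <= Sh (/ N) 0 A0 <= PI/2 + Rabs d/N /\ 0 <= A <= PI/2 /\ Rabs (Sh (/ N) 0 A0 - A) <= Rabs d/N.
Proof.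
  intros HC. have D2 := pow2_ge_0 d. have dd := Rabs_pos d. have PI1 := PI2_3_2.
  have iN : 0 < / N.
  have dN : 0 <= Rabs d/N.
  destruct HC as [(e1 & e2 & e3)|(e1 & e2 & e3)].
  - rewrite e1, e2, Sh_0. rewrite Rminus_0_r, Rabs_R0. splits; lra.
  - have h := Sh_near_half (/ N) 0 A0 d iN e1 e2. destruct (Sh_cot (/ N) 0 A0 d iN e1 e2) as [h2 _].
    rewrite Rplus_0_r, Rabs_mult, (Rabs_pos_eq (/ N)) in h by lra. rewrite e3.
    obv.
Qed.

Lemma transition_lt1 : 0 <= Sh (/ N) 0 A0 <= PI/2 + Rabs d/N -> 0 <= A <= PI/2 ->
  Rabs (Sh (/ N) 0 A0 - A) <= Rabs d/N -> w <= 1 -> Rabs (bwkb nu al t1 - awkb b (yh (bxi nu t1)))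
  <= exp 3 * ((9 * (transition_const + 9) + 8) * (Y^3/N)).
Proof.
  intros c1 c2 c3 Hw1. have D2 := pow2_ge_0 d. have N1 : 100 <= N. have Np : 0 < N.
  have y3 := Y3N. have dd := Rabs_pos d. have iN : 0 < / N.
  have one2 : 1^2 <= N. have one : 1 <= 1.
  destruct (N_facts N Y d HN HY HY2) as (F1 & F2 & F3 & F4 & F5 & F6).
  set (a := fun y => Sh (/ N) 0 (al (ln nu + y/N))).
  have Pa : prufer (kq N) a by (apply prufer_scaled; auto).
  assert (wpos : forall x, - Y <= x -> 0 < 1 + x/N).
  { intros x Hx. have : x/N * N = x. nra. }
  assert (lnw : forall x, - Y <= x -> ln nu + N * ln (1 + x/N)/N = wtime nu N x).
  { intros x Hx. unfold wtime. rewrite ln_mult; auto. field; lra. }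
  assert (L : Rabs (a 1 - b 1) <= transition_const * (Y^3/N)).
  { have sh : a (N * ln (1 + w/N)) = Sh (/ N) 0 A0 by (unfold a; rewrite lnw by lra; now rewrite Ea).
    eapply Rle_trans; [apply (transition_left d N Y w a b _ A HN HY HY2 ok Pa Hb sh Eb c1 c2 c3)|].
    unfold transition_const. rewrite Rmult_assoc. apply Rmult_le_compat_l; [pos|].
    rewrite Rmult_plus_distr_r. apply Rplus_le_compat; [|pos].
    rewrite Rmult_assoc. apply Rmult_le_compat_l; [pos|]. obv. }
  set (y1 := N * ln (1 + 1/N)).
  have n1 : 0 < 1/N <= 1/100.
  assert (Y1 : 1 - 2/N <= y1 <= 1).
  { destruct (ln_bounds (1/N) ok) as [l1 l2]. unfold y1. split.
    - apply Rle_trans with (N * (1/N - 2 * (1/N)^2)); [right; field; lra|pos].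
    - apply Rle_trans with (N * (1/N)); [pos|right; field; lra]. }
  assert (L1 : Rabs (a 1 - a y1) <= 6/N).
  { apply Rle_trans with (3 * (1 - y1)); [|pos].
    apply (deriv_bound a (fun t => cos (a t)^2 + kq N t * sin (a t)^2)); [lra|].
    intros t Ht. split; [obv|]. eapply Rle_trans; [apply prufer_rate|].
    have h := kq_bounds N t Np ok.
    have t0 : 0 <= t.
    have : 4 * t^2/N <= 4 * (1/N) by (unfold Rdiv; have : t^2 <= 1; nra).
    rewrite Rabs_pos_eq by lra. lra. }
  apply (transition_from 1); [lra|auto|].
  have Q := wtime_q_pos nu N 1 Hnu N1 HE one one2.
  have S := wtime_bs nu N 1 Hnu N1 HE one one2. destruct (wtime_bounds N 1 N1 one one2) as [k1 k2].
  destruct (wtime_wkb_b nu N 1 Hnu N1 HE one one2) as [_ B].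
  have sk : 1 <= sqrt (wk N 1) by (rewrite <- sqrt_1 at 1; apply sqrt_le_1_alt; lra).
  have ssk := sqrt_sqrt (wk N 1) ok.
  have wk1 : wk N 1 = 1 + 1/N/2 by (unfold wk; field; lra).
  (* The WKB shear is the scaling by [/ N] followed by a shear with parameters of order one, so
     [Sh_lip] applies to the second factor without any loss in [N]. *)
  assert (W : bwkb nu al (wtime nu N 1) = Sh (/ sqrt (wk N 1)) (wkb_b (bq nu) bq1 (wtime nu N 1)) (a y1)).
  { unfold bwkb, wkb, a, y1. rewrite lnw by lra. rewrite Sh_comp; [|auto|pos].
    apply f_equal2 with (f := fun x y => Sh x y _); [|ring].
    unfold wkb_a. fold (bs nu (wtime nu N 1)). rewrite S. field; lra. }
  rewrite W, awkb_at, sqrt_1, Rinv_1.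
  rewrite sqrt_1, !Rmult_1_r in B.
  assert (isk : 1 - 1/N <= / sqrt (wk N 1) <= 1).
  { split.
    - apply Rmult_le_reg_r with (sqrt (wk N 1)); [lra|]. rewrite Rinv_l by lra. nra.
    - rewrite <- Rinv_1 at 2. obv. }
  have iN2 : / N <= 1/100.
  have B' := B. apply Rabs_le_between in B'.
  eapply Rle_trans; [apply Sh_lip|].
  - lra.
  - lra.
  - apply Rabs_le. lra.
  - apply Rabs_le. lra.
  - turn (1/(4 * 1 * 1)) into (1/4).
    have h1 : Rabs (/ sqrt (wk N 1) - 1) <= 1/N.
    have h2 := Rabs_triang3 (a y1) (a 1) (b 1).
    rewrite <- (Rabs_Ropp (a y1 - a 1)), Ropp_minus_distr in h2.
    obv.
Qed.
End Transition.

Lemma transition_const_pos d : 0 < transition_const d.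
Proof.
  have dd := Rabs_pos d. unfold transition_const. obv.
Qed.

Lemma transition d : exists C, 0 < C /\ forall nu N Y w al b A0 A t1,
  100 + 144 * d^2 <= N -> 0 < nu -> N^3 = 2 * nu^2 -> 1 <= Y -> Y^2 <= N -> - Y <= w <= Y ->
  prufer (bq nu) al -> prufer aq b -> al (wtime nu N w) = A0 -> b w = A -> tcond A0 A d ->
  wtime nu N w <= t1 -> wtime nu N 1 <= t1 ->
  Rabs (bwkb nu al t1 - awkb b (yh (bxi nu t1))) <= C * (Y^3/N).
Proof.
  have dd := Rabs_pos d. have K := transition_const_pos d. have E := exp_pos 3.
  exists (exp 3 * (Rabs d + 1 + 8) + exp 3 * (9 * (transition_const d + 9) + 8)). split; [nra|].
  intros nu N Y w al b A0 A t1 h1 h2 h3 h4 h5 h6 h7 h8 h9 h10 h11 h12 h13.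
  have : 0 <= d^2.
  have : 0 <= Y^3/N.
  destruct (Rle_dec 1 w).
  - have G := transition_ge1 d nu N Y w al b A0 A t1 h1 h2 h3 h4 h5 h6 h7 h8 h9 h10 h12 h11 r.
    have : 0 <= exp 3 * (9 * (transition_const d + 9) + 8) * (Y^3/N). lra.
  - destruct (tcond_scaled d N A0 A h1 h11) as (c1 & c2 & c3).
    have G := transition_lt1 d nu N Y w al b A0 A t1 h1 h2 h3 h4 h5 h6 h7 h8 h9 h10 h13 c1 c2 c3 ok.
    have : 0 <= exp 3 * (Rabs d + 1 + 8) * (Y^3/N). lra.
Qed.

Lemma transition_recessive : exists C, 0 < C /\ forall nu N Y al b t1,
  100 <= N -> 0 < nu -> N^3 = 2 * nu^2 -> 1 <= Y -> Y^2 <= N ->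
  prufer (bq nu) al -> prufer aq b -> 0 <= al (wtime nu N (- Y)) <= PI/2 ->
  b (- Y) = Sh (/ N) 0 (al (wtime nu N (- Y))) -> 0 <= b (- Y) <= PI/2 -> wtime nu N 1 <= t1 ->
  Rabs (bwkb nu al t1 - awkb b (yh (bxi nu t1))) <= C * (Y^3/N).
Proof.
  have K := transition_const_pos 0. have E := exp_pos 3.
  exists (exp 3 * (9 * (transition_const 0 + 9) + 8)). split; [nra|].
  intros nu N Y al b t1 h1 h2 h3 h4 h5 h6 h7 h8 h9 h10 h11. rewrite Rmult_assoc.
  apply (transition_lt1 0 nu N Y (- Y) al b (al (wtime nu N (- Y))) (b (- Y)) t1); auto; try lra.
  - rewrite <- h9, Rabs_R0. unfold Rdiv; rewrite Rmult_0_l. lra.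
  - rewrite <- h9, Rminus_diag, Rabs_R0. obv.
Qed.

(** * Asymptotic phases *)

(** The constant is taken as the supremum of [f], so both inequalities hold at every point at once,
    with the tail [B] as explicit rate. *)
Lemma sandwich_limit (P : R -> Prop) (f B : R -> R) t0 : P t0 ->
  (forall a b, P a -> P b -> a <= b -> 0 <= f b - f a <= B a) ->
  exists L, forall t, P t -> L - B t <= f t <= L.
Proof.
  intros H0 H.
  destruct (completeness (fun y => exists t, P t /\ y = f t)) as [L [L1 L2]].
  - exists (f t0 + B t0). intros y [t [Ht e]]. subst y.
    destruct (Rle_dec t0 t) as [h|h].
    + have g := H t0 t H0 Ht h. lra.
    + have g := H t t0 Ht H0 ok. have g2 := H t0 t0 H0 H0 ok. lra.
  - exists (f t0), t0; auto.
  - exists L. intros t Ht. split.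
    + assert (L <= f t + B t); [|lra]. apply L2. intros y [s [Hs e]]. subst y.
      destruct (Rle_dec t s) as [h|h].
      * have g := H t s Ht Hs h. lra.
      * have g := H s t Hs Ht ok. have g2 := H t t Ht Ht ok. lra.
    + apply L1. exists t; auto.
Qed.

(** [L] is the asymptotic phase, or outcome, of the angle: the WKB angle approaches [xi + L] from
    below, with an explicit error at every point right of the turning point. [aout] is the same for
    the Airy equation. *)
Definition bout nu al L := forall t, 0 < bq nu t -> L - bB nu t <= bwkb nu al t - bxi nu t <= L.

Definition axi y := 2/3 * (y * sqrt y).
Definition aB y := 5/24/(y * sqrt y).
Definition aout b L := forall y, 0 < y -> L - aB y <= awkb b y - axi y <= L.

Lemma bq_pos_exists nu T : exists t, T <= t /\ 0 < bq nu t.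
Proof.
  exists (Rmax T (nu^2)). split; [apply Rmax_l|]. unfold bq.
  have h := Rmax_r T (nu^2). set (t := Rmax T (nu^2)) in *.
  have h2 := exp_ineq1_le (2 * t). obv.
Qed.

Lemma bout_exists nu al : 0 <= nu -> prufer (bq nu) al -> exists L, bout nu al L.
Proof.
  intros Hn Ha. destruct (bq_pos_exists nu 0) as [t0 [_ Ht0]].
  apply (sandwich_limit (fun t => 0 < bq nu t) (fun t => bwkb nu al t - bxi nu t) (bB nu) t0 Ht0).
  intros a b Pa Pb Hab. have G := bwkb_growth nu al a b Hn Ha Pa Hab. have h := bB_pos nu b Pb. lra.
Qed.

Lemma axi_derive y : 0 < y -> is_derive axi y (sqrt y).
Proof.
  intros Hy. have Q := sqrt_lt_R0 _ Hy. have S := sqrt_sqrt y (Rlt_le _ _ Hy). unfold axi. derive_tac; [lra|].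
  apply Rmult_eq_reg_r with (sqrt y); [|lra]. set (w := sqrt y) in *. rewrite <- S. Rfield. lra.
Qed.

Lemma aB_derive y : 0 < y -> is_derive aB y (- (5/(16 * y^3)) * sqrt y).
Proof.
  intros Hy. have Q := sqrt_lt_R0 _ Hy. have S := sqrt_sqrt y (Rlt_le _ _ Hy). unfold aB. derive_tac; [lra|nra|].
  set (w := sqrt y) in *. rewrite <- S. Rfield. lra.
Qed.

Lemma aB_pos y : 0 < y -> 0 < aB y.
Proof. intros Hy. have Q := sqrt_lt_R0 _ Hy. apply Rdiv_lt_0_compat; nra. Qed.

Lemma awkb_growth b y z : prufer aq b -> 0 < y -> y <= z ->
  axi z - axi y <= awkb b z - awkb b y <= axi z - axi y + (aB y - aB z).
Proof.
  intros Hb Hy Hyz. apply (wkb_growth aq (fun _ => 1) (fun _ => 0) b axi aB y z Hb Hyz).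
  intros t Ht. have E : wkb_rho aq (fun _ => 1) (fun _ => 0) t = 5/(16 * t^3) by (unfold wkb_rho, aq; field; lra).
  rewrite E. unfold aq. splits.
  - lra.
  - apply (is_derive_id t).
  - apply (is_derive_const 1 t).
  - apply axi_derive; lra.
  - apply aB_derive; lra.
  - obv.
Qed.

Lemma aout_exists b : prufer aq b -> exists L, aout b L.
Proof.
  intros Hb.
  apply (sandwich_limit (fun t => 0 < t) (fun t => awkb b t - axi t) aB 1); [lra|].
  intros y z Py Pz Hyz. have G := awkb_growth b y z Hb Py Hyz. have h := aB_pos z Pz. lra.
Qed.

Lemma axi_yh xi : 0 < xi -> axi (yh xi) = xi.
Proof. intros H. apply (proj2 (yh_spec xi H)). Qed.

Lemma aB_axi y : 0 < y -> aB y = 5/36/axi y.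
Proof. intros Hy. have Q := sqrt_lt_R0 _ Hy. unfold aB, axi. field. lra. Qed.

Lemma aout_at_xi b L xi : aout b L -> 0 < xi -> L - 5/36/xi <= awkb b (yh xi) - xi <= L.
Proof.
  intros H Hx. destruct (yh_spec xi Hx) as [Y _]. have h := H (yh xi) Y.
  rewrite aB_axi, axi_yh in h; auto.
Qed.

Lemma exp_lower M : exists T, forall t, T <= t -> M <= exp t.
Proof. exists M. intros t Ht. have h := exp_ineq1_le t. lra. Qed.

Lemma bessel_large nu t : 0 <= nu -> Rmax 1 (2 * nu) <= exp t -> 0 < bq nu t /\ exp t/2 <= bs nu t <= exp t /\
  bB nu t <= 10/exp t /\ exp t - bs nu t <= nu^2/exp t.
Proof.
  intros Hn H. have h1 := Rmax_l 1 (2 * nu). have h2 := Rmax_r 1 (2 * nu).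
  set (T := exp t) in *.
  have Q : bq nu t = T^2 - nu^2 by (unfold bq, T; turn (2 * t) into (t + t); rewrite exp_plus; ring).
  have P : 0 < bq nu t. have S := bs_pos nu t P. have S2 := bs_sq nu t P. rewrite Q in S2.
  have B : T/2 <= bs nu t <= T.
  splits; auto; try lra.
  - eapply Rle_trans; [now apply bB_le_size|]. unfold wkb_size.
    have iT : 0 < / T.
    assert (i1 : / bs nu t <= 2/T). { turn (2/T) into (/ (T/2)). obv. }
    assert (nb : nu^2 * (/ bs nu t)^2 <= 1).
    { apply Rmult_le_reg_r with (bs nu t^2); [pos|].
      turn (nu^2 * (/ bs nu t)^2 * bs nu t^2) into (nu^2). nra. }
    turn (nu^2/bs nu t^3) into (nu^2 * (/ bs nu t)^2 * / bs nu t).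
    nra.
  - apply Rmult_le_reg_r with T; [lra|]. unfold Rdiv. rewrite Rmult_assoc, Rinv_l by lra. nra.
Qed.

Lemma bxi_mono_inf nu t : 0 < nu -> Rmax 1 (2 * nu) <= exp t -> exp t/4 - 2 * nu <= bxi nu t.
Proof.
  intros Hn H. destruct (bessel_large nu t ok H) as (P & (B & _) & _).
  unfold bxi, Xi. have h := atan_bound (bs nu t/nu). have h2 := PI_4. have h3 := exp_pos t. nra.
Qed.

Lemma outcome_close nu al b L La T e : 0 < nu -> bout nu al L -> aout b La ->
  (forall t, T <= t -> Rabs (bwkb nu al t - awkb b (yh (bxi nu t))) <= e) -> Rabs (L - La) <= e.
Proof.
  intros Hn HL HA H. apply Rnot_lt_le; intro c.
  set (d := Rabs (L - La) - e) in *. have Hd : 0 < d.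
  destruct (exp_lower (Rmax (Rmax 1 (2 * nu)) (Rmax (20/d + 1) (4 * (2 * nu + 1/d + 1))))) as [T' HT'].
  set (t := Rmax T T'). have h := HT' t ltac:(apply Rmax_r).
  have g1 := Rmax_l (Rmax 1 (2 * nu)) (Rmax (20/d + 1) (4 * (2 * nu + 1/d + 1))).
  have g2 := Rmax_r (Rmax 1 (2 * nu)) (Rmax (20/d + 1) (4 * (2 * nu + 1/d + 1))).
  have g3 := Rmax_l (20/d + 1) (4 * (2 * nu + 1/d + 1)).
  have g4 := Rmax_r (20/d + 1) (4 * (2 * nu + 1/d + 1)).
  destruct (bessel_large nu t ok ok) as (P & _ & B & _).
  have X := bxi_mono_inf nu t Hn ok.
  have i : 0 < 1/d.
  have Xp : 1/d + 1 <= bxi nu t.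
  have A := aout_at_xi b La (bxi nu t) HA ok. have HLt := HL t P. have Ht := H t ltac:(apply Rmax_l).
  assert (E1 : 5/36/bxi nu t <= d/4).
  { apply Rmult_le_reg_r with (bxi nu t); [lra|]. unfold Rdiv at 1. rewrite Rmult_assoc, Rinv_l by lra.
    have : d * (1/d) = 1. nra. }
  assert (E2 : 10/exp t <= d/2).
  { apply Rmult_le_reg_r with (exp t); [pos|]. unfold Rdiv at 1. rewrite Rmult_assoc, Rinv_l by pos.
    have : d * (20/d) = 20. nra. }
  apply Rabs_le_between in Ht.
  have : Rabs (L - La) <= e + 3/4 * d. unfold d in *. lra.
Qed.

Lemma awkb_pair b1 b2 y z : prufer aq b1 -> prufer aq b2 -> 0 < y -> y <= z ->
  Rabs (awkb b1 z - awkb b2 z) <= exp (aB y) * Rabs (awkb b1 y - awkb b2 y).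
Proof.
  intros H1 H2 Hy Ht.
  have G := gronwall_abs (fun t => awkb b1 t - awkb b2 t)
    (fun t => sqrt t * (1 + 5/(16 * t^3) * sin (awkb b1 t)^2) - sqrt t * (1 + 5/(16 * t^3) * sin (awkb b2 t)^2))
    (fun t => - aB t) (fun t => 5/(16 * t^3) * sqrt t) (fun _ => 0) (fun _ => 0) y z Ht.
  cbv beta in G. eapply Rle_trans; [apply G|].
  - intros t [h1 h2]. have Q : 0 < t. have S := sqrt_lt_R0 t Q.
    have R : 0 < 5/(16 * t^3).
    set (rho := 5/(16 * t^3)) in *.
    set (u := awkb b1 t). set (v := awkb b2 t).
    have s2 := sin2_sub_le u v. apply Rabs_le_between in s2.
    splits; try lra.
    + apply (is_derive_minus (awkb b1) (awkb b2)); apply awkb_derive; auto.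
    + eapply is_derive_eq; [apply (is_derive_opp aB), aB_derive; auto|]. unfold opp; simpl. unfold rho; simpl. ring.
    + apply (is_derive_const 0 t).
    + nra.
    + intros h. rewrite (Rabs_pos_eq (u - v)) in s2 by lra.
      replace (sqrt t * (1 + rho * sin u^2) - sqrt t * (1 + rho * sin v^2)) with
        (rho * sqrt t * (sin u^2 - sin v^2)) by ring. rewrite Rplus_0_l. apply Rmult_le_compat_l; nra.
    + intros h. rewrite (Rabs_left (u - v)) in s2 by lra.
      replace (- (sqrt t * (1 + rho * sin u^2) - sqrt t * (1 + rho * sin v^2))) with
        (rho * sqrt t * (sin v^2 - sin u^2)) by ring. rewrite Rplus_0_l. apply Rmult_le_compat_l; nra.
  - have B := aB_pos z ok. rewrite Rminus_diag, Rplus_0_r. apply Rmult_le_compat_r; [pos|].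
    left; apply exp_increasing. lra.
Qed.

(** * Frobenius series *)

Lemma fact_radius c K C : 0 <= K -> 0 <= C -> (forall m, Rabs (c m) <= C * K^m/INR (fact m)) ->
  CV_radius c = p_infty.
Proof.
  intros HK HC H.
  assert (G : forall r : R, Rbar_le r (CV_radius c)).
  { intros r. destruct (CV_radius_bounded c) as [U _]. apply U.
    exists (C * exp (K * Rabs r)). intros n. rewrite Rabs_mult, <- RPow_abs.
    have F := INR_fact_lt_0 n.
    apply Rle_trans with (C * K^n/INR (fact n) * Rabs r^n).
    - apply Rmult_le_compat_r; [pos|obv].
    - replace (C * K^n/INR (fact n) * Rabs r^n) with (C * ((K * Rabs r)^n/INR (fact n))) by (rewrite Rpow_mult_distr; field; lra).
      apply Rmult_le_compat_l; auto.
      have Kr : 0 <= K * Rabs r.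
      have E := exp_ge_taylor (K * Rabs r) n Kr. destruct n as [|n].
      + simpl in *. lra.
      + rewrite tech5 in E.
        assert (0 <= sum_f_R0 (fun k : nat => (K * Rabs r)^k/INR (fact k)) n); [|lra].
        apply cond_pos_sum. intros k. apply Rmult_le_pos; [pos|left; apply Rinv_0_lt_compat, INR_fact_lt_0]. }
  destruct (CV_radius c) as [x| |]; auto.
  - specialize (G (x + 1)). simpl in G. lra.
  - specialize (G 0). destruct G.
Qed.

Definition entire (c : nat -> R) := CV_radius c = p_infty.

Lemma entire_ex c x : entire c -> ex_pseries c x.
Proof. intros H. apply CV_radius_inside. rewrite H. exact I. Qed.

Lemma entire_derive c : entire c -> entire (PS_derive c).
Proof. unfold entire. now rewrite CV_radius_derive. Qed.

Lemma entire_is_derive c x : entire c -> is_derive (PSeries c) x (PSeries (PS_derive c) x).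
Proof. intros H. apply is_derive_PSeries. rewrite H. exact I. Qed.

(** For [s = 0] this is the Bessel recurrence. The source [s] is there for the derivative of [J_nu]
    in its order, whose coefficients satisfy the recurrence with a right-hand side. *)
Lemma frob_ode nu c s X : entire c -> entire s ->
  (forall n, (INR n + 1) * (INR n + 1 + nu) * c (S n) + c n = - s n) ->
  (nu + 1) * PSeries (PS_derive c) X + X * PSeries (PS_derive (PS_derive c)) X + PSeries c X = - PSeries s X.
Proof.
  intros Hc Hs R. have H1 := entire_derive _ Hc. have H2 := entire_derive _ H1.
  rewrite <- PSeries_scal, <- PSeries_incr_1, <- PSeries_opp.
  have E1 : ex_pseries (PS_scal (nu + 1) (PS_derive c)) X by (apply ex_pseries_scal; [apply Rmult_comm|now apply entire_ex]).
  have E2 : ex_pseries (PS_incr_1 (PS_derive (PS_derive c))) X by (apply ex_pseries_incr_1; now apply entire_ex).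
  rewrite <- PSeries_plus by auto.
  rewrite <- PSeries_plus; [|now apply ex_pseries_plus|now apply entire_ex].
  apply PSeries_ext. intros n. unfold PS_plus, PS_scal, PS_incr_1, PS_derive, PS_opp.
  unfold plus, scal, opp, mult; simpl. unfold mult; simpl. rewrite <- (R n).
  destruct n as [|n].
  - unfold zero; simpl. ring.
  - repeat change (match n with 0%nat => 1 | S _ => INR n + 1 end) with (INR (S n)). obv.
Qed.

Definition frobU nu c t := exp (nu * t) * PSeries c (exp (2 * t)/4).
Definition frobU1 nu c t := exp (nu * t) * (nu * PSeries c (exp (2 * t)/4) + exp (2 * t)/2 * PSeries (PS_derive c) (exp (2 * t)/4)).

Lemma exp2_derive t : is_derive (fun t => exp (2 * t)/4) t (exp (2 * t)/2).
Proof. derive_tac. Rfield. Qed.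

Lemma comp_PSeries_derive c t : entire c ->
  is_derive (fun t => PSeries c (exp (2 * t)/4)) t (exp (2 * t)/2 * PSeries (PS_derive c) (exp (2 * t)/4)).
Proof.
  intros H. eapply is_derive_eq; [apply (is_derive_comp (PSeries c) (fun t => exp (2 * t)/4));
    [now apply entire_is_derive|apply exp2_derive]|obv].
Qed.

Lemma frobU_derive nu c t : entire c -> is_derive (frobU nu c) t (frobU1 nu c t).
Proof.
  intros H. have D := comp_PSeries_derive c t H. unfold frobU, frobU1. set (P := fun t => PSeries c (exp (2 * t)/4)) in *.
  change (is_derive (fun t => exp (nu * t) * P t) t (exp (nu * t) * (nu * P t + exp (2 * t)/2 * PSeries (PS_derive c) (exp (2 * t)/4)))).
  derive_tac. Rring.
Qed.

Lemma frobU1_derive nu c s t : entire c -> entire s ->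
  (forall n, (INR n + 1) * (INR n + 1 + nu) * c (S n) + c n = - s n) ->
  is_derive (frobU1 nu c) t (- bq nu t * frobU nu c t - exp (nu * t) * exp (2 * t) * PSeries s (exp (2 * t)/4)).
Proof.
  intros Hc Hs R. have O := frob_ode nu c s (exp (2 * t)/4) Hc Hs R.
  have D := comp_PSeries_derive c t Hc. have D1 := comp_PSeries_derive _ t (entire_derive _ Hc).
  unfold frobU1, frobU.
  set (P := fun t => PSeries c (exp (2 * t)/4)) in *.
  set (P1 := fun t => PSeries (PS_derive c) (exp (2 * t)/4)) in *.
  change (PSeries c (exp (2 * t)/4)) with (P t) in *. change (PSeries (PS_derive c) (exp (2 * t)/4)) with (P1 t) in *.
  change (is_derive (fun t => exp (nu * t) * (nu * P t + exp (2 * t)/2 * P1 t)) t (- bq nu t * (exp (nu * t) * P t) - exp (nu * t) * exp (2 * t) * PSeries s (exp (2 * t)/4))).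
  derive_tac. unfold bq. obv.
Qed.

Lemma entire_zero : entire (fun _ => 0).
Proof.
  apply (fact_radius _ 0 0); try lra. obv.
Qed.

Lemma frobU_sol nu c : entire c -> (forall n, (INR n + 1) * (INR n + 1 + nu) * c (S n) = - c n) ->
  sol (bq nu) (frobU nu c) (frobU1 nu c).
Proof.
  intros Hc R t. split; [now apply frobU_derive|].
  eapply is_derive_eq; [apply (frobU1_derive nu c (fun _ => 0)); auto using entire_zero; intros n; specialize (R n); lra|].
  rewrite PSeries_const_0. ring.
Qed.

Fixpoint uc (nu : R) (m : nat) : R :=
  match m with O => 1 | S j => - uc nu j/((INR j + 1) * (INR j + 1 + nu)) end.

Lemma uc_rec nu n : -1 < nu -> (INR n + 1) * (INR n + 1 + nu) * uc nu (S n) = - uc nu n.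
Proof. intros Hn. simpl. have h := pos_INR n. field. lra. Qed.

Lemma uc_entire nu : -1 < nu -> entire (uc nu).
Proof.
  intros Hn. set (K := / (1 + nu)). have HK : 0 < K.
  apply (fact_radius _ K 1); try lra.
  induction m as [|m IH].
  - simpl. rewrite Rabs_R1. lra.
  - have h := pos_INR m. simpl uc. unfold Rdiv at 1. rewrite Rabs_mult, Rabs_Ropp.
    rewrite (Rabs_pos_eq (/ _)) by pos.
    have F := INR_fact_lt_0 m. rewrite fact_simpl, mult_INR, S_INR. simpl pow.
    turn (1 * (K * K^m)/((INR m + 1) * INR (fact m))) into (1 * K^m/INR (fact m) * (/ (INR m + 1) * K)).
    rewrite Rinv_mult. apply Rmult_le_compat; auto using Rabs_pos.
    + left; apply Rmult_lt_0_compat; apply Rinv_0_lt_compat; lra.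
    + obv.
Qed.

(** [J_nu(e^t)] without its Gamma factor and power of 2, normalized to behave like [e^(nu t)] at
    minus infinity. *)
Definition U nu := frobU nu (uc nu).
Definition U1 nu := frobU1 nu (uc nu).

Lemma U_sol nu : -1 < nu -> sol (bq nu) (U nu) (U1 nu).
Proof. intros H. apply frobU_sol; [now apply uc_entire|intros; now apply uc_rec]. Qed.

Lemma uc_derive nu m : -1 < nu -> PS_derive (uc nu) m = - / (1 + nu) * uc (nu + 1) m.
Proof.
  intros Hn. unfold PS_derive. rewrite S_INR. induction m as [|m IH].
  - simpl. field. lra.
  - have h := pos_INR m. rewrite S_INR.
    have R1 := uc_rec nu (S m) Hn. have R2 := uc_rec (nu + 1) m ok. rewrite S_INR in R1.
    apply Rmult_eq_reg_r with (INR m + 1 + 1 + nu); [|lra].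
    turn ((INR m + 1 + 1) * uc nu (S (S m)) * (INR m + 1 + 1 + nu)) into (- uc nu (S m)).
    apply Rmult_eq_reg_r with (INR m + 1); [|lra].
    replace (- / (1 + nu) * uc (nu + 1) (S m) * (INR m + 1 + 1 + nu) * (INR m + 1)) with
      (- / (1 + nu) * ((INR m + 1) * (INR m + 1 + (nu + 1)) * uc (nu + 1) (S m))) by ring.
    obv.
Qed.

(* The recurrence [t J_(nu+1) = nu J_nu - t J_nu'] and its companion. *)
Lemma U_ladder nu t : -1 < nu ->
  / (2 * (1 + nu)) * U (nu + 1) t = (nu * U nu t - U1 nu t) * exp (- t) /\
  / (2 * (1 + nu)) * U1 (nu + 1) t = exp t * U nu t - (nu + 1) * (/ (2 * (1 + nu)) * U (nu + 1) t).
Proof.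
  intros Hn.
  assert (A : forall t, / (2 * (1 + nu)) * U (nu + 1) t = (nu * U nu t - U1 nu t) * exp (- t)).
  { clear t; intros t. unfold U, U1, frobU, frobU1.
    rewrite (PSeries_ext _ _ _ (fun m => uc_derive nu m Hn)).
    change (fun n => - / (1 + nu) * uc (nu + 1) n) with (PS_scal (- / (1 + nu)) (uc (nu + 1))).
    rewrite PSeries_scal. set (Q := PSeries (uc (nu + 1)) (exp (2 * t)/4)).
    turn ((nu + 1) * t) into (nu * t + t). rewrite exp_plus.
    have E : exp (2 * t) * exp (- t) = exp t by (rewrite <- exp_plus; f_equal; ring).
    turn ((nu * (exp (nu * t) * PSeries (uc nu) (exp (2 * t)/4)) -
       exp (nu * t) * (nu * PSeries (uc nu) (exp (2 * t)/4) + exp (2 * t)/2 * (- / (1 + nu) * Q))) * exp (- t))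
      into (exp (nu * t) * (/ (2 * (1 + nu))) * Q * (exp (2 * t) * exp (- t))).
    obv. }
  split; [obv|].
  destruct (U_sol nu Hn t) as [D1 D2]. destruct (U_sol (nu + 1) ok t) as [D3 _].
  have E1 : is_derive (fun t => / (2 * (1 + nu)) * U (nu + 1) t) t (/ (2 * (1 + nu)) * U1 (nu + 1) t) by (derive_tac; Rring).
  assert (E2 : is_derive (fun t => / (2 * (1 + nu)) * U (nu + 1) t) t
     ((nu * U1 nu t + bq nu t * U nu t) * exp (- t) - (nu * U nu t - U1 nu t) * exp (- t))).
  { eapply is_derive_ext; [intros s; symmetry; apply A|]. derive_tac. Rring. }
  rewrite <- (is_derive_unique _ _ _ E1), (is_derive_unique _ _ _ E2), A.
  unfold bq. have E : exp (2 * t) * exp (- t) = exp t by (rewrite <- exp_plus; f_equal; ring). obv.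
Qed.

(** * The connection constant of the recessive Bessel solution *)

(* The line spanned by [(u, v)] is asymptotic to that of [(sin, cos)(e^t + phi)]. *)
Definition dir (u v : R -> R) phi := forall e, 0 < e -> exists T, forall t, T <= t -> exists n, n <> 0 /\
  Rabs (u t - n * sin (exp t + phi)) <= e * Rabs n /\ Rabs (v t - n * cos (exp t + phi)) <= e * Rabs n.

Lemma sin_lip x y : Rabs (sin x - sin y) <= Rabs (x - y).
Proof.
  rewrite form4.
  rewrite !Rabs_mult, (Rabs_pos_eq 2) by lra. have h := sin_le_abs ((x - y)/2).
  unfold Rdiv in h at 2. rewrite Rabs_mult, (Rabs_pos_eq (/ 2)) in h by lra.
  have : Rabs (cos ((x + y)/2)) <= 1 by (apply Rabs_le, COS_bound).
  have h2 := Rabs_pos (sin ((x - y)/2)). nra.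
Qed.

Lemma cos_lip x y : Rabs (cos x - cos y) <= Rabs (x - y).
Proof.
  rewrite <- !sin_shift. eapply Rle_trans; [apply sin_lip|].
  turn (PI/2 - x - (PI/2 - y)) into (- (x - y)). rewrite Rabs_Ropp; lra.
Qed.

Lemma dir_intro u v phi K T0 : (forall t, T0 <= t -> exists n x, n <> 0 /\ Rabs (x - (exp t + phi)) <= K/exp t /\
  Rabs (u t - n * sin x) <= K/exp t * Rabs n /\ Rabs (v t - n * cos x) <= K/exp t * Rabs n) -> dir u v phi.
Proof.
  intros H e He. destruct (exp_lower (Rabs K * 2/e)) as [T HT].
  exists (Rmax T0 T). intros t Ht. have h1 := Rmax_l T0 T. have h2 := Rmax_r T0 T.
  destruct (H t ok) as (n & x & Hn & Hx & Hu & Hv). exists n. specialize (HT t ok).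
  have E := exp_pos t.
  assert (Ke : K/exp t <= e/2).
  { apply Rmult_le_reg_r with (exp t); auto. unfold Rdiv at 1. rewrite Rmult_assoc, Rinv_l by lra.
    have h := Rle_abs K. have : Rabs K * 2/e * (e/2) = Rabs K. nra. }
  have An := Rabs_pos n.
  splits; auto.
  - apply Rle_trans with (Rabs (u t - n * sin x) + Rabs (n * sin x - n * sin (exp t + phi))); [apply Rabs_triang3|].
    rewrite <- Rmult_minus_distr_l, Rabs_mult. have s := sin_lip x (exp t + phi). nra.
  - apply Rle_trans with (Rabs (v t - n * cos x) + Rabs (n * cos x - n * cos (exp t + phi))); [apply Rabs_triang3|].
    rewrite <- Rmult_minus_distr_l, Rabs_mult. have s := cos_lip x (exp t + phi). nra.
Qed.

Lemma dir_scal u v phi k : k <> 0 -> dir u v phi -> dir (fun t => k * u t) (fun t => k * v t) phi.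
Proof.
  intros Hk H e He. destruct (H e He) as [T HT]. exists T. intros t Ht.
  destruct (HT t Ht) as (n & Hn & Hu & Hv). exists (k * n). have Kp := Rabs_pos_lt k Hk. splits.
  - now apply Rmult_integral_contrapositive.
  - rewrite Rmult_assoc, <- Rmult_minus_distr_l, !Rabs_mult. nra.
  - rewrite Rmult_assoc, <- Rmult_minus_distr_l, !Rabs_mult. nra.
Qed.

Lemma dir_ext u v u' v' phi : (forall t, u t = u' t) -> (forall t, v t = v' t) -> dir u v phi -> dir u' v' phi.
Proof.
  intros Eu Ev H e He. destruct (H e He) as [T HT]. exists T. intros t Ht. rewrite <- Eu, <- Ev. auto.
Qed.

Lemma dir_unique u v phi1 phi2 : dir u v phi1 -> dir u v phi2 -> exists k : Z, phi1 - phi2 = IZR k * PI.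
Proof.
  intros H1 H2. apply sin_eq_0_0.
  destruct (Req_dec (sin (phi1 - phi2)) 0) as [h|h]; auto. exfalso. apply Rabs_pos_lt in h.
  set (e := Rabs (sin (phi1 - phi2))/8). have He : 0 < e.
  have E8 : Rabs (sin (phi1 - phi2)) = 8 * e. clearbody e.
  destruct (H1 e He) as [T1 HT1]. destruct (H2 e He) as [T2 HT2].
  set (t := Rmax T1 T2). destruct (HT1 t (Rmax_l _ _)) as (n1 & N1 & A1 & B1).
  destruct (HT2 t (Rmax_r _ _)) as (n2 & N2 & A2 & B2).
  set (x1 := exp t + phi1) in *. set (x2 := exp t + phi2) in *.
  turn (phi1 - phi2) into (x1 - x2) in *.
  have P1 := Rabs_pos_lt n1 N1.
  assert (bound : forall a b x, Rabs (a * cos x - b * sin x) <= Rabs a + Rabs b).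
  { intros a b x. eapply Rle_trans; [apply Rabs_triang|]. rewrite Rabs_Ropp, !Rabs_mult.
    have : Rabs (cos x) <= 1 by (apply Rabs_le, COS_bound). have : Rabs (sin x) <= 1 by (apply Rabs_le, SIN_bound).
    have h1 := Rabs_pos a. have h2 := Rabs_pos b. nra. }
  assert (S1 : Rabs n1 * Rabs (sin (x1 - x2)) <= 2 * e * (Rabs n1 + Rabs n2)).
  { rewrite <- Rabs_mult, sin_minus.
    replace (n1 * (sin x1 * cos x2 - cos x1 * sin x2)) with
      (((u t - n2 * sin x2) * cos x2 - (v t - n2 * cos x2) * sin x2) - ((u t - n1 * sin x1) * cos x2 - (v t - n1 * cos x1) * sin x2)) by ring.
    eapply Rle_trans; [apply Rabs_triang|]. rewrite Rabs_Ropp.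
    have b1 := bound (u t - n2 * sin x2) (v t - n2 * cos x2) x2. have b2 := bound (u t - n1 * sin x1) (v t - n1 * cos x1) x2.
    lra. }
  assert (S2 : Rabs n2 * Rabs (sin (x1 - x2)) <= 2 * e * (Rabs n1 + Rabs n2)).
  { rewrite <- Rabs_mult, sin_minus.
    replace (n2 * (sin x1 * cos x2 - cos x1 * sin x2)) with
      (((u t - n2 * sin x2) * cos x1 - (v t - n2 * cos x2) * sin x1) - ((u t - n1 * sin x1) * cos x1 - (v t - n1 * cos x1) * sin x1)) by ring.
    eapply Rle_trans; [apply Rabs_triang|]. rewrite Rabs_Ropp.
    have b1 := bound (u t - n2 * sin x2) (v t - n2 * cos x2) x1. have b2 := bound (u t - n1 * sin x1) (v t - n1 * cos x1) x1.
    lra. }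
  obv.
Qed.

(** Up to a relative error [O(e^(-t))] the pair [(u2, v2)] is [(- v, u)], the quarter turn of
    [(u, v)]. *)
Lemma dir_rotate u v u2 v2 phi K : 0 <= K -> dir u v phi ->
  (forall t, 0 <= t -> Rabs (u2 t + v t) <= K/exp t * (Rabs (u t) + Rabs (v t)) /\ Rabs (v2 t - u t) <= K/exp t * (Rabs (u t) + Rabs (v t))) ->
  dir u2 v2 (phi - PI/2).
Proof.
  intros HK H R e He. set (e' := Rmin (e/2) 1).
  have He' : 0 < e' by (apply Rmin_pos; lra). have e1 := Rmin_l (e/2) 1. have e2 := Rmin_r (e/2) 1. fold e' in e1, e2.
  destruct (H e' He') as [T1 HT1]. destruct (exp_lower (8 * K/e + 1)) as [T2 HT2].
  exists (Rmax 0 (Rmax T1 T2)). intros t Ht. have h0 := Rmax_l 0 (Rmax T1 T2). have h0' := Rmax_r 0 (Rmax T1 T2).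
  have h1 := Rmax_l T1 T2. have h2 := Rmax_r T1 T2.
  destruct (HT1 t ok) as (n & Hn & A & B). specialize (HT2 t ok). destruct (R t ok) as [Ra Rb].
  exists n. split; auto. have Np := Rabs_pos_lt n Hn. have Et := exp_pos t.
  set (x := exp t + phi) in *.
  turn (exp t + (phi - PI/2)) into (- (PI/2 - x)). rewrite sin_neg, cos_neg, sin_shift, cos_shift.
  assert (big : Rabs (u t) + Rabs (v t) <= 4 * Rabs n).
  { assert (Rabs (u t) <= Rabs (u t - n * sin x) + Rabs (n * sin x)).
    { turn (u t) into ((u t - n * sin x) + n * sin x) at 1. apply Rabs_triang. }
    assert (Rabs (v t) <= Rabs (v t - n * cos x) + Rabs (n * cos x)).
    { turn (v t) into ((v t - n * cos x) + n * cos x) at 1. apply Rabs_triang. }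
    rewrite Rabs_mult in *. have : Rabs (cos x) <= 1 by (apply Rabs_le, COS_bound).
    have : Rabs (sin x) <= 1 by (apply Rabs_le, SIN_bound). nra. }
  assert (Kt : K/exp t <= e/8).
  { apply Rmult_le_reg_r with (exp t); auto. unfold Rdiv at 1. rewrite Rmult_assoc, Rinv_l by lra.
    have : 8 * K/e * (e/8) = K. nra. }
  have K0 : 0 <= K/exp t.
  have Z : K/exp t * (Rabs (u t) + Rabs (v t)) <= e/2 * Rabs n by nra.
  split.
  - turn (u2 t - n * - cos x) into ((u2 t + v t) - (v t - n * cos x)).
    eapply Rle_trans; [apply Rabs_triang|]. rewrite Rabs_Ropp. nra.
  - turn (v2 t - n * sin x) into ((v2 t - u t) + (u t - n * sin x)).
    eapply Rle_trans; [apply Rabs_triang|]. nra.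
Qed.

Lemma dir_shift_PI u v phi : dir u v phi -> dir u v (phi + PI).
Proof.
  intros H e He. destruct (H e He) as [T HT]. exists T. intros t Ht. destruct (HT t Ht) as (n & Hn & A & B).
  exists (- n). rewrite <- Rplus_assoc, neg_sin, neg_cos, Rabs_Ropp. splits.
  - lra.
  - turn (- n * - sin (exp t + phi)) into (n * sin (exp t + phi)). auto.
  - obv.
Qed.

Definition Udir nu phi := dir (U nu) (fun t => exp (- t) * U1 nu t) phi.

Lemma exp_opp_inv t : exp (- t) = / exp t.
Proof. apply exp_Ropp. Qed.

(** At infinity the ladder is a quarter turn, since [J_(nu+1)] behaves there like [- J_nu']. So the
    direction at one order determines it at all orders obtained by subtracting integers, as long as
    they exceed [-1]. *)
Lemma Udir_down nu phi : -1 < nu -> Udir (nu + 1) phi -> Udir nu (phi + PI/2).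
Proof.
  intros Hn H. set (k := / (2 * (1 + nu))). have Hk : 0 < k.
  apply (dir_scal _ _ _ k) in H; [|lra].
  turn (phi + PI/2) into (phi - PI/2 + PI). apply dir_shift_PI.
  assert (D : dir (fun t => -1 * U nu t) (fun t => -1 * (exp (- t) * U1 nu t)) (phi - PI/2)).
  { eapply (dir_rotate _ _ _ _ phi (Rabs nu * (1 + Rabs (nu + 1)) + Rabs (nu + 1))); [|exact H|].
    - have h := Rabs_pos nu. have h' := Rabs_pos (nu + 1). nra.
    - intros t Ht. destruct (U_ladder nu t Hn) as [E1 E2]. fold k in E1, E2.
      turn (k * (exp (- t) * U1 (nu + 1) t)) into (exp (- t) * (k * U1 (nu + 1) t)).
      rewrite E2. set (j := k * U (nu + 1) t) in *. set (w := exp (- t) * (exp t * U nu t - (nu + 1) * j)).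
      have Et := exp_pos t. have iE : 0 < / exp t.
      have Ew : w = U nu t - (nu + 1) * / exp t * j by (unfold w; rewrite exp_opp_inv; field; lra).
      rewrite exp_opp_inv in E1 |- *.
      have h := Rabs_pos nu. have h' := Rabs_pos (nu + 1). have ha := Rabs_pos j. have hb := Rabs_pos w.
      split.
      + turn (-1 * U nu t + w) into (- ((nu + 1) * / exp t * j)).
        rewrite Rabs_Ropp, !Rabs_mult, (Rabs_pos_eq (/ exp t)) by lra.
        apply Rmult_le_compat; try nra. apply Rmult_le_compat_r; nra.
      + turn (-1 * (/ exp t * U1 nu t) - j) into (- (nu * / exp t * U nu t)).
        have iE1 : / exp t <= 1 by (have E1' := exp_ineq1_le t; rewrite <- Rinv_1; apply Rinv_le_contravar; lra).
        rewrite Rabs_Ropp, !Rabs_mult, (Rabs_pos_eq (/ exp t)) by lra.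
        turn (U nu t) into (w + (nu + 1) * / exp t * j).
        assert (X : Rabs (w + (nu + 1) * / exp t * j) <= (1 + Rabs (nu + 1)) * (Rabs j + Rabs w)).
        { eapply Rle_trans; [apply Rabs_triang|]. rewrite !Rabs_mult, (Rabs_pos_eq (/ exp t)) by lra.
          have : Rabs (nu + 1) * / exp t <= Rabs (nu + 1). nra. }
        apply Rle_trans with (Rabs nu * / exp t * ((1 + Rabs (nu + 1)) * (Rabs j + Rabs w))); [pos|].
        replace (Rabs nu * / exp t * ((1 + Rabs (nu + 1)) * (Rabs j + Rabs w))) with
          (Rabs nu * (1 + Rabs (nu + 1)) * / exp t * (Rabs j + Rabs w)) by ring.
        apply Rmult_le_compat_r; [lra|]. obv. }
  apply (dir_scal _ _ _ (-1)) in D; [|lra].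
  eapply dir_ext; [| |exact D]; intros t; cbv beta; ring.
Qed.

Lemma Xi_asymp nu t : 0 <= nu -> Rmax 1 (2 * nu) <= exp t ->
  Rabs (bxi nu t - (exp t - nu * (PI/2))) <= 3 * nu^2/exp t.
Proof.
  intros Hn H. destruct (bessel_large nu t Hn H) as (P & (B1 & B2) & _ & B3).
  have g1 := Rmax_l 1 (2 * nu). set (E := exp t) in *.
  unfold bxi, Xi. set (s := bs nu t) in *.
  assert (A : 0 <= nu * (PI/2) - nu * atan (s/nu) <= 2 * nu^2/E).
  { destruct Hn as [Hn|Hn].
    - have x : 0 < s/nu. have I := atan_inv (s/nu) x.
      rewrite <- Rmult_minus_distr_l, <- I. set (y := / (s/nu)).
      have yp : 0 < y.
      have a1 := atan_cubic y yp. have a2 : 0 < atan y by (rewrite <- atan_0; now apply atan_increasing).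
      have : 0 < y^3/(3 * (1 + y^2)).
      assert (y2 : nu * y <= 2 * nu^2/E).
      { unfold y. turn (nu * / (s/nu)) into (nu^2 * / s).
        turn (2 * nu^2/E) into (nu^2 * / (E/2)).
        obv. }
      split; nra.
    - subst nu. obv. }
  obv.
Qed.

(** Far out [xi = e^t - nu PI/2 + o(1)] and the shear tends to the scaling by [e^(-t)], so an
    outcome [L] is the direction [L - nu PI/2]. *)
Lemma prufer_dir nu u u1 al L : 0 <= nu -> (forall t, 0 < u t^2 + u1 t^2) ->
  (forall t, u t = sqrt (u t^2 + u1 t^2) * sin (al t) /\ u1 t = sqrt (u t^2 + u1 t^2) * cos (al t)) ->
  bout nu al L -> dir u (fun t => exp (- t) * u1 t) (L - nu * (PI/2)).
Proof.
  intros Hn Hp Hl HL. destruct (exp_lower (Rmax 1 (2 * nu))) as [T HT].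
  apply (dir_intro _ _ _ (20 + 4 * nu^2) T). intros t Ht. specialize (HT t Ht).
  destruct (bessel_large nu t Hn HT) as (P & (B1 & B2) & B0 & B3). have X := Xi_asymp nu t Hn HT.
  have g1 := Rmax_l 1 (2 * nu). have Ep := exp_pos t. rewrite exp_opp_inv. set (E := exp t) in *.
  have iE1 : / E <= 1 by (rewrite <- Rinv_1; apply Rinv_le_contravar; lra).
  destruct (bwkb_bc nu t 0 P) as [a0 ab]. rewrite Rmult_0_r, Rplus_0_l in ab.
  assert (bb : 0 <= wkb_b (bq nu) bq1 t <= 20/E).
  { have i0 : 0 < / bs nu t.
    have i3 : 0 <= nu^2/bs nu t^3.
    rewrite ab. turn (0/bs nu t + / (2 * bs nu t) + nu^2/(2 * bs nu t^3)) into (/ bs nu t/2 + nu^2/bs nu t^3/2).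
    unfold bB in B0. turn (/ (4 * bs nu t) + 5 * nu^2/(12 * bs nu t^3)) into (/ bs nu t/4 + 5/12 * (nu^2/bs nu t^3)) in B0.
    lra. }
  have ea : wkb_a (bq nu) t = / bs nu t.
  destruct (Sh_dir (wkb_a (bq nu) t) (wkb_b (bq nu) bq1 t) (al t) a0) as [E1 E2].
  fold (wkb (bq nu) bq1 al t) in E1, E2. fold (bwkb nu al t) in E1, E2.
  have M0 := sqrt_lt_R0 _ (Shn_pos (wkb_a (bq nu) t) (wkb_b (bq nu) bq1 t) (al t) a0).
  set (m := sqrt (Shn _ _ _)) in *. set (rho := sqrt (u t^2 + u1 t^2)) in *.
  have R0 : 0 < rho by (apply sqrt_lt_R0, Hp). destruct (Hl t) as [L1 L2]. fold rho in L1, L2.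
  set (eta := bwkb nu al t) in *. set (b := wkb_b (bq nu) bq1 t) in *. set (s := bs nu t) in *.
  have N0 : 0 < rho * m.
  exists (rho * m), eta. rewrite (Rabs_pos_eq (rho * m)) by lra. splits.
  - lra.
  - have h := HL t P. fold eta in h. apply Rabs_le_between in X.
    apply Rabs_le. lra.
  - rewrite L1, E1. turn (rho * (m * sin eta) - rho * m * sin eta) into 0. rewrite Rabs_R0.
    apply Rmult_le_pos; [|lra]. nra.
  - assert (c : cos (al t) = s * m * (cos eta - b * sin eta)).
    { unfold Shc in E2. rewrite ea in E2. rewrite E1 in E2.
      transitivity (s * (/ s * cos (al t))); [obv|].
      obv. }
    rewrite L2, c.
    replace (/ E * (rho * (s * m * (cos eta - b * sin eta))) - rho * m * cos eta) with
      (rho * m * (- ((E - s) * / E * cos eta) - s * / E * b * sin eta)) by obv.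
    rewrite Rabs_mult, (Rabs_pos_eq (rho * m)) by lra. rewrite Rmult_comm. apply Rmult_le_compat_r; [lra|].
    have sE : 0 <= s * / E <= 1 by (split; [nra|apply Rmult_le_reg_r with E; auto; rewrite Rmult_assoc, Rinv_l by lra; lra]).
    have dE : 0 <= (E - s) * / E <= nu^2 * / E.
    have Cb := COS_bound eta. have Sb := SIN_bound eta.
    have sb : 0 <= s * / E * b <= 20 * / E.
    apply Rabs_le. split; nra.
Qed.

Lemma sol_zero_forward q u u1 M t0 t1 : sol q u u1 -> t0 <= t1 -> (forall s, t0 <= s <= t1 -> Rabs (q s) <= M) ->
  0 < u t0^2 + u1 t0^2 -> 0 < u t1^2 + u1 t1^2.
Proof.
  intros H Ht HM H0.
  assert (G : (u t0^2 + u1 t0^2) * exp ((1 + M) * t0) <= (u t1^2 + u1 t1^2) * exp ((1 + M) * t1)).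
  { apply (deriv_nonneg_le (fun t => (u t^2 + u1 t^2) * exp ((1 + M) * t))); auto.
    intros t Htt. destruct (H t) as [h1 h2]. eexists; split; [derive_tac; reflexivity|].
    specialize (HM t Htt). apply Rabs_le_between in HM. have E := exp_pos ((1 + M) * t).
    match goal with |- 0 <= ?x => turn x into (((1 + M) * (u t^2 + u1 t^2) + 2 * (1 - q t) * (u t * u1 t)) * exp ((1 + M) * t)) end.
    apply Rmult_le_pos; [|lra].
    have a1 : 0 <= (u t + u1 t)^2. have a2 : 0 <= (u t - u1 t)^2.
    nra. }
  have E := exp_pos ((1 + M) * t0). have E1 := exp_pos ((1 + M) * t1). nra.
Qed.

Lemma sol_zero_backward q u u1 M t0 t1 : sol q u u1 -> t1 <= t0 -> (forall s, t1 <= s <= t0 -> Rabs (q s) <= M) ->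
  0 < u t0^2 + u1 t0^2 -> 0 < u t1^2 + u1 t1^2.
Proof.
  intros H Ht HM H0.
  assert (S : sol (fun t => q (- t)) (fun t => u (- t)) (fun t => - u1 (- t))).
  { intros t. destruct (H (- t)) as [h1 h2]. split.
    - eapply is_derive_eq; [apply (is_derive_comp u (fun t => - t)); [exact h1|]|].
      + apply (is_derive_opp (fun t : R => t)), is_derive_id.
      + unfold scal, opp, one; simpl. unfold mult; simpl. ring.
    - eapply is_derive_eq; [apply (is_derive_opp (fun t => u1 (- t))), (is_derive_comp u1 (fun t => - t)); [exact h2|]|].
      + apply (is_derive_opp (fun t : R => t)), is_derive_id.
      + unfold scal, opp, one; simpl. unfold mult; simpl. ring. }
  have G := sol_zero_forward _ _ _ M (- t0) (- t1) S ok. cbv beta in G. rewrite !Ropp_involutive in G.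
  assert (K : 0 < u t1^2 + (- u1 t1)^2).
  { apply G; [intros s Hs; apply HM; lra|nra]. }
  nra.
Qed.

Lemma bq_bound nu s T : s <= T -> Rabs (bq nu s) <= exp (2 * T) + nu^2.
Proof.
  intros H. have h := bq_mono nu s T H. unfold bq in *. have h2 := exp_pos (2 * s). have n := pow2_ge_0 nu.
  obv.
Qed.

Lemma bsol_nonvanish nu u u1 t0 : sol (bq nu) u u1 -> 0 < u t0^2 + u1 t0^2 -> forall t, 0 < u t^2 + u1 t^2.
Proof.
  intros H H0 t. set (M := exp (2 * Rmax t t0) + nu^2). destruct (Rle_dec t0 t).
  - apply (sol_zero_forward (bq nu) u u1 M t0 t); auto. intros s Hs. apply bq_bound. have h := Rmax_l t t0. lra.
  - apply (sol_zero_backward (bq nu) u u1 M t0 t); auto; try lra. intros s Hs. apply bq_bound. have h := Rmax_r t t0. lra.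
Qed.

Lemma bq_continuous nu t : continuous (bq nu) t.
Proof. apply continuity_pt_filterlim. eapply is_derive_ct, bq_derive. Qed.

Lemma U_near_zero nu e : -1 < nu -> 0 < e -> exists T, forall t, t <= T ->
  Rabs (U nu t - exp (nu * t)) <= e * exp (nu * t) /\ Rabs (U1 nu t - nu * exp (nu * t)) <= e * exp (nu * t).
Proof.
  intros Hn He. set (P := PSeries (uc nu)). set (P1 := PSeries (PS_derive (uc nu))).
  have E := uc_entire nu Hn.
  have C0 : continuity_pt P 0 by (eapply is_derive_ct, entire_is_derive; auto).
  have C1 : continuity_pt P1 0 by (eapply is_derive_ct, entire_is_derive; now apply entire_derive).
  set (f := fun X => nu * P X + 2 * X * P1 X).
  assert (Cf : continuity_pt f 0).
  { apply continuity_pt_plus; apply continuity_pt_mult; auto.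
    - apply continuity_pt_const; intros ? ?; auto.
    - apply continuity_pt_mult; [apply continuity_pt_const; intros ? ?; auto|apply derivable_continuous_pt, derivable_pt_id]. }
  have P0 : P 0 = 1 by (unfold P; rewrite PSeries_0; auto).
  destruct (C0 e He) as [d0 [D0 H0]]. destruct (Cf e He) as [d1 [D1 H1]].
  unfold dist in H0, H1; simpl in H0, H1; unfold R_dist in H0, H1.
  have f0 : f 0 = nu by (unfold f; rewrite P0; ring). rewrite f0 in H1. rewrite P0 in H0.
  set (d := Rmin d0 d1). have Dp : 0 < d by (apply Rmin_pos; lra).
  exists (ln d/2). intros t Ht.
  assert (X : 0 < exp (2 * t)/4 < d).
  { have h := exp_pos (2 * t). split; [lra|]. assert (exp (2 * t) <= d); [|lra].
    rewrite <- (exp_ln d) by auto. destruct (Rle_lt_or_eq_dec (2 * t) (ln d) ok) as [g|g]; [left; now apply exp_increasing|rewrite g; lra]. }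
  have m0 := Rmin_l d0 d1. have m1 := Rmin_r d0 d1. fold d in m0, m1. have Ep := exp_pos (nu * t).
  set (x := exp (2 * t)/4) in *.
  have hx : (True /\ 0 <> x) /\ Rabs (x - 0) < d0 /\ Rabs (x - 0) < d1.
  destruct hx as (h1 & h2 & h3). specialize (H0 x (conj h1 h2)). specialize (H1 x (conj h1 h3)).
  have Eu : U nu t = exp (nu * t) * P x.
  assert (Eu1 : U1 nu t = exp (nu * t) * f x).
  { unfold U1, frobU1, f, P, P1, x. obv. }
  rewrite Eu, Eu1. split.
  - turn (exp (nu * t) * P x - exp (nu * t)) into (exp (nu * t) * (P x - 1)).
    rewrite Rabs_mult, (Rabs_pos_eq (exp (nu * t))) by lra. nra.
  - turn (exp (nu * t) * f x - nu * exp (nu * t)) into (exp (nu * t) * (f x - nu)).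
    rewrite Rabs_mult, (Rabs_pos_eq (exp (nu * t))) by lra. nra.
Qed.

Lemma U_nonvanish nu : -1 < nu -> forall t, 0 < U nu t^2 + U1 nu t^2.
Proof.
  intros Hn. destruct (U_near_zero nu (1/2) Hn ok) as [T HT]. destruct (HT T (Rle_refl _)) as [h _].
  apply (bsol_nonvanish nu _ _ T); [now apply U_sol|]. have E := exp_pos (nu * T). obv.
Qed.

Lemma U_prufer nu t0 th0 : -1 < nu ->
  U nu t0 = sqrt (U nu t0^2 + U1 nu t0^2) * sin th0 -> U1 nu t0 = sqrt (U nu t0^2 + U1 nu t0^2) * cos th0 ->
  exists al, al t0 = th0 /\ prufer (bq nu) al /\ forall t,
    U nu t = sqrt (U nu t^2 + U1 nu t^2) * sin (al t) /\ U1 nu t = sqrt (U nu t^2 + U1 nu t^2) * cos (al t).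
Proof.
  intros Hn. apply sol_prufer; auto using bq_continuous, U_nonvanish. now apply U_sol.
Qed.

Lemma polar_quadrant x y : 0 < x -> 0 < y -> exists th, 0 <= th <= PI/2 /\
  x = sqrt (x^2 + y^2) * sin th /\ y = sqrt (x^2 + y^2) * cos th.
Proof.
  intros Hx Hy. have P : 0 < x^2 + y^2. have Q := sqrt_lt_R0 _ P.
  set (z := atan (x/y)). have Bz := atan_bound (x/y).
  have z0 : 0 < z by (unfold z; rewrite <- atan_0; apply atan_increasing, Rdiv_lt_0_compat; auto).
  exists z. fold z in Bz. split; [lra|]. unfold z. rewrite sin_atan, cos_atan.
  replace (1 + (x/y)²) with ((x^2 + y^2)/y^2) by (unfold Rsqr; field; lra).
  rewrite sqrt_div_alt by nra. rewrite sqrt_pow2 by lra. split; field; lra.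
Qed.

Lemma bq_nonpos nu t : 0 < nu -> t <= ln nu -> bq nu t <= 0.
Proof.
  intros Hn Ht. have h := bq_mono nu t (ln nu) Ht. unfold bq in h at 2.
  turn (2 * ln nu) into (ln nu + ln nu) in h. rewrite exp_plus, exp_ln in h by auto. nra.
Qed.

Lemma quadrant_stays nu al t0 t1 : 0 < nu -> prufer (bq nu) al -> t0 <= t1 -> t1 <= ln nu ->
  0 <= al t0 <= PI/2 -> 0 <= al t1 <= PI/2.
Proof.
  intros Hn Ha Ht Hl H0. split.
  - apply (prufer_nonneg (bq nu) al t0 t1 (exp (2 * t1) + nu^2)); auto; try lra.
    intros; apply bq_bound; lra.
  - assert (al t1 <= PI/2 + 2 * 0); [|lra].
    apply (prufer_le_half (bq nu) al t0 t1 0); auto; try lra. intros; apply bq_nonpos; auto; lra.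
Qed.

Lemma U_positive nu T : 0 < nu -> exists T0, T0 <= T /\ 0 < U nu T0 /\ 0 < U1 nu T0.
Proof.
  intros Hn. destruct (U_near_zero nu (Rmin (1/2) (nu/2)) ok ltac:(apply Rmin_pos; lra)) as [T1 HT].
  exists (Rmin T T1). split; [apply Rmin_l|]. destruct (HT (Rmin T T1) (Rmin_r _ _)) as [h1 h2].
  have m1 := Rmin_l (1/2) (nu/2). have m2 := Rmin_r (1/2) (nu/2).
  have E := exp_pos (nu * Rmin T T1). apply Rabs_le_between in h1. apply Rabs_le_between in h2. split; nra.
Qed.

(** Near minus infinity [U] and [U1] are positive, which puts the angle in the first quadrant, and
    the quadrant is invariant as long as the coefficient is nonpositive. This also pins the multiple
    of [2 PI] in the choice of the angle. *)
Lemma U_recessive nu T : 0 < nu -> exists al, prufer (bq nu) al /\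
  (forall t, U nu t = sqrt (U nu t^2 + U1 nu t^2) * sin (al t) /\ U1 nu t = sqrt (U nu t^2 + U1 nu t^2) * cos (al t)) /\
  (forall t, T <= t <= ln nu -> 0 <= al t <= PI/2).
Proof.
  intros Hn. destruct (U_positive nu (Rmin T (ln nu)) Hn) as (T0 & h0 & h1 & h2).
  have m1 := Rmin_l T (ln nu).
  destruct (polar_quadrant _ _ h1 h2) as (th & Hth & E1 & E2).
  destruct (U_prufer nu T0 th ok E1 E2) as (al & A0 & A1 & A2).
  exists al. splits; auto. intros t Ht. apply (quadrant_stays nu al T0 t); auto; lra.
Qed.

Lemma U_recessive_dir nu al L : 0 < nu ->
  (forall t, U nu t = sqrt (U nu t^2 + U1 nu t^2) * sin (al t) /\ U1 nu t = sqrt (U nu t^2 + U1 nu t^2) * cos (al t)) ->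
  bout nu al L -> Udir nu (L - nu * (PI/2)).
Proof. intros Hn Hl HL. apply (prufer_dir nu _ _ al); auto; try lra. apply U_nonvanish; lra. Qed.

(* [U_(1/2)] is a multiple of [sin t / sqrt t]. *)
Lemma U_half_dir : Udir (1/2) 0.
Proof.
  set (C := fun t => exp (- (t/2)) * sin (exp t)). set (C1 := fun t => exp (- (t/2)) * (exp t * cos (exp t) - sin (exp t)/2)).
  assert (SC : sol (bq (1/2)) C C1).
  { intros t. split; unfold C, C1.
    - derive_tac. unfold Rdiv. Rfield.
    - derive_tac. unfold bq. turn (2 * t) into (t + t). rewrite exp_plus. obv. }
  have SU := U_sol (1/2) ok.
  (* The Wronskian with the explicit solution is constant, and at minus infinity it is [O(e^t)];
     hence it is 0 and the two solutions are proportional. *)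
  assert (W : forall t, U (1/2) t * C1 t - U1 (1/2) t * C t = 0).
  { intros t0. set (w := U (1/2) t0 * C1 t0 - U1 (1/2) t0 * C t0).
    have Ww : forall t, U (1/2) t * C1 t - U1 (1/2) t * C t = w by (intros t; apply (sol_wronskian _ _ _ _ _ SU SC)).
    destruct (Req_dec w 0) as [e|e]; auto. exfalso. apply Rabs_pos_lt in e.
    destruct (U_near_zero (1/2) 1 ok ok) as [T HT].
    set (t := Rmin T (Rmin 0 (ln (Rabs w/10)))).
    have m1 : t <= T by apply Rmin_l. have m2 : t <= 0 by (eapply Rle_trans; [apply Rmin_r|apply Rmin_l]).
    have m3 : t <= ln (Rabs w/10) by (eapply Rle_trans; [apply Rmin_r|apply Rmin_r]).
    destruct (HT t m1) as [h1 h2]. specialize (Ww t).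
    assert (Et : exp t <= Rabs w/10).
    { rewrite <- (exp_ln (Rabs w/10)) by lra. destruct m3 as [m3|m3]; [left; now apply exp_increasing|rewrite m3; lra]. }
    have Ep := exp_pos t. have Eh := exp_pos (1/2 * t). have Eh' := exp_pos (- (t/2)).
    have EE : exp (1/2 * t) * exp (- (t/2)) = 1 by (transitivity (exp 0); [rewrite <- exp_plus; f_equal; field|apply exp_0]).
    have S := sin_le_abs (exp t). rewrite (Rabs_pos_eq (exp t)) in S by lra. apply Rabs_le_between in S.
    have Cb := COS_bound (exp t). apply Rabs_le_between in h1. apply Rabs_le_between in h2.
    set (a := exp (1/2 * t)) in *. set (b := exp (- (t/2))) in *.
    have U2 : Rabs (U (1/2) t) <= 2 * a.
    have U12 : Rabs (U1 (1/2) t) <= 2 * a.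
    have c2 : Rabs (C t) <= b * exp t by (unfold C; fold b; rewrite Rabs_mult, (Rabs_pos_eq b) by lra; apply Rmult_le_compat_l; [lra|pos]).
    have c3 : Rabs (C1 t) <= b * (2 * exp t) by (unfold C1; fold b; rewrite Rabs_mult, (Rabs_pos_eq b) by lra; apply Rmult_le_compat_l; [lra|apply Rabs_le; nra]).
    assert (Rabs w <= 2 * a * (b * (2 * exp t)) + 2 * a * (b * exp t)).
    { rewrite <- Ww. unfold Rminus. eapply Rle_trans; [apply Rabs_triang|]. rewrite Rabs_Ropp, !Rabs_mult.
      obv. }
    obv. }
  apply (dir_intro _ _ _ (1/2) 0). intros t Ht.
  have Ep := exp_pos t. have Eh' := exp_pos (- (t/2)). have UN := U_nonvanish (1/2) ok t.
  assert (CN : 0 < C t^2 + C1 t^2).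
  { unfold C, C1. set (b := exp (- (t/2))) in *. set (x := exp t) in *. have h := cs1 x.
    destruct (Req_dec (sin x) 0) as [e|e].
    - rewrite e in *. have : cos x^2 = 1. turn ((b * 0)^2 + (b * (x * cos x - 0/2))^2) into (b^2 * x^2 * cos x^2).
      rewrite H, Rmult_1_r. apply Rmult_lt_0_compat; apply pow_lt; lra.
    - have : 0 < (b * sin x)^2 by (apply pow2_gt_0, Rmult_integral_contrapositive; split; lra).
      obv. }
  set (D := C t^2 + C1 t^2) in *.
  set (k := (U (1/2) t * C t + U1 (1/2) t * C1 t)/D). specialize (W t).
  assert (Ku : U (1/2) t = k * C t).
  { unfold k. apply Rmult_eq_reg_r with D; [|lra]. unfold D.
    replace ((U (1/2) t * C t + U1 (1/2) t * C1 t)/(C t^2 + C1 t^2) * C t * (C t^2 + C1 t^2)) with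
      ((U (1/2) t * C t + U1 (1/2) t * C1 t) * C t) by obv.
    transitivity (U (1/2) t * C t^2 + (U (1/2) t * C1 t) * C1 t); [ring|]. turn (U (1/2) t * C1 t) into (U1 (1/2) t * C t). ring. }
  assert (Ku1 : U1 (1/2) t = k * C1 t).
  { unfold k. apply Rmult_eq_reg_r with D; [|lra]. unfold D.
    replace ((U (1/2) t * C t + U1 (1/2) t * C1 t)/(C t^2 + C1 t^2) * C1 t * (C t^2 + C1 t^2)) with
      ((U (1/2) t * C t + U1 (1/2) t * C1 t) * C1 t) by obv.
    transitivity (U1 (1/2) t * C1 t^2 + (U1 (1/2) t * C t) * C t); [ring|]. turn (U1 (1/2) t * C t) into (U (1/2) t * C1 t). ring. }
  have k0 : k <> 0 by (intro e; rewrite Ku, Ku1, e in UN; lra).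
  exists (k * exp (- (t/2))), (exp t). rewrite Rplus_0_r, Rminus_diag, Rabs_R0. splits.
  - apply Rmult_integral_contrapositive; split; lra.
  - left; apply Rdiv_lt_0_compat; lra.
  - rewrite Ku. unfold C. turn (k * (exp (- (t/2)) * sin (exp t)) - k * exp (- (t/2)) * sin (exp t)) into 0.
    rewrite Rabs_R0. apply Rmult_le_pos; [pos|pos].
  - rewrite Ku1, exp_opp_inv. unfold C1.
    turn (/ exp t * (k * (exp (- (t/2)) * (exp t * cos (exp t) - sin (exp t)/2))) - k * exp (- (t/2)) * cos (exp t))
      into (- (1/2/exp t * sin (exp t)) * (k * exp (- (t/2)))).
    rewrite Rabs_mult. apply Rmult_le_compat_r; [pos|]. rewrite Rabs_Ropp, Rabs_mult.
    have p : 0 < 1/2/exp t. rewrite (Rabs_pos_eq (1/2/exp t)) by lra.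
    have : Rabs (sin (exp t)) <= 1 by (apply Rabs_le, SIN_bound). obv.
Qed.

(** * The Airy equation *)

(* The two Maclaurin solutions of [w'' = - y w], as Bessel series of order [-1/3] and [1/3]. *)
Definition aF y := PSeries (uc (- (1/3))) (y^3/9).
Definition aF1 y := y^2/3 * PSeries (PS_derive (uc (- (1/3)))) (y^3/9).
Definition aG y := y * PSeries (uc (1/3)) (y^3/9).
Definition aG1 y := PSeries (uc (1/3)) (y^3/9) + y^3/3 * PSeries (PS_derive (uc (1/3))) (y^3/9).

Lemma cube_PSeries_derive c y : entire c ->
  is_derive (fun y => PSeries c (y^3/9)) y (y^2/3 * PSeries (PS_derive c) (y^3/9)).
Proof.
  intros H. eapply is_derive_eq; [apply (is_derive_comp (PSeries c) (fun y => y^3/9));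
    [now apply entire_is_derive|]|].
  - instantiate (1 := y^2/3). derive_tac. Rfield.
  - reflexivity.
Qed.

Lemma uc_ode nu X : -1 < nu ->
  (nu + 1) * PSeries (PS_derive (uc nu)) X + X * PSeries (PS_derive (PS_derive (uc nu))) X + PSeries (uc nu) X = 0.
Proof.
  intros Hn. rewrite (frob_ode nu (uc nu) (fun _ => 0)); auto using uc_entire, entire_zero.
  - rewrite PSeries_const_0; ring.
  - intros n. rewrite uc_rec by auto. ring.
Qed.

Lemma aF_sol : sol aq aF aF1.
Proof.
  have E := uc_entire (- (1/3)) ok. intros y. split.
  - now apply cube_PSeries_derive.
  - have D := cube_PSeries_derive _ y (entire_derive _ E). have O := uc_ode (- (1/3)) (y^3/9) ok.
    set (P1 := fun y => PSeries (PS_derive (uc (- (1/3)))) (y^3/9)) in *.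
    set (P := PSeries (uc (- (1/3))) (y^3/9)) in *. set (P2 := PSeries (PS_derive (PS_derive (uc (- (1/3))))) (y^3/9)) in *.
    change (is_derive (fun y => y^2/3 * P1 y) y (- y * P)). change (PSeries (PS_derive (uc (- (1/3)))) (y^3/9)) with (P1 y) in O.
    derive_tac. obv.
Qed.

Lemma aG_sol : sol aq aG aG1.
Proof.
  have E := uc_entire (1/3) ok. intros y.
  have D0 := cube_PSeries_derive _ y E. have D := cube_PSeries_derive _ y (entire_derive _ E).
  have O := uc_ode (1/3) (y^3/9) ok.
  set (P := fun y => PSeries (uc (1/3)) (y^3/9)) in *.
  set (P1 := fun y => PSeries (PS_derive (uc (1/3))) (y^3/9)) in *.
  set (P2 := PSeries (PS_derive (PS_derive (uc (1/3)))) (y^3/9)) in *.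
  change (PSeries (PS_derive (uc (1/3))) (y^3/9)) with (P1 y) in *.
  change (PSeries (uc (1/3)) (y^3/9)) with (P y) in *. split.
  - change (is_derive (fun y => y * P y) y (P y + y^3/3 * P1 y)). derive_tac. Rfield.
  - change (is_derive (fun y => P y + y^3/3 * P1 y) y (- y * (y * P y))). derive_tac.
    obv.
Qed.

Lemma airy_init : aF 0 = 1 /\ aF1 0 = 0 /\ aG 0 = 0 /\ aG1 0 = 1.
Proof.
  unfold aF, aF1, aG, aG1. turn (0^3/9) into 0. rewrite !PSeries_0. simpl. obv.
Qed.

Lemma airy_wronskian y : aF y * aG1 y - aF1 y * aG y = 1.
Proof.
  rewrite (sol_wronskian aq aF aF1 aG aG1 aF_sol aG_sol y 0).
  destruct airy_init as (e1 & e2 & e3 & e4). obv.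
Qed.

Lemma angle_lift q q1 u u1 v v1 W th c t : sys q q1 u u1 v v1 W -> phase u v W th -> exists n, 0 < n /\
  v t * cos c - u t * sin c = n * sin (angle u u1 v v1 W th c t) /\
  v1 t * cos c - u1 t * sin c = n * cos (angle u u1 v v1 W th c t).
Proof.
  intros H Hth. have HP := sysP_pos _ _ _ _ _ _ _ t H.
  destruct H as (Hu & Hv & HW & Hw & Hq). specialize (Hw t). destruct (Hth t) as (T & Tv & Tu).
  unfold angle. set (P := sysP u v t) in *. set (Q := sysQ u u1 v v1 t). set (x := th t - c).
  have Pa : 0 < W/P.
  destruct (Sh_dir (W/P) (Q/P) x Pa) as [E1 E2].
  have PN := sqrt_lt_R0 _ (Shn_pos (W/P) (Q/P) x Pa). set (m := sqrt (Shn _ _ _)) in *.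
  have Pn := sqrt_lt_R0 _ HP.
  have X1 : v t * cos c - u t * sin c = sqrt P * sin x by (rewrite Tv, Tu; unfold x; rewrite sin_minus; ring).
  have X2 : u t * cos c + v t * sin c = sqrt P * cos x by (rewrite Tv, Tu; unfold x; rewrite cos_minus; ring).
  assert (V1 : v1 t = (Q * v t + W * u t)/P).
  { apply Rmult_eq_reg_r with P; [|lra]. unfold Rdiv; rewrite Rmult_assoc, Rinv_l, Rmult_1_r by lra.
    rewrite <- Hw. unfold P, Q, sysP, sysQ. ring. }
  assert (U1' : u1 t = (Q * u t - W * v t)/P).
  { apply Rmult_eq_reg_r with P; [|lra]. unfold Rdiv; rewrite Rmult_assoc, Rinv_l, Rmult_1_r by lra.
    rewrite <- Hw. unfold P, Q, sysP, sysQ. ring. }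
  exists (sqrt P * m). splits.
  - nra.
  - rewrite X1, E1. ring.
  - rewrite V1, U1'.
    transitivity ((Q * (v t * cos c - u t * sin c) + W * (u t * cos c + v t * sin c))/P); [pos|].
    rewrite X1, X2. rewrite Rmult_assoc, <- E2. unfold Shc. field; lra.
Qed.

Lemma angle_anti u u1 v v1 W th c c' t : 0 < W -> 0 < sysP u v t -> c <= c' ->
  angle u u1 v v1 W th c' t <= angle u u1 v v1 W th c t.
Proof. intros HW HP H. apply Sh_le; [pos|lra]. Qed.

Lemma aout_le b b' L L' : prufer aq b -> prufer aq b' -> aout b L -> aout b' L' -> (forall y, 0 < y -> b y <= b' y) -> L <= L'.
Proof.
  intros Hb Hb' H H' Hle. apply Rnot_lt_le; intro c. set (d := L - L').
  set (xi := 1/d). have Hx : 0 < xi.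
  destruct (yh_spec xi Hx) as [Y _]. have h := aout_at_xi b L xi H Hx. have h' := aout_at_xi b' L' xi H' Hx.
  assert (awkb b (yh xi) <= awkb b' (yh xi)).
  { apply Sh_le; auto. apply Rinv_0_lt_compat, sqrt_lt_R0; auto. }
  turn (5/36/xi) into (5/36 * d) in *. unfold d in *. lra.
Qed.

Lemma awkb_shift b (k : Z) y : awkb (fun t => b t + IZR k * PI) y = awkb b y + IZR k * PI.
Proof. rewrite !awkb_at. apply Sh_shift. Qed.

(* A solution of the Airy equation, seen from the Bessel equation through [xi = (2/3) y^(3/2)]. *)
Lemma airy_dir w w1 b L (u v k : R -> R) g :
  (forall y, exists n, 0 < n /\ w y = n * sin (b y) /\ w1 y = n * cos (b y)) -> aout b L ->
  (forall t, let y := yh (exp t) in k t <> 0 /\ u t = k t * w y /\ v t = k t * (w1 y/sqrt y + g * w y/exp t)) ->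
  dir u v L.
Proof.
  intros Hw HL Hk. apply (dir_intro _ _ _ (1 + Rabs g) 0). intros t Ht.
  have Ep := exp_pos t. destruct (yh_spec (exp t) Ep) as [Y EY]. destruct (Hk t) as (k0 & Eu & Ev).
  set (y := yh (exp t)) in *. destruct (Hw y) as (n & Hn & W0 & W1).
  have Sy := sqrt_lt_R0 _ Y. have a0 : 0 < / sqrt y.
  destruct (Sh_dir (/ sqrt y) (1/(4 * y * sqrt y)) (b y) a0) as [E1 E2]. rewrite <- awkb_at in E1, E2.
  have PN := sqrt_lt_R0 _ (Shn_pos (/ sqrt y) (1/(4 * y * sqrt y)) (b y) a0). set (m := sqrt (Shn _ _ _)) in *.
  set (eta := awkb b y) in *. exists (k t * (n * m)), eta. have gp := Rabs_pos g.
  have nm : 0 < n * m. have iE : 0 < / exp t.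
  splits.
  - apply Rmult_integral_contrapositive; split; lra.
  - have h := aout_at_xi b L (exp t) HL Ep. fold y in h. fold eta in h. apply Rabs_le. nra.
  - rewrite Eu, W0, E1. turn (k t * (n * (m * sin eta)) - k t * (n * m) * sin eta) into 0. rewrite Rabs_R0.
    apply Rmult_le_pos; [pos|pos].
  - assert (c : w1 y/sqrt y = n * m * cos eta - n * m * sin eta/(6 * exp t)).
    { rewrite W1. unfold Shc in E2. rewrite E1 in E2.
      transitivity (n * (/ sqrt y * cos (b y))); [pos|].
      turn (/ sqrt y * cos (b y)) into (m * cos eta - 1/(4 * y * sqrt y) * (m * sin eta)).
      turn (6 * exp t) into (4 * y * sqrt y). field. lra. }
    rewrite Ev, c, W0, E1.
    turn (k t * (n * m * cos eta - n * m * sin eta/(6 * exp t) + g * (n * (m * sin eta))/exp t) - k t * (n * m) * cos eta)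
      into ((g - 1/6) * sin eta/exp t * (k t * (n * m))).
    rewrite Rabs_mult. apply Rmult_le_compat_r; [pos|]. unfold Rdiv. rewrite !Rabs_mult.
    rewrite (Rabs_pos_eq (/ exp t)) by lra. apply Rmult_le_compat_r; [lra|].
    have : Rabs (sin eta) <= 1 by (apply Rabs_le, SIN_bound). have h := Rabs_pos (sin eta).
    assert (Rabs (g - 1 * / 6) <= Rabs g + 1/6).
    { eapply Rle_trans; [apply Rabs_triang|]. obv. }
    obv.
Qed.

Lemma yh_exp t : let y := yh (exp t) in 0 < y /\ exp (2 * t)/4 = y^3/9 /\ 2/3 * (y * sqrt y) = exp t.
Proof.
  intros y. destruct (yh_spec (exp t) (exp_pos t)) as [Y E]. fold y in Y, E. splits; auto.
  turn (2 * t) into (t + t). rewrite exp_plus, <- E.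
  have S := sqrt_sqrt y (Rlt_le _ _ Y). obv.
Qed.

Lemma aF_dir b L : (forall y, exists n, 0 < n /\ aF y = n * sin (b y) /\ aF1 y = n * cos (b y)) -> aout b L ->
  Udir (- (1/3)) L.
Proof.
  intros Hb HL. apply (airy_dir aF aF1 b L _ _ (fun t => exp (- (1/3) * t)) (- (1/3)) Hb HL).
  intros t y. destruct (yh_exp t) as (Y & X & E). fold y in Y, X, E. have Sy := sqrt_lt_R0 _ Y.
  have SS := sqrt_sqrt y (Rlt_le _ _ Y). splits.
  - apply Rgt_not_eq, exp_pos.
  - unfold U, frobU, aF. now rewrite X.
  - unfold U1, frobU1, aF, aF1. rewrite X, exp_opp_inv. turn (exp (2 * t)/2) into (2 * (y^3/9)).
    rewrite <- E. obv.
Qed.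

Lemma aG_dir b L : (forall y, exists n, 0 < n /\ aG y = n * sin (b y) /\ aG1 y = n * cos (b y)) -> aout b L ->
  Udir (1/3) L.
Proof.
  intros Hb HL. apply (airy_dir aG aG1 b L _ _ (fun t => exp (1/3 * t)/yh (exp t)) (- (1/3)) Hb HL).
  intros t y. destruct (yh_exp t) as (Y & X & E). fold y in Y, X, E |- *. have Sy := sqrt_lt_R0 _ Y.
  have SS := sqrt_sqrt y (Rlt_le _ _ Y). have Ep := exp_pos (1/3 * t). splits.
  - apply Rgt_not_eq, Rdiv_lt_0_compat; auto.
  - unfold U, frobU, aG. rewrite X. field. lra.
  - unfold U1, frobU1, aG, aG1. rewrite X, exp_opp_inv. turn (exp (2 * t)/2) into (2 * (y^3/9)).
    rewrite <- E. obv.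
Qed.

(** * Connection formulas *)

Definition Nof nu := Rpower (2 * nu^2) (1/3).

Lemma Nof_spec nu : 0 < nu -> 0 < Nof nu /\ Nof nu^3 = 2 * nu^2.
Proof.
  intros Hn. have P : 0 < 2 * nu^2. split; [apply exp_pos|].
  rewrite <- Rpower_pow by apply exp_pos. unfold Nof. rewrite Rpower_mult.
  replace (1/3 * INR 3) with 1 by (simpl; field). now apply Rpower_1.
Qed.

Lemma Nof_large M : exists V, 0 < V /\ forall nu, V < nu -> M <= Nof nu.
Proof.
  exists (Rmax 1 (Rabs M^3)). split; [have h := Rmax_l 1 (Rabs M^3); lra|]. intros nu Hv.
  have h1 := Rmax_l 1 (Rabs M^3). have h2 := Rmax_r 1 (Rabs M^3).
  destruct (Nof_spec nu ok) as [P E]. apply Rnot_lt_le; intro c.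
  have a := Rle_abs M. have : Nof nu^3 < Rabs M^3 by (apply cube_lt; lra). nra.
Qed.

Lemma wtime_mono nu N w w' : 0 < nu -> 0 < N -> 0 < 1 + w/N -> w <= w' -> wtime nu N w <= wtime nu N w'.
Proof.
  intros Hn HN Hw [H|H]; [|subst; lra]. left. apply ln_increasing; [nra|]. apply Rmult_lt_compat_l; auto.
  assert (w/N < w'/N); [|lra]. obv.
Qed.

Lemma wtime_le_ln nu N w : 0 < nu -> 0 < N -> 0 < 1 + w/N -> w <= 0 -> wtime nu N w <= ln nu.
Proof.
  intros Hn HN Hw H. replace (ln nu) with (wtime nu N 0); [now apply wtime_mono|].
  unfold wtime. f_equal. field; lra.
Qed.

Section Airy.
Context (c1 c2 : R) (Hc1 : 0 < c1) (Hc2 : 0 < c2).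

(** For [c1 = Ai(0)] and [c2 = - Ai'(0)] these are [Ai(- y)] and [- Bi(- y)]; the factor [sqrt 3] is
    [Bi(0)/Ai(0)]. The section keeps the constants abstract and records in [Hrec] that [au] is the
    recessive solution on the left. The value [- PI/3] of [th] at 0 has tangent
    [av/au = - sqrt 3]. *)
Definition au y := c1 * aF y + c2 * aG y.
Definition au1 y := c1 * aF1 y + c2 * aG1 y.
Definition av y := - (sqrt 3 * c1) * aF y + sqrt 3 * c2 * aG y.
Definition av1 y := - (sqrt 3 * c1) * aF1 y + sqrt 3 * c2 * aG1 y.
Definition aW := 2 * sqrt 3 * c1 * c2.

Context (Hrec : forall y, y <= 0 -> 0 < au y /\ 0 <= au1 y).
Context (th : R -> R) (Hth : phase au av aW th) (Hth0 : th 0 = - (PI/3)).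

Lemma sqrt3_pos : 0 < sqrt 3. Proof. obv. Qed.

Lemma asys : sys aq (fun _ => 1) au au1 av av1 aW.
Proof.
  have s := sqrt3_pos. unfold sys. splits.
  - apply (sol_comb aq aF aF1 aG aG1); [apply aF_sol|apply aG_sol].
  - apply (sol_comb aq aF aF1 aG aG1); [apply aF_sol|apply aG_sol].
  - repeat apply Rmult_lt_0_compat; lra.
  - intros t. unfold au, au1, av, av1, aW.
    transitivity (2 * sqrt 3 * c1 * c2 * (aF t * aG1 t - aF1 t * aG t)); [ring|]. rewrite airy_wronskian. ring.
  - intros t. apply (is_derive_id t).
Qed.

Definition aang c := angle au au1 av av1 aW th c.

Lemma aang_prufer c : prufer aq (aang c).
Proof. apply (angle_prufer _ _ _ _ _ _ _ _ _ asys Hth). Qed.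

Lemma aW_pos : 0 < aW. Proof. apply asys. Qed.
Lemma aP_pos t : 0 < sysP au av t. Proof. apply (sysP_pos _ _ _ _ _ _ _ _ asys). Qed.

Lemma aang_shift c (k : Z) t : aang (c - IZR k * PI) t = aang c t + IZR k * PI.
Proof. apply angle_shift. Qed.

(** [au] is a positive multiple of [cos th] and stays positive on the left, so the increasing phase
    [th] can never have been at [- PI/2]. *)
Lemma th_neg y : y <= 0 -> - (PI/2) < th y <= - (PI/3).
Proof.
  intros Hy. have P := PI_RGT_0. split.
  - apply (no_cross_above th (y - 1) 1 (- (PI/2)) 0 y); try lra.
    + intros x _. eapply is_derive_ct. apply (Hth x).
    + intros x Hx E. destruct (Rle_dec x 0) as [h|h].
      * destruct (Hth x) as (_ & _ & T). rewrite E, cos_neg, cos_PI2, Rmult_0_r in T. destruct (Hrec x h). lra.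
      * assert (th 0 <= th x); [|lra]. apply deriv_nonneg_le; [lra|]. intros t _. destruct (Hth t) as (T & _).
        eexists; split; [exact T|]. left; apply Rdiv_lt_0_compat; [apply aW_pos|apply aP_pos].
  - rewrite <- Hth0. apply deriv_nonneg_le; [lra|]. intros t _. destruct (Hth t) as (T & _).
    eexists; split; [exact T|]. left; apply Rdiv_lt_0_compat; [apply aW_pos|apply aP_pos].
Qed.

(* [aang (-PI/2)] is the Prüfer angle of the recessive solution [au]. *)
Lemma recessive_angle y : y <= 0 -> 0 <= aang (- (PI/2)) y <= PI/2.
Proof.
  intros Hy. have T := th_neg y Hy. have P := PI_RGT_0.
  assert (R : IZR 0 * PI <= aang (- (PI/2)) y <= (IZR 0 + 1) * PI).
  { unfold aang, angle. apply Sh_range; [apply Rdiv_lt_0_compat; [apply aW_pos|apply aP_pos]|]. simpl. lra. }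
  destruct (angle_lift _ _ _ _ _ _ _ _ (- (PI/2)) y asys Hth) as (n & Hn & _ & E). fold (aang (- (PI/2)) y) in E.
  rewrite cos_neg, sin_neg, cos_PI2, sin_PI2 in E. destruct (Hrec y Hy) as [_ h].
  simpl in R. split; [lra|]. apply Rnot_lt_le; intro c.
  have : cos (aang (- (PI/2)) y) < 0 by (apply cos_lt_0; lra). nra.
Qed.

(** For [y <= -1] the derivative of [sysQ] exceeds [2 aW] by a sum of nonnegative terms, so [sysQ]
    tends to minus infinity on the left. There the whole first quadrant of Prüfer angles corresponds
    to a tiny range of mixing phases. *)
Lemma aQ_small z : exists Y0, 1 <= Y0 /\ forall y, y <= - Y0 -> z * aW <= - sysQ au au1 av av1 y.
Proof.
  set (Q0 := sysQ au au1 av av1 (-1)). have W := aW_pos.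
  exists (1 + Rabs ((z * aW + Q0)/(2 * aW))). split; [have h := Rabs_pos ((z * aW + Q0)/(2 * aW)); lra|].
  intros y Hy. have h := Rle_abs ((z * aW + Q0)/(2 * aW)). have h0 := Rabs_pos ((z * aW + Q0)/(2 * aW)).
  assert (M : sysQ au au1 av av1 y - 2 * aW * y <= Q0 - 2 * aW * (-1)).
  { apply (deriv_nonneg_le (fun y => sysQ au au1 av av1 y - 2 * aW * y)); [lra|].
    intros t Ht. destruct asys as (Hu & Hv & _ & Hw & _). specialize (Hw t).
    destruct (Hu t) as [a1 a2], (Hv t) as [a3 a4].
    exists (au1 t^2 + av1 t^2 - t * (au t^2 + av t^2) - 2 * aW). split.
    - unfold sysQ. derive_tac. unfold aq. Rring.
    - have : 0 <= (- au1 t - av t)^2. have : 0 <= (av1 t - au t)^2.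
      have : 0 <= (-1 - t) * (au t^2 + av t^2).
      obv. }
  have : 2 * aW * ((z * aW + Q0)/(2 * aW)) = z * aW + Q0. nra.
Qed.

(* All angles in the first quadrant far to the left have almost the same outcome. *)
Lemma recessive_outcomes a e : aout (aang (- (PI/2))) a -> 0 < e -> exists Y0, 1 <= Y0 /\
  forall Y A, Y0 <= Y -> 0 <= A <= PI/2 -> exists b L, prufer aq b /\ b (- Y) = A /\ aout b L /\ Rabs (L - a) <= e.
Proof.
  intros Ha He. set (a1 := aW/sysP au av 1). set (b1 := sysQ au au1 av av1 1/sysP au av 1).
  have Pa : 0 < a1 by (apply Rdiv_lt_0_compat; [apply aW_pos|apply aP_pos]).
  set (K := (1 + a1^2 + b1^2)/a1). have HK : 0 < K.
  (* Chosen so that the final error is exactly [e]: the factors are the Gronwall growth to the right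
     of [y = 1], the constant of [Sh_lip], and the Lipschitz constant [K] of the shear at
     [y = 1]. *)
  set (z := exp (aB 1) * (9 * K)/e). have Ez := exp_pos (aB 1).
  have Hz : 0 < z.
  destruct (aQ_small z) as (Y0 & HY0 & HQ). exists Y0. split; auto. intros Y A HY HA.
  set (c := phaseA au au1 av av1 aW th A (- Y)). have P := PI_RGT_0.
  have Bc : aang c (- Y) = A by (apply (angle_phaseA _ _ _ _ _ _ _ _ _ _ asys)).
  destruct (aout_exists (aang c) (aang_prufer c)) as [L HL].
  exists (aang c), L. splits; auto using aang_prufer.
  specialize (HQ (- Y) ok).
  (* the two phases lie within the small angle of the vectors (au, av), (au1, av1) *)
  set (aY := sysP au av (- Y)/aW). set (bY := - sysQ au au1 av av1 (- Y)/aW).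
  have PaY : 0 < aY by (apply Rdiv_lt_0_compat; [apply aP_pos|apply aW_pos]).
  have zY : z <= bY by (apply Rmult_le_reg_r with aW; [apply aW_pos|]; unfold bY, Rdiv; rewrite Rmult_assoc, Rinv_l by (apply Rgt_not_eq, aW_pos); lra).
  assert (w : Sh aY bY (PI/2) <= / z).
  { destruct (Sh_cot aY bY (PI/2) 0 PaY ok) as [g1 g2]; [rewrite cos_PI2; ring|].
    rewrite (arccot_unique _ _ g1 g2). rewrite Rmult_0_r, Rplus_0_l. rewrite <- atan_inv by lra.
    have i := Rinv_0_lt_compat bY ok. have h := atan_cubic _ i.
    have : 0 < (/ bY)^3/(3 * (1 + (/ bY)^2)).
    have : / bY <= / z. lra. }
  assert (cc : forall c0, 0 <= aang c0 (- Y) <= PI/2 -> th (- Y) - / z <= c0 <= th (- Y)).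
  { intros c0 H0. have Pi : 0 < aW/sysP au av (- Y) by (apply Rdiv_lt_0_compat; [apply aW_pos|apply aP_pos]).
    split; apply Rnot_lt_le; intro h.
    - assert (X : Sh (aW/sysP au av (- Y)) (sysQ au au1 av av1 (- Y)/sysP au av (- Y)) (Sh aY bY (PI/2)) < aang c0 (- Y)).
      { apply Sh_lt; auto. lra. }
      replace aY with (/ (aW/sysP au av (- Y))) in X by (unfold aY; have p1 := aP_pos (- Y); have p2 := aW_pos; field; lra).
      replace bY with (- (sysQ au au1 av av1 (- Y)/sysP au av (- Y))/(aW/sysP au av (- Y))) in X
        by (unfold bY; have p1 := aP_pos (- Y); have p2 := aW_pos; field; lra).
      rewrite Sh_inv in X by auto. lra.
    - assert (X : aang c0 (- Y) < 0); [|lra]. unfold aang, angle.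
      eapply Rlt_le_trans; [apply (Sh_lt _ _ _ 0 Pi); lra|rewrite Sh_0; lra]. }
  have D1 := cc c ok. have D2 := cc (- (PI/2)) (recessive_angle (- Y) ok).
  have iz := Rinv_0_lt_compat z Hz.
  have Dc : Rabs (c - - (PI/2)) <= / z.
  assert (L1 : forall x y, Rabs (Sh a1 b1 x - Sh a1 b1 y) <= K * Rabs (x - y)).
  { assert (G : forall x y, x <= y -> Rabs (Sh a1 b1 y - Sh a1 b1 x) <= K * (y - x)).
    { intros x y Hxy. apply (deriv_bound (Sh a1 b1) (fun t => (a1 * 1 - sin t * cos t * 0 - sin t^2 * 0)/Shn a1 b1 t)); auto.
      intros t _. split.
      - apply (Sh_derive (fun _ => a1) (fun _ => b1) (fun t => t)); auto; [apply (is_derive_const a1 t)|apply (is_derive_const b1 t)|apply (is_derive_id t)].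
      - have N := Shn_lower a1 b1 t Pa. have N0 : 0 < a1^2/(1 + a1^2 + b1^2).
        turn ((a1 * 1 - sin t * cos t * 0 - sin t^2 * 0)/Shn a1 b1 t) into (a1 * / Shn a1 b1 t).
        rewrite Rabs_pos_eq by pos.
        replace K with (a1 * / (a1^2/(1 + a1^2 + b1^2))) by (unfold K; field; split; nra).
        obv. }
    intros x y. destruct (Rle_dec x y).
    - rewrite <- Rabs_Ropp, Ropp_minus_distr, (Rabs_left1 (x - y)) by lra. turn (- (x - y)) into (y - x). auto.
    - rewrite (Rabs_pos_eq (x - y)) by lra. apply G; lra. }
  assert (X1 : Rabs (aang c 1 - aang (- (PI/2)) 1) <= K * / z).
  { unfold aang, angle. fold a1 b1. eapply Rle_trans; [apply L1|]. obv. }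
  assert (X2 : Rabs (awkb (aang c) 1 - awkb (aang (- (PI/2))) 1) <= 9 * K * / z).
  { rewrite !awkb_at, sqrt_1, Rinv_1. eapply Rle_trans; [apply Sh_lip; try lra; apply Rabs_le; lra|].
    rewrite !Rminus_diag, Rabs_R0. lra. }
  assert (X3 : forall y, 1 <= y -> Rabs (awkb (aang c) y - awkb (aang (- (PI/2))) y) <= e).
  { intros y Hy. eapply Rle_trans; [apply (awkb_pair _ _ 1 y); auto using aang_prufer; lra|].
    apply Rle_trans with (exp (aB 1) * (9 * K * / z)); [pos|].
    right. unfold z. field. lra. }
  apply Rnot_lt_le; intro c0. set (d := Rabs (L - a) - e) in *. have Hd : 0 < d.
  set (y := Rmax 1 (1/d)). have y1 : 1 <= y by apply Rmax_l. have y2 : 1/d <= y by apply Rmax_r.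
  have h1 := HL y ok. have h2 := Ha y ok. specialize (X3 y y1). apply Rabs_le_between in X3.
  assert (hB : aB y <= 5/24 * d).
  { have sy : 1 <= sqrt y by (rewrite <- sqrt_1; apply sqrt_le_1_alt; lra). unfold aB.
    apply Rmult_le_reg_r with (y * sqrt y); [nra|]. unfold Rdiv at 1. rewrite Rmult_assoc, Rinv_l by nra.
    have : d * (1/d) = 1. have : 1 <= d * y. nra. }
  have : Rabs (L - a) <= e + 5/24 * d. unfold d in *. lra.
Qed.

(** The order of choices matters: [Y] depends only on [e] and makes the Airy outcomes insensitive to
    the initial angle; then [nu] is taken so large that the comparison error [C Y^3/N] is below
    [e/2]. *)
Lemma recessive_limit a e : aout (aang (- (PI/2))) a -> 0 < e -> exists V Y, 0 < V /\ 1 <= Y /\ forall nu, V < nu ->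
  100 <= Nof nu /\ Y^2 <= Nof nu /\
  forall al L, prufer (bq nu) al -> 0 <= al (wtime nu (Nof nu) (- Y)) <= PI/2 -> bout nu al L -> Rabs (L - a) <= e.
Proof.
  intros Ha He. destruct transition_recessive as (C & HC & HT).
  destruct (recessive_outcomes a (e/2) Ha ok) as (Y & HY & HO).
  destruct (Nof_large (100 + Y^2 + 2 * C * Y^3/e)) as (V & HV & HN).
  exists V, Y. splits; auto. intros nu Hnu. specialize (HN nu Hnu). destruct (Nof_spec nu ok) as [N0 NE].
  set (N := Nof nu) in *. have Y2 : 1 <= Y^2.
  have Q : 0 < 2 * C * Y^3/e. splits; try lra.
  intros al L Hal Hq HL.
  have iN : 0 < / N. have P := PI_RGT_0.
  assert (QA : 0 <= Sh (/ N) 0 (al (wtime nu N (- Y))) <= PI/2).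
  { have h0 := Sh_le (/ N) 0 _ _ iN (proj1 Hq). rewrite Sh_0 in h0. split; auto.
    eapply Rle_trans; [apply Sh_le; [auto|apply Hq]|].
    destruct (Sh_cot (/ N) 0 (PI/2) 0 iN ok) as [g1 g2]; [rewrite cos_PI2; ring|].
    rewrite (arccot_unique _ _ g1 g2). rewrite Rmult_0_r, Rplus_0_r, atan_0. lra. }
  destruct (HO Y _ (Rle_refl Y) QA) as (b & Lb & B1 & B2 & B3 & B4).
  assert (X : Rabs (L - Lb) <= C * (Y^3/N)).
  { apply (outcome_close nu al b L Lb (wtime nu N 1)); auto; try lra.
    intros t Ht. apply (HT nu N Y al b t); auto; try lra. }
  assert (C * (Y^3/N) <= e/2).
  { apply Rmult_le_reg_r with N; auto. turn (C * (Y^3/N) * N) into (C * Y^3).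
    have : 2 * C * Y^3/e * (e/2) = C * Y^3. nra. }
  obv.
Qed.

Lemma kPI_small (k : Z) : Rabs (IZR k * PI) < PI -> IZR k * PI = 0.
Proof.
  intros H. have P := PI_RGT_0. rewrite Rabs_mult, (Rabs_pos_eq PI) in H by lra.
  assert (k = 0%Z); [|subst; ring].
  have B : Rabs (IZR k) < 1. apply Rabs_lt_between in B. destruct B as [B1 B2].
  change (- (1)) with (IZR (-1)) in B1 || rewrite <- opp_IZR in B1. apply lt_IZR in B1. apply lt_IZR in B2. lia.
Qed.

(** Raising [nu0] by a large integer makes the outcome of [U] differ from [a] by at most [e], and
    the ladder brings the direction back to [nu0]. A direction is known only modulo [PI], but
    outcomes found for two small tolerances differ by less than [PI], hence coincide; letting [e]
    tend to 0 gives exactly [a]. *)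
Lemma Udir_from_large nu0 a : -1 < nu0 -> aout (aang (- (PI/2))) a -> Udir nu0 (a - nu0 * (PI/2)).
Proof.
  intros Hn0 Ha.
  assert (down : forall n phi, Udir (nu0 + INR n) phi -> Udir nu0 (phi + INR n * (PI/2))).
  { induction n as [|n IH]; intros phi H.
    - simpl in *. rewrite Rplus_0_r in H. now turn (phi + 0 * (PI/2)) into phi.
    - rewrite S_INR in *. turn (phi + (INR n + 1) * (PI/2)) into (phi + PI/2 + INR n * (PI/2)).
      apply IH, Udir_down; [have h := pos_INR n; lra|]. now rewrite Rplus_assoc. }
  assert (step : forall e, 0 < e -> exists L, Udir nu0 (L - nu0 * (PI/2)) /\ Rabs (L - a) <= e).
  { intros e He. destruct (recessive_limit a e Ha He) as (V & Y & HV & HY & HL).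
    destruct (INR_unbounded (V + Rabs nu0 + 1)) as [n Hn]. set (nu := nu0 + INR n).
    have h := Rle_abs (- nu0). rewrite Rabs_Ropp in h. have Hnu : V < nu.
    destruct (HL nu Hnu) as (h1 & h2 & h3).
    destruct (U_recessive nu (wtime nu (Nof nu) (- Y)) ok) as (al & A1 & A2 & A3).
    destruct (bout_exists nu al ok A1) as [L HL']. exists L. split.
    - turn (L - nu0 * (PI/2)) into (L - nu * (PI/2) + INR n * (PI/2)).
      apply down. apply (U_recessive_dir nu al L); auto; lra.
    - apply (h3 al L); auto. apply A3. split; [lra|].
      assert (0 < 1 + - Y/Nof nu).
      { have : - Y/Nof nu * Nof nu = - Y. obv. }
      apply wtime_le_ln; lra. }
  destruct (step 1 ok) as (L & HL & HLa).
  assert (E : forall e, 0 < e -> Rabs (L - a) <= e).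
  { intros e He. set (e' := Rmin e 1). have He' : 0 < e' by (apply Rmin_pos; lra).
    have m1 := Rmin_l e 1. have m2 := Rmin_r e 1. fold e' in m1, m2.
    destruct (step e' He') as (L' & HL' & HLa'). destruct (dir_unique _ _ _ _ HL HL') as [k Hk].
    turn (L - nu0 * (PI/2) - (L' - nu0 * (PI/2))) into (L - L') in Hk.
    have T := Rabs_triang3 L a L'. rewrite <- (Rabs_Ropp (a - L')), Ropp_minus_distr in T.
    have P := PI2_3_2. rewrite (kPI_small k) in Hk by obv. obv. }
  assert (L = a); [|subst; auto]. destruct (Req_dec L a) as [h|h]; auto. exfalso.
  have p : 0 < Rabs (L - a) by (apply Rabs_pos_lt; lra). specialize (E (Rabs (L - a)/2) ok). lra.
Qed.

(** At order [1/2] the direction is elementary, which gives [PI/4] modulo [PI]. The crude location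
    of the WKB angle at [y = 1] in [[0, PI]] removes the ambiguity. *)
Lemma recessive_outcome : aout (aang (- (PI/2))) (PI/4).
Proof.
  destruct (aout_exists _ (aang_prufer (- (PI/2)))) as [a Ha].
  destruct (dir_unique _ _ _ _ (Udir_from_large (1/2) a ok Ha) U_half_dir) as [k Hk].
  have P := PI2_3_2.
  set (b := aang (- (PI/2))) in *. have Hb : prufer aq b by apply aang_prufer.
  have b0 := recessive_angle 0 (Rle_refl 0). fold b in b0.
  assert (b1 : 0 <= b 1 <= PI).
  { split.
    - apply (prufer_nonneg aq b 0 1 1); auto; try lra. intros t Ht; unfold aq; apply Rabs_le; lra.
    - assert (b 1 - b 0 <= 1); [|lra].
      assert (b 1 - 1 * 1 <= b 0 - 1 * 0); [|lra].
      assert (- (b 0 - 1 * 0) <= - (b 1 - 1 * 1)); [|lra].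
      apply (deriv_nonneg_le (fun t => - (b t - 1 * t))); [lra|]. intros t Ht. have h := Hb t.
      eexists; split; [derive_tac; reflexivity|]. unfold aq. rewrite cs1. nra. }
  assert (w1 : IZR 0 * PI <= awkb b 1 <= (IZR 0 + 1) * PI).
  { rewrite awkb_at. apply Sh_range; [pos|pos]. }
  have h := Ha 1 ok. unfold aB, axi in h. rewrite sqrt_1 in h. simpl in w1.
  turn (a - 1/2 * (PI/2) - 0) into (a - PI/4) in Hk.
  rewrite (kPI_small k) in Hk; [turn (PI/4) into a; auto|]. obv.
Qed.

Lemma Udir_all nu : -1 < nu -> Udir nu (PI/4 - nu * (PI/2)).
Proof. intros Hn. apply Udir_from_large; auto. apply recessive_outcome. Qed.
End Airy.

(* A projective map that rotates three directions by the same angle is that rotation. *)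
Lemma three_directions rf rg rr rc ef eg er ec A B c e : 0 < rf -> 0 < rg -> 0 < rr -> 0 < rc ->
  A = sin (- (PI/3) - c) -> B = sin (c + 2 * (PI/3)) ->
  sqrt 3 * rr * sin er = rf * sin ef + rg * sin eg -> sqrt 3 * rr * cos er = rf * cos ef + rg * cos eg ->
  sqrt 3/2 * rc * sin ec = A * rf * sin ef + B * rg * sin eg ->
  sqrt 3/2 * rc * cos ec = A * rf * cos ef + B * rg * cos eg ->
  0 < e <= 1/20 -> Rabs (ef - er - PI/6) <= e -> Rabs (eg - er + PI/6) <= e ->
  Rabs (sin (ec - (er - PI/2 - c))) <= 8 * e.
Proof.
  intros Hf Hg Hr Hc EA EB E1 E2 E3 E4 He Df Dg.
  have s3 := sqrt3_pos. have s33 := sqrt_sqrt 3 ok. set (s := sqrt 3) in *.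
  assert (S1 : Rabs (sin (ef - er) - 1/2) <= e).
  { rewrite <- sin_PI6. eapply Rle_trans; [apply sin_lip|]. exact Df. }
  assert (S2 : Rabs (sin (eg - er) - - (1/2)) <= e).
  { rewrite <- sin_PI6, <- sin_neg. eapply Rle_trans; [apply sin_lip|]. obv. }
  assert (X1 : rf * sin (ef - er) + rg * sin (eg - er) = 0).
  { rewrite !sin_minus. transitivity ((rf * sin ef + rg * sin eg) * cos er - (rf * cos ef + rg * cos eg) * sin er); [ring|].
    rewrite <- E1, <- E2. ring. }
  apply Rabs_le_between in S1. apply Rabs_le_between in S2.
  have F : Rabs (rf - rg) <= 2 * e * (rf + rg) by (apply Rabs_le; nra).
  set (psi := er - PI/2 - c).
  assert (X2 : s/2 * rc * sin (ec - psi) = A * rf * sin (ef - psi) + B * rg * sin (eg - psi)).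
  { rewrite !sin_minus. transitivity ((s/2 * rc * sin ec) * cos psi - (s/2 * rc * cos ec) * sin psi); [ring|].
    rewrite E3, E4. ring. }
  assert (T1 : Rabs (sin (ef - psi) - B) <= e).
  { rewrite EB. eapply Rle_trans; [apply sin_lip|]. obv. }
  assert (T2 : Rabs (sin (eg - psi) - - A) <= e).
  { rewrite EA, <- sin_neg. eapply Rle_trans; [apply sin_lip|]. obv. }
  have bA : Rabs A <= 1 by (rewrite EA; apply Rabs_le, SIN_bound). have bB : Rabs B <= 1 by (rewrite EB; apply Rabs_le, SIN_bound).
  set (S := Rabs A * rf + Rabs B * rg). have pA := Rabs_pos A. have pB := Rabs_pos B.
  assert (Z : Rabs (s/2 * rc * sin (ec - psi)) <= 3 * e * S).
  { rewrite X2. replace (A * rf * sin (ef - psi) + B * rg * sin (eg - psi)) with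
      (A * B * (rf - rg) + (A * rf * (sin (ef - psi) - B) + B * rg * (sin (eg - psi) - - A))) by ring.
    eapply Rle_trans; [apply Rabs_triang|].
    assert (Y1 : Rabs (A * rf * (sin (ef - psi) - B) + B * rg * (sin (eg - psi) - - A)) <= e * S).
    { eapply Rle_trans; [apply Rabs_triang|]. rewrite !Rabs_mult, (Rabs_pos_eq rf), (Rabs_pos_eq rg) by lra.
      have : 0 <= Rabs A * rf. have : 0 <= Rabs B * rg. unfold S. nra. }
    assert (Y2 : Rabs (A * B * (rf - rg)) <= 2 * e * S).
    { rewrite !Rabs_mult. apply Rle_trans with (Rabs A * Rabs B * (2 * e * (rf + rg))); [pos|].
      unfold S. have : Rabs A * Rabs B * rf <= Rabs A * rf by (apply Rmult_le_compat_r; nra).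
      have : Rabs A * Rabs B * rg <= Rabs B * rg by (apply Rmult_le_compat_r; nra). nra. }
    lra. }
  assert (M : 3/4 * rc^2 = A^2 * rf^2 + B^2 * rg^2 + 2 * (A * B * rf * rg) * cos (ef - eg)).
  { rewrite cos_minus. have h1 := cs1 ef. have h2 := cs1 eg. have h3 := cs1 ec.
    transitivity ((s/2 * rc * sin ec)^2 + (s/2 * rc * cos ec)^2).
    - transitivity (s * s/4 * rc^2 * (sin ec^2 + cos ec^2)); [rewrite s33, h3; field|pos].
    - rewrite E3, E4. transitivity (A^2 * rf^2 * (sin ef^2 + cos ef^2) + B^2 * rg^2 * (sin eg^2 + cos eg^2)
        + 2 * (A * B * rf * rg) * (cos ef * cos eg + sin ef * sin eg)); [ring|rewrite h1, h2; ring]. }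
  assert (K : Rabs (cos (ef - eg) - 1/2) <= 1/10).
  { rewrite <- cos_PI3. eapply Rle_trans; [apply cos_lip|]. obv. }
  apply Rabs_le_between in K.
  assert (AB : Rabs (A * B * rf * rg * cos (ef - eg)) <= 6/10 * (Rabs A * rf * (Rabs B * rg))).
  { rewrite !Rabs_mult, (Rabs_pos_eq rf), (Rabs_pos_eq rg) by lra.
    turn (Rabs A * Rabs B * rf * rg * Rabs (cos (ef - eg))) into (Rabs A * rf * (Rabs B * rg) * Rabs (cos (ef - eg))).
    rewrite (Rmult_comm (6/10)). obv. }
  apply Rabs_le_between in AB.
  have qA : A^2 = Rabs A^2 by (rewrite <- !Rsqr_pow2; apply Rsqr_abs).
  have qB : B^2 = Rabs B^2 by (rewrite <- !Rsqr_pow2; apply Rsqr_abs).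
  assert (N1 : 2/10 * S^2 <= 3/4 * rc^2).
  { rewrite M, qA, qB. unfold S. have : 0 <= (Rabs A * rf - Rabs B * rg)^2. nra. }
  have S0 : 0 <= S.
  rewrite Rabs_mult, (Rabs_pos_eq (s/2 * rc)) in Z by nra.
  have h := Rabs_pos (sin (ec - psi)).
  have : 85/100 * rc * Rabs (sin (ec - psi)) <= 3 * e * S by (have : 85/100 * rc <= s/2 * rc; nra).
  apply Rmult_le_reg_l with rc; auto. nra.
Qed.

(** * Outcomes of all solutions of the Airy equation *)

Section Airy2.
Context (c1 c2 : R) (Hc1 : 0 < c1) (Hc2 : 0 < c2) (Hrec : forall y, y <= 0 -> 0 < au c1 c2 y /\ 0 <= au1 c1 c2 y)
  (th : R -> R) (Hth : phase (au c1 c2) (av c1 c2) (aW c1 c2) th) (Hth0 : th 0 = - (PI/3)).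

Let ang := aang c1 c2 th.
Let sy := asys c1 c2 Hc1 Hc2.
Let ang_pr c : prufer aq (ang c) := aang_prufer c1 c2 Hc1 Hc2 th Hth c.
Let rec_out : aout (ang (- (PI/2))) (PI/4) := recessive_outcome c1 c2 Hc1 Hc2 Hrec th Hth Hth0.

Lemma aang_lift c y : exists n, 0 < n /\ av c1 c2 y * cos c - au c1 c2 y * sin c = n * sin (ang c y) /\
  av1 c1 c2 y * cos c - au1 c1 c2 y * sin c = n * cos (ang c y).
Proof. apply (angle_lift _ _ _ _ _ _ _ _ c y sy Hth). Qed.

Lemma outcome_mono c c' L L' : c <= c' -> aout (ang c) L -> aout (ang c') L' -> L' <= L.
Proof.
  intros H HL HL'. apply (aout_le (ang c') (ang c)); auto using ang_pr. intros y _.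
  apply angle_anti; auto; [apply sy|apply (sysP_pos _ _ _ _ _ _ _ _ sy)].
Qed.

Lemma outcome_shift c L (k : Z) : aout (ang c) L -> aout (ang (c - IZR k * PI)) (L + IZR k * PI).
Proof.
  intros H y Hy. have h := H y Hy.
  assert (E : awkb (ang (c - IZR k * PI)) y = awkb (ang c) y + IZR k * PI).
  { rewrite <- awkb_shift. rewrite !awkb_at. unfold ang. now rewrite aang_shift. }
  obv.
Qed.

Lemma outcome_range c L : - (PI/2) <= c <= PI/2 -> aout (ang c) L -> - (3 * (PI/4)) <= L <= PI/4.
Proof.
  intros Hc HL. split; [|apply (outcome_mono (- (PI/2)) c); auto; lra].
  have h := outcome_shift _ _ (-1) rec_out. turn (- (PI/2) - IZR (-1) * PI) into (PI/2) in h.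
  have g := outcome_mono c (PI/2) L _ (proj2 Hc) HL h. obv.
Qed.

Lemma trig3 : cos (- (2 * (PI/3))) = - (1/2) /\ sin (- (2 * (PI/3))) = - (sqrt 3/2) /\
  cos (- (PI/3)) = 1/2 /\ sin (- (PI/3)) = - (sqrt 3/2).
Proof. rewrite !cos_neg, !sin_neg, cos_PI3, sin_PI3, cos_2PI3, sin_2PI3. obv. Qed.

(** At this phase the combination of [av] and [au] is a positive multiple of [aF], a Bessel series
    of order [- 1/3] in [xi]. Its direction [PI/4 + PI/6] fixes the outcome modulo [PI], and
    monotonicity of outcomes in the phase fixes the multiple. *)
Lemma outcome_F : aout (ang (- (2 * (PI/3)))) (5 * (PI/12)).
Proof.
  destruct (aout_exists _ (ang_pr (- (2 * (PI/3))))) as [L HL]. have P := PI_RGT_0. have s3 := sqrt3_pos.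
  assert (D : Udir (- (1/3)) L).
  { apply (aF_dir (ang (- (2 * (PI/3)))) L); auto. intros y. destruct (aang_lift (- (2 * (PI/3))) y) as (n & Hn & E1 & E2).
    destruct trig3 as (t1 & t2 & _). rewrite t1, t2 in E1, E2. exists (n/(sqrt 3 * c1)).
    have p : 0 < sqrt 3 * c1. splits; [pos| |].
    - transitivity ((n * sin (ang (- (2 * (PI/3))) y))/(sqrt 3 * c1)); [rewrite <- E1; unfold av, au; field; lra|pos].
    - transitivity ((n * cos (ang (- (2 * (PI/3))) y))/(sqrt 3 * c1)); [rewrite <- E2; unfold av1, au1; field; lra|pos]. }
  destruct (dir_unique _ _ _ _ D (Udir_all c1 c2 Hc1 Hc2 Hrec th Hth Hth0 (- (1/3)) ok)) as [k Hk].
  have m1 := outcome_mono (- (2 * (PI/3))) (- (PI/2)) L (PI/4) ok HL rec_out.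
  have h := outcome_shift _ _ 1 rec_out. have m2 := outcome_mono (- (PI/2) - IZR 1 * PI) (- (2 * (PI/3))) (PI/4 + IZR 1 * PI) L ok h HL.
  replace L with (5 * (PI/12)) in HL; auto. simpl in m2.
  turn (L - (PI/4 - - (1/3) * (PI/2))) into (L - 5 * (PI/12)) in Hk.
  assert (L - 5 * (PI/12) = 0); [|lra]. rewrite Hk. apply kPI_small. obv.
Qed.

Lemma outcome_G : aout (ang (- (PI/3))) (PI/12).
Proof.
  destruct (aout_exists _ (ang_pr (- (PI/3)))) as [L HL]. have P := PI_RGT_0. have s3 := sqrt3_pos.
  assert (D : Udir (1/3) L).
  { apply (aG_dir (ang (- (PI/3))) L); auto. intros y. destruct (aang_lift (- (PI/3)) y) as (n & Hn & E1 & E2).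
    destruct trig3 as (_ & _ & t1 & t2). rewrite t1, t2 in E1, E2. exists (n/(sqrt 3 * c2)).
    splits; [pos| |].
    - transitivity ((n * sin (ang (- (PI/3)) y))/(sqrt 3 * c2)); [rewrite <- E1; unfold av, au; field; lra|pos].
    - transitivity ((n * cos (ang (- (PI/3)) y))/(sqrt 3 * c2)); [rewrite <- E2; unfold av1, au1; field; lra|pos]. }
  destruct (dir_unique _ _ _ _ D (Udir_all c1 c2 Hc1 Hc2 Hrec th Hth Hth0 (1/3) ok)) as [k Hk].
  have m1 := outcome_range (- (PI/3)) L ok HL.
  replace L with (PI/12) in HL; auto.
  turn (L - (PI/4 - 1/3 * (PI/2))) into (L - PI/12) in Hk.
  assert (L - PI/12 = 0); [|lra]. rewrite Hk. apply kPI_small. obv.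
Qed.

Lemma wkb_vector c y : 0 < y -> exists r, 0 < r /\
  r * sin (awkb (ang c) y) = av c1 c2 y * cos c - au c1 c2 y * sin c /\
  r * cos (awkb (ang c) y) = (av1 c1 c2 y * cos c - au1 c1 c2 y * sin c)/sqrt y
     + (av c1 c2 y * cos c - au c1 c2 y * sin c)/(4 * y * sqrt y).
Proof.
  intros Y. have Sy := sqrt_lt_R0 _ Y. have a0 : 0 < / sqrt y.
  destruct (aang_lift c y) as (n & Hn & W0 & W1).
  destruct (Sh_dir (/ sqrt y) (1/(4 * y * sqrt y)) (ang c y) a0) as [E1 E2]. rewrite <- awkb_at in E1, E2.
  have PN := sqrt_lt_R0 _ (Shn_pos (/ sqrt y) (1/(4 * y * sqrt y)) (ang c y) a0). set (m := sqrt (Shn _ _ _)) in *.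
  exists (n * m). splits.
  - nra.
  - rewrite W0, E1. ring.
  - rewrite W0, W1. rewrite Rmult_assoc, <- E2. unfold Shc. field. lra.
Qed.

(** At a fixed [y] one linear map sends the coefficients [(cos c, - sin c)] to the WKB vector of the
    solution. Its action is known up to [e] on the lines of [aF], [aG] and the recessive solution,
    so [three_directions] yields it on every line; [outcome_range] settles the multiple of [PI]. *)
Lemma outcome_inner c : - (PI/2) < c < PI/2 -> aout (ang c) (- (PI/4) - c).
Proof.
  intros Hc. destruct (aout_exists _ (ang_pr c)) as [L HL]. have R := outcome_range c L ok HL.
  have P := PI_RGT_0. have s3 := sqrt3_pos. have s33 := sqrt_sqrt 3 ok.
  set (D := L - (- (PI/4) - c)).
  assert (S : sin D = 0).
  { destruct (Req_dec (sin D) 0) as [h|h]; auto. exfalso. apply Rabs_pos_lt in h.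
    (* [three_directions] loses [8 e] and the passage from the angle at [y] to the outcome another
       [e]; [9 e] is still below [|sin D|]. *)
    set (e := Rmin (1/20) (Rabs (sin D)/20)). have He : 0 < e by (apply Rmin_pos; lra).
    have e1 := Rmin_l (1/20) (Rabs (sin D)/20). have e2 := Rmin_r (1/20) (Rabs (sin D)/20). fold e in e1, e2.
    set (xi := 1/e). have Hx : 0 < xi.
    have E5 : 5/36/xi <= e/4 by (turn (5/36/xi) into (5/36 * e); lra).
    set (y := yh xi). destruct (yh_spec xi Hx) as [Y _]. fold y in Y.
    destruct (wkb_vector (- (2 * (PI/3))) y Y) as (rf & F0 & F1 & F2).
    destruct (wkb_vector (- (PI/3)) y Y) as (rg & G0 & G1 & G2).
    destruct (wkb_vector (- (PI/2)) y Y) as (rr & R0 & R1 & R2).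
    destruct (wkb_vector c y Y) as (rc & C0 & C1 & C2).
    have of := aout_at_xi _ _ xi outcome_F Hx. have og := aout_at_xi _ _ xi outcome_G Hx.
    have or := aout_at_xi _ _ xi rec_out Hx. have oc := aout_at_xi _ _ xi HL Hx. fold y in of, og, or, oc.
    destruct trig3 as (t1 & t2 & t3 & t4). rewrite cos_neg, sin_neg, cos_PI2, sin_PI2 in R1, R2.
    rewrite t1, t2 in F1, F2. rewrite t3, t4 in G1, G2.
    set (ef := awkb (ang (- (2 * (PI/3)))) y) in *. set (eg := awkb (ang (- (PI/3))) y) in *.
    set (er := awkb (ang (- (PI/2))) y) in *. set (ec := awkb (ang c) y) in *.
    assert (lin : forall X Z, sin (- (PI/3) - c) * (X * - (1/2) - Z * - (sqrt 3/2)) + sin (c + 2 * (PI/3)) * (X * (1/2) - Z * - (sqrt 3/2))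
       = sqrt 3/2 * (X * cos c - Z * sin c)).
    { intros X Z. rewrite sin_minus, sin_plus, sin_neg, cos_neg, sin_PI3, cos_PI3, cos_2PI3, sin_2PI3. obv. }
    have G := three_directions rf rg rr rc ef eg er ec _ _ c e F0 G0 R0 C0 eq_refl eq_refl.
    assert (B : Rabs (sin (ec - (er - PI/2 - c))) <= 8 * e).
    { apply G; try lra.
      - rewrite F1, G1. transitivity (sqrt 3 * (rr * sin er)); [ring|]. rewrite R1. field.
      - rewrite F2, G2. transitivity (sqrt 3 * (rr * cos er)); [ring|]. rewrite R2. have sY := sqrt_lt_R0 _ Y. field. lra.
      - turn (sqrt 3/2 * rc * sin ec) into (sqrt 3/2 * (rc * sin ec)). rewrite C1, <- lin.
        rewrite !Rmult_assoc, F1, G1. reflexivity.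
      - turn (sqrt 3/2 * rc * cos ec) into (sqrt 3/2 * (rc * cos ec)). rewrite C2.
        rewrite !Rmult_assoc, F2, G2. have sY := sqrt_lt_R0 _ Y.
        transitivity ((sqrt 3/2 * (av1 c1 c2 y * cos c - au1 c1 c2 y * sin c)) * / sqrt y
          + (sqrt 3/2 * (av c1 c2 y * cos c - au c1 c2 y * sin c)) * / (4 * y * sqrt y)); [obv|].
        rewrite <- !lin. field. lra.
      - apply Rabs_le. lra.
      - obv. }
    have Lp := sin_lip D (ec - (er - PI/2 - c)).
    have : Rabs (D - (ec - (er - PI/2 - c))) <= e by (unfold D; apply Rabs_le; lra).
    have T := Rabs_triang3 (sin D) (sin (ec - (er - PI/2 - c))) 0. rewrite !Rminus_0_r in T. lra. }
  apply sin_eq_0_0 in S. destruct S as [k Hk]. replace (- (PI/4) - c) with L; auto.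
  assert (D = 0); [|unfold D in *; lra]. rewrite Hk. apply kPI_small. rewrite <- Hk. obv.
Qed.

Theorem aang_outcome c : aout (ang c) (- (PI/4) - c).
Proof.
  destruct (floor_exists (c + PI/2)) as [k Hk].
  set (c' := c - IZR k * PI). have B : - (PI/2) <= c' < PI/2.
  assert (H : aout (ang c') (- (PI/4) - c')).
  { destruct (Req_dec c' (- (PI/2))) as [e|e].
    - rewrite e. turn (- (PI/4) - - (PI/2)) into (PI/4). exact rec_out.
    - apply outcome_inner; lra. }
  have h := outcome_shift _ _ (- k) H. rewrite opp_IZR in h.
  turn (c' - - IZR k * PI) into c in h.
  turn (- (PI/4) - c' + - IZR k * PI) into (- (PI/4) - c) in h. exact h.
Qed.

(** The direction of [U nu] is known exactly for every order, hence the outcome modulo [PI]. For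
    large [nu] the Airy comparison puts it within 1 of [PI/4], so it is exactly [PI/4], with no
    error term in [nu]. *)
Theorem recessive_bessel : exists V Y, 0 < V /\ 1 <= Y /\ forall nu, V < nu -> 100 <= Nof nu /\ Y^2 <= Nof nu /\
  forall al, prufer (bq nu) al ->
  (forall t, U nu t = sqrt (U nu t^2 + U1 nu t^2) * sin (al t) /\ U1 nu t = sqrt (U nu t^2 + U1 nu t^2) * cos (al t)) ->
  0 <= al (wtime nu (Nof nu) (- Y)) <= PI/2 -> bout nu al (PI/4).
Proof.
  destruct (recessive_limit c1 c2 Hc1 Hc2 Hrec th Hth Hth0 (PI/4) 1 rec_out ok) as (V & Y & HV & HY & H).
  exists V, Y. splits; auto. intros nu Hnu. destruct (H nu Hnu) as (h1 & h2 & h3). splits; auto.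
  intros al Ha Hl Hq. destruct (bout_exists nu al ok Ha) as [L HL].
  have D := U_recessive_dir nu al L ok Hl HL.
  destruct (dir_unique _ _ _ _ D (Udir_all c1 c2 Hc1 Hc2 Hrec th Hth Hth0 nu ok)) as [k Hk].
  turn (L - nu * (PI/2) - (PI/4 - nu * (PI/2))) into (L - PI/4) in Hk.
  specialize (h3 al L Ha Hq HL). have P := PI2_3_2.
  replace (PI/4) with L; auto. assert (L - PI/4 = 0); [|lra]. rewrite Hk. apply kPI_small. obv.
Qed.
End Airy2.

(** * The reciprocal Gamma function *)

Definition gauss z n := prod_f_R0 (fun i : nat => z + INR i) n/(INR (fact n) * Rpower (INR n) z).

Definition inv_sq (i : nat) := / (INR i + 1)^2.

Lemma sum_n_S (a : nat -> R) n : sum_n a (S n) = sum_n a n + a (S n).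
Proof. exact (sum_Sn a n). Qed.

Lemma prod_f_S a n : prod_f_R0 a (S n) = prod_f_R0 a n * a (S n).
Proof. reflexivity. Qed.

Lemma ex_inv_sq : ex_series inv_sq.
Proof.
  assert (H : ex_finite_lim_seq (sum_n inv_sq)).
  { apply (ex_finite_lim_seq_incr _ 2).
    - intros n. rewrite sum_Sn. unfold plus; simpl. have h := pos_INR (S n).
      have : 0 < inv_sq (S n) by (apply Rinv_0_lt_compat, pow_lt; lra). lra.
    - intros n. assert (sum_n inv_sq n <= 2 - / (INR n + 1)).
      { induction n as [|n IH].
        - rewrite sum_O. unfold inv_sq. simpl INR. turn (/ (0 + 1)^2) into 1. turn (/ (0 + 1)) into 1. lra.
        - rewrite sum_Sn. change (sum_n inv_sq n + / (INR (S n) + 1)^2 <= 2 - / (INR (S n) + 1)). rewrite S_INR.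
          assert (/ (INR n + 1 + 1)^2 <= / (INR n + 1) - / (INR n + 1 + 1)); [|lra].
          have : 0 <= / ((INR n + 1) * (INR n + 1 + 1)^2).
          turn (/ (INR n + 1 + 1)^2) into (/ (INR n + 1) - / (INR n + 1 + 1) - / ((INR n + 1) * (INR n + 1 + 1)^2)). lra. }
      have : 0 < / (INR n + 1). lra. }
  obv.
Qed.

Lemma ln_sub_sq u : Rabs u <= 1/2 -> Rabs (ln (1 + u) - u) <= 2 * u^2.
Proof.
  intros H. apply Rabs_le_between in H. destruct (ln_bounds u ok). obv.
Qed.

(* [ln] of the Gauss product at [1 + e], as a series with terms [O(1/i^2)]. *)
Definition gs e (i : nat) := ln (1 + e/(INR i + 1)) - e/(INR i + 1).
Definition ge (i : nat) := / (INR i + 1) - ln (1 + / (INR i + 1)).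

Lemma inv_INR i : 0 < / (INR i + 1) <= 1 /\ inv_sq i = / (INR i + 1)^2.
Proof.
  have h := pos_INR i. split; auto. split; [pos|]. rewrite <- Rinv_1. obv.
Qed.

Lemma gs_bound e i : Rabs e <= 1/2 -> Rabs (gs e i) <= 2 * e^2 * inv_sq i.
Proof.
  intros He. destruct (inv_INR i) as [h E]. eapply Rle_trans; [apply ln_sub_sq|].
  - unfold Rdiv. rewrite Rabs_mult, (Rabs_pos_eq (/ _)) by lra. nra.
  - rewrite E. right. obv.
Qed.

Lemma ge_bound i : Rabs (ge i) <= 2 * inv_sq i.
Proof.
  destruct (inv_INR i) as [h E]. unfold ge. set (u := / (INR i + 1)) in *.
  destruct (ln_bounds u ok). have : inv_sq i = u^2 by (rewrite E; unfold u; field; have p := pos_INR i; lra).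
  obv.
Qed.

Lemma ex_dominated (a : nat -> R) C : (forall i, Rabs (a i) <= C * inv_sq i) -> ex_series a /\ Rabs (Series a) <= C * Series inv_sq.
Proof.
  intros H. have E : ex_series (fun i => C * inv_sq i) by (apply (ex_series_scal (K := R_AbsRing) (V := R_NormedModule) C inv_sq), ex_inv_sq).
  assert (Ea : ex_series (fun i => Rabs (a i))).
  { apply (ex_series_le (K := R_AbsRing) (V := R_CompleteNormedModule)) with (b := fun i => C * inv_sq i); auto. intros n. unfold norm; simpl. unfold abs; simpl.
    rewrite Rabs_Rabsolu. apply H. }
  split; [now apply ex_series_Rabs|].
  eapply Rle_trans; [now apply Series_Rabs|]. rewrite <- Series_scal_l. apply Series_le; auto.
  intros n; split; [pos|obv].
Qed.

Lemma gauss_ln e n : Rabs e <= 1/2 -> (0 < n)%nat -> gauss (1 + e) n =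
  exp (sum_n (gs e) n + e * sum_n ge n + e * ln ((INR n + 2)/INR n)) * ((INR n + 1)/INR n).
Proof.
  intros He Hn. apply Rabs_le_between in He.
  assert (P : forall m, prod_f_R0 (fun i : nat => 1 + e + INR i) m = INR (fact m) * (INR m + 1) * exp (sum_n (gs e) m + e * sum_n ge m + e * ln (INR m + 2))).
  { induction m as [|m IH].
    - rewrite !sum_O. simpl. unfold gs, ge. simpl.
      turn (0 + 1) into 1. turn (e/1) into e. rewrite Rinv_1. turn (0 + 2) into (1 + 1).
      turn (ln (1 + e) - e + e * (1 - ln (1 + 1)) + e * ln (1 + 1)) into (ln (1 + e)).
      rewrite exp_ln by lra. ring.
    - rewrite prod_f_S, IH, !sum_n_S, fact_simpl, mult_INR.
      change (gs e (S m)) with (ln (1 + e/(INR (S m) + 1)) - e/(INR (S m) + 1)). change (ge (S m)) with (/ (INR (S m) + 1) - ln (1 + / (INR (S m) + 1))). rewrite !S_INR. have h := pos_INR m.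
      assert (L : ln (1 + / (INR m + 1 + 1)) = ln (INR m + 1 + 2) - ln (INR m + 2)).
      { rewrite <- ln_div by lra. f_equal. field. lra. }
      set (a := ln (1 + e/(INR m + 1 + 1))).
      turn (sum_n (gs e) m + (a - e/(INR m + 1 + 1)) + e * (sum_n ge m + (/ (INR m + 1 + 1) - ln (1 + / (INR m + 1 + 1)))) + e * ln (INR m + 1 + 2))
        into ((sum_n (gs e) m + e * sum_n ge m + e * ln (INR m + 2)) + a).
      rewrite (exp_plus _ a). unfold a. rewrite exp_ln; [obv|].
      have : e/(INR m + 1 + 1) * (INR m + 1 + 1) = e. nra. }
  unfold gauss. rewrite P. have h : 0 < INR n. have F := INR_fact_lt_0 n.
  unfold Rpower. turn ((1 + e) * ln (INR n)) into (ln (INR n) + e * ln (INR n)).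
  rewrite (exp_plus (ln (INR n)) _), exp_ln by auto. rewrite ln_div by lra.
  replace (sum_n (gs e) n + e * sum_n ge n + e * (ln (INR n + 2) - ln (INR n))) with
    ((sum_n (gs e) n + e * sum_n ge n + e * ln (INR n + 2)) - e * ln (INR n)) by ring.
  unfold Rminus. rewrite (exp_plus (_ + _ + _)), exp_Ropp. obv.
Qed.

Lemma ratio_lim c : is_lim_seq (fun n => (INR n + c)/INR n) 1.
Proof.
  apply is_lim_seq_ext_loc with (fun n => 1 + c * / INR n).
  - exists 1%nat. intros n Hn. have : 0 < INR n. field. lra.
  - replace (Finite 1) with (Finite (1 + c * 0)) by (f_equal; ring).
    apply (is_lim_seq_plus _ _ 1 (c * 0)); [apply is_lim_seq_const| |obv].
    apply (is_lim_seq_scal_l (fun n => / INR n) c 0). apply (is_lim_seq_inv INR p_infty); [apply is_lim_seq_INR|discriminate].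
Qed.

(** Euler's constant. *)
Definition gamma1 := Series ge.

Lemma gauss_lim_near e : Rabs e <= 1/2 -> is_lim_seq (gauss (1 + e)) (exp (Series (gs e) + e * gamma1)).
Proof.
  intros He.
  apply is_lim_seq_ext_loc with (fun n => exp (sum_n (gs e) n + e * sum_n ge n + e * ln ((INR n + 2)/INR n)) * ((INR n + 1)/INR n)).
  { exists 1%nat. intros n Hn. symmetry; apply gauss_ln; auto. }
  replace (Finite (exp (Series (gs e) + e * gamma1))) with (Finite (exp (Series (gs e) + e * gamma1 + e * ln 1) * 1)) by (rewrite ln_1; do 2 f_equal; rewrite Rmult_1_r; f_equal; ring).
  apply is_lim_seq_mult'; [|apply ratio_lim].
  apply is_lim_seq_continuous; [apply derivable_continuous_pt, derivable_pt_exp|].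
  apply is_lim_seq_plus'; [apply is_lim_seq_plus'|].
  - apply Series_correct. apply (ex_dominated _ (2 * e^2)). intros; now apply gs_bound.
  - apply (is_lim_seq_scal_l _ e gamma1). apply Series_correct. apply (ex_dominated _ 2). apply ge_bound.
  - apply (is_lim_seq_scal_l _ e (ln 1)). apply is_lim_seq_continuous; [|apply ratio_lim].
    apply derivable_continuous_pt. exists (/ 1). apply derivable_pt_lim_ln; lra.
Qed.

Lemma gauss_step z n : (0 < n)%nat -> gauss z n = z * gauss (z + 1) n * (INR n/(INR n + (z + 1))) \/ INR n + (z + 1) = 0.
Proof.
  intros Hn. have h : 0 < INR n. destruct (Req_dec (INR n + (z + 1)) 0) as [e|e]; [pos|left].
  assert (P : forall m, prod_f_R0 (fun i : nat => z + INR i) m * (z + 1 + INR m) = z * prod_f_R0 (fun i : nat => z + 1 + INR i) m).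
  { induction m as [|m IH]; [simpl; ring|]. rewrite !prod_f_S, S_INR.
    transitivity (prod_f_R0 (fun i : nat => z + INR i) m * (z + 1 + INR m) * (z + 1 + (INR m + 1))); [ring|]. rewrite IH. ring. }
  specialize (P n). unfold gauss. rewrite Rpower_plus, Rpower_1 by auto. have F := INR_fact_lt_0 n.
  have R : Rpower (INR n) z <> 0.
  apply Rmult_eq_reg_r with (z + 1 + INR n); [|lra].
  replace (prod_f_R0 (fun i : nat => z + INR i) n/(INR (fact n) * Rpower (INR n) z) * (z + 1 + INR n)) with
    (prod_f_R0 (fun i : nat => z + INR i) n * (z + 1 + INR n)/(INR (fact n) * Rpower (INR n) z)) by pos.
  rewrite P. obv.
Qed.

Lemma ratio_lim' c : is_lim_seq (fun n => INR n/(INR n + c)) 1.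
Proof.
  have H := is_lim_seq_inv _ _ (ratio_lim c) ltac:(intros E; inversion E; lra). simpl in H. rewrite Rinv_1 in H.
  apply is_lim_seq_ext_loc with (2 := H). destruct (INR_unbounded (Rabs c + 1)) as [N HN].
  exists N. intros n Hn. have a := Rle_abs (- c). rewrite Rabs_Ropp in a. have b := Rabs_pos c. have d := le_INR _ _ Hn.
  field. lra.
Qed.

Lemma gauss_step_lim z (l : R) : is_lim_seq (gauss (z + 1)) l -> is_lim_seq (gauss z) (z * l).
Proof.
  intros H. apply is_lim_seq_ext_loc with (fun n => z * gauss (z + 1) n * (INR n/(INR n + (z + 1)))).
  - destruct (INR_unbounded (Rabs (z + 1) + 1)) as [N HN]. exists (S N). intros n Hn.
    destruct (gauss_step z n ok) as [E|E]; auto. exfalso.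
    have a := Rle_abs (- (z + 1)). rewrite Rabs_Ropp in a. have : INR N < INR n by (apply lt_INR; lia). lra.
  - replace (Finite (z * l)) with (Finite (z * l * 1)) by (f_equal; ring).
    apply is_lim_seq_mult'; [apply (is_lim_seq_scal_l _ z l H)|apply ratio_lim'].
Qed.

Lemma gauss_step_lim' z (l : R) : z <> 0 -> is_lim_seq (gauss z) l -> is_lim_seq (gauss (z + 1)) (l/z).
Proof.
  intros Hz H. apply is_lim_seq_ext_loc with (fun n => / z * gauss z n * ((INR n + (z + 1))/INR n)).
  - destruct (INR_unbounded (Rabs (z + 1) + 1)) as [N HN]. exists (S N). intros n Hn.
    have a := Rle_abs (- (z + 1)). rewrite Rabs_Ropp in a. have : INR N < INR n by (apply lt_INR; lia). have b := Rabs_pos (z + 1).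
    destruct (gauss_step z n ok) as [E|E]; [|lra]. rewrite E. field. lra.
  - replace (Finite (l/z)) with (Finite (/ z * l * 1)) by (f_equal; field; auto).
    apply is_lim_seq_mult'; [apply (is_lim_seq_scal_l _ (/ z) l H)|apply ratio_lim].
Qed.

(** The logarithmic series converges within [1/2] of 1. The recurrence carries the limit to all
    other points: upward it divides by numbers that are at least [1/2], downward it multiplies and
    may produce the zeros at the poles of Gamma. *)
Lemma gauss_lim z : is_lim_seq (gauss z) (rGamma z).
Proof.
  assert (G : exists l : R, is_lim_seq (gauss z) l).
  { have base : forall e, Rabs e <= 1/2 -> exists l : R, is_lim_seq (gauss (1 + e)) l by (intros e He; eexists; now apply gauss_lim_near).
    assert (up : forall n e, Rabs e <= 1/2 -> exists l : R, is_lim_seq (gauss (1 + e + INR n)) l).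
    { induction n as [|n IH]; intros e He.
      - simpl. rewrite Rplus_0_r. auto.
      - destruct (IH e He) as [l Hl]. rewrite S_INR, <- Rplus_assoc. eexists. apply gauss_step_lim'; [|exact Hl].
        obv. }
    assert (dn : forall n e, Rabs e <= 1/2 -> exists l : R, is_lim_seq (gauss (1 + e - INR n)) l).
    { induction n as [|n IH]; intros e He.
      - simpl. rewrite Rminus_0_r. auto.
      - destruct (IH e He) as [l Hl]. rewrite S_INR. eexists. apply gauss_step_lim.
        turn (1 + e - (INR n + 1) + 1) into (1 + e - INR n). exact Hl. }
    destruct (archimed (z - 1/2)) as [h1 h2]. set (k := Rdefinitions.up (z - 1/2)) in *.
    have K : z = 1 + (z - IZR k) + IZR (k - 1) by (rewrite minus_IZR; ring).
    have He : Rabs (z - IZR k) <= 1/2.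
    rewrite K. destruct (Z.le_gt_cases 0 (k - 1)) as [g|g].
    - rewrite <- (Z2Nat.id (k - 1)) by lia. rewrite <- INR_IZR_INZ. apply up; auto.
    - replace (IZR (k - 1)) with (- INR (Z.to_nat (1 - k))).
      + apply dn; auto.
      + rewrite INR_IZR_INZ, Z2Nat.id by lia. rewrite <- opp_IZR. f_equal. lia. }
  destruct G as [l Hl]. unfold rGamma. fold (gauss z).
  replace (real (Lim_seq (gauss z))) with l; auto. now rewrite (is_lim_seq_unique _ _ Hl).
Qed.

Lemma rGamma_rec z : rGamma z = z * rGamma (z + 1).
Proof.
  have H := gauss_step_lim z _ (gauss_lim (z + 1)). have H2 := gauss_lim z.
  apply is_lim_seq_unique in H. apply is_lim_seq_unique in H2. rewrite H in H2. now inversion H2.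
Qed.

Lemma rGamma_near e : Rabs e <= 1/2 -> rGamma (1 + e) = exp (Series (gs e) + e * gamma1).
Proof.
  intros He. have H := is_lim_seq_unique _ _ (gauss_lim_near e He).
  have H2 := is_lim_seq_unique _ _ (gauss_lim (1 + e)). rewrite H in H2. now inversion H2.
Qed.

Lemma rGamma_1 : rGamma 1 = 1.
Proof.
  have h := rGamma_near 0 ok. rewrite Rplus_0_r in h. rewrite h.
  replace (Series (gs 0)) with 0; [rewrite Rmult_0_l, Rplus_0_r; apply exp_0|].
  symmetry. transitivity (Series (fun n => 0 * gs 0 n)); [|rewrite Series_scal_l; ring]. apply Series_ext. intros n. unfold gs.
  turn (0/(INR n + 1)) into 0. rewrite Rplus_0_r, ln_1. ring.
Qed.

Lemma rGamma_pos z : 0 < z <= 3/2 -> 0 < rGamma z.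
Proof.
  intros Hz. destruct (Rle_dec (1/2) z).
  - turn z into (1 + (z - 1)). rewrite rGamma_near by pos. apply exp_pos.
  - rewrite rGamma_rec. turn (z + 1) into (1 + z). rewrite rGamma_near by pos.
    obv.
Qed.

Lemma rGamma_derive_1 : is_derive rGamma 1 gamma1.
Proof.
  set (S := Series inv_sq). assert (S0 : 0 <= S).
  { destruct (ex_dominated inv_sq 1) as [_ h]; [intros i; rewrite Rabs_pos_eq; [lra|]; left; destruct (inv_INR i) as [h E]; rewrite E; apply Rinv_0_lt_compat, pow_lt; have p := pos_INR i; lra|].
    obv. }
  apply is_derive_Reals. intros eps Heps.
  set (K := 2 * S + 2 * (2 * S + Rabs gamma1)^2).
  set (d := Rmin (1/2) (Rmin (1/2/(2 * S + Rabs gamma1 + 1)) (eps/(K + 1)))).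
  have i1 : 0 < 1/2/(2 * S + Rabs gamma1 + 1).
  have i2 : 0 < eps/(K + 1).
  have d0 : 0 < d by (repeat apply Rmin_pos; lra).
  exists (mkposreal d d0). intros e He0 He. simpl in He.
  have m1 : d <= 1/2 by apply Rmin_l.
  have m2 : d <= 1/2/(2 * S + Rabs gamma1 + 1) by (eapply Rle_trans; [apply Rmin_r|apply Rmin_l]).
  have m3 : d <= eps/(K + 1) by (eapply Rle_trans; [apply Rmin_r|apply Rmin_r]).
  rewrite rGamma_1, rGamma_near by lra. set (s := Series (gs e)).
  have B : Rabs s <= 2 * e^2 * S by (apply (ex_dominated _ (2 * e^2)); intros; apply gs_bound; lra).
  have ep := Rabs_pos e. have e2 : e^2 = Rabs e^2 by (rewrite <- !Rsqr_pow2; apply Rsqr_abs).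
  have e3 : e^2 <= Rabs e.
  set (w := s + e * gamma1).
  assert (Bw : Rabs w <= Rabs e * (2 * S + Rabs gamma1)).
  { eapply Rle_trans; [apply Rabs_triang|]. rewrite Rabs_mult. nra. }
  assert (w12 : Rabs w <= 1/2).
  { eapply Rle_trans; [exact Bw|]. have : 1/2/(2 * S + Rabs gamma1 + 1) * (2 * S + Rabs gamma1 + 1) = 1/2. nra. }
  destruct (exp_le_quadratic w w12) as [x1 x2].
  assert (w2 : w^2 <= e^2 * (2 * S + Rabs gamma1)^2).
  { rewrite e2. rewrite <- Rpow_mult_distr. replace (w^2) with (Rabs w^2) by (rewrite <- !Rsqr_pow2; symmetry; apply Rsqr_abs).
    obv. }
  assert (Z : Rabs (exp w - 1 - e * gamma1) <= K * e^2).
  { apply Rabs_le_between in B. unfold K. apply Rabs_le. unfold w in *. nra. }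
  turn ((exp w - 1)/e - gamma1) into ((exp w - 1 - e * gamma1)/e).
  unfold Rdiv. rewrite Rabs_mult, Rabs_inv. have ap := Rabs_pos_lt e He0.
  apply Rle_lt_trans with (K * Rabs e).
  - apply Rmult_le_reg_r with (Rabs e); auto. rewrite Rmult_assoc, Rinv_l by lra. rewrite e2 in Z. nra.
  - have : eps/(K + 1) * (K + 1) = eps. nra.
Qed.

Lemma rGamma_derive_up z l : z <> 0 -> is_derive rGamma z l -> ex_derive rGamma (z + 1).
Proof.
  intros Hz H. assert (D : ex_derive (fun w => rGamma (w - 1)/(w - 1)) (z + 1)).
  { auto_derive. split; [|lra]. exists l. turn (z + 1 + - (1)) into z. exact H. }
  destruct D as [l' D].
  eexists. apply is_derive_ext_loc with (2 := D).
  apply (locally_interval _ (z + 1) (z + 1 - Rabs z) (z + 1 + Rabs z)); simpl; try (have h := Rabs_pos_lt z Hz; lra).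
  intros w h1 h2. assert (w - 1 <> 0).
  { intro e. destruct (Rle_dec 0 z); [rewrite Rabs_pos_eq in * by lra|rewrite Rabs_left in * by lra]; lra. }
  rewrite (rGamma_rec (w - 1)). turn (w - 1 + 1) into w. obv.
Qed.

(** The derivative at 1 spreads to all integers by the recurrence. Integers are the points where the
    limit that defines [Y_n] differentiates in the order. *)
Lemma rGamma_derive_int (k : Z) : ex_derive rGamma (IZR k).
Proof.
  assert (up : forall n, ex_derive rGamma (1 + INR n)).
  { induction n as [|n [l IH]].
    - simpl. rewrite Rplus_0_r. eexists; apply rGamma_derive_1.
    - rewrite S_INR, <- Rplus_assoc. apply (rGamma_derive_up _ l); auto. obv. }
  assert (dn : forall n, ex_derive rGamma (1 - INR n)).
  { induction n as [|n [l IH]].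
    - simpl. rewrite Rminus_0_r. eexists; apply rGamma_derive_1.
    - rewrite S_INR. set (z := 1 - (INR n + 1)). turn (1 - INR n) into (z + 1) in IH.
      eexists. eapply is_derive_ext; [intros w; symmetry; apply rGamma_rec|].
      apply (is_derive_mult (fun w => w) (fun w => rGamma (w + 1)) z 1 (1 * l)).
      + apply (is_derive_id z).
      + apply (is_derive_comp rGamma (fun w => w + 1)); auto. derive_tac. Rring.
      + intros; apply Rmult_comm. }
  destruct (Z.le_gt_cases 1 k) as [g|g].
  - replace (IZR k) with (1 + INR (Z.to_nat (k - 1))); auto. rewrite INR_IZR_INZ, Z2Nat.id, minus_IZR by lia. ring.
  - replace (IZR k) with (1 - INR (Z.to_nat (1 - k))); auto. rewrite INR_IZR_INZ, Z2Nat.id, minus_IZR by lia. ring.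
Qed.

(** * The recessive Airy solution *)

Lemma is_series_shift (b : nat -> R) (l : R) : b 0%nat = 0 -> is_series (fun k => b (S k)) l -> is_series b l.
Proof.
  intros H0 H. apply is_series_decr_1. rewrite H0. change (is_series (fun k => b (S k)) (l + - 0)).
  now rewrite Ropp_0, Rplus_0_r.
Qed.

Lemma series_partial_le (b : nat -> R) (l : R) n : (forall k, 0 <= b k) -> is_series b l -> sum_n b n <= l.
Proof.
  intros Hb H. apply (is_lim_seq_incr_compare (sum_n b) l H). intros m. rewrite sum_n_S. have h := Hb (S m). lra.
Qed.

Lemma series_nonneg (b : nat -> R) (l : R) : (forall k, 0 <= b k) -> is_series b l -> 0 <= l.
Proof.
  intros Hb H. have h := series_partial_le b l 0 Hb H. rewrite sum_O in h. have h0 := Hb 0%nat. lra.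
Qed.

(* The weights [X^k / (k! (nu+1)_k)] and their moments. *)
Definition wt nu X k := uc nu k * (- X)^k.
Definition wS nu X := PSeries (uc nu) (- X).
Definition wS1 nu X := - PSeries (PS_derive (uc nu)) (- X).

Lemma wt_S nu X k : -1 < nu -> (INR k + 1) * (INR k + 1 + nu) * wt nu X (S k) = X * wt nu X k.
Proof.
  intros Hn. unfold wt. transitivity ((INR k + 1) * (INR k + 1 + nu) * uc nu (S k) * (- X)^S k); [ring|].
  rewrite uc_rec by auto. simpl. ring.
Qed.

Lemma wt_pos nu X k : -1 < nu -> 0 < X -> 0 < wt nu X k.
Proof.
  intros Hn HX. induction k as [|k IH]; [unfold wt; simpl; lra|].
  have h := pos_INR k. have E := wt_S nu X k Hn.
  apply Rmult_lt_reg_l with ((INR k + 1) * (INR k + 1 + nu)); [nra|]. obv.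
Qed.

(** The recurrence of the weights makes the moment of [k (k + nu)] equal to [X] times the mass.
    Quadratic functions of [k], written in the basis 1, [k], [k (k + nu)], therefore have closed
    sums in terms of the mass and the mean. *)
Lemma wt_moments nu X al be ga : -1 < nu ->
  is_series (fun k => (al + be * INR k + ga * (INR k * (INR k + nu))) * wt nu X k)
    (al * wS nu X + be * (X * wS1 nu X) + ga * (X * wS nu X)).
Proof.
  intros Hn. have E := uc_entire nu Hn.
  assert (I0 : is_series (wt nu X) (wS nu X)).
  { have h := PSeries_correct _ _ (entire_ex _ (- X) E).
    apply (is_pseries_R (uc nu) (- X) (wS nu X)) in h. exact h. }
  assert (I1 : is_series (fun k => INR k * wt nu X k) (X * wS1 nu X)).
  { apply is_series_shift; [simpl; ring|].
    have h := PSeries_correct _ _ (entire_ex _ (- X) (entire_derive _ E)). apply is_pseries_R in h.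
    apply (is_series_scal (K := R_AbsRing) (V := R_NormedModule) (- X)) in h.
    replace (X * wS1 nu X) with (scal (- X) (PSeries (PS_derive (uc nu)) (- X))) by (unfold wS1, scal; simpl; unfold mult; simpl; ring).
    eapply is_series_ext; [|exact h]. intros k.
    change (- X * (INR (S k) * uc nu (S k) * (- X)^k) = INR (S k) * (uc nu (S k) * (- X * (- X)^k))). ring. }
  assert (I2 : is_series (fun k => INR k * (INR k + nu) * wt nu X k) (X * wS nu X)).
  { apply is_series_shift; [simpl; ring|].
    apply (is_series_scal (K := R_AbsRing) (V := R_NormedModule) X) in I0.
    eapply is_series_ext; [|exact I0]. intros k.
    change (X * wt nu X k = INR (S k) * (INR (S k) + nu) * wt nu X (S k)). rewrite <- wt_S by auto. now rewrite S_INR. }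
  apply (is_series_scal (K := R_AbsRing) (V := R_NormedModule) al) in I0.
  apply (is_series_scal (K := R_AbsRing) (V := R_NormedModule) be) in I1.
  apply (is_series_scal (K := R_AbsRing) (V := R_NormedModule) ga) in I2.
  have h := is_series_plus _ _ _ _ (is_series_plus _ _ _ _ I0 I1) I2.
  eapply is_series_ext; [|exact h]. intros k. unfold plus, scal; simpl; unfold mult; simpl. Rring.
Qed.

Lemma wS_pos nu X : -1 < nu -> 0 < X -> 0 < wS nu X.
Proof.
  intros Hn HX. have h := wt_moments nu X 1 0 0 Hn.
  apply (series_partial_le _ _ 0) in h.
  - rewrite sum_O in h. unfold wt in h. simpl in h. lra.
  - intros k. have a := wt_pos nu X k Hn HX. nra.
Qed.

Lemma wS1_pos nu X : -1 < nu -> 0 < X -> 0 < wS1 nu X.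
Proof.
  intros Hn HX. have h := wt_moments nu X 0 1 0 Hn.
  apply (series_partial_le _ _ 1) in h.
  - rewrite sum_n_S, sum_O in h. have a := wt_pos nu X 1 Hn HX. simpl in h. nra.
  - intros k. have a := wt_pos nu X k Hn HX. obv.
Qed.

Definition wm nu X := X * wS1 nu X/wS nu X.

(** [wm] is the mean of [k] under the weights, and this is the nonnegativity of the variance. *)
Lemma wm_le nu X : -1 < nu -> 0 < X -> wm nu X^2 + nu * wm nu X <= X.
Proof.
  intros Hn HX. have p := wS_pos nu X Hn HX. set (m := wm nu X).
  have E : X * wS1 nu X = m * wS nu X by (unfold m, wm; field; lra).
  have h := wt_moments nu X (m^2) (- (2 * m + nu)) 1 Hn. apply series_nonneg in h.
  - rewrite E in h. nra.
  - intros k. have a := wt_pos nu X k Hn HX.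
    turn (m^2 + - (2 * m + nu) * INR k + 1 * (INR k * (INR k + nu))) into ((INR k - m)^2).
    obv.
Qed.

Lemma wm_derive nu X : -1 < nu -> 0 < X -> is_derive (wm nu) X ((X - nu * wm nu X - wm nu X^2)/X).
Proof.
  intros Hn HX. have p := wS_pos nu X Hn HX. have E := uc_entire nu Hn.
  have D0 := entire_is_derive (uc nu) (- X) E. have D1 := entire_is_derive _ (- X) (entire_derive _ E).
  have O := uc_ode nu (- X) Hn. unfold wm, wS1, wS in *.
  set (P := PSeries (uc nu)) in *. set (P1 := PSeries (PS_derive (uc nu))) in *. set (P2 := PSeries (PS_derive (PS_derive (uc nu))) (- X)) in *.
  derive_tac; try lra.
  match goal with |- ?a = ?b => change (@eq R a b) end.
  transitivity (((- P1 (- X) + X * P2) * P (- X) - X * P1 (- X)^2)/P (- X)^2); [obv|].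
  turn (X * P2) into ((nu + 1) * P1 (- X) + P (- X)). field. lra.
Qed.

(** The mean satisfies a Riccati equation in [X], for which [M - 1/2] is a lower barrier along
    [X = M^2]. At [M = 1/2] the bound is only positivity. *)
Lemma wm_ge M : 1 <= M -> M - 1/2 <= wm (1/3) (M^2).
Proof.
  intros HM. assert (0 <= wm (1/3) (M^2) - (M - 1/2)); [|lra].
  apply (nonneg_barrier (fun M => wm (1/3) (M^2) - (M - 1/2)) (1/2) M); [lra| |].
  - have h := wS_pos (1/3) ((1/2)^2) ok ok. have h1 := wS1_pos (1/3) ((1/2)^2) ok ok.
    have : 0 < wm (1/3) ((1/2)^2) by (unfold wm; apply Rdiv_lt_0_compat; [nra|lra]). lra.
  - intros t Ht. have Pt : 0 < t^2.
    have D := wm_derive (1/3) (t^2) ok Pt. set (m := wm (1/3)) in *.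
    exists (2 * t * ((t^2 - 1/3 * m (t^2) - m (t^2)^2)/t^2) - 1). split.
    + apply (is_derive_minus (fun M => m (M^2)) (fun M => M - 1/2)); [|derive_tac; Rring].
      eapply is_derive_eq; [apply (is_derive_comp m (fun M => M^2)); [exact D|]|].
      * instantiate (1 := 2 * t). derive_tac. Rring.
      * reflexivity.
    + intros Hm. assert (0 < m (t^2)).
      { have h := wS_pos (1/3) (t^2) ok Pt. have h1 := wS1_pos (1/3) (t^2) ok Pt.
        apply Rdiv_lt_0_compat; [nra|lra]. }
      set (w := m (t^2)) in *.
      turn (2 * t * ((t^2 - 1/3 * w - w^2)/t^2) - 1) into ((2 * (t^2 - 1/3 * w - w^2) - t)/t).
      apply Rdiv_le_0_compat; [nra|lra].
Qed.

(* [(2/3)_k / (4/3)_k], the ratio of the weights for [1/3] and [-1/3]. *)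
Definition hk k := uc (1/3) k/uc (- (1/3)) k.

Lemma uc_neq nu k : -1 < nu -> uc nu k <> 0.
Proof. intros Hn e. have h := wt_pos nu 1 k Hn ok. unfold wt in h. obv. Qed.

Lemma hk_S k : hk (S k) = hk k * ((INR k + 2/3)/(INR k + 4/3)).
Proof.
  have h := pos_INR k. unfold hk. simpl uc. have a := uc_neq (- (1/3)) k ok. obv.
Qed.

Lemma hk_pos k : 0 < hk k.
Proof.
  induction k as [|k IH]; [unfold hk; simpl; lra|]. rewrite hk_S. obv.
Qed.

(** [Gamma(4/3)/Gamma(2/3)], the limit of [hk k * k^(2/3)]. The lemmas use cubes in order to avoid
    the fractional power. *)
Definition hL := rGamma (2/3)/rGamma (4/3).

Lemma hL_pos : 0 < hL.
Proof. apply Rdiv_lt_0_compat; apply rGamma_pos; lra. Qed.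

Lemma hk_gauss n : (0 < n)%nat -> hk (S n)^3 * INR n^2 = (gauss (2/3) n/gauss (4/3) n)^3.
Proof.
  intros Hn. have h : 0 < INR n. have F := INR_fact_lt_0 n.
  assert (Q : forall m, 0 < prod_f_R0 (fun i => 4/3 + INR i) m).
  { induction m as [|m IH]; [simpl; lra|]. rewrite prod_f_S. obv. }
  assert (P : forall m, hk (S m) = prod_f_R0 (fun i => 2/3 + INR i) m/prod_f_R0 (fun i => 4/3 + INR i) m).
  { induction m as [|m IH].
    - rewrite hk_S. unfold hk. simpl. field.
    - rewrite hk_S, IH, !prod_f_S. have q := Q m. obv. }
  rewrite P. have q := Q n. unfold gauss. set (R1 := Rpower (INR n) (2/3)). set (R2 := Rpower (INR n) (4/3)).
  have r1 : 0 < R1.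
  have r2 : R2 = R1 * R1 by (unfold R1, R2; rewrite <- Rpower_plus; f_equal; field).
  assert (r3 : R1^3 = INR n^2).
  { rewrite <- !Rpower_pow by pos. unfold R1. rewrite Rpower_mult. f_equal. simpl; field. }
  rewrite <- r3, r2. obv.
Qed.

Lemma hk_lim c : is_lim_seq (fun n => hk (S n)^3 * (INR n + c)^2) (hL^3).
Proof.
  apply is_lim_seq_ext_loc with (fun n => (gauss (2/3) n/gauss (4/3) n)^3 * ((INR n + c)/INR n)^2).
  { exists 1%nat. intros n Hn. rewrite <- hk_gauss by lia. obv. }
  replace (Finite (hL^3)) with (Finite (hL^3 * 1^2)) by (f_equal; ring).
  have g : rGamma (4/3) <> 0 by (apply Rgt_not_eq, rGamma_pos; lra).
  assert (A : is_lim_seq (fun n => gauss (2/3) n/gauss (4/3) n) hL).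
  { apply is_lim_seq_div'; auto using gauss_lim. }
  have B := ratio_lim c.
  assert (Pw : forall (u : nat -> R) (l : R) m, is_lim_seq u l -> is_lim_seq (fun n => u n^m) (l^m)).
  { intros u l m H. induction m as [|m IH]; simpl; [apply is_lim_seq_const|now apply is_lim_seq_mult']. }
  apply is_lim_seq_mult'; now apply Pw.
Qed.

(** With the shift [1/3] the sequence increases to its limit, with the shift 1 in [hk_lower] it
    decreases; both are then bounds at every [k], which is what allows summation against the
    weights. *)
Lemma hk_upper k : hk k^3 * (INR k + 1/3)^2 <= hL^3.
Proof.
  apply (is_lim_seq_incr_compare (fun k => hk k^3 * (INR k + 1/3)^2)).
  - apply is_lim_seq_incr_1. eapply is_lim_seq_ext; [|apply (hk_lim (4/3))]. intros n. cbv beta. rewrite S_INR. do 2 f_equal. field.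
  - intros n. rewrite hk_S, S_INR. have h := pos_INR n. have p := hk_pos n.
    turn ((hk n * ((INR n + 2/3)/(INR n + 4/3)))^3 * (INR n + 1 + 1/3)^2) into (hk n^3 * ((INR n + 2/3)^3/(INR n + 4/3))).
    apply Rmult_le_compat_l; [pos|]. apply Rmult_le_reg_r with (INR n + 4/3); [lra|].
    turn ((INR n + 2/3)^3/(INR n + 4/3) * (INR n + 4/3)) into ((INR n + 2/3)^3). nra.
Qed.

Lemma hk_lower k : hL^3 <= hk k^3 * (INR k + 1)^2.
Proof.
  apply (is_lim_seq_decr_compare (fun k => hk k^3 * (INR k + 1)^2)).
  - apply is_lim_seq_incr_1. eapply is_lim_seq_ext; [|apply (hk_lim 2)]. intros n. cbv beta. rewrite S_INR. do 2 f_equal. field.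
  - intros n. rewrite hk_S, S_INR. set (x := INR n). have h := pos_INR n. fold x in h. have p := hk_pos n.
    turn ((hk n * ((x + 2/3)/(x + 4/3)))^3 * (x + 1 + 1)^2) into (hk n^3 * ((x + 2/3)^3 * (x + 2)^2/(x + 4/3)^3)).
    apply Rmult_le_compat_l; [pos|]. apply Rmult_le_reg_r with ((x + 4/3)^3); [pos|].
    turn ((x + 2/3)^3 * (x + 2)^2/(x + 4/3)^3 * (x + 4/3)^3) into ((x + 2/3)^3 * (x + 2)^2).
    obv.
Qed.

(* Both are tangent line (parabola) inequalities at [s = 1]. *)
Lemma hk_tangent_lower k q : 0 < q -> let s := (INR k + 1)/q^3 in hL/q^2 * ((5 - 2 * s)/3) <= hk k.
Proof.
  intros Hq s. have L := hL_pos. have P := hk_pos k.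
  have Hs : 0 < s. set (l := hL/q^2). have Hl : 0 < l.
  destruct (Rle_dec (5 - 2 * s) 0) as [h|h]; [nra|].
  apply Rnot_lt_le; intro c. apply cube_lt in c; [|lra].
  have H := hk_lower k. turn ((INR k + 1)^2) into (s^2 * q^6) in H.
  turn (hL^3) into (l^3 * q^6) in H.
  have Q6 : 0 < q^6.
  have H' : l^3 <= hk k^3 * s^2.
  have s2 : 0 < s^2. have l3 : 0 < l^3.
  assert (T : s^2 * (5 - 2 * s)^3 <= 27).
  { assert (0 <= 8 * s^3 - 44 * s^2 + 54 * s + 27).
    { turn (8 * s^3 - 44 * s^2 + 54 * s + 27) into ((5 - 2 * s) * (s * (12 - 4 * s) + 3) + 12).
      obv. }
    have : 0 <= (s - 1)^2. nra. }
  obv.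
Qed.

Lemma hk_tangent_upper k q : 0 < q -> let s := (INR k + 1/3)/q^3 in hL/q^2 * ((4 * s - s^2)/3) * / hL^2 * q^4 * hk k <= 1.
Proof.
  intros Hq s. have L := hL_pos. have P := hk_pos k.
  have Hs : 0 < s. set (l := hL/q^2).
  turn (l * ((4 * s - s^2)/3) * / hL^2 * q^4 * hk k) into ((4 * s - s^2)/3 * (hk k/l)).
  have Hr : 0 < hk k/l.
  destruct (Rle_dec (4 - s) 0) as [h|h]; [have : 4 * s - s^2 <= 0; nra|].
  apply Rnot_lt_le; intro c. apply cube_lt in c; [|lra].
  have H := hk_upper k. turn ((INR k + 1/3)^2) into (s^2 * q^6) in H.
  turn (hL^3) into (l^3 * q^6) in H.
  have Q6 : 0 < q^6. have l3 : 0 < l^3.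
  have H' : hk k^3 * s^2 <= l^3.
  set (r := hk k/l) in *. have E : hk k = r * l. rewrite E in H'.
  have H2 : r^3 * s^2 <= 1.
  assert (T : s * (4 - s)^3 <= 27).
  { have : 0 <= (s - 1)^2. nra. }
  turn (((4 * s - s^2)/3 * r)^3) into (r^3 * s^2 * (s * (4 - s)^3)/27) in c.
  have : 0 <= r^3 * s^2. nra.
Qed.

(** At [y = - c9 q^2] the argument [y^3/9] of the Airy series is [- q^6], so the weights concentrate
    around [k = q^3]. *)
Definition c9 := Rpower 9 (1/3).

Lemma c9_spec : 0 < c9 /\ c9^3 = 9.
Proof.
  split; [apply exp_pos|]. unfold c9. rewrite <- Rpower_pow by pos. rewrite Rpower_mult.
  replace (1/3 * INR 3) with 1 by (simpl; field). apply Rpower_1; lra.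
Qed.

Lemma airy_minus q : 0 < q -> aF (- (c9 * q^2)) = wS (- (1/3)) (q^6) /\ aG (- (c9 * q^2)) = - (c9 * q^2) * wS (1/3) (q^6).
Proof.
  intros Hq. destruct c9_spec as [_ E]. unfold aF, aG, wS.
  replace ((- (c9 * q^2))^3/9) with (- q^6); [auto|].
  obv.
Qed.

(** The tangent bound for [hk] is summed against the weights of order [- 1/3]. It is sharp at [k]
    near [M = q^3], where the mean lies up to a constant, so only a relative error [1/M] is lost.
    [wS_ratio_upper] does the same with weights of order [1/3]. *)
Lemma wS_ratio_lower q : 1 <= q -> hL/q^2 * (1 - / q^3) * wS (- (1/3)) (q^6) <= wS (1/3) (q^6).
Proof.
  intros Hq. set (M := q^3). have HM : 1 <= M.
  turn (q^6) into (M^2). have PX : 0 < M^2.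
  set (l := hL/q^2). have Hl : 0 < l by (apply Rdiv_lt_0_compat; [apply hL_pos|pos]).
  have A := wt_moments (- (1/3)) (M^2) (- (l * (5 - 2/M)/3)) (l * (2/M/3)) 0 ok.
  have B := wt_moments (1/3) (M^2) 1 0 0 ok.
  have S := is_series_plus _ _ _ _ A B. clear A B. apply series_nonneg in S.
  - have p := wS_pos (- (1/3)) (M^2) ok PX. have m := wm_le (- (1/3)) (M^2) ok PX.
    have E : M^2 * wS1 (- (1/3)) (M^2) = wm (- (1/3)) (M^2) * wS (- (1/3)) (M^2) by (unfold wm; field; lra).
    set (w := wm (- (1/3)) (M^2)) in *. set (s0 := wS (- (1/3)) (M^2)) in *. set (s1 := wS (1/3) (M^2)) in *. rewrite E in S.
    change (0 <= - (l * (5 - 2/M)/3) * s0 + l * (2/M/3) * (w * s0) + 0 * (M^2 * s0) + (1 * s1 + 0 * (M^2 * wS1 (1/3) (M^2)) + 0 * (M^2 * s1))) in S.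
    have : w <= M + 1/3.
    have iM : / M * M = 1.
    assert (l * s0 * ((1 - / M) - ((5 - 2/M)/3 - 2/M/3 * w)) <= 0).
    { apply Rmult_le_0_l; [nra|]. nra. }
    nra.
  - intros k. have T := hk_tangent_lower k q ok. fold M l in T. cbv zeta in T.
    assert (W : wt (1/3) (M^2) k = hk k * wt (- (1/3)) (M^2) k).
    { unfold wt, hk. field. apply uc_neq; lra. }
    change (0 <= (- (l * (5 - 2/M)/3) + l * (2/M/3) * INR k + 0 * (INR k * (INR k + - (1/3)))) * wt (- (1/3)) (M^2) k +
       (1 + 0 * INR k + 0 * (INR k * (INR k + 1/3))) * wt (1/3) (M^2) k).
    rewrite W. have pw := wt_pos (- (1/3)) (M^2) k ok PX. obv.
Qed.

Lemma wS_ratio_upper q : 1 <= q -> (1 - / q^3) * wS (1/3) (q^6) <= hL/q^2 * wS (- (1/3)) (q^6).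
Proof.
  intros Hq. set (M := q^3). have HM : 1 <= M.
  turn (q^6) into (M^2). have PX : 0 < M^2.
  set (l := hL/q^2). have q2 : 0 < q^2. have Hl : 0 < l by (apply Rdiv_lt_0_compat; [apply hL_pos|auto]).
  have A := wt_moments (- (1/3)) (M^2) l 0 0 ok.
  (* (4 s - s^2)/3 with s = (k+1/3)/M, expanded in 1, k, k(k+1/3) *)
  have B := wt_moments (1/3) (M^2) (- ((4/3 * / M - / 9 * / M^2)/3)) (- ((4 * / M - / 3 * / M^2)/3)) (/ M^2/3) ok.
  have S := is_series_plus _ _ _ _ A B. clear A B. apply series_nonneg in S.
  - have p := wS_pos (1/3) (M^2) ok PX. have m := wm_ge M HM.
    have E : M^2 * wS1 (1/3) (M^2) = wm (1/3) (M^2) * wS (1/3) (M^2) by (unfold wm; field; lra).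
    set (w := wm (1/3) (M^2)) in *. set (s0 := wS (- (1/3)) (M^2)) in *. set (s1 := wS (1/3) (M^2)) in *. rewrite E in S.
    change (0 <= l * s0 + 0 * (M^2 * wS1 (- (1/3)) (M^2)) + 0 * (M^2 * s0) +
      (- ((4/3 * / M - / 9 * / M^2)/3) * s1 + - ((4 * / M - / 3 * / M^2)/3) * (w * s1) + / M^2/3 * (M^2 * s1))) in S.
    set (i := / M) in *. have iM : i * M = 1.
    turn (/ M^2) into (i^2) in S.
    turn (i^2/3 * (M^2 * s1)) into (s1/3) in S.
    have iw : 1 - i/2 <= i * w.
    assert (0 <= s1 * ((4/3 * i - / 9 * i^2)/3 + (4 - / 3 * i)/3 * (i * w) - 1/3 - (1 - i))).
    { apply Rmult_le_pos; [lra|]. nra. }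
    nra.
  - intros k. have T := hk_tangent_upper k q ok. fold M l in T. cbv zeta in T.
    assert (W : wt (1/3) (M^2) k = hk k * wt (- (1/3)) (M^2) k).
    { unfold wt, hk. field. apply uc_neq; lra. }
    have pw := wt_pos (- (1/3)) (M^2) k ok PX. set (w := wt (- (1/3)) (M^2) k) in *.
    set (s := (INR k + 1/3)/M) in *.
    replace (l * ((4 * s - s^2)/3) * / hL^2 * q^4 * hk k) with ((4 * s - s^2)/3 * hk k/l) in T by (unfold l; have h := hL_pos; field; lra).
    have T2 : (4 * s - s^2)/3 * hk k <= l by (apply Rmult_le_reg_r with (/ l); [pos|]; rewrite Rinv_r by lra; exact T).
    change (0 <= (l + 0 * INR k + 0 * (INR k * (INR k + - (1/3)))) * w +
       (- ((4/3 * / M - / 9 * / M^2)/3) + - ((4 * / M - / 3 * / M^2)/3) * INR k + / M^2/3 * (INR k * (INR k + 1/3))) * wt (1/3) (M^2) k).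
    rewrite W.
    match goal with |- 0 <= ?x => turn x into ((l - (4 * s - s^2)/3 * hk k) * w) end.
    obv.
Qed.

(** On the left axis [P = aF/(- aG)] increases and [Q = - aF1/aG1] decreases in [t], with [Q <= P],
    while [P] comes arbitrarily close to [1/(c9 hL) = c2/c1] far to the left. Hence [Q <= c2/c1 < P]
    everywhere, which are the two claims divided by [c1]. *)
Lemma airy_rec_pos c1 c2 : 0 < c1 -> c2 * c9 * hL = c1 -> forall y, y <= 0 -> 0 < au c1 c2 y /\ 0 <= au1 c1 c2 y.
Proof.
  intros H1 HE y Hy. have C := proj1 c9_spec. have L := hL_pos. have H2 : 0 < c2 by (apply Rmult_lt_reg_r with (c9 * hL); [nra|pos]).
  destruct Hy as [Hy|Hy]; [|subst y; destruct airy_init as (a & b & c & d); unfold au, au1; rewrite a, b, c, d; lra].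
  assert (sg : forall t, t < 0 -> 0 < aF t /\ aG t < 0 /\ aF1 t < 0 /\ 0 < aG1 t).
  { intros t Ht. have HX : 0 < - (t^3/9) by (turn (- (t^3/9)) into ((- t)^3/9); apply Rdiv_lt_0_compat; [apply pow_lt|]; lra). set (X := - (t^3/9)) in *.
    turn (t^3/9) into (- X) in *.
    have a := wS_pos (- (1/3)) X ok HX. have b := wS_pos (1/3) X ok HX.
    have c := wS1_pos (- (1/3)) X ok HX. have d := wS1_pos (1/3) X ok HX. unfold wS, wS1 in *.
    unfold aF, aG, aF1, aG1. turn (t^3/9) into (- X). turn (t^3/3) into (- (3 * X)).
    have : t^2 > 0. splits; nra. }
  set (P t := aF t / - aG t). set (Q t := - aF1 t/aG1 t).
  assert (DP : forall t, t < 0 -> is_derive P t (/ aG t^2)).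
  { intros t Ht. destruct (sg t Ht) as (s1 & s2 & s3 & s4). destruct (aF_sol t) as [d1 _], (aG_sol t) as [d2 _].
    have w := airy_wronskian t. unfold P. derive_tac; try lra. match goal with |- ?a = ?b => change (@eq R a b) end.
    transitivity ((aF t * aG1 t - aF1 t * aG t)/aG t^2); [obv|]. rewrite w. field; lra. }
  assert (DQ : forall t, t < 0 -> exists l, is_derive Q t l /\ l <= 0).
  { intros t Ht. destruct (sg t Ht) as (s1 & s2 & s3 & s4). destruct (aF_sol t) as [_ d1], (aG_sol t) as [_ d2].
    have w := airy_wronskian t. unfold aq in *. exists (t/aG1 t^2). split.
    - unfold Q. derive_tac; try lra. match goal with |- ?a = ?b => change (@eq R a b) end.
      transitivity (t * (aF t * aG1 t - aF1 t * aG t)/aG1 t^2); [obv|]. rewrite w. field; lra.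
    - have : 0 < / aG1 t^2. nra. }
  set (ka := c2/c1).
  assert (PQ : forall t, t < 0 -> Q t <= P t).
  { intros t Ht. destruct (sg t Ht) as (s1 & s2 & s3 & s4). have w := airy_wronskian t.
    assert (P t - Q t = / (- aG t * aG1 t)).
    { transitivity ((aF t * aG1 t - aF1 t * aG t)/(- aG t * aG1 t)); [obv|]. rewrite w. field; lra. }
    have : 0 < / (- aG t * aG1 t). lra. }
  assert (lim : forall d, 0 < d -> exists t, t < y - 1 /\ ka - d <= P t <= ka + d).
  { intros d Hd. set (q := 2 + 2 * ka/d + (- y)/c9 + 1/c9).
    have K : 0 < ka.
    have a1 : 0 < ka/d. have a2 : 0 < - y/c9.
    have Hq : 2 <= q by (unfold q; unfold Rdiv in *; nra).
    exists (- (c9 * q^2)). have qq : q <= q^2. have qq3 : q <= q^3.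
    assert (g1 : - (c9 * q^2) < y - 1).
    { have E : c9 * ((- y)/c9 + 1/c9) = 1 - y. have : (- y)/c9 + 1/c9 < q by (unfold q; unfold Rdiv in *; nra). nra. }
    split; auto.
    destruct (airy_minus q ok) as [e1 e2]. unfold P. rewrite e1, e2.
    have l1 := wS_ratio_lower q ok. have l2 := wS_ratio_upper q ok.
    have p1 := wS_pos (1/3) (q^6) ok ok.
    set (s0 := wS (- (1/3)) (q^6)) in *. set (s1 := wS (1/3) (q^6)) in *.
    set (i := / q^3) in *. have Hi : 0 < i.
    assert (id : i * (2 * ka + 2 * d) <= d).
    { assert (B : (2 * ka + 2 * d) <= d * q^3).
      { have : d * (ka/d) = ka. have : 2 + 2 * (ka/d) <= q. nra. }
      have : i * q^3 = 1. nra. }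
    replace (s0 / - (- (c9 * q^2) * s1)) with (ka * (s0 * (hL/q^2)/s1)).
    2: { unfold ka. rewrite <- HE. obv. }
    set (rho := s0 * (hL/q^2)/s1). have E : rho * s1 = s0 * (hL/q^2).
    have r1 : 1 - i <= rho.
    have r2 : (1 - i) * rho <= 1.
    split; nra. }
  assert (BP : ka < P y).
  { apply Rnot_le_lt; intro c.
    assert (s : P (y - 1) < P y).
    { apply deriv_pos_lt; [lra|]. intros t Ht. eexists; split; [apply DP; lra|]. destruct (sg t ok) as (_ & s2 & _).
      apply Rinv_0_lt_compat. obv. }
    destruct (lim ((P y - P (y - 1))/2) ok) as (t & t1 & t2 & _).
    assert (P t <= P (y - 1)); [|lra]. apply deriv_nonneg_le; [lra|]. intros x Hx. eexists; split; [apply DP; lra|].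
    left. destruct (sg x ok) as (_ & s2 & _). apply Rinv_0_lt_compat. obv. }
  assert (BQ : Q y <= ka).
  { apply Rnot_lt_le; intro c. destruct (lim ((Q y - ka)/2) ok) as (t & t1 & _ & t2).
    assert (- Q t <= - Q y).
    { apply (deriv_nonneg_le (fun t => - Q t)); [lra|]. intros x Hx. destruct (DQ x ok) as (l & d & dl). exists (- l). split; [|lra].
      apply (is_derive_opp Q x l d). }
    have h := PQ t ok. lra. }
  destruct (sg y Hy) as (s1 & s2 & s3 & s4). unfold au, au1, P, Q, ka in *.
  have E1 : c2 = c1 * (c2/c1). set (k := c2/c1) in *.
  have E2 : aF y = - aG y * (aF y / - aG y). set (p := aF y / - aG y) in *.
  have E3 : aF1 y = - aG1 y * (- aF1 y/aG1 y). set (w := - aF1 y/aG1 y) in *.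
  rewrite E1. split; [rewrite E2|rewrite E3].
  - turn (c1 * (- aG y * p) + c1 * k * aG y) into (c1 * (- aG y) * (p - k)). apply Rmult_lt_0_compat; nra.
  - turn (c1 * (- aG1 y * w) + c1 * k * aG1 y) into (c1 * aG1 y * (k - w)). obv.
Qed.

(** * The functions [beta_1] and [beta_2] *)

Definition ai0 := Rpower 3 (- (2/3)) * rGamma (2/3).
Definition ai1 := Rpower 3 (- (1/3)) * rGamma (1/3).

Lemma ai_pos : 0 < ai0 /\ 0 < ai1.
Proof. split; (apply Rmult_lt_0_compat; [pos|apply rGamma_pos; lra]). Qed.

(** The ratio demanded by [airy_rec_pos] is the classical one between [Ai(0)] and [- Ai'(0)]: powers
    of 3 and one use of the Gamma recurrence at [1/3]. *)
Lemma airy_rec y : y <= 0 -> 0 < au ai0 ai1 y /\ 0 <= au1 ai0 ai1 y.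
Proof.
  apply airy_rec_pos; [apply ai_pos|]. unfold ai0, ai1, hL.
  have g : 0 < rGamma (4/3) by (apply rGamma_pos; lra).
  rewrite (rGamma_rec (1/3)). turn (1/3 + 1) into (4/3).
  assert (E : Rpower 3 (- (1/3)) * c9 = Rpower 3 (- (2/3)) * 3).
  { unfold c9. turn 9 into (3^2). rewrite <- Rpower_pow by lra. rewrite Rpower_mult.
    transitivity (Rpower 3 (- (2/3)) * Rpower 3 1); [|rewrite Rpower_1; lra]. rewrite <- !Rpower_plus. f_equal. simpl; field. }
  transitivity (Rpower 3 (- (1/3)) * c9 * (1/3 * rGamma (2/3))); [obv|]. obv.
Qed.

Lemma airy_coef_uc k : airy_coef0 k * (- 9)^k = uc (- (1/3)) k /\ airy_coef1 k * (- 9)^k = uc (1/3) k.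
Proof.
  induction k as [|k [I0 I1]]; [simpl; lra|]. have h := pos_INR k.
  change (airy_coef0 (S k)) with (airy_coef0 k/((3 * INR (S k) - 1) * (3 * INR (S k)))).
  change (airy_coef1 (S k)) with (airy_coef1 k/((3 * INR (S k)) * (3 * INR (S k) + 1))).
  change (uc (- (1/3)) (S k)) with (- uc (- (1/3)) k/((INR k + 1) * (INR k + 1 + - (1/3)))).
  change (uc (1/3) (S k)) with (- uc (1/3) k/((INR k + 1) * (INR k + 1 + 1/3))).
  rewrite <- I0, <- I1, S_INR. change ((-9)^S k) with (-9 * (-9)^k). split; field; lra.
Qed.

Lemma airy_solution_neg w0 w1 y : airy_solution w0 w1 (- y) = w0 * aF y - w1 * aG y.
Proof.
  unfold airy_solution, aF, aG.
  assert (E : forall a nu, (forall k, a k * (- 9)^k = uc nu k) -> PSeries a ((- y)^3) = PSeries (uc nu) (y^3/9)).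
  { intros a nu H. apply Series_ext. intros k. rewrite <- H, Rmult_assoc. f_equal.
    rewrite <- Rpow_mult_distr. f_equal. field. }
  rewrite (E _ (- (1/3))), (E _ (1/3)) by (intros; apply airy_coef_uc). ring.
Qed.

Lemma Ai_neg y : Ai (- y) = au ai0 ai1 y.
Proof. unfold Ai. rewrite airy_solution_neg. unfold au, ai0, ai1. ring. Qed.

Lemma Bi_neg y : Bi (- y) = - av ai0 ai1 y.
Proof.
  unfold Bi. rewrite airy_solution_neg. unfold av, ai0, ai1. rewrite <- Rpower_sqrt by lra.
  replace (Rpower 3 (- (1/6))) with (Rpower 3 (/ 2) * Rpower 3 (- (2/3))) by (rewrite <- Rpower_plus; f_equal; field).
  replace (Rpower 3 (1/6)) with (Rpower 3 (/ 2) * Rpower 3 (- (1/3))) by (rewrite <- Rpower_plus; f_equal; field). ring.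
Qed.

Lemma Ai_Bi_derive y : Derive Ai (- y) = - au1 ai0 ai1 y /\ Derive Bi (- y) = av1 ai0 ai1 y.
Proof.
  destruct ai_pos as [p0 p1]. destruct (asys ai0 ai1 p0 p1) as (Hu & Hv & _). destruct (Hu y) as [a _], (Hv y) as [b _].
  assert (R : forall (f h : R -> R) l, (forall t, f (- t) = h t) -> is_derive h y l -> Derive f (- y) = - l).
  { intros f h l E D. apply is_derive_unique. apply is_derive_ext with (fun t => h (- t)); [intros t; rewrite <- E; f_equal; ring|].
    turn y into (- - y) in D. eapply is_derive_eq; [apply (is_derive_comp h (fun t => - t)); [exact D|]|].
    - instantiate (1 := -1). derive_tac. Rring.
    - change (-1 * l = - l). ring. }
  split; [now apply (R _ (au ai0 ai1)); [apply Ai_neg|]|].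
  rewrite (R _ (fun t => - av ai0 ai1 t) (- av1 ai0 ai1 y)); [ring|apply Bi_neg|].
  apply (is_derive_opp (av ai0 ai1) y _ b).
Qed.

Lemma argument_polar (w : C) (rho phi th : R) : 0 < rho -> Re w = rho * cos phi -> Im w = rho * sin phi -> is_argument th w ->
  cos th = cos phi /\ sin th = sin phi.
Proof.
  intros Hr E1 E2 [H1 H2]. have h := Cmod_ge_0 w. have a := sin2_cos2 phi. have b := sin2_cos2 th. unfold Rsqr in *.
  rewrite H1 in E1. rewrite H2 in E2. set (m := Cmod w) in *.
  assert (m^2 = rho^2).
  { transitivity ((m * cos th)^2 + (m * sin th)^2); [nra|]. rewrite E1, E2. nra. }
  have : m = rho.
  obv.
Qed.

(** The difference takes values in the multiples of [2 PI] and starts at 0; by the intermediate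
    value theorem it would have to pass through [PI] or [- PI] to leave. *)
Lemma continuous_angle_unique (f h : R -> R) : (forall z, continuous f z) -> (forall z, continuous h z) -> f 0 = h 0 ->
  (forall z, cos (f z) = cos (h z) /\ sin (f z) = sin (h z)) -> forall z, f z = h z.
Proof.
  intros Cf Ch E0 H z. have P := PI_RGT_0.
  assert (C : Ranalysis1.continuity (fun z => f z - h z)).
  { intros t. apply continuity_pt_filterlim. apply (continuous_minus f h); auto. }
  assert (K : forall t, cos (f t - h t) = 1 /\ sin (f t - h t) = 0).
  { intros t. destruct (H t) as [a b]. rewrite cos_minus, sin_minus, a, b. have s := sin2_cos2 (h t). unfold Rsqr in s. lra. }
  assert (B : Rabs (f z - h z) < 2 * PI).
  { assert (NB : forall p, (p = PI \/ p = - PI) -> ~ (Rmin (f 0 - h 0) (f z - h z) <= p <= Rmax (f 0 - h 0) (f z - h z))).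
    { intros p Hp Hr. destruct (IVT_gen (fun z => f z - h z) 0 z p C Hr) as (t & _ & Et). destruct (K t) as [k _].
      rewrite Et in k. destruct Hp; subst p; rewrite ?cos_neg, cos_PI in k; lra. }
    rewrite E0 in NB. turn (h 0 - h 0) into 0 in NB.
    apply Rabs_def1; apply Rnot_le_lt; intro c.
    - apply (NB PI); auto. rewrite Rmin_left, Rmax_right by lra. lra.
    - apply (NB (- PI)); auto. rewrite Rmin_right, Rmax_left by lra. lra. }
  assert (f z - h z = 0); [|lra]. apply angle_unique; [obv| |]; rewrite ?sin_0, ?cos_0; apply K.
Qed.

Lemma aF_phase : exists th, phase (au ai0 ai1) (av ai0 ai1) (aW ai0 ai1) th /\ th 0 = - (PI/3).
Proof.
  destruct ai_pos as [p0 p1]. destruct airy_init as (i1 & i2 & i3 & i4).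
  assert (E : sqrt (sysP (au ai0 ai1) (av ai0 ai1) 0) = 2 * ai0).
  { unfold sysP, au, av. rewrite i1, i3. have s := sqrt_sqrt 3 ok.
    turn ((ai0 * 1 + ai1 * 0)^2 + (- (sqrt 3 * ai0) * 1 + sqrt 3 * ai1 * 0)^2) into ((1 + sqrt 3 * sqrt 3) * ai0^2).
    rewrite s. turn ((1 + 3) * ai0^2) into ((2 * ai0)^2). apply sqrt_pow2; lra. }
  destruct (phase_exists aq _ _ _ _ _ _ 0 (- (PI/3)) (asys ai0 ai1 p0 p1)) as (th & h0 & h1); eauto;
    rewrite E; [rewrite sin_neg, sin_PI3|rewrite cos_neg, cos_PI3]; unfold au, av; rewrite i1, i3; field.
Qed.

Definition cbrt2 := Rpower 2 (1/3).

Lemma cbrt2_pos : 0 < cbrt2. Proof. apply exp_pos. Qed.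

Lemma beta_continuous (beta : R -> R) : (forall z, continuous beta z) -> forall y, continuous (fun y => - (PI * beta (y/cbrt2))) y.
Proof.
  intros H y. apply (continuous_opp (fun y => PI * beta (y/cbrt2))). apply (continuous_scal_r PI (fun y => beta (y/cbrt2))).
  apply (continuous_comp (fun y => y/cbrt2) beta); [|obv].
  apply (ex_derive_continuous (K := R_AbsRing) (V := R_NormedModule)). auto_derive; auto.
Qed.

(** The solution with mixing phase [th y] vanishes at [y] and has outcome [- PI/4 - th y]. Since
    [av] is [- Bi(- y)], the phase [th] is minus the argument that defines [beta1]. *)
Lemma beta1_outcome beta1 : is_beta1 beta1 ->
  forall z, exists b, prufer aq b /\ b (cbrt2 * z) = 0 /\ aout b (- (PI/4) + PI * beta1 z).
Proof.
  intros (Hc & H0 & Ha). destruct ai_pos as [p0 p1]. destruct aF_phase as (th & Hth & Hth0). have C2 := cbrt2_pos.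
  have S := asys ai0 ai1 p0 p1. have P := PI_RGT_0.
  assert (E : forall y, th y = - (PI * beta1 (y/cbrt2))).
  { apply continuous_angle_unique; [|now apply beta_continuous| |].
    - intros y. apply (ex_derive_continuous (K := R_AbsRing) (V := R_NormedModule)). eexists; apply (Hth y).
    - turn (0/cbrt2) into 0. rewrite Hth0, H0. field.
    - intros y. specialize (Ha (y/cbrt2)). fold cbrt2 in Ha. turn (- cbrt2 * (y/cbrt2)) into (- y) in Ha.
      rewrite Ai_neg, Bi_neg in Ha. destruct (Hth y) as (_ & hv & hu).
      destruct (argument_polar (au ai0 ai1 y, - av ai0 ai1 y) (sqrt (sysP (au ai0 ai1) (av ai0 ai1) y)) (- th y) _ ltac:(apply sqrt_lt_R0, (sysP_pos _ _ _ _ _ _ _ _ S))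
        ltac:(rewrite cos_neg; exact hu) ltac:(rewrite sin_neg; simpl; lra) Ha) as [a b].
      rewrite cos_neg in *. rewrite sin_neg in *. obv. }
  intros z. set (y := cbrt2 * z). exists (aang ai0 ai1 th (th y)). splits.
  - now apply aang_prufer.
  - unfold aang, angle. rewrite Rminus_diag_eq by auto. apply Sh_0.
  - replace (- (PI/4) + PI * beta1 z) with (- (PI/4) - th y).
    + apply aang_outcome; auto. apply airy_rec.
    + rewrite E. unfold y. turn (cbrt2 * z/cbrt2) into z. ring.
Qed.

(** The Neumann phase plays the part of [th]: the vector [(au1, av1)] is a negative multiple of its
    [(cos, sin)], so the derivatives of [Ai] and [Bi] at [- y] have argument [- ph y], and the
    solution with this phase has vanishing derivative at [y]. *)
Lemma beta2_outcome beta2 : is_beta2 beta2 ->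
  forall z, exists b, prufer aq b /\ b (cbrt2 * z) = PI/2 /\ aout b (- (PI/4) + PI * beta2 z).
Proof.
  intros (Hc & H0 & Ha). destruct ai_pos as [p0 p1]. destruct aF_phase as (th & Hth & Hth0). have C2 := cbrt2_pos.
  have S := asys ai0 ai1 p0 p1. have P := PI_RGT_0.
  set (ph := phaseA (au ai0 ai1) (au1 ai0 ai1) (av ai0 ai1) (av1 ai0 ai1) (aW ai0 ai1) th (PI/2)).
  assert (K : forall y, exists m, 0 < m /\ au1 ai0 ai1 y = - (m * cos (ph y)) /\ av1 ai0 ai1 y = - (m * sin (ph y)) /\ ex_derive ph y).
  { intros y. destruct (phaseA_derive _ _ _ _ _ _ _ _ (PI/2) y S Hth) as (n2 & Hn & h1 & h2 & h3). fold ph in h1, h2, h3.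
    rewrite sin_PI2 in h1. rewrite cos_PI2 in h2. have s := sqrt_lt_R0 _ Hn. destruct S as (_ & _ & HW & Hw & _). specialize (Hw y).
    have t := sin2_cos2 (ph y). unfold Rsqr in t.
    set (m := - (au1 ai0 ai1 y * cos (ph y) + av1 ai0 ai1 y * sin (ph y))).
    assert (e1 : au1 ai0 ai1 y = - (m * cos (ph y))).
    { transitivity (au1 ai0 ai1 y * (sin (ph y) * sin (ph y) + cos (ph y) * cos (ph y)) + (av1 ai0 ai1 y * cos (ph y) - au1 ai0 ai1 y * sin (ph y)) * sin (ph y)); [rewrite t, h2; ring|obv]. }
    assert (e2 : av1 ai0 ai1 y = - (m * sin (ph y))).
    { transitivity (av1 ai0 ai1 y * (sin (ph y) * sin (ph y) + cos (ph y) * cos (ph y)) - (av1 ai0 ai1 y * cos (ph y) - au1 ai0 ai1 y * sin (ph y)) * cos (ph y)); [rewrite t, h2; ring|obv]. }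
    exists m. splits; auto; [|now eexists; exact h3]. obv. }
  (* The initial values give sine and cosine of [ph 0]; the branch follows because the sheared angle
     [x] lies in [[0, PI]]. *)
  assert (I : ph 0 = - (2 * PI/3)).
  { destruct (K 0) as (m & Hm & k1 & k2 & _). destruct airy_init as (i1 & i2 & i3 & i4).
    unfold au1, av1 in k1, k2. rewrite i2, i4 in k1, k2.
    set (x := Sh (sysP (au ai0 ai1) (av ai0 ai1) 0/aW ai0 ai1) (- sysQ (au ai0 ai1) (au1 ai0 ai1) (av ai0 ai1) (av1 ai0 ai1) 0/aW ai0 ai1) (PI/2)).
    assert (X : IZR 0 * PI <= x <= (IZR 0 + 1) * PI).
    { apply Sh_range; [|pos]. apply Rdiv_lt_0_compat; [apply (sysP_pos _ _ _ _ _ _ _ _ S)|apply S]. }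
    have E : ph 0 = - (PI/3) - x by (unfold ph, phaseA; rewrite Hth0; reflexivity). simpl in X.
    have s3 := sqrt_sqrt 3 ok. have s3' := sqrt3_pos. have t := sin2_cos2 (ph 0). unfold Rsqr in t.
    assert (m2 : m = 2 * ai1).
    { apply Rsqr_inj; try lra. unfold Rsqr. transitivity ((m * cos (ph 0))^2 + (m * sin (ph 0))^2); [nra|].
      turn (m * cos (ph 0)) into (- ai1). turn (m * sin (ph 0)) into (- (sqrt 3 * ai1)). nra. }
    rewrite m2 in k1, k2.
    have cc : cos (- (2 * PI/3)) = - 1/2 by (rewrite cos_neg; turn (2 * PI/3) into (2 * (PI/3)); rewrite cos_2PI3; field).
    have ss : sin (- (2 * PI/3)) = - sqrt 3/2 by (rewrite sin_neg; turn (2 * PI/3) into (2 * (PI/3)); rewrite sin_2PI3; field).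
    apply angle_unique; [pos|rewrite ss|rewrite cc].
    - apply Rmult_eq_reg_l with (2 * ai1); lra.
    - obv. }
  assert (E : forall y, ph y = - (PI * beta2 (y/cbrt2))).
  { apply continuous_angle_unique; [|now apply beta_continuous| |].
    - intros y. apply (ex_derive_continuous (K := R_AbsRing) (V := R_NormedModule)). destruct (K y) as (m & _ & _ & _ & d). exact d.
    - turn (0/cbrt2) into 0. rewrite I, H0. field.
    - intros y. specialize (Ha (y/cbrt2)). fold cbrt2 in Ha. turn (- cbrt2 * (y/cbrt2)) into (- y) in Ha.
      destruct (Ai_Bi_derive y) as [d1 d2]. rewrite d1, d2 in Ha. destruct (K y) as (m & Hm & k1 & k2 & _).
      destruct (argument_polar (- au1 ai0 ai1 y, av1 ai0 ai1 y) m (- ph y) _ Hm ltac:(rewrite cos_neg; simpl; lra) ltac:(rewrite sin_neg; simpl; lra) Ha) as [a b].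
      rewrite cos_neg in *. rewrite sin_neg in *. obv. }
  intros z. set (y := cbrt2 * z). exists (aang ai0 ai1 th (ph y)). splits.
  - now apply aang_prufer.
  - apply (angle_phaseA _ _ _ _ _ _ _ _ _ _ S).
  - replace (- (PI/4) + PI * beta2 z) with (- (PI/4) - ph y).
    + apply aang_outcome; auto. apply airy_rec.
    + rewrite E. unfold y. turn (cbrt2 * z/cbrt2) into z. ring.
Qed.

(* The outcome [PI/4] of the recessive solution [J_nu], uniformly for large order. *)
Lemma J_outcome : exists V Y, 0 < V /\ 1 <= Y /\ forall nu, V < nu -> 100 <= Nof nu /\ Y^2 <= Nof nu /\
  forall al, prufer (bq nu) al ->
    (forall t, U nu t = sqrt (U nu t^2 + U1 nu t^2) * sin (al t) /\ U1 nu t = sqrt (U nu t^2 + U1 nu t^2) * cos (al t)) ->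
    0 <= al (wtime nu (Nof nu) (- Y)) <= PI/2 -> bout nu al (PI/4).
Proof.
  destruct ai_pos as [p0 p1]. destruct aF_phase as (th & Hth & Hth0). exact (recessive_bessel ai0 ai1 p0 p1 airy_rec th Hth Hth0).
Qed.

(** * Bessel functions as solutions *)

Lemma derive_along (f : R -> R) (x l : R) (h : nat -> R) : is_derive f x l -> (forall k, h k <> 0) -> is_lim_seq h 0 ->
  is_lim_seq (fun k => (f (x + h k) - f x)/h k) l.
Proof.
  intros D H0 Hh. apply is_derive_Reals in D. apply is_lim_seq_spec. intros eps. destruct (D eps (cond_pos eps)) as [d Hd].
  apply is_lim_seq_spec in Hh. destruct (Hh d) as [N HN]. exists N. intros k Hk. apply Hd; auto.
  specialize (HN k Hk). obv.
Qed.

Lemma sum_lim (a : nat -> nat -> R) (l : nat -> R) N : (forall m, is_lim_seq (fun k => a k m) (l m)) ->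
  is_lim_seq (fun k => sum_f_R0 (a k) N) (sum_f_R0 l N).
Proof. intros H. induction N as [|N IH]; simpl; auto. now apply is_lim_seq_plus'. Qed.

Lemma tannery (a : nat -> nat -> R) (l b : nat -> R) : (forall k m, Rabs (a k m) <= b m) -> ex_series b ->
  (forall m, is_lim_seq (fun k => a k m) (l m)) -> is_lim_seq (fun k => Series (a k)) (Series l).
Proof.
  intros Hb Eb Hl.
  assert (Hlb : forall m, Rabs (l m) <= b m).
  { intros m. apply (is_lim_seq_le (fun k => Rabs (a k m)) (fun _ => b m) (Rabs (l m)) (b m)); auto.
    - now apply (is_lim_seq_abs _ (l m)).
    - apply is_lim_seq_const. }
  assert (Ex : forall c, (forall m, Rabs (c m) <= b m) -> ex_series (fun m => Rabs (c m))).
  { intros c Hc. apply (ex_series_le (K := R_AbsRing) (V := R_CompleteNormedModule)) with (b := b); auto.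
    intros n. change (Rabs (Rabs (c n)) <= b n). rewrite Rabs_Rabsolu. apply Hc. }
  assert (Tail : forall c n, (0 < n)%nat -> (forall m, Rabs (c m) <= b m) ->
    Rabs (Series c - sum_f_R0 c (pred n)) <= Series b - sum_f_R0 b (pred n)).
  { intros c n Hn Hc. rewrite (Series_incr_n c n Hn) by (apply ex_series_Rabs; auto). rewrite (Series_incr_n b n Hn Eb).
    turn (sum_f_R0 c (pred n) + Series (fun k => c (n + k)%nat) - sum_f_R0 c (pred n)) into (Series (fun k => c (n + k)%nat)).
    turn (sum_f_R0 b (pred n) + Series (fun k => b (n + k)%nat) - sum_f_R0 b (pred n)) into (Series (fun k => b (n + k)%nat)).
    have E1 := proj1 (ex_series_incr_n _ n) (Ex c Hc). have E2 := proj1 (ex_series_incr_n _ n) Eb.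
    eapply Rle_trans; [now apply Series_Rabs|]. apply Series_le; auto. intros k. split; [pos|obv]. }
  apply is_lim_seq_spec. intros eps. have He := cond_pos eps.
  have Sb : is_lim_seq (sum_n b) (Series b) by exact (Series_correct b Eb). apply is_lim_seq_spec in Sb. destruct (Sb (mkposreal (eps/3) ok)) as [N HN].
  specialize (HN N ok). simpl in HN. rewrite sum_n_Reals in HN.
  have Sl := sum_lim a l N Hl. apply is_lim_seq_spec in Sl. destruct (Sl (mkposreal (eps/3) ok)) as [N2 HN2].
  exists N2. intros k Hk. specialize (HN2 k Hk). simpl in HN2.
  have T1 := Tail (a k) (S N) ok (Hb k). have T2 := Tail l (S N) ok Hlb. simpl pred in T1, T2.
  apply Rabs_def2 in HN. obv.
Qed.

Lemma bounded_prefix (D : nat -> nat -> R) : (forall m, exists B, forall k, Rabs (D k m) <= B) ->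
  forall N, exists C, 0 <= C /\ forall m k, (m <= N)%nat -> Rabs (D k m) <= C.
Proof.
  intros H. induction N as [|N (C & H0 & HC)].
  - destruct (H 0%nat) as [B HB]. exists B. split; [eapply Rle_trans; [apply Rabs_pos|apply (HB 0%nat)]|].
    intros m k Hm. turn m into 0%nat. auto.
  - destruct (H (S N)) as [B HB]. exists (Rmax B C). split; [eapply Rle_trans; [exact H0|apply Rmax_r]|].
    intros m k Hm. destruct (Nat.eq_dec m (S N)) as [->|e]; [eapply Rle_trans; [apply HB|apply Rmax_l]|].
    eapply Rle_trans; [apply HC; lia|apply Rmax_r].
Qed.

Lemma shift_large mu : exists N, forall m, (N <= m)%nat -> 1 <= INR m + mu.
Proof.
  destruct (INR_unbounded (1 - mu)) as [N HN]. exists N. intros m Hm. have h := le_INR _ _ Hm. lra.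
Qed.

Lemma rG_bounded mu : exists C, 0 <= C /\ forall m, Rabs (rGamma (INR m + mu + 1)) <= C.
Proof.
  destruct (shift_large mu) as [N HN].
  destruct (bounded_prefix (fun _ m => rGamma (INR m + mu + 1)) ltac:(intros m; eexists; intros _; apply Rle_refl) N) as (C & C0 & HC).
  exists C. split; auto. intros m. destruct (Nat.le_gt_cases m N) as [h|h]; [obv|].
  turn m into (N + (m - N))%nat. induction (m - N)%nat as [|j IH]; [rewrite Nat.add_0_r; apply (HC N 0%nat); lia|].
  rewrite Nat.add_succ_r, S_INR. eapply Rle_trans; [|exact IH]. specialize (HN (N + j)%nat ok).
  set (z := INR (N + j) + mu + 1). turn (INR (N + j) + 1 + mu + 1) into (z + 1).
  rewrite (rGamma_rec z), Rabs_mult. rewrite (Rabs_pos_eq z) by obv. have p := Rabs_pos (rGamma (z + 1)). unfold z in *. nra.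
Qed.

(** The domination for Tannery's theorem. Finitely many [m] are covered by convergence of the
    quotients; beyond [N] the recurrence divides by a number at least 1 and adds a bounded term, so
    the growth in [m] is at most linear. *)
Lemma rG_quot (n : Z) (h : nat -> R) : (forall k, h k <> 0 /\ Rabs (h k) <= 1) -> is_lim_seq h 0 ->
  exists C, 0 <= C /\ forall m k, Rabs ((rGamma (INR m + IZR n + 1 + h k) - rGamma (INR m + IZR n + 1))/h k) <= C * (1 + INR m).
Proof.
  intros H0 Hh. set (D := fun k m => (rGamma (INR m + IZR n + 1 + h k) - rGamma (INR m + IZR n + 1))/h k).
  destruct (shift_large (IZR n - 1)) as [N HN]. destruct (rG_bounded (IZR n)) as (C1 & C10 & HC1).
  destruct (bounded_prefix D) with (N := N) as (C & C0 & HC).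
  { intros m. have E : INR m + IZR n + 1 = IZR (Z.of_nat m + n + 1) by (rewrite !plus_IZR, <- INR_IZR_INZ; reflexivity).
    destruct (rGamma_derive_int (Z.of_nat m + n + 1)) as [l Hl]. rewrite <- E in Hl.
    have L := derive_along rGamma _ l h Hl (fun k => proj1 (H0 k)) Hh.
    destruct (filterlim_bounded (K := R_AbsRing) (V := R_NormedModule) (fun k => D k m)) as [M HM]; [exists l; exact L|exists M; exact HM]. }
  exists (C + C1). split; [lra|]. intros m k. have p := pos_INR m. change (Rabs (D k m) <= (C + C1) * (1 + INR m)).
  destruct (Nat.le_gt_cases m N) as [c|c]; [eapply Rle_trans; [apply HC; auto|nra]|].
  assert (G : forall j, Rabs (D k (N + j)%nat) <= C + C1 * INR j).
  { induction j as [|j IH]; [rewrite Nat.add_0_r; simpl; rewrite Rmult_0_r, Rplus_0_r; apply HC; lia|].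
    rewrite Nat.add_succ_r, S_INR. specialize (HN (N + j)%nat ok). destruct (H0 k) as [hk0 hk1].
    apply Rabs_le_between in hk1. set (z := INR (N + j) + IZR n + 1) in *. specialize (HC1 (N + j)%nat). fold z in HC1.
    have Hz : 2 <= z.
    assert (E : D k (S (N + j)) = D k (N + j)%nat/(z + h k) - rGamma z/(z * (z + h k))).
    { unfold D. rewrite S_INR. turn (INR (N + j) + 1 + IZR n + 1) into (z + 1). fold z.
      rewrite (rGamma_rec z), (rGamma_rec (z + h k)). turn (z + 1 + h k) into (z + h k + 1). obv. }
    rewrite E. eapply Rle_trans; [apply Rabs_triang|]. rewrite Rabs_Ropp. unfold Rdiv. rewrite !Rabs_mult.
    have i1 : 0 < / (z + h k) <= 1 by (split; [pos|rewrite <- Rinv_1; apply Rinv_le_contravar; lra]).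
    have i2 : 0 < / (z * (z + h k)) <= 1 by (split; [pos|rewrite <- Rinv_1; apply Rinv_le_contravar; nra]).
    rewrite !(Rabs_pos_eq (/ _)) by lra. have a := Rabs_pos (D k (N + j)%nat). nra. }
  turn m into (N + (m - N))%nat. eapply Rle_trans; [apply G|]. turn (N + (m - N))%nat into m.
  have : INR (m - N) <= INR m by (apply le_INR; lia). nra.
Qed.

Definition Jc mu (m : nat) := (-1)^m * rGamma (INR m + mu + 1)/INR (fact m).
(** The derivative of [Jc mu m] in [mu], meaningful at integers [mu] by [rGamma_derive_int]. *)
Definition Jd mu (m : nat) := (-1)^m * Derive rGamma (INR m + mu + 1)/INR (fact m).

Lemma coef_entire (d : nat -> R) C : 0 <= C -> (forall m, Rabs (d m) <= C * (1 + INR m)) -> entire (fun m => (-1)^m * d m/INR (fact m)).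
Proof.
  intros HC H. apply (fact_radius _ 2 C); try lra. intros m. have F := INR_fact_lt_0 m.
  unfold Rdiv. rewrite !Rabs_mult, pow_1_abs, Rmult_1_l, Rabs_inv, (Rabs_pos_eq (INR _)) by lra.
  apply Rmult_le_compat_r; [pos|]. eapply Rle_trans; [apply H|]. apply Rmult_le_compat_l; auto.
  clear. induction m as [|m IH]; [simpl; lra|]. rewrite S_INR. simpl pow. have p := pos_INR m. lra.
Qed.

Lemma Jc_entire mu : entire (Jc mu).
Proof.
  destruct (rG_bounded mu) as (C & C0 & HC). apply (coef_entire (fun m => rGamma (INR m + mu + 1)) C C0).
  intros m. eapply Rle_trans; [apply HC|]. have p := pos_INR m. nra.
Qed.

Lemma Jc_rec mu n : (INR n + 1) * (INR n + 1 + mu) * Jc mu (S n) = - Jc mu n.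
Proof.
  unfold Jc. rewrite S_INR, fact_simpl, mult_INR, S_INR, (rGamma_rec (INR n + mu + 1)).
  turn (INR n + 1 + mu + 1) into (INR n + mu + 1 + 1). have F := INR_fact_lt_0 n. have p := pos_INR n. simpl pow. field. lra.
Qed.

Lemma rG_derive_int m n : is_derive rGamma (INR m + IZR n + 1) (Derive rGamma (INR m + IZR n + 1)).
Proof.
  apply Derive_correct. replace (INR m + IZR n + 1) with (IZR (Z.of_nat m + n + 1)) by (rewrite !plus_IZR, <- INR_IZR_INZ; reflexivity).
  apply rGamma_derive_int.
Qed.

Definition hseq (k : nat) := / (INR k + 1).

Lemma hseq_spec : (forall k, 0 < hseq k <= 1) /\ is_lim_seq hseq 0.
Proof.
  split.
  - intros k. have p := pos_INR k. split; [apply Rinv_0_lt_compat; lra|]. rewrite <- Rinv_1. apply Rinv_le_contravar; lra.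
  - apply is_lim_seq_ext with (fun k => / INR (S k)); [intros k; unfold hseq; now rewrite S_INR|].
    apply (is_lim_seq_incr_1 (fun k => / INR k)). apply (is_lim_seq_inv INR p_infty); [apply is_lim_seq_INR|discriminate].
Qed.

Lemma hseq_ok s : s = 1 \/ s = -1 -> (forall k, s * hseq k <> 0 /\ Rabs (s * hseq k) <= 1) /\ is_lim_seq (fun k => s * hseq k) 0.
Proof.
  intros Hs. destruct hseq_spec as [a b]. split.
  - intros k. specialize (a k). destruct Hs; subst s; (split; [lra|pos]).
  - replace (Finite 0) with (Finite (s * 0)) by (f_equal; ring). apply (is_lim_seq_scal_l hseq s 0 b).
Qed.

Lemma Jd_entire n : entire (Jd (IZR n)).
Proof.
  destruct (hseq_ok 1 (or_introl eq_refl)) as [a b]. destruct (rG_quot n _ a b) as (C & C0 & HC).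
  apply (coef_entire (fun m => Derive rGamma (INR m + IZR n + 1)) C C0). intros m.
  have L := derive_along _ _ _ _ (rG_derive_int m n) (fun k => proj1 (a k)) b.
  apply (is_lim_seq_le (fun k => Rabs ((rGamma (INR m + IZR n + 1 + 1 * hseq k) - rGamma (INR m + IZR n + 1))/(1 * hseq k))) (fun _ => C * (1 + INR m))
    (Rabs (Derive rGamma (INR m + IZR n + 1))) (C * (1 + INR m))).
  - intros k. apply HC.
  - now apply (is_lim_seq_abs _ (Derive rGamma (INR m + IZR n + 1))).
  - apply is_lim_seq_const.
Qed.

Lemma Jd_rec n m : (INR m + 1) * (INR m + 1 + IZR n) * Jd (IZR n) (S m) + Jd (IZR n) m = - PS_derive (Jc (IZR n)) m.
Proof.
  unfold PS_derive, Jd, Jc. rewrite S_INR, fact_simpl, mult_INR, S_INR. set (z := INR m + IZR n + 1).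
  turn (INR m + 1 + IZR n + 1) into (z + 1).
  have D1 := rG_derive_int (S m) n. rewrite S_INR in D1. turn (INR m + 1 + IZR n + 1) into (z + 1) in D1.
  assert (E : Derive rGamma z = rGamma (z + 1) + z * Derive rGamma (z + 1)).
  { apply is_derive_unique. apply is_derive_ext with (fun w => w * rGamma (w + 1)); [intros; symmetry; apply rGamma_rec|].
    assert (D2 : is_derive (fun w => rGamma (w + 1)) z (Derive rGamma (z + 1))).
    { eapply is_derive_eq; [apply (is_derive_comp rGamma (fun w => w + 1)); [exact D1|instantiate (1 := 1); derive_tac; Rring]|].
      change (1 * Derive rGamma (z + 1) = Derive rGamma (z + 1)). ring. }
    eapply is_derive_eq; [apply (is_derive_mult (fun w => w) (fun w => rGamma (w + 1)) z); [apply is_derive_id|exact D2|intros; apply Rmult_comm]|].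
    change (1 * rGamma (z + 1) + z * Derive rGamma (z + 1) = rGamma (z + 1) + z * Derive rGamma (z + 1)). ring. }
  rewrite E. have F := INR_fact_lt_0 m. simpl pow. obv.
Qed.

Lemma besselJ_exp mu t : besselJ mu (exp t) = exp (mu * (t - ln 2)) * PSeries (Jc mu) (exp (2 * t)/4).
Proof.
  unfold besselJ, Rpower. rewrite ln_div, ln_exp by pos. do 2 f_equal.
  turn (2 * t) into (t + t). rewrite exp_plus. field.
Qed.

Lemma besselJ_frob mu t : besselJ mu (exp t) = exp (- mu * ln 2) * frobU mu (Jc mu) t.
Proof.
  rewrite besselJ_exp. unfold frobU. rewrite <- Rmult_assoc, <- exp_plus. do 2 f_equal. ring.
Qed.

Lemma Jc_uc mu m : -1 < mu -> Jc mu m = rGamma (mu + 1) * uc mu m.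
Proof.
  intros Hm. induction m as [|m IH].
  - unfold Jc. simpl. rewrite Rplus_0_l. field.
  - have h := pos_INR m. apply Rmult_eq_reg_l with ((INR m + 1) * (INR m + 1 + mu)); [|nra].
    rewrite Jc_rec, IH. transitivity (rGamma (mu + 1) * ((INR m + 1) * (INR m + 1 + mu) * uc mu (S m))); [rewrite uc_rec by auto; ring|ring].
Qed.

Lemma besselJ_U nu t : -1 < nu -> besselJ nu (exp t) = exp (- nu * ln 2) * rGamma (nu + 1) * U nu t.
Proof.
  intros Hn. rewrite besselJ_frob. unfold U, frobU. rewrite (PSeries_ext _ (PS_scal (rGamma (nu + 1)) (uc nu))).
  - rewrite PSeries_scal. ring.
  - intros m. now apply Jc_uc.
Qed.

(** The derivative of [J_mu(e^t)] in the order at [mu = n]; the factor [t - ln 2] comes from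
    differentiating [(x/2)^mu]. *)
Definition JV n t := exp (- IZR n * ln 2) * ((t - ln 2) * frobU (IZR n) (Jc (IZR n)) t + frobU (IZR n) (Jd (IZR n)) t).
Definition JV1 n t := exp (- IZR n * ln 2) * (frobU (IZR n) (Jc (IZR n)) t + (t - ln 2) * frobU1 (IZR n) (Jc (IZR n)) t + frobU1 (IZR n) (Jd (IZR n)) t).

(** The Bessel equation differentiated in its order: the source [2 n J_n] comes from [nu^2]. In
    [Y_n] the sources at [n] and [- n] cancel because [J_(- n) = (-1)^n J_n]. *)
Lemma JV_ode n t : is_derive (JV n) t (JV1 n t) /\ is_derive (JV1 n) t (- bq (IZR n) t * JV n t + 2 * IZR n * besselJ (IZR n) (exp t)).
Proof.
  set (mu := IZR n). have Ec := Jc_entire mu. have Ed := Jd_entire n.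
  have A := frobU_derive mu (Jc mu) t Ec. have B := frobU_derive mu (Jd mu) t Ed.
  have A1 := frobU1_derive mu (Jc mu) (fun _ => 0) t Ec entire_zero ltac:(intros m; rewrite Jc_rec; ring).
  have B1 := frobU1_derive mu (Jd mu) (PS_derive (Jc mu)) t Ed (entire_derive _ Ec) (Jd_rec n).
  rewrite PSeries_const_0 in A1. rewrite besselJ_frob. unfold JV, JV1. fold mu.
  have U1e : frobU1 mu (Jc mu) t = mu * frobU mu (Jc mu) t + exp (mu * t) * exp (2 * t)/2 * PSeries (PS_derive (Jc mu)) (exp (2 * t)/4) by (unfold frobU1, frobU; field).
  set (a := frobU mu (Jc mu)) in *. set (a1 := frobU1 mu (Jc mu)) in *. set (b := frobU mu (Jd mu)) in *. set (b1 := frobU1 mu (Jd mu)) in *.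
  split; unfold Rminus; derive_tac.
  - Rring.
  - obv.
Qed.

Lemma besselJ_order_derive n t s : s = 1 \/ s = -1 ->
  is_lim_seq (fun k => (besselJ (IZR n + s * hseq k) (exp t) - besselJ (IZR n) (exp t))/(s * hseq k)) (JV n t).
Proof.
  intros Hs. destruct (hseq_ok s Hs) as [a b]. set (h := fun k => s * hseq k) in *. set (mu := IZR n). set (X := exp (2 * t)/4).
  set (E := fun w => exp (w * (t - ln 2))).
  have DE : is_derive E mu ((t - ln 2) * E mu) by (unfold E; unfold Rminus; derive_tac; Rring).
  apply is_lim_seq_ext with (fun k => E (mu + h k) * ((PSeries (Jc (mu + h k)) X - PSeries (Jc mu) X)/h k) + PSeries (Jc mu) X * ((E (mu + h k) - E mu)/h k)).
  { intros k. rewrite !besselJ_exp. fold X. change (exp ((mu + s * hseq k) * (t - ln 2))) with (E (mu + h k)). obv. }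
  replace (JV n t) with (E mu * PSeries (Jd mu) X + PSeries (Jc mu) X * ((t - ln 2) * E mu)).
  2: { unfold JV, frobU, E. fold mu X. turn (mu * (t - ln 2)) into (- mu * ln 2 + mu * t). rewrite exp_plus. ring. }
  apply is_lim_seq_plus'; apply is_lim_seq_mult'.
  - apply (is_lim_seq_continuous E); [eapply is_derive_ct; exact DE|].
    replace (Finite mu) with (Finite (mu + 0)) by (f_equal; ring). apply is_lim_seq_plus'; [apply is_lim_seq_const|pos].
  - destruct (rG_quot n h a b) as (C & C0 & HC).
    apply is_lim_seq_ext with (fun k => Series (fun m => (-1)^m * ((rGamma (INR m + mu + 1 + h k) - rGamma (INR m + mu + 1))/h k)/INR (fact m) * X^m)).
    { intros k. transitivity (PSeries (PS_minus (Jc (mu + h k)) (Jc mu)) X/h k); [|now rewrite PSeries_minus by (apply entire_ex, Jc_entire)].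
      unfold PSeries. match goal with |- _ = ?a / ?b => change (a/b) with (a * / b) end. rewrite <- Series_scal_r. apply Series_ext. intros m.
      change (PS_minus (Jc (mu + h k)) (Jc mu) m) with (Jc (mu + h k) m - Jc mu m). unfold Jc. turn (INR m + (mu + h k) + 1) into (INR m + mu + 1 + h k).
      obv. }
    apply (tannery _ (fun m => Jd mu m * X^m) (fun m => C * (1 + INR m)/INR (fact m) * X^m)).
    + intros k m. have F := INR_fact_lt_0 m. have PX : 0 < X.
      unfold Rdiv at 1. rewrite !Rabs_mult, pow_1_abs, Rmult_1_l, <- RPow_abs, (Rabs_pos_eq X), Rabs_inv, (Rabs_pos_eq (INR _)) by lra.
      apply Rmult_le_compat_r; [pos|]. apply Rmult_le_compat_r; [pos|]. apply HC.
    + assert (En : entire (fun m => C * (1 + INR m)/INR (fact m))).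
      { apply (fact_radius _ 2 C); try lra. intros m. have F := INR_fact_lt_0 m. have p := pos_INR m.
        rewrite Rabs_pos_eq by pos. apply Rmult_le_compat_r; [pos|].
        apply Rmult_le_compat_l; auto. clear. induction m as [|m IH]; [simpl; lra|]. rewrite S_INR. simpl pow. have p := pos_INR m. lra. }
      apply (entire_ex _ X) in En. apply ex_pseries_R in En. exact En.
    + intros m. have L := derive_along _ _ _ _ (rG_derive_int m n) (fun k => proj1 (a k)) b. fold mu in L.
      apply is_lim_seq_mult'; [|apply is_lim_seq_const]. unfold Jd, Rdiv. apply is_lim_seq_mult'; [|apply is_lim_seq_const].
      apply is_lim_seq_mult'; [apply is_lim_seq_const|pos].
  - apply is_lim_seq_const.
  - apply derive_along; auto. intros k; apply a.
Qed.

Lemma rGamma_fact j : rGamma (INR j + 1) = / INR (fact j).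
Proof.
  induction j as [|j IH]; [simpl; rewrite Rplus_0_l, rGamma_1; field|].
  have p := pos_INR j. have F := INR_fact_lt_0 j. rewrite fact_simpl, mult_INR, !S_INR. apply Rmult_eq_reg_l with (INR j + 1); [|lra].
  rewrite <- rGamma_rec, IH. field. lra.
Qed.

Lemma rGamma_pole j : rGamma (- INR j) = 0.
Proof.
  induction j as [|j IH]; rewrite rGamma_rec; [simpl; ring|]. rewrite S_INR.
  turn (- (INR j + 1) + 1) into (- INR j). obv.
Qed.

Lemma besselJ_neg_int n t : besselJ (- INR n) (exp t) = (-1)^n * besselJ (INR n) (exp t).
Proof.
  rewrite !besselJ_exp. set (X := exp (2 * t)/4).
  assert (E : PSeries (Jc (- INR n)) X = (-1)^n * (X^n * PSeries (Jc (INR n)) X)).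
  { rewrite <- PSeries_incr_n, <- PSeries_scal. apply PSeries_ext. intros m.
    change (PS_scal ((-1)^n) (PS_incr_n (Jc (INR n)) n) m) with ((-1)^n * PS_incr_n (Jc (INR n)) n m).
    rewrite PS_incr_n_simplify. unfold Jc. destruct (Compare_dec.le_lt_dec n m) as [c|c].
    - replace (INR m + - INR n + 1) with (INR (m - n) + 1) by (rewrite minus_INR by auto; ring).
      replace (INR (m - n) + INR n + 1) with (INR m + 1) by (rewrite minus_INR by auto; ring). rewrite !rGamma_fact.
      replace ((-1)^m) with ((-1)^n * (-1)^(m - n)) by (rewrite <- pow_add; f_equal; lia).
      field. split; apply INR_fact_neq_0.
    - replace (INR m + - INR n + 1) with (- INR (n - m - 1)) by (rewrite !minus_INR by lia; simpl; ring).
      rewrite rGamma_pole. change (@zero (NormedModule.AbelianMonoid R_AbsRing R_NormedModule)) with 0. obv. }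
  rewrite E. replace (X^n) with (exp (2 * INR n * (t - ln 2))).
  - turn (INR n * (t - ln 2)) into (- INR n * (t - ln 2) + 2 * INR n * (t - ln 2)). rewrite (exp_plus (- INR n * _)). ring.
  - have PX : 0 < X.
    rewrite <- Rpower_pow by auto. unfold Rpower. f_equal. unfold X. rewrite ln_div, ln_exp by pos.
    turn 4 into (2 * 2). rewrite ln_mult by lra. ring.
Qed.

Lemma cos_int n : cos (INR n * PI) = (-1)^n.
Proof.
  induction n as [|n IH]; [simpl; rewrite Rmult_0_l; apply cos_0|]. rewrite S_INR, Rmult_plus_distr_r, Rmult_1_l, neg_cos, IH. simpl; ring.
Qed.

Lemma sin_int n : sin (INR n * PI) = 0.
Proof. apply sin_eq_0_1. exists (Z.of_nat n). now rewrite <- INR_IZR_INZ. Qed.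

Lemma besselY_int n t : besselY (INR n) (exp t) = (JV (Z.of_nat n) t + (-1)^n * JV (- Z.of_nat n) t)/PI.
Proof.
  unfold besselY. destruct (Req_EM_T (sin (INR n * PI)) 0) as [_|e]; [|destruct e; apply sin_int].
  set (ep := (-1)^n). have e2 : ep * ep = 1 by (unfold ep; rewrite <- Rpow_mult_distr; turn (-1 * -1) into 1; apply pow1).
  have e0 : ep <> 0.
  have In : IZR (Z.of_nat n) = INR n by now rewrite <- INR_IZR_INZ.
  have Im : IZR (- Z.of_nat n) = - INR n by now rewrite opp_IZR, In.
  set (j0 := besselJ (INR n) (exp t)). have P := PI_RGT_0.
  have L1 := besselJ_order_derive (Z.of_nat n) t 1 (or_introl eq_refl). have L2 := besselJ_order_derive (- Z.of_nat n) t (-1) (or_intror eq_refl).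
  rewrite In in L1. rewrite Im, besselJ_neg_int in L2.
  destruct hseq_spec as [hs hl].
  assert (Lsin : is_lim_seq (fun k => sin (PI * hseq k)/hseq k) PI).
  { have D : is_derive (fun x => sin (PI * x)) 0 PI by (derive_tac; rewrite Rmult_0_r, cos_0; Rring).
    eapply is_lim_seq_ext; [|apply (derive_along _ _ _ hseq D); [intros k; specialize (hs k); lra|pos]].
    intros k. cbv beta. rewrite Rplus_0_l, Rmult_0_r, sin_0, Rminus_0_r. reflexivity. }
  assert (Lcos : is_lim_seq (fun k => (cos (PI * hseq k) - 1)/hseq k) 0).
  { have D : is_derive (fun x => cos (PI * x)) 0 0 by (derive_tac; rewrite Rmult_0_r, sin_0; Rring).
    eapply is_lim_seq_ext; [|apply (derive_along _ _ _ hseq D); [intros k; specialize (hs k); lra|pos]].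
    intros k. cbv beta. rewrite Rplus_0_l, Rmult_0_r, cos_0. reflexivity. }
  assert (Lc : is_lim_seq (fun k => cos (PI * hseq k)) 1).
  { replace (Finite 1) with (Finite (cos (PI * 0))) by (rewrite Rmult_0_r, cos_0; auto).
    apply (is_lim_seq_continuous cos); [apply continuity_cos|]. apply (is_lim_seq_scal_l hseq PI 0 hl). }
  (* [Lim] at a finite point is by definition the limit along [n + 1/(k + 1)], so this sequence is
     followed. *)
  assert (L : is_lim_seq (fun k => besselY_quot (Rbar_loc_seq (INR n) k) (exp t)) ((JV (Z.of_nat n) t + ep * JV (- Z.of_nat n) t)/PI)).
  { apply is_lim_seq_ext with (fun k => (cos (PI * hseq k) * ((besselJ (INR n + 1 * hseq k) (exp t) - j0)/(1 * hseq k)) + j0 * ((cos (PI * hseq k) - 1)/hseq k)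
        + ep * ((besselJ (- INR n + -1 * hseq k) (exp t) - ep * j0)/(-1 * hseq k)))/(sin (PI * hseq k)/hseq k)).
    - intros k. specialize (hs k). change (Rbar_loc_seq (INR n) k) with (INR n + hseq k). unfold besselY_quot.
      turn ((INR n + hseq k) * PI) into (INR n * PI + PI * hseq k). rewrite sin_plus, cos_plus, sin_int, cos_int.
      turn (INR n + 1 * hseq k) into (INR n + hseq k). turn (- INR n + -1 * hseq k) into (- (INR n + hseq k)).
      set (A := besselJ (INR n + hseq k) (exp t)). set (B := besselJ (- (INR n + hseq k)) (exp t)). set (c := cos (PI * hseq k)).
      (* At [k = 0] the shift is 1 and the sine vanishes; both quotients are then 0 by the
         convention on division by 0. *)
      have s : sin (PI * hseq k) <> 0 \/ sin (PI * hseq k) = 0. destruct s as [s|s].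
      + set (sn := sin (PI * hseq k)) in *. apply Rmult_eq_reg_l with ep; auto.
        transitivity ((ep * c * (A - j0) + ep * j0 * (c - 1) - ep * ep * (B - ep * j0))/sn); [obv|].
        transitivity ((A * (ep * c) - B)/sn); [rewrite e2; field; auto|obv].
      + rewrite s. unfold Rdiv. now rewrite !Rmult_0_l, !Rmult_0_r, Rplus_0_l, Rinv_0, !Rmult_0_r.
    - turn (JV (Z.of_nat n) t + ep * JV (- Z.of_nat n) t) into (1 * JV (Z.of_nat n) t + j0 * 0 + ep * JV (- Z.of_nat n) t).
      apply is_lim_seq_div'; [|pos|lra].
      repeat apply is_lim_seq_plus'; apply is_lim_seq_mult'; auto; apply is_lim_seq_const. }
  unfold Lim. apply is_lim_seq_unique in L. rewrite L. reflexivity.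
Qed.

(** Independence of the two solutions is not asserted here. It is recovered later from the fact that
    the zeros of the cross-product form a list. *)
Lemma bessel_pair nu : 0 <= nu -> exists ka v v1, sol (bq nu) v v1 /\
  (forall t, besselJ nu (exp t) = ka * U nu t) /\ (forall t, besselY nu (exp t) = v t).
Proof.
  intros Hn. exists (exp (- nu * ln 2) * rGamma (nu + 1)).
  assert (S : forall mu, (mu = nu \/ mu = - nu) -> exists w, sol (bq nu) (fun t => besselJ mu (exp t)) w).
  { intros mu Hm. exists (fun t => exp (- mu * ln 2) * frobU1 mu (Jc mu) t).
    have Q := frobU_sol mu (Jc mu) (Jc_entire mu) (Jc_rec mu). intros t. destruct (Q t) as [a b]. split.
    - apply is_derive_ext with (fun t => exp (- mu * ln 2) * frobU mu (Jc mu) t); [intros; symmetry; apply besselJ_frob|].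
      apply (is_derive_scal (frobU mu (Jc mu)) t (exp (- mu * ln 2)) _ a).
    - replace (- bq nu t * besselJ mu (exp t)) with (exp (- mu * ln 2) * (- bq mu t * frobU mu (Jc mu) t)).
      + apply (is_derive_scal (frobU1 mu (Jc mu)) t (exp (- mu * ln 2)) _ b).
      + rewrite besselJ_frob. unfold bq. obv. }
  destruct (Req_dec (sin (nu * PI)) 0) as [e|e].
  - destruct (sin_eq_0_0 _ e) as [k Ek]. have P := PI_RGT_0.
    have Ek' : nu = IZR k.
    have Hk : (0 <= k)%Z by (apply le_IZR; lra). set (n := Z.to_nat k).
    have En : nu = INR n by (rewrite Ek'; unfold n; rewrite INR_IZR_INZ, Z2Nat.id; auto).
    exists (fun t => (JV (Z.of_nat n) t + (-1)^n * JV (- Z.of_nat n) t)/PI), (fun t => (JV1 (Z.of_nat n) t + (-1)^n * JV1 (- Z.of_nat n) t)/PI).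
    splits.
    + intros t. destruct (JV_ode (Z.of_nat n) t) as [a a1]. destruct (JV_ode (- Z.of_nat n) t) as [b b1].
      have In : IZR (Z.of_nat n) = INR n by now rewrite <- INR_IZR_INZ.
      have Im : IZR (- Z.of_nat n) = - INR n by now rewrite opp_IZR, In.
      rewrite Im, besselJ_neg_int in b1. rewrite In in a1. rewrite En.
      split; unfold Rdiv; derive_tac; match goal with |- ?x = ?y => change (@eq R x y) end; [ring|].
      have e2 : (-1)^n * (-1)^n = 1 by (rewrite <- Rpow_mult_distr; turn (-1 * -1) into 1; apply pow1).
      unfold bq. set (ep := (-1)^n) in *.
      match goal with |- ?l = ?r => have F : l - r = (2 * INR n * besselJ (INR n) (exp t) * (1 - ep * ep))/PI end.
      rewrite e2 in F. unfold Rdiv in F. turn (1 - 1) into 0 in F. rewrite Rmult_0_r, Rmult_0_l in F. lra.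
    + intros t. apply besselJ_U. lra.
    + intros t. rewrite En. apply besselY_int.
  - destruct (S nu (or_introl eq_refl)) as [w Hw]. destruct (S (- nu) (or_intror eq_refl)) as [w' Hw'].
    have Q := sol_comb (bq nu) _ _ _ _ (cos (nu * PI)/sin (nu * PI)) (- / sin (nu * PI)) Hw Hw'.
    eexists; eexists; splits; [exact Q| |].
    + intros t. apply besselJ_U. lra.
    + intros t. unfold besselY. destruct (Req_EM_T (sin (nu * PI)) 0) as [e'|_]; [pos|]. unfold besselY_quot. field. auto.
Qed.

(** * The function [F] *)

Lemma bq_exp nu y : 0 < y -> bq nu (ln y) = y^2 - nu^2.
Proof. intros Hy. unfold bq. turn (2 * ln y) into (ln y + ln y). rewrite exp_plus, exp_ln by auto. ring. Qed.

Lemma Xi_0 nu : Xi nu 0 = 0.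
Proof. unfold Xi, Rdiv. rewrite Rmult_0_l, atan_0. ring. Qed.

Lemma bs_neg nu t : bq nu t <= 0 -> bs nu t = 0 /\ bxi nu t = 0.
Proof. intros H. have E : bs nu t = 0 by (unfold bs; now apply sqrt_neg_0). split; auto. unfold bxi. rewrite E. apply Xi_0. Qed.

Lemma bs_neg_ln nu y : 0 < y <= nu -> bs nu (ln y) = 0 /\ bxi nu (ln y) = 0.
Proof. intros Hy. apply bs_neg. rewrite bq_exp by lra. nra. Qed.

Lemma bs_nonneg nu t : 0 <= bs nu t.
Proof. apply sqrt_pos. Qed.

Lemma bs_sqr nu t : 0 <= bq nu t -> bs nu t^2 = bq nu t.
Proof. intros H. simpl. rewrite Rmult_1_r. now apply sqrt_sqrt. Qed.

Lemma bxi_cubic nu t : 0 < nu -> 0 <= bxi nu t <= bs nu t^3/(3 * nu^2).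
Proof.
  intros Hn. unfold bxi. destruct (Rle_lt_or_eq_dec _ _ (bs_nonneg nu t)) as [h|h].
  - split; [left; now apply Xi_pos|now apply Xi_cubic].
  - rewrite <- h, Xi_0. obv.
Qed.

(* The kink at [t = ln nu] is harmless: [bxi] behaves like the power 3/2 there. *)
Lemma bxi_derive_all nu t : 0 <= nu -> is_derive (bxi nu) t (bs nu t).
Proof.
  intros Hn. destruct (Rlt_dec 0 (bq nu t)) as [h|h]; [now apply bxi_derive|].
  have Hn' : 0 < nu by (destruct Hn as [c|c]; auto; subst; exfalso; apply h; unfold bq; have e := exp_pos (2 * t); lra).
  destruct (bs_neg nu t ok) as [E1 E2]. rewrite E1.
  have e2 : exp (2 * t) <= nu^2 by (unfold bq in h; lra).
  apply is_derive_Reals. intros eps Heps. set (d := Rmin (1/4) ((eps/2/(2 * nu))^2)).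
  have p : 0 < eps/2/(2 * nu).
  have d0 : 0 < d by (apply Rmin_pos; [lra|pos]).
  exists (mkposreal d d0). intros x Hx0 Hx. simpl in Hx. rewrite E2.
  have d1 : d <= 1/4 by apply Rmin_l. have d2 : d <= (eps/2/(2 * nu))^2 by apply Rmin_r.
  have ax := Rabs_pos_lt x Hx0. set (s := bs nu (t + x)).
  assert (s2 : s^2 <= 4 * nu^2 * Rabs x).
  { have n2 : 0 < nu^2. destruct (Rle_dec (bq nu (t + x)) 0) as [c|c].
    - unfold s. rewrite (proj1 (bs_neg _ _ c)). nra.
    - unfold s. rewrite bs_sqr by lra. unfold bq in *. turn (2 * (t + x)) into (2 * t + 2 * x). rewrite exp_plus.
      have a := Rle_abs x. have b := exp_pos (2 * t).
      assert (k : exp (2 * x) <= 1 + 4 * Rabs x).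
      { apply Rle_trans with (exp (2 * Rabs x) ).
        - destruct (Rle_lt_or_eq_dec _ _ a) as [g|g]; [left; apply exp_increasing; lra|rewrite <- g; lra].
        - destruct (exp_le_quadratic (2 * Rabs x)) as [_ w]; [pos|]. nra. }
      nra. }
  have s0 : 0 <= s by apply bs_nonneg.
  assert (s1 : s <= eps/2).
  { apply Rnot_lt_le; intro c. have : (eps/2)^2 < s^2.
    have : 4 * nu^2 * (eps/2/(2 * nu))^2 = (eps/2)^2.
    obv. }
  destruct (bxi_cubic nu (t + x) Hn') as [x0 x1]. fold s in x1.
  assert (x2 : bxi nu (t + x) <= 4/3 * Rabs x * s).
  { eapply Rle_trans; [exact x1|]. apply Rmult_le_reg_r with (3 * nu^2); [nra|].
    turn (s^3/(3 * nu^2) * (3 * nu^2)) into (s * s^2). nra. }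
  rewrite !Rminus_0_r. unfold Rdiv. rewrite Rabs_mult, Rabs_inv, (Rabs_pos_eq (bxi _ _)) by auto.
  apply Rmult_lt_reg_r with (Rabs x); auto. rewrite Rmult_assoc, Rinv_l, Rmult_1_r by lra. nra.
Qed.

Section Inversion.
Context (r R' : R) (hr : 0 < r) (hrR : r < R').

(** Because [bxi] vanishes left of the turning point, one formula covers both branches of [G]: for
    [R' t >= nu] it equals [PI t G(nu/t)], and it is 0 before. *)
Definition HH nu t := bxi nu (ln (R' * t)) - bxi nu (ln (r * t)).
Definition HH1 nu t := (bs nu (ln (R' * t)) - bs nu (ln (r * t)))/t.

Lemma HH_derive nu t : 0 <= nu -> 0 < t -> is_derive (HH nu) t (HH1 nu t).
Proof.
  intros Hn Ht.
  assert (D : forall rho, 0 < rho -> is_derive (fun t => bxi nu (ln (rho * t))) t (bs nu (ln (rho * t))/t)).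
  { intros rho Hr. eapply is_derive_eq; [apply (is_derive_comp (bxi nu) (fun t => ln (rho * t))); [now apply bxi_derive_all|]|].
    - instantiate (1 := / t). derive_tac; [nra|]. Rfield. lra.
    - change (/ t * bs nu (ln (rho * t)) = bs nu (ln (rho * t))/t). field. lra. }
  have h := is_derive_minus _ _ _ _ _ (D R' ok) (D r hr).
  eapply is_derive_eq; [exact h|]. change (bs nu (ln (R' * t))/t - bs nu (ln (r * t))/t = (bs nu (ln (R' * t)) - bs nu (ln (r * t)))/t).
  field. lra.
Qed.

Lemma bs_ln nu y : 0 <= nu -> 0 < y -> bs nu (ln y) <= y /\ (nu <= y -> bs nu (ln y)^2 = y^2 - nu^2).
Proof.
  intros Hn Hy. split.
  - unfold bs. rewrite <- (sqrt_pow2 y) at 2 by lra. apply sqrt_le_1_alt. rewrite bq_exp by auto. have : 0 <= nu^2. lra.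
  - intros H. rewrite bs_sqr; rewrite bq_exp; auto. nra.
Qed.

Lemma HH1_bounds nu t : 0 <= nu -> 0 < t -> 0 <= HH1 nu t <= R'.
Proof.
  intros Hn Ht. unfold HH1. have a := bs_nonneg nu (ln (r * t)). have Rt : 0 < R' * t. have rt : 0 < r * t.
  destruct (bs_ln nu (R' * t) Hn Rt) as [b _].
  assert (c : bs nu (ln (r * t)) <= bs nu (ln (R' * t))).
  { apply sqrt_le_1_alt, bq_mono. left. obv. }
  split; [pos|]. apply Rmult_le_reg_r with t; auto. unfold Rdiv. rewrite Rmult_assoc, Rinv_l by lra. lra.
Qed.

Definition hc := Rmin ((R'^2 - r^2)/(2 * R')) r.

Lemma hc_pos : 0 < hc.
Proof. apply Rmin_pos; auto. apply Rdiv_lt_0_compat; nra. Qed.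

(** If [r t >= nu], the squares of the two roots differ by [(R'^2 - r^2) t^2] while their sum is at
    most [2 R' t]. Otherwise only the outer root remains, and [mu^3 nu <= HH <= S^3/(3 nu^2)] forces
    [S >= mu nu], where [nu >= r t]. The two cases are the two entries of [hc]. *)
Lemma HH1_lower nu t mu : 0 <= nu -> 0 < t -> nu < R' * t -> 0 <= mu <= 1 -> mu^3 * nu <= HH nu t -> hc * mu <= HH1 nu t.
Proof.
  intros Hn Ht HR Hmu HH0. have Rt : 0 < R' * t. have rt : 0 < r * t.
  have c1 : hc <= (R'^2 - r^2)/(2 * R') by apply Rmin_l. have c2 : hc <= r by apply Rmin_r. have c0 := hc_pos.
  destruct (bs_ln nu (R' * t) Hn Rt) as [b b2]. specialize (b2 ok). unfold HH1. set (S := bs nu (ln (R' * t))) in *.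
  have S0 : 0 <= S by apply bs_nonneg.
  destruct (Rle_dec nu (r * t)) as [h|h].
  - destruct (bs_ln nu (r * t) Hn rt) as [a a2]. specialize (a2 h). set (s := bs nu (ln (r * t))) in *. have s0 : 0 <= s by apply bs_nonneg.
    apply Rle_trans with ((R'^2 - r^2)/(2 * R')); [nra|].
    apply Rmult_le_reg_r with (t * (2 * R')); [nra|].
    turn ((R'^2 - r^2)/(2 * R') * (t * (2 * R'))) into ((R'^2 - r^2) * t).
    turn ((S - s)/t * (t * (2 * R'))) into ((S - s) * (2 * R')).
    have E : (S - s) * (S + s) = (R'^2 - r^2) * t * t.
    have K : 0 < (R'^2 - r^2) * t.
    have : s <= S.
    apply Rmult_le_reg_r with t; auto. rewrite <- E. rewrite Rmult_assoc. apply Rmult_le_compat_l; nra.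
  - have q : bq nu (ln (r * t)) <= 0 by (rewrite bq_exp by auto; nra). destruct (bs_neg _ _ q) as [q1 q2].
    unfold HH in HH0. rewrite q2, Rminus_0_r in HH0. rewrite q1, Rminus_0_r.
    destruct (bxi_cubic nu (ln (R' * t)) ok) as [_ x1]. fold S in x1.
    have n3 : 0 < nu. have n2 : 0 < nu^2.
    assert (x2 : 3 * (mu * nu)^3 <= S^3).
    { turn (S^3) into (S^3/(3 * nu^2) * (3 * nu^2)). nra. }
    assert (x3 : mu * nu <= S).
    { apply Rnot_lt_le; intro c. apply cube_lt in c; auto. obv. }
    apply Rmult_le_reg_r with t; auto. turn (S/t * t) into S.
    have : hc * t <= nu. obv.
Qed.

Lemma HH_mono nu x y : 0 <= nu -> 0 < x -> x <= y -> HH nu x <= HH nu y.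
Proof.
  intros Hn Hx Hxy. apply deriv_nonneg_le; auto. intros t Ht. eexists; split; [apply HH_derive; lra|]. apply HH1_bounds; lra.
Qed.

Lemma HH_upper nu x y : 0 <= nu -> 0 < x -> x <= y -> HH nu y - HH nu x <= R' * (y - x).
Proof.
  intros Hn Hx Hxy. assert (R' * x - HH nu x <= R' * y - HH nu y); [|lra].
  apply (deriv_nonneg_le (fun t => R' * t - HH nu t)); auto. intros t Ht. exists (R' - HH1 nu t). split.
  - apply (is_derive_minus (fun t => R' * t) (HH nu)); [derive_tac; Rring|apply HH_derive; lra].
  - destruct (HH1_bounds nu t); lra.
Qed.

Lemma HH_zero nu t : 0 < t -> R' * t <= nu -> HH nu t = 0.
Proof.
  intros Ht H. unfold HH. rewrite (proj2 (bs_neg_ln nu (R' * t) ok)), (proj2 (bs_neg_ln nu (r * t) ok)). ring.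
Qed.

Lemma HH_inv nu x y mu : 0 <= nu -> 0 < x -> 0 < y -> 0 < mu <= 1 -> mu^3 * nu <= HH nu x -> mu^3 * nu <= HH nu y ->
  hc * mu * Rabs (x - y) <= Rabs (HH nu x - HH nu y).
Proof.
  intros Hn Hx Hy Hmu. have m3 : 0 < mu^3.
  assert (G : forall x y, 0 < x -> x <= y -> mu^3 * nu <= HH nu x -> hc * mu * (y - x) <= HH nu y - HH nu x).
  { clear x y Hx Hy. intros x y Hx Hxy H. assert (HH nu x - hc * mu * x <= HH nu y - hc * mu * y); [|lra].
    apply (deriv_nonneg_le (fun t => HH nu t - hc * mu * t)); auto. intros t Ht. exists (HH1 nu t - hc * mu). split.
    - apply (is_derive_minus (HH nu) (fun t => hc * mu * t)); [apply HH_derive; lra|derive_tac; Rring].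
    - have M := HH_mono nu x t Hn Hx ok.
      assert (hc * mu <= HH1 nu t); [|lra]. apply HH1_lower; try lra.
      destruct Hn as [Hn|Hn]; [|obv]. apply Rnot_le_lt; intro c. rewrite (HH_zero nu t) in M by lra. nra. }
  intros h1 h2. destruct (Rle_dec x y) as [c|c].
  - rewrite (Rabs_left1 (x - y)) by lra. have g := G x y Hx c h1. have m := HH_mono nu x y Hn Hx c. rewrite Rabs_left1 by lra. lra.
  - rewrite (Rabs_pos_eq (x - y)) by lra. have g := G y x Hy ok h2. have m := HH_mono nu y x Hn Hy ok. rewrite Rabs_pos_eq by lra. lra.
Qed.

Lemma HH_pos nu y : 0 <= nu -> 0 < y -> nu < R' * y -> 0 < HH nu y.
Proof.
  intros [Hn|Hn] Hy H.
  - assert (K : forall y, 0 < y -> nu < R' * y -> r * y <= nu -> 0 < HH nu y).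
    { clear y Hy H. intros y Hy H h. unfold HH. rewrite (proj2 (bs_neg_ln nu (r * y) ok)), Rminus_0_r.
      apply bxi_pos; auto. rewrite bq_exp; nra. }
    destruct (Rle_dec (r * y) nu) as [h|h]; [obv|]. have e : r * (nu/r) = nu.
    have p : 0 < nu/r. have : nu/r <= y.
    apply Rlt_le_trans with (HH nu (nu/r)); [apply K; nra|apply HH_mono; lra].
  - subst nu. unfold HH, bxi, Xi. rewrite !Rmult_0_l, !Rminus_0_r.
    assert (E : forall z, 0 < z -> bs 0 (ln z) = z).
    { intros z Hz. unfold bs. rewrite bq_exp by auto. turn (z^2 - 0^2) into (z^2). apply sqrt_pow2; lra. }
    rewrite !E by nra. nra.
Qed.

(** [HH] is constant up to [nu/R'] and its slope vanishes there, so a positive [mu] is only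
    available from an intermediate point on; it depends on that point. *)
Lemma HH_lt nu x y : 0 <= nu -> 0 < x -> nu <= R' * x -> x < y -> HH nu x < HH nu y.
Proof.
  intros Hn Hx H Hxy. set (z := (x + y)/2). have Hz : x < z < y. clearbody z.
  have h := HH_pos nu z Hn ok ok. have c := hc_pos.
  set (mu := Rmin 1 (HH nu z/(nu + 1))). have M0 : 0 < mu by (apply Rmin_pos; [lra|pos]).
  have M1 : mu <= 1 by apply Rmin_l. have M2 : mu <= HH nu z/(nu + 1) by apply Rmin_r.
  assert (M3 : mu^3 * nu <= HH nu z).
  { have : mu^3 <= mu. have : HH nu z/(nu + 1) * (nu + 1) = HH nu z. nra. }
  have m1 := HH_mono nu x z Hn Hx ok. have m2 := HH_mono nu z y Hn ok ok.
  have I := HH_inv nu z y mu Hn ok ok ok M3 ok. rewrite !Rabs_left1 in I by lra.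
  have : 0 < hc * mu * (y - z). lra.
Qed.

Lemma g_bxi nu rho t : 0 < rho -> 0 < t -> 0 <= nu <= rho * t -> PI * (rho * t * g (nu/t/rho)) = bxi nu (ln (rho * t)).
Proof.
  intros Hr Ht Hn. have P := PI_RGT_0. have rt : 0 < rho * t. unfold g, bxi, Xi.
  set (x := nu/t/rho). have Ex : x = nu/(rho * t).
  assert (x1 : 0 <= x <= 1).
  { rewrite Ex. split; [pos|]. apply Rmult_le_reg_r with (rho * t); auto. unfold Rdiv. rewrite Rmult_assoc, Rinv_l by lra. lra. }
  assert (Es : bs nu (ln (rho * t)) = rho * t * sqrt (1 - x^2)).
  { unfold bs. rewrite bq_exp by auto. rewrite <- (sqrt_pow2 (rho * t)) at 2 by lra. rewrite <- sqrt_mult_alt by nra. f_equal. obv. }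
  rewrite Es. destruct (proj1 Hn) as [Hn0|Hn0].
  - have x0 : 0 < x. rewrite acos_atan by auto. rewrite Rsqr_pow2.
    turn (rho * t * sqrt (1 - x^2)/nu) into (sqrt (1 - x^2)/x).
    rewrite Ex at 2. field. lra.
  - rewrite Ex, <- Hn0. obv.
Qed.

(** The scalings [s] that put [(nu/s, v/s)] on the graph are the solutions of [HH nu s = PI v] with
    [R' s >= nu]. Strict monotonicity leaves just one, so the infimum is over a single point. *)
Lemma F_spec nu v t : 0 <= nu -> 0 < t -> nu <= R' * t -> HH nu t = PI * v -> F r R' nu v = t.
Proof.
  intros Hn Ht HR HE. have P := PI_RGT_0.
  assert (K : forall s, 0 < s -> (graph_G r R' (nu/s) (v/s) <-> (nu <= R' * s /\ HH nu s = PI * v))).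
  { intros s Hs. have e0 : 0 <= nu/s.
    assert (e1 : forall rho, nu/s <= rho <-> nu <= rho * s).
    { intros rho. split; intros h; [|apply Rmult_le_reg_r with s; auto; unfold Rdiv; rewrite Rmult_assoc, Rinv_l; lra].
      turn nu into (nu/s * s). nra. }
    assert (GE : nu <= R' * s -> PI * (s * G r R' (nu/s)) = HH nu s).
    { intros h. unfold G, HH. destruct (Rle_dec (nu/s) r) as [c|c].
      - apply e1 in c. rewrite <- !g_bxi by lra. ring.
      - rewrite e1 in c. rewrite <- g_bxi by lra. rewrite (proj2 (bs_neg_ln nu (r * s) ok)). ring. }
    unfold graph_G. rewrite e1. split.
    - intros [[_ h1] h2]. split; auto. rewrite <- GE, <- h2 by auto. field. lra.
    - intros [h1 h2]. splits; auto. rewrite <- GE in h2 by auto. apply Rmult_eq_reg_l with (PI * s); [|nra].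
      transitivity (PI * v); [obv|lra]. }
  unfold F, minkowski_functional. rewrite (is_glb_Rbar_unique _ (Finite t)); auto. split.
  - intros s [Hs Gs]. apply K in Gs; auto. destruct Gs as [g1 g2]. simpl. apply Rnot_lt_le; intro c.
    have h := HH_lt nu s t Hn Hs g1 c. lra.
  - intros b Hb. apply (Hb t). split; auto. apply K; auto.
Qed.

Lemma HH_surj nu v : 0 <= nu -> 0 <= v -> 0 < nu \/ 0 < v -> exists t, 0 < t /\ nu <= R' * t /\ HH nu t = v.
Proof.
  intros Hn Hv Hnv. have c := hc_pos.
  assert (a : exists a, 0 < a /\ nu <= R' * a /\ HH nu a <= v).
  { destruct Hn as [Hn|Hn].
    - exists (nu/R'). have E : R' * (nu/R') = nu. splits; [pos|lra|rewrite HH_zero; auto; [pos|lra]].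
    - subst nu. exists (v/R'). have p : 0 < v/R'. splits; [lra|nra|].
      assert (b : bxi 0 (ln (R' * (v/R'))) <= R' * (v/R')).
      { unfold bxi, Xi. rewrite Rmult_0_l, Rminus_0_r. apply bs_ln; nra. }
      unfold HH. have : 0 <= bxi 0 (ln (r * (v/R'))) by (unfold bxi, Xi; rewrite Rmult_0_l, Rminus_0_r; apply bs_nonneg).
      turn (R' * (v/R')) into v in *. lra. }
  destruct a as (a & a0 & a1 & a2). destruct (Rle_lt_or_eq_dec _ _ a2) as [a3|a3]; [|now exists a].
  set (z := a + nu/r + 1). have zz : 0 <= nu/r. have rz : nu <= r * z by (unfold z; have : r * (nu/r) = nu; nra).
  set (h := HH nu z). have hp : 0 < h by (apply HH_pos; auto; unfold z in *; nra).
  set (mu := Rmin 1 (h/(nu + 1))). have M0 : 0 < mu by (apply Rmin_pos; [lra|pos]).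
  have M1 : mu <= 1 by apply Rmin_l. have M2 : mu <= h/(nu + 1) by apply Rmin_r.
  have M3 : mu^3 * nu <= h by (have : mu^3 <= mu; have : h/(nu + 1) * (nu + 1) = h; nra).
  set (b := z + (v + 1)/(hc * mu)). have bp : 0 < (v + 1)/(hc * mu).
  have m := HH_mono nu z b Hn ok ltac:(unfold b; lra).
  have I := HH_inv nu z b mu Hn ok ok ok M3 ltac:(fold h in m; lra).
  rewrite !Rabs_left1 in I by (unfold b; lra). fold h in I. turn (hc * mu * - (z - b)) into (v + 1) in I.
  fold h in m. rewrite Rabs_left1 in I by lra. have Hb : 0 < HH nu b - v.
  assert (Cf : forall t, a <= t <= b -> continuity_pt (fun t => HH nu t - v) t).
  { intros t Ht. apply (is_derive_ct _ _ (HH1 nu t)). eapply is_derive_eq; [apply (is_derive_minus (HH nu) (fun _ => v)); [apply HH_derive; lra|apply is_derive_const]|].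
    change (HH1 nu t - 0 = HH1 nu t). ring. }
  destruct (Ranalysis5.IVT_interv (fun t => HH nu t - v) a b Cf ltac:(unfold b, z; lra) ok Hb) as (t & Ht & Et).
  exists t. obv.
Qed.

(* Near the turning point [nu / R'], a bounded phase confines [x] to the scale [nu^(1/3)]. *)
Lemma HH_crude C : 1 <= C -> exists D V, 0 < D /\ 0 < V /\ forall nu n3 x, 0 < n3 -> nu = n3^3 -> V < nu -> 0 < x ->
  nu <= R' * x -> HH nu x <= C -> R' * x - nu <= D * n3.
Proof.
  intros HC. set (rho := R'/r). have Hrho : 1 < rho by (apply Rmult_lt_reg_r with r; auto; unfold rho; turn (R'/r * r) into R'; lra).
  set (E := 3 * C * rho^2). have HE : 1 <= E by (unfold E; nra). set (D := E^2). have HD : 1 <= D by (unfold D; nra).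
  (* For [nu^(1/3)] beyond [K] the phase at [nu/r] already exceeds [C], which excludes points right
     of the inner turning point. *)
  set (K := 1 + D/(rho - 1)). have HK : 1 < K by (have : 0 < D/(rho - 1); unfold K; lra).
  have K3 : 1 <= K^3.
  exists D, (K^3). splits; [lra|lra|]. intros nu n3 x H3 En HV Hx HR H.
  assert (Hn3 : K < n3).
  { apply Rnot_le_lt; intro c. have : n3^3 <= K^3. lra. }
  have Hn : 0 < nu.
  assert (G : forall x, 0 < x -> nu <= R' * x -> r * x <= nu -> HH nu x <= C -> R' * x - nu <= D * n3).
  { clear x Hx HR H. intros x Hx HR Hr H. destruct HR as [HR|HR]; [|nra]. have Rx : 0 < R' * x.
    destruct (bs_ln nu (R' * x) ok Rx) as [_ b]. specialize (b ok).
    unfold HH in H. rewrite (proj2 (bs_neg_ln nu (r * x) ok)), Rminus_0_r in H. unfold bxi in H.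
    set (S := bs nu (ln (R' * x))) in *. have S0 : 0 < S by (apply sqrt_lt_R0; rewrite bq_exp; nra).
    destruct (Xi_cubic nu S Hn S0) as [h _]. have Rr : R' * x <= rho * nu by (turn (R' * x) into (rho * (r * x)); nra).
    assert (k : S^3 <= E * n3^6).
    { have p : 0 < 3 * (nu^2 + S^2). turn (S^3) into (S^3/(3 * (nu^2 + S^2)) * (3 * (nu^2 + S^2))).
      turn (E * n3^6) into (C * (3 * (rho * nu)^2)).
      have : nu^2 + S^2 <= (rho * nu)^2.
      obv. }
    assert (s : S <= E * n3^2).
    { apply Rnot_lt_le; intro c. apply cube_lt in c; [|pos].
      turn ((E * n3^2)^3) into (E^3 * n3^6) in c. have : E <= E^3. have : 0 < n3^6. nra. }
    have s2 : S^2 <= D * n3 * nu by (rewrite En; unfold D; turn (E^2 * n3 * n3^3) into ((E * n3^2)^2); apply pow_incr; lra).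
    have : (R' * x - nu) * (R' * x + nu) = S^2.
    obv. }
  destruct (Rle_dec (r * x) nu) as [c|c]; [obv|exfalso].
  have e : r * (nu/r) = nu. have p : 0 < nu/r.
  have m := HH_mono nu (nu/r) x ok p ok.
  have g := G (nu/r) p ok ok ok. turn (R' * (nu/r)) into (rho * nu) in g.
  have q : (rho - 1) * n3^2 <= D.
  have : D = (rho - 1) * (K - 1). have : K <= n3^2. nra.
Qed.
End Inversion.

(** * Below the turning point *)

Lemma exp_ge_sqr x : 0 <= x -> (1 + x)^2 <= exp (2 * x).
Proof.
  intros Hx. turn (2 * x) into (x + x). rewrite exp_plus. have h : 1 + x <= exp x by apply exp_ineq1_le. nra.
Qed.

(** * Exponential growth where the coefficient is at most [- m^2] *)

Section Growth.
Context (q u u1 : R -> R) (m t0 ta : R) (Hs : sol q u u1) (Hm : 0 < m) (Hq : forall t, t0 <= t <= ta -> q t <= - m^2).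
Let z t := u1 t + m * u t.
Let w t := u1 t - m * u t.
Context (H0 : 0 <= u t0 * z t0) (Hz : z t0 <> 0) (Hw : w t0^2 <= 9 * z t0^2).

Lemma growth_uz t : t0 <= t <= ta -> 0 <= u t * z t.
Proof.
  intros Ht. apply Rle_trans with (u t0 * z t0); auto. apply (deriv_nonneg_le (fun t => u t * z t)); [lra|].
  intros s Hs'. destruct (Hs s) as [a b]. exists (z s^2 + (- q s - m^2) * u s^2). split.
  - unfold z. derive_tac. Rring.
  - have Hqs := Hq s ok. nra.
Qed.

(** [z] is the growing component of [u'' = m^2 u]. In general [z' = m z + (- q - m^2) u], and
    [u z >= 0] means that the extra term pushes [z] in its own direction. *)
Lemma growth_z t : t0 <= t <= ta -> z t0^2 * exp (2 * m * (t - t0)) <= z t^2.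
Proof.
  intros Ht. assert (K : z t0^2 * exp (- (2 * m * (t0 - t0))) <= z t^2 * exp (- (2 * m * (t - t0)))).
  { apply (deriv_nonneg_le (fun t => z t^2 * exp (- (2 * m * (t - t0))))); [lra|].
    intros s Hs'. destruct (Hs s) as [a b]. exists (2 * (- q s - m^2) * (u s * z s) * exp (- (2 * m * (s - t0)))). split.
    - unfold z, Rminus. derive_tac. Rring.
    - have Hqs := Hq s ok. have g := growth_uz s ok. obv. }
  turn (- (2 * m * (t0 - t0))) into 0 in K. rewrite exp_0, Rmult_1_r, exp_Ropp in K. have e := exp_pos (2 * m * (t - t0)).
  apply Rmult_le_reg_r with (/ exp (2 * m * (t - t0))); [pos|]. rewrite Rmult_assoc, Rinv_r by lra. lra.
Qed.

Lemma growth_nonzero t : t0 < t <= ta -> u t <> 0.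
Proof.
  intros Ht e. have Z : 0 < z t0^2.
  assert (K : u t0 * z t0 - z t0^2 * t0 <= u t * z t - z t0^2 * t).
  { apply (deriv_nonneg_le (fun t => u t * z t - z t0^2 * t)); [lra|].
    intros s Hs'. destruct (Hs s) as [a b]. exists (z s^2 + (- q s - m^2) * u s^2 - z t0^2). split.
    - unfold z, Rminus. derive_tac. Rring.
    - have Hqs := Hq s ok. have g := growth_z s ok.
      have : 1 <= exp (2 * m * (s - t0)) by (have h := exp_ineq1_le (2 * m * (s - t0)); nra). nra. }
  obv.
Qed.

Lemma growth_uu1 t : t0 <= t <= ta -> z t0^2 * (exp (2 * m * (t - t0)) - 9) <= 4 * m * (u t * u1 t).
Proof.
  intros Ht. assert (K : 4 * m * (u t0 * u1 t0) - z t0^2 * exp (2 * m * (t0 - t0)) <= 4 * m * (u t * u1 t) - z t0^2 * exp (2 * m * (t - t0))).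
  { apply (deriv_nonneg_le (fun t => 4 * m * (u t * u1 t) - z t0^2 * exp (2 * m * (t - t0)))); [lra|].
    intros s Hs'. destruct (Hs s) as [a b]. exists (4 * m * (u1 s^2 - q s * u s^2) - z t0^2 * (2 * m * exp (2 * m * (s - t0)))). split.
    - unfold Rminus. derive_tac. Rring.
    - have Hqs := Hq s ok. have g := growth_z s ok.
      have k2 := pow2_ge_0 (w s). unfold z, w in *. nra. }
  turn (2 * m * (t0 - t0)) into 0 in K. rewrite exp_0 in K. unfold z, w in *. nra.
Qed.

(** From [4 m u u1 = z^2 - w^2] and [w^2 <= 9 z^2] at the start, the product [u u1] is nonnegative
    after time [2/m], as [exp 4 >= 9]. From then on [u1^2] grows with it, and the length 10 leaves
    room to reach an eighth of the full exponential. *)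
Lemma growth : 10 <= m * (ta - t0) -> 0 <= u ta * u1 ta /\ z t0^2 * exp (2 * m * (ta - t0))/8 <= u1 ta^2.
Proof.
  intros HT. set (tm := t0 + 2/m). have Em : m * (tm - t0) = 2.
  have Htm : t0 <= tm <= ta.
  assert (e9 : forall t, tm <= t <= ta -> 9 <= exp (2 * m * (t - t0))).
  { intros t Ht. have g := exp_ge_sqr (m * (t - t0)) ok. turn (2 * (m * (t - t0))) into (2 * m * (t - t0)) in g.
    have : 2 <= m * (t - t0). nra. }
  assert (UU : forall t, tm <= t <= ta -> 0 <= u t * u1 t).
  { intros t Ht. have g := growth_uu1 t ok. specialize (e9 t Ht). nra. }
  split; [apply UU; lra|].
  assert (K : u1 tm^2 - z t0^2 * (exp (2 * m * (tm - t0))/4 - 9/2 * (m * (tm - t0))) <= u1 ta^2 - z t0^2 * (exp (2 * m * (ta - t0))/4 - 9/2 * (m * (ta - t0)))).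
  { apply (deriv_nonneg_le (fun t => u1 t^2 - z t0^2 * (exp (2 * m * (t - t0))/4 - 9/2 * (m * (t - t0))))); [lra|].
    intros s Hs'. destruct (Hs s) as [a b]. exists (2 * (- q s) * (u s * u1 s) - z t0^2 * (m * (exp (2 * m * (s - t0))/2) - 9/2 * m)). split.
    - unfold Rminus, Rdiv. derive_tac. Rfield.
    - have Hqs := Hq s ok. have g := growth_uu1 s ok. specialize (UU s Hs').
      nra. }
  rewrite Em in K. turn (2 * m * (tm - t0)) into 4 in K.
  set (x := m * (ta - t0) - 2). turn (2 * m * (ta - t0)) into (4 + 2 * x) in *. turn (m * (ta - t0)) into (x + 2) in *.
  rewrite exp_plus in *. have e4 : 9 <= exp 4 by (have h := exp_ge_sqr 2 ok; turn (2 * 2) into 4 in h; lra).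
  have ex := exp_ge_sqr x ok.
  have : exp 4/4 + 9/2 * x <= exp 4 * exp (2 * x)/8 by nra.
  nra.
Qed.
End Growth.

(* Beyond [ta] the amplitude cannot fall back: the energy [u1^2 + q u^2] increases with [q]. *)
Lemma amplitude_after nu u u1 ta Q t : sol (bq nu) u u1 -> 0 < nu -> ta <= ln nu -> 0 <= u ta * u1 ta -> ta <= t -> bq nu t <= Q -> 0 <= Q ->
  u1 ta^2 <= (u t^2 + u1 t^2) * (1 + Q).
Proof.
  intros Hs Hn Hta H0 Ht HQ HQ0.
  assert (B : forall s, s <= ln nu -> bq nu s <= 0).
  { intros s h. apply Rle_trans with (bq nu (ln nu)); [now apply bq_mono|]. rewrite bq_exp by auto. lra. }
  assert (A1 : forall s, ta <= s <= ln nu -> 0 <= u s * u1 s).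
  { intros s h. apply Rle_trans with (u ta * u1 ta); auto. apply (deriv_nonneg_le (fun s => u s * u1 s)); [lra|].
    intros x Hx. destruct (Hs x) as [a b]. exists (u1 x^2 - bq nu x * u x^2). split; [derive_tac; Rring|].
    specialize (B x ok). nra. }
  assert (A2 : forall s, ta <= s <= ln nu -> u1 ta^2 <= u1 s^2).
  { intros s h. apply (deriv_nonneg_le (fun s => u1 s^2)); [lra|].
    intros x Hx. destruct (Hs x) as [a b]. exists (2 * - bq nu x * (u x * u1 x)). split; [derive_tac; Rring|].
    specialize (A1 x ok). specialize (B x ok). obv. }
  destruct (Rle_dec t (ln nu)) as [c|c]; [specialize (A2 t ok); nra|].
  specialize (A2 (ln nu) ok).
  assert (E : u1 (ln nu)^2 + bq nu (ln nu) * u (ln nu)^2 <= u1 t^2 + bq nu t * u t^2).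
  { apply (deriv_nonneg_le (fun s => u1 s^2 + bq nu s * u s^2)); [lra|].
    intros x Hx. destruct (Hs x) as [a b]. exists (2 * exp (2 * x) * u x^2). split; [unfold bq in *; derive_tac; Rring|].
    obv. }
  rewrite bq_exp in E by auto. nra.
Qed.

Lemma small_angle D : Rabs D < PI/2 -> Rabs (sin D) <= 1/2 -> Rabs D <= 2 * Rabs (sin D).
Proof.
  assert (G : forall x, 0 <= x < PI/2 -> sin x <= 1/2 -> x <= 2 * sin x).
  { intros x Hx Hs. assert (x3 : x <= PI/3).
    { apply Rnot_lt_le; intro c. have h := sin_increasing_1 (PI/3) x ok ok ok ok c. rewrite sin_PI3 in h.
      have s := sqrt_sqrt 3 ok. have s0 := sqrt_pos 3. nra. }
    assert (2 * sin 0 - 0 <= 2 * sin x - x); [|rewrite sin_0 in *; lra].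
    apply (deriv_nonneg_le (fun x => 2 * sin x - x)); [lra|]. intros t Ht. exists (2 * cos t - 1). split; [derive_tac; Rring|].
    have h := cos_decr_1 t (PI/3) ok ok ok ok ok. rewrite cos_PI3 in h. lra. }
  intros HD Hs. destruct (Rle_dec 0 D) as [c|c].
  - rewrite Rabs_pos_eq in * by lra. have : 0 <= sin D by (apply sin_ge_0; lra). rewrite Rabs_pos_eq in * by auto. apply G; lra.
  - rewrite Rabs_left in HD |- * by lra. rewrite <- Rabs_Ropp, <- sin_neg in *. have : 0 <= sin (- D) by (apply sin_ge_0; lra).
    rewrite Rabs_pos_eq in * by auto. apply G; lra.
Qed.

Lemma IVT_avoid (f : R -> R) a b p : a <= b -> (forall t, exists l, is_derive f t l) -> (forall t, a <= t <= b -> f t <> p) -> f a < p -> f b < p.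
Proof.
  intros Hab D N Ha. apply Rnot_le_lt; intro c.
  have C : Ranalysis1.continuity f by (intros t; destruct (D t) as [l Hl]; eapply is_derive_ct; exact Hl).
  destruct (IVT_gen f a b p C) as (t & Ht & E); [rewrite Rmin_left, Rmax_right by lra; lra|].
  rewrite Rmin_left, Rmax_right in Ht by lra. now apply (N t).
Qed.

Lemma Sh_lip_gen a b x y : 0 < a -> Rabs (Sh a b x - Sh a b y) <= (1 + a^2 + b^2)/a * Rabs (x - y).
Proof.
  intros Ha. set (K := (1 + a^2 + b^2)/a).
  assert (D : forall t, exists l, is_derive (Sh a b) t l /\ 0 <= l <= K).
  { intros t. have p := Shn_pos a b t Ha. have lw := Shn_lower a b t Ha. exists (a/Shn a b t). split.
    - eapply is_derive_eq; [apply (Sh_derive (fun _ => a) (fun _ => b) (fun t => t) 0 0 1 t Ha); [apply (is_derive_const a)|apply (is_derive_const b)|apply (is_derive_id t)]|].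
      change ((a * 1 - sin t * cos t * 0 - sin t^2 * 0)/Shn a b t = a/Shn a b t). field. lra.
    - split; [pos|]. apply Rmult_le_reg_r with (Shn a b t); auto. unfold Rdiv at 1. rewrite Rmult_assoc, Rinv_l, Rmult_1_r by lra.
      turn a into (K * (a^2/(1 + a^2 + b^2))) at 1. obv. }
  assert (G : forall x y, x <= y -> 0 <= Sh a b y - Sh a b x <= K * (y - x)).
  { intros x' y' h. split.
    - assert (Sh a b x' <= Sh a b y'); [|lra]. apply deriv_nonneg_le; auto. intros t _. destruct (D t) as (l & d & dl). exists l. split; auto; lra.
    - assert (K * x' - Sh a b x' <= K * y' - Sh a b y'); [|lra]. apply (deriv_nonneg_le (fun t => K * t - Sh a b t)); auto.
      intros t _. destruct (D t) as (l & d & dl). exists (K - l). split; [|lra].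
      apply (is_derive_minus (fun t => K * t) (Sh a b)); [derive_tac; Rring|pos]. }
  destruct (Rle_dec x y) as [c|c].
  - specialize (G x y c). rewrite !Rabs_left1 by lra. lra.
  - specialize (G y x ok). rewrite !Rabs_pos_eq by lra. lra.
Qed.

Lemma Rpower_dominates eps M : 0 < eps -> 0 < M -> exists V, 1 <= V /\ forall nu, V < nu -> M + M * ln nu <= Rpower nu eps.
Proof.
  intros He HM. set (K := 1 + M + 2 * M/eps). have k1 : 0 < 2 * M/eps.
  have HK : 1 < K.
  assert (V1 : 1 <= Rpower K (2/eps)).
  { rewrite <- (Rpower_O K) by lra. obv. }
  exists (Rpower K (2/eps)). split; auto. intros nu Hn. set (Z := Rpower nu (eps/2)).
  assert (HZ : K < Z).
  { replace K with (Rpower (Rpower K (2/eps)) (eps/2)).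
    - apply Rlt_Rpower_l; [lra|pos].
    - rewrite Rpower_mult. turn (2/eps * (eps/2)) into 1. apply Rpower_1; lra. }
  replace (Rpower nu eps) with (Z * Z) by (unfold Z; rewrite <- Rpower_plus; f_equal; field).
  assert (L : ln nu <= 2/eps * Z).
  { replace (ln nu) with (2/eps * ln Z) by (unfold Z, Rpower; rewrite ln_exp; field; lra).
    apply Rmult_le_compat_l; [pos|]. have h := exp_ineq1_le (ln Z). rewrite exp_ln in h by lra. lra. }
  unfold K in *. nra.
Qed.

(** [ta] is halfway through the forbidden window. Left of it the coefficient stays below [- m^2]
    with [m >= N/2], and the way to it takes the time [Y/(2N)] at least: this is the exponent
    [Y/4]. *)
Lemma wtime_minus nu N Y : 0 < nu -> 0 < N -> N^3 = 2 * nu^2 -> 1 <= Y -> 2 * Y <= N ->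
  let ta := wtime nu N (- (Y/2)) in let m := sqrt (- bq nu ta) in
  wtime nu N (- Y) <= ta <= ln nu /\ bq nu ta = - m^2 /\ N/2 <= m /\ Y/4 <= m * (ta - wtime nu N (- Y)).
Proof.
  intros Hn HN HE HY HYN ta m. set (a := Y/(2 * N)). have aN : a * N = Y/2.
  have a0 : 0 < a. have a4 : a <= 1/4.
  have e1 : 1 + - (Y/2)/N = 1 - a. have e2 : 1 + - Y/N = 1 - 2 * a.
  assert (Eq : bq nu ta = - (nu^2 * (2 * a - a^2))).
  { unfold ta, wtime. rewrite bq_exp; rewrite e1; [ring|nra]. }
  have Hm2 : m^2 = nu^2 * (2 * a - a^2) by (unfold m; simpl; rewrite Rmult_1_r, sqrt_sqrt; rewrite Eq; nra).
  have m0 : 0 <= m.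
  have m2 : nu^2 * a <= m^2.
  assert (T : a <= ta - wtime nu N (- Y)).
  { unfold ta, wtime. rewrite e1, e2, <- ln_div by nra. turn (nu * (1 - a)/(nu * (1 - 2 * a))) into (/ ((1 - 2 * a)/(1 - a))).
    rewrite ln_Rinv by pos. have h := exp_ineq1_le (ln ((1 - 2 * a)/(1 - a))). rewrite exp_ln in h by pos.
    assert ((1 - 2 * a)/(1 - a) <= 1 - a); [|lra]. apply Rmult_le_reg_r with (1 - a); [lra|]. unfold Rdiv. rewrite Rmult_assoc, Rinv_l by lra. nra. }
  splits; auto.
  - lra.
  - apply wtime_le_ln; auto; rewrite ?e1; lra.
  - rewrite Hm2, Eq. ring.
  - apply Rnot_lt_le; intro c. have : N^2/4 <= nu^2 * a.
    nra.
  - apply Rnot_lt_le; intro c. have c2 : m * a < Y/4. have p : 0 <= m * a.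
    have : nu^2 * a * a^2 = Y^3/16 by (turn (nu^2) into (N^3/2); turn (N^3/2 * a * a^2) into ((a * N)^3/2); rewrite aN; field).
    nra.
Qed.

Definition traced (w w1 al : R -> R) := forall t, exists n, 0 < n /\ w t = n * sin (al t) /\ w1 t = n * cos (al t).

(** Whatever the boundary condition, both [w] and the recessive [U] have grown by the square root of
    [E = exp (2 m (ta - t0))] at the turning point, up to polynomial factors, while their Wronskian
    is constant. With [Y >= nu^eps] the factor [E] beats every power of [nu], so the angles
    practically coincide and [w] inherits the exact outcome [PI/4]. *)
Lemma below_turning d L eps : 0 < eps -> 1 <= L -> exists V, 1 <= V /\ forall nu Y al w w1 A t0 t, V < nu -> Rpower nu eps <= Y -> 2 * Y <= Nof nu ->
  prufer (bq nu) al -> sol (bq nu) w w1 -> traced w w1 al -> bcond A d -> al t0 = A -> t0 <= wtime nu (Nof nu) (- Y) ->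
  t <= ln (L * nu) -> 1 <= bq nu t -> Rabs (bwkb nu al t - (bxi nu t + PI/4)) <= bB nu t + / nu.
Proof.
  intros He HL. destruct J_outcome as (V1 & YJ & HV1 & HYJ & HJ). destruct (Nof_large (4 * (1 + Rabs d))) as (V2 & HV2 & HN).
  (* Dictated by [ka1]: there [E] has to dominate [2 Q] times [48 (1 + |d|) L^5 nu^6] with
     [Q = L^2 nu^2], which is [C nu^8]. *)
  set (C := 96 * L^7 * (1 + Rabs d)). have dp := Rabs_pos d. have L7 : 1 <= L^7 by (apply pow_R1_Rle; auto).
  have HC : 96 <= C. set (M := 2 * C). destruct (Rpower_dominates eps M He ok) as (V3 & HV3 & HP).
  exists (Rmax (Rmax V1 V2) V3). split; [eapply Rle_trans; [exact HV3|apply Rmax_r]|].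
  intros nu Y al w w1 A t0 t HV HY HYN Hal Hw Htr HA At Ht0 Ht Hq.
  have v1 : V1 < nu by (eapply Rle_lt_trans; [eapply Rle_trans; [apply Rmax_l|apply Rmax_l]|exact HV]).
  have v2 : V2 < nu by (eapply Rle_lt_trans; [eapply Rle_trans; [apply Rmax_r|apply Rmax_l]|exact HV]).
  have v3 : V3 < nu by (eapply Rle_lt_trans; [apply Rmax_r|exact HV]).
  destruct (HJ nu v1) as (N100 & NJ & HJ'). specialize (HN nu v2). specialize (HP nu v3). have Hn : 1 < nu.
  destruct (Nof_spec nu ok) as [Np NE]. set (N := Nof nu) in *. have P := PI_RGT_0.
  have lnn : 0 < ln nu by (rewrite <- ln_1; apply ln_increasing; lra).
  have HY1 : 96 <= Y by (unfold M in HP; nra).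
  destruct (wtime_minus nu N Y ok Np NE ok HYN) as ((t1 & t2) & Em & mN & mT).
  set (ta := wtime nu N (- (Y/2))) in *. set (m := sqrt (- bq nu ta)) in *.
  have mt : Y/4 <= m * (ta - t0).
  set (E := exp (2 * m * (ta - t0))).
  assert (HE : C * nu^8 <= E).
  { apply Rle_trans with (exp (C + C * ln nu)).
    - rewrite exp_plus. apply Rmult_le_compat; [lra|pos|have h := exp_ineq1_le C; lra|].
      rewrite <- Rpower_pow by lra. unfold Rpower. replace (INR 8) with 8 by (simpl; ring).
      have : 8 * ln nu <= C * ln nu. destruct H as [H|H]; [left; now apply exp_increasing|obv].
    - unfold E. have H : C + C * ln nu <= 2 * m * (ta - t0) by (unfold M in HP; lra). destruct H as [H|H]; [left; now apply exp_increasing|rewrite H; lra]. }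
  have Ep : 0 < E.
  have Qm : forall s, t0 <= s <= ta -> bq nu s <= - m^2 by (intros s Hs; rewrite <- Em; apply bq_mono; lra).
  destruct (U_recessive nu (Rmin t0 (wtime nu N (- YJ))) ok) as (au & Hau & Hlau & Hqu).
  have HU := U_sol nu ok.
  assert (TrU : traced (U nu) (U1 nu) au).
  { intros s. destruct (Hlau s) as [a b]. exists (sqrt (U nu s^2 + U1 nu s^2)). splits; auto.
    apply sqrt_lt_R0. apply U_nonvanish; lra. }
  assert (B0 : bout nu au (PI/4)).
  { apply HJ'; auto. apply Hqu. split; [apply Rmin_r|]. apply wtime_le_ln; try lra.
    assert (YJ/N <= 1/10). { apply Rmult_le_reg_r with N; auto. unfold Rdiv at 1. rewrite Rmult_assoc, Rinv_l by lra. nra. }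
    obv. }
  destruct (Htr t0) as (n & n0 & nw & nw1). rewrite At in nw, nw1. destruct (TrU t0) as (k & k0 & ku & ku1).
  have Qt0 : 0 <= au t0 <= PI/2 by (apply Hqu; split; [apply Rmin_l|lra]).
  have cU : 0 <= U1 nu t0 by (rewrite ku1; apply Rmult_le_pos; [lra|apply cos_ge_0; lra]).
  have sU : 0 <= U nu t0 by (rewrite ku; apply Rmult_le_pos; [lra|apply sin_ge_0; lra]).
  have k2 : U nu t0^2 + U1 nu t0^2 = k^2 by (rewrite ku, ku1; have h := cs1 (au t0); turn ((k * sin (au t0))^2 + (k * cos (au t0))^2) into (k^2 * (sin (au t0)^2 + cos (au t0)^2)); rewrite h; ring).
  have da := Rle_abs d. have da' := Rle_abs (- d). rewrite Rabs_Ropp in da'. have m2 : 2 * (1 + Rabs d) <= m.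
  set (z := w1 t0 + m * w t0). set (zU := U1 nu t0 + m * U nu t0).
  (* Hypotheses of [growth] from the boundary condition: [m >= 2 (1 + |d|)] gives
     [m - d <= 3 (m + d)], the origin of the constant 9. *)
  assert (Zw : 0 <= w t0 * z /\ (w1 t0 - m * w t0)^2 <= 9 * z^2 /\ n^2 <= (1 + d^2) * z^2 /\ z <> 0).
  { unfold z. destruct HA as [[a1 a2]|[a1 a2]].
    - rewrite nw, nw1, a1, a2, sin_0, cos_0. splits; try nra.
    - have s0 : 0 < sin A by (apply sin_gt_0; lra). have s1 : n^2 = (1 + d^2) * (n * sin A)^2 by (have h := cs1 A; rewrite a2 in h; nra).
      rewrite nw, nw1, a2. set (s := n * sin A) in *. have sp : 0 < s.
      turn (n * (d * sin A)) into (d * s).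
      turn (d * s + m * s) into ((m + d) * s). turn (d * s - m * s) into (- (m - d) * s).
      have md : 1 <= m + d. splits.
      + nra.
      + rewrite !Rpow_mult_distr. have : (- (m - d))^2 <= 9 * (m + d)^2 by nra. have : 0 < s^2. nra.
      + rewrite s1. apply Rmult_le_compat_l; [nra|]. rewrite Rpow_mult_distr. have : 0 < s^2. have : 1 <= (m + d)^2 by nra. nra.
      + nra. }
  destruct Zw as (z1 & z2 & z3 & z4).
  assert (ZU : 0 <= U nu t0 * zU /\ (U1 nu t0 - m * U nu t0)^2 <= 9 * zU^2 /\ k^2 <= zU^2 /\ zU <> 0).
  { unfold zU. set (a := U nu t0) in *. set (b := U1 nu t0) in *. have m1 : 1 <= m. have am : a <= m * a by nra.
    have kk : 0 < k^2. have K : k^2 <= (b + m * a)^2 by (rewrite <- k2; nra). splits; auto; nra. }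
  destruct ZU as (y1 & y2 & y3 & y4).
  destruct (growth (bq nu) w w1 m t0 ta Hw ok Qm z1 z2 ok) as [g1 g2].
  destruct (growth (bq nu) (U nu) (U1 nu) m t0 ta HU ok Qm y1 y2 ok) as [gU1 gU2]. fold z E in g2. fold zU E in gU2.
  set (Q := L^2 * nu^2). have HQ : 1 <= Q by (unfold Q; have : 1 <= L^2; nra).
  assert (bQ : forall s, s <= t -> bq nu s <= Q).
  { intros s hs. apply Rle_trans with (bq nu (ln (L * nu))); [apply bq_mono; lra|]. rewrite bq_exp by pos. unfold Q. have : 0 < nu^2. obv. }
  assert (Dd : forall s, exists l, is_derive (fun s => al s - au s) s l).
  { intros s. eexists. apply (is_derive_minus al au); [apply Hal|apply Hau]. }
  (* the Wronskian bounds the angle between the two solutions *)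
  set (ka := 8 * (1 + Q) * (1 + Rabs d)/E).
  have ka0 : 0 < ka.
  assert (SD : forall s, ta <= s <= t -> Rabs (sin (al s - au s)) <= ka).
  { intros s hs. destruct (Htr s) as (n' & n0' & e1 & e2). destruct (TrU s) as (k' & k0' & e3 & e4).
    have W := sol_wronskian (bq nu) w w1 (U nu) (U1 nu) Hw HU t0 s.
    rewrite nw, nw1, ku, ku1, e1, e2, e3, e4 in W.
    have W1 : n * k * sin (A - au t0) = n' * k' * sin (al s - au s) by (rewrite !sin_minus; lra).
    have a1 := amplitude_after nu w w1 ta Q s Hw ok t2 g1 ok (bQ s ok) ok.
    have a2 := amplitude_after nu (U nu) (U1 nu) ta Q s HU ok t2 gU1 ok (bQ s ok) ok.
    have pyt : forall n a, (n * sin a)^2 + (n * cos a)^2 = n^2 by (intros n1 a; have h := cs1 a; rewrite !Rpow_mult_distr, h; ring).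
    rewrite e1, e2, pyt in a1. rewrite e3, e4, pyt in a2.
    assert (b1 : n^2 * E <= 8 * (1 + d^2) * (1 + Q) * n'^2).
    { apply Rle_trans with ((1 + d^2) * z^2 * E); [pos|].
      turn ((1 + d^2) * z^2 * E) into ((1 + d^2) * (8 * (z^2 * E/8))).
      turn (8 * (1 + d^2) * (1 + Q) * n'^2) into ((1 + d^2) * (8 * (n'^2 * (1 + Q)))).
      obv. }
    assert (b2 : k^2 * E <= 8 * (1 + Q) * k'^2).
    { apply Rle_trans with (zU^2 * E); [pos|].
      obv. }
    assert (b3 : (n * k * E)^2 <= (8 * (1 + Q) * (1 + Rabs d) * (n' * k'))^2).
    { apply Rle_trans with (8 * (1 + d^2) * (1 + Q) * n'^2 * (8 * (1 + Q) * k'^2)).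
      - turn ((n * k * E)^2) into (n^2 * E * (k^2 * E)). apply Rmult_le_compat; auto; (apply Rmult_le_pos; [pos|lra]).
      - have : 1 + d^2 <= (1 + Rabs d)^2 by (rewrite <- (pow2_abs d); clear - dp; nra).
        turn (8 * (1 + d^2) * (1 + Q) * n'^2 * (8 * (1 + Q) * k'^2)) into ((8 * (1 + Q) * (n' * k'))^2 * (1 + d^2)).
        turn ((8 * (1 + Q) * (1 + Rabs d) * (n' * k'))^2) into ((8 * (1 + Q) * (n' * k'))^2 * (1 + Rabs d)^2).
        obv. }
    assert (b4 : n * k * E <= 8 * (1 + Q) * (1 + Rabs d) * (n' * k')).
    { apply Rnot_lt_le; intro c. have : 0 <= 8 * (1 + Q) * (1 + Rabs d) * (n' * k'). clear - b3 c H. nra. }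
    have pk : 0 < n' * k'.
    apply Rmult_le_reg_l with (n' * k'); auto. rewrite <- (Rabs_pos_eq (n' * k')) at 1 by lra. rewrite <- Rabs_mult, <- W1, Rabs_mult, Rabs_pos_eq by pos.
    apply Rle_trans with (n * k).
    - have h := SIN_bound (A - au t0). have : Rabs (sin (A - au t0)) <= 1. have : 0 < n * k. clear - H H0. nra.
    - apply Rmult_le_reg_r with E; auto. eapply Rle_trans; [exact b4|]. right. obv. }
  have nu8 : 1 <= nu^8 by (apply pow_R1_Rle; lra). have nu2 : 0 < nu^2. have L2 : 1 <= L^2 by (apply pow_R1_Rle; auto).
  assert (ka1 : ka * (6 * L^5 * nu^6) <= 1).
  { unfold ka. apply Rmult_le_reg_r with E; auto. turn (8 * (1 + Q) * (1 + Rabs d)/E * (6 * L^5 * nu^6) * E) into ((1 + Q) * (48 * (1 + Rabs d) * L^5 * nu^6)).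
    apply Rle_trans with (2 * Q * (48 * (1 + Rabs d) * L^5 * nu^6)).
    - apply Rmult_le_compat_r; [|lra]. repeat apply Rmult_le_pos; try lra; apply pow_le; lra.
    - rewrite Rmult_1_l. eapply Rle_trans; [|exact HE]. obv. }
  have L5 : 1 <= L^5 by (apply pow_R1_Rle; auto). have nu6 : 1 <= nu^6 by (apply pow_R1_Rle; lra).
  have ka2 : ka <= 1/2 by (clear - ka0 ka1 L5 nu6; have : 1 <= L^5 * nu^6; nra).
  have lt : ln nu < t by (apply Rnot_le_lt; intro c; have h := bq_mono nu t (ln nu) c; rewrite bq_exp in h by lra; lra).
  (* At [ta] both angles lie in [[0, PI/2]]; for [al] because [w] does not vanish after [t0] and
     [w w1 >= 0]. The small sine excludes the extreme differences. *)
  assert (Dta : Rabs (al ta - au ta) < PI/2).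
  { have Qta : 0 <= au ta <= PI/2 by (apply Hqu; split; [eapply Rle_trans; [apply Rmin_l|lra]|auto]).
    have A0 : 0 <= A < PI by (destruct HA as [[a1 _]|[a1 _]]; lra).
    assert (al0 : 0 <= al ta).
    { apply (prufer_nonneg (bq nu) al t0 ta (nu^2) Hal); try lra. intros s hs. apply Rabs_le. have h := Qm s hs. have e := exp_pos (2 * s). clear - h e. unfold bq in *. nra. }
    assert (al1 : al ta < PI).
    { apply (IVT_avoid al t0 ta PI); try lra; [intros s; eexists; apply Hal|]. intros s hs e.
      destruct (Rle_lt_or_eq_dec t0 s (proj1 hs)) as [c|c]; [|subst; lra].
      apply (growth_nonzero (bq nu) w w1 m t0 ta Hw ok Qm z1 z4 s ok). destruct (Htr s) as (n' & _ & e1 & _). rewrite e1, e, sin_PI. ring. }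
    assert (al2 : al ta <= PI/2).
    { apply Rnot_lt_le; intro c. destruct (Htr ta) as (n' & n0' & e1 & e2). have s1 : 0 < sin (al ta) by (apply sin_gt_0; lra).
      have c1 : cos (al ta) < 0 by (apply cos_lt_0; lra). rewrite e1, e2 in g1. clear - g1 n0' s1 c1. have : 0 < n' * n'. have : sin (al ta) * cos (al ta) < 0. nra. }
    have S := SD ta ok. apply Rabs_def1; apply Rnot_le_lt; intro c.
    - turn (al ta - au ta) into (PI/2) in S. rewrite sin_PI2, Rabs_R1 in S. lra.
    - turn (al ta - au ta) into (- (PI/2)) in S. rewrite sin_neg, sin_PI2, Rabs_Ropp, Rabs_R1 in S. lra. }
  apply Rabs_def2 in Dta.
  (* The sine stays small on the whole way to [t], so the difference cannot reach [PI/2] in absolute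
     value and no multiple of [PI] slips in. *)
  assert (Dt : Rabs (al t - au t) < PI/2).
  { apply Rabs_def1.
    - apply (IVT_avoid (fun s => al s - au s) ta t (PI/2)); auto; try lra. intros s hs e. have S := SD s hs. rewrite e, sin_PI2, Rabs_R1 in S. lra.
    - assert (- (al t - au t) < PI/2); [|lra]. apply (IVT_avoid (fun s => - (al s - au s)) ta t (PI/2)); try lra.
      + intros s. destruct (Dd s) as [l hl]. eexists. apply (is_derive_opp (fun s => al s - au s) s l hl).
      + intros s hs e. have S := SD s hs. turn (al s - au s) into (- (PI/2)) in S. rewrite sin_neg, sin_PI2, Rabs_Ropp, Rabs_R1 in S. lra. }
  have St := SD t ok. have Sm := small_angle _ Dt ok.
  (* the shear at t is at most polynomially large *)
  set (s := bs nu t). have ss : s^2 = bq nu t by (apply bs_sqr; lra). have s0 : 0 <= s by apply bs_nonneg.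
  have s1 : 1 <= s by (apply Rnot_lt_le; intro; clear - ss s0 Hq H; nra).
  have sL : s <= L * nu by (apply Rnot_lt_le; intro c; have h := bQ t ok; rewrite <- ss in h; unfold Q in h; clear - h c s0 HL Hn; have : 0 < L * nu; nra).
  have wa : wkb_a (bq nu) t = / s.
  assert (wb : 0 <= wkb_b (bq nu) bq1 t <= L^2 * nu^2).
  { unfold wkb_b. fold (bs nu t). fold s. rewrite <- ss. unfold bq1. have e : exp (2 * t) = s^2 + nu^2 by (rewrite ss; unfold bq; ring).
    rewrite e. clear - s1 sL HL Hn nu2 L2. have p3 : 0 < 4 * s^2 * s. split; [pos|].
    apply Rmult_le_reg_r with (4 * s^2 * s); auto. unfold Rdiv. rewrite Rmult_assoc, Rinv_l by lra.
    have : 1 <= s^2 * s. assert (s^2 + nu^2 <= 2 * (L^2 * nu^2) * (s^2 * s)); [|nra].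
    have : s^2 <= L^2 * nu^2.
    obv. }
  assert (Df : Rabs (bwkb nu al t - bwkb nu au t) <= / nu).
  { unfold bwkb, wkb. eapply Rle_trans; [apply Sh_lip_gen; rewrite wa; apply Rinv_0_lt_compat; lra|].
    set (b := wkb_b (bq nu) bq1 t) in *. rewrite wa.
    assert (K : (1 + (/ s)^2 + b^2) / / s <= 3 * L^5 * nu^5).
    { clear - s1 sL wb HL Hn nu2 L2. turn ((1 + (/ s)^2 + b^2) / / s) into (s * (1 + b^2) + / s).
      have : / s <= 1 by (rewrite <- Rinv_1; apply Rinv_le_contravar; lra).
      have : b^2 <= (L^2 * nu^2)^2. have X4 : 1 <= (L^2 * nu^2)^2 by (apply pow_R1_Rle; nra).
      obv. }
    have dd := Rabs_pos (al t - au t). have L5p : 0 < 3 * L^5 * nu^5.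
    apply Rle_trans with (3 * L^5 * nu^5 * (2 * ka)); [pos|].
    apply Rmult_le_reg_r with nu; [lra|]. rewrite Rinv_l by lra. obv. }
  destruct (B0 t ok) as [c1 c2]. obv.
Qed.

(** * The zeros *)

(** A listed zero set has gaps, so [f] is not identically 0. This yields, in [zero_list], both
    [ka <> 0] and the independence of the two Bessel solutions without computing a Wronskian. *)
Lemma no_zero_list (f : R -> R) k0 x : lists_positive_zeros f k0 x -> ~ (forall t, 0 < t -> f t = 0).
Proof.
  intros [H1 H2] H. destruct (H1 k0 (le_n _)) as (p & _ & i). destruct (H2 ((x k0 + x (S k0))/2)) as (k & Hk & E); [lra|apply H; lra|].
  assert (M : forall j, x (S k0) <= x (S k0 + j)%nat).
  { induction j as [|j IH]; [rewrite Nat.add_0_r; lra|]. rewrite Nat.add_succ_r. destruct (H1 (S k0 + j)%nat ok) as (_ & _ & h). lra. }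
  destruct (Nat.eq_dec k k0) as [->|e]; [lra|]. specialize (M (k - S k0)%nat). turn (S k0 + (k - S k0))%nat into k in M. lra.
Qed.

(** All that the asymptotics use of the [k]-th zero: some solution has a Prüfer angle that goes from
    [A] to [A + k PI] between the two ends. *)
Definition zero_at r R' nu A k x := 0 < x /\ exists al w w1, prufer (bq nu) al /\ sol (bq nu) w w1 /\ traced w w1 al /\
  al (ln (r * x)) = A /\ al (ln (R' * x)) = A + INR k * PI.

Definition bform (A : R) (u u1 : R -> R) y := u (ln y) * cos A - u1 (ln y) * sin A.

Lemma zero_list r R' nu A d (f v v1 : R -> R) ka k0 x : 0 < r < R' -> 0 <= nu -> sol (bq nu) v v1 ->
  (forall y, 0 < y -> exists e, e <> 0 /\ f y * e = ka * (bform A (U nu) (U1 nu) (R' * y) * bform A v v1 (r * y) - bform A (U nu) (U1 nu) (r * y) * bform A v v1 (R' * y))) ->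
  (k0 = 1%nat /\ ((A = 0 /\ d = 0) \/ (cos A = d * sin A /\ nu = Rabs d /\ 0 < A < PI)) \/
   k0 = 0%nat /\ cos A = d * sin A /\ Rabs d < nu /\ 0 < A < PI) ->
  lists_positive_zeros f k0 x -> forall k, (k0 <= k)%nat -> zero_at r R' nu A k (x k).
Proof.
  intros Hr Hn Hv Hf HA Hx.
  have NZ : ~ forall t, 0 < t -> f t = 0 by (eapply no_zero_list; exact Hx).
  have HU := U_sol nu ok. have UN := U_nonvanish nu ok 0.
  assert (ka0 : ka <> 0).
  { intros e. apply NZ. intros t Ht. destruct (Hf t Ht) as (c & c0 & E). obv. }
  set (W := U nu 0 * v1 0 - U1 nu 0 * v 0).
  assert (W0 : W <> 0).
  { intros e. apply NZ. set (n := U nu 0^2 + U1 nu 0^2) in *. set (la := (U nu 0 * v 0 + U1 nu 0 * v1 0)/n).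
    have S := sol_comb (bq nu) v v1 (U nu) (U1 nu) 1 (- la) Hv HU.
    assert (Z : forall t, v t = la * U nu t /\ v1 t = la * U1 nu t).
    { intros t. have N := bsol_nonvanish nu _ _ t S. cbv beta in N.
      set (a := 1 * v t + - la * U nu t) in *. set (b := 1 * v1 t + - la * U1 nu t) in *.
      assert (a^2 + b^2 <= 0).
      { apply Rnot_lt_le; intro c. specialize (N c 0).
        assert (e1 : v 0 = la * U nu 0).
        { apply Rmult_eq_reg_r with n; [|lra]. transitivity (v 0 * n + U1 nu 0 * W); [obv|]. obv. }
        assert (e2 : v1 0 = la * U1 nu 0).
        { apply Rmult_eq_reg_r with n; [|lra]. transitivity (v1 0 * n - U nu 0 * W); [obv|]. obv. }
        obv. }
      have : a = 0 /\ b = 0. unfold a, b in *. lra. }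
    intros t Ht. destruct (Hf t Ht) as (c & c0 & E). unfold bform in E. rewrite !(proj1 (Z _)), !(proj2 (Z _)) in E.
    obv. }
  (* [sys] asks for a positive Wronskian; changing the sign of the second solution does not move the
     zeros. *)
  set (s := if Rlt_dec 0 W then 1 else -1). have Hs : 0 < s * W /\ s <> 0 by (unfold s; destruct (Rlt_dec 0 W); split; lra).
  have Hsv := sol_comb (bq nu) v v1 v v1 s 0 Hv Hv.
  set (y := fun t => s * v t + 0 * v t) in *. set (y1 := fun t => s * v1 t + 0 * v1 t) in *.
  assert (SY : sys (bq nu) bq1 (U nu) (U1 nu) y y1 (s * W)).
  { unfold sys. splits; auto; try apply Hs.
    - intros t. transitivity (s * (U nu t * v1 t - U1 nu t * v t)); [obv|]. f_equal. apply (sol_wronskian (bq nu)); auto.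
    - apply bq_derive. }
  destruct (polar (y 0) (U nu 0) ltac:(have p := sysP_pos _ _ _ _ _ _ _ 0 SY; unfold sysP in p; lra)) as (th0 & p1 & p2).
  destruct (phase_exists _ _ _ _ _ _ _ 0 th0 SY) as (th & _ & Hth); [unfold sysP; now rewrite Rplus_comm|unfold sysP; now rewrite Rplus_comm|].
  intros k Hk. split; [apply Hx; auto|].
  destruct (zeros_angle _ _ _ _ _ _ _ th A r R' f k0 x SY Hth) with (k := k) as (c & c1 & c2); auto.
  - apply bq1_pos.
  - intros z Hz. destruct (Hf z Hz) as (e & e0 & E). unfold bform in E.
    match goal with |- _ <-> ?L = 0 => have EE : ka * L = s * (f z * e) by (rewrite E; unfold y, y1; ring) end.
    split; intros h.
    + rewrite h in EE. apply Rmult_eq_reg_l with ka; auto. rewrite EE. ring.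
    + rewrite h, Rmult_0_r in EE. symmetry in EE. apply Rmult_integral in EE. destruct EE as [EE|EE]; [pos|]. apply Rmult_integral in EE. tauto.
  - set (T := ln R' - ln r). have HT : 0 < T by (unfold T; have h := ln_increasing r R' ok ok; lra).
    have LT : forall z, 0 < z -> ln (R' * z) - ln (r * z) = T by (intros z Hz; rewrite !ln_mult by lra; unfold T; ring).
    assert (Bq : forall e z t, 0 < e -> 0 < z <= e -> ln (r * z) <= t <= ln (R' * z) -> exp (2 * t) <= (R' * e)^2).
    { clear - Hr. intros e z t He Hz Ht. have h := bq_mono 0 t (ln (R' * z)) ok. rewrite bq_exp in h by nra. unfold bq in h.
      have : (R' * z)^2 <= (R' * e)^2. lra. }
    assert (small : (forall t, 0 < cos A^2 + bq nu t * sin A^2) -> exists e, 0 < e /\ forall z, 0 < z <= e ->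
       0 < phaseA (U nu) (U1 nu) y y1 (s * W) th A (ln (R' * z)) - phaseA (U nu) (U1 nu) y y1 (s * W) th A (ln (r * z)) < PI).
    { intros HC. set (om := / (T + 1)). have o0 : 0 < om. have oT : om * (T + 1) = 1.
      exists (om/R'). have e0 : 0 < om/R'. split; auto. intros z Hz. have P2 := PI2_1.
      specialize (LT z ok). apply (phaseA_small_pos _ _ _ _ _ _ _ _ _ _ _ om SY Hth); try lra; [obv|].
      intros t Ht. split; auto. have h := Bq (om/R') z t e0 Hz Ht. turn (R' * (om/R')) into om in h.
      unfold bq. have p := pow2_ge_0 nu. lra. }
    destruct HA as [[-> HA]|(-> & a1 & a2 & a3)].
    + destruct small as (e & e0 & He).
      { intros t. destruct HA as [[-> _]|(a1 & a2 & a3)]; [rewrite cos_0, sin_0; lra|].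
        have sA : 0 < sin A by (apply sin_gt_0; lra). have nd : nu^2 = d^2 by (rewrite a2; apply pow2_abs).
        rewrite a1. unfold bq. rewrite nd. have ex := exp_pos (2 * t). have : 0 < sin A^2. nra. }
      exists e. split; auto. intros z Hz. specialize (He z Hz). simpl INR. lra.
    + have sA : 0 < sin A by (apply sin_gt_0; lra). have nd : d^2 < nu^2 by (rewrite <- (pow2_abs d); have h := Rabs_pos d; nra).
      set (e := Rmin 1 ((nu^2 - d^2)/2)/R'). have m0 : 0 < Rmin 1 ((nu^2 - d^2)/2) by (apply Rmin_pos; lra).
      have e0 : 0 < e. exists e. split; auto. intros z Hz. simpl INR.
      have h := phaseA_small_neg _ _ _ _ _ _ _ th A (ln (r * z)) (ln (R' * z)) SY Hth ok a3.
      destruct h; [|lra]. intros t Ht. have b := Bq e z t e0 Hz Ht. turn (R' * e) into (Rmin 1 ((nu^2 - d^2)/2)) in b.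
      have m1 := Rmin_l 1 ((nu^2 - d^2)/2). have m2 := Rmin_r 1 ((nu^2 - d^2)/2).
      set (mm := Rmin 1 ((nu^2 - d^2)/2)) in *. rewrite a1. unfold bq. clear - sA b m1 m2 m0 nd. have : 0 < sin A^2. have : mm^2 <= mm. nra.
  - exists (angle (U nu) (U1 nu) y y1 (s * W) th c).
    exists (fun t => cos c * y t + - sin c * U nu t), (fun t => cos c * y1 t + - sin c * U1 nu t). splits; auto.
    + exact (angle_prufer _ _ _ _ _ _ _ th c SY Hth).
    + apply sol_comb; auto.
    + intros t. destruct (angle_lift _ _ _ _ _ _ _ th c t SY Hth) as (n & n0 & e1 & e2). exists n. obv.
Qed.

Lemma zero_list_f r R' nu x : 0 < r < R' -> 0 <= nu -> lists_positive_zeros (frak_f r R' nu) 1 x ->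
  forall k, (1 <= k)%nat -> zero_at r R' nu 0 k (x k).
Proof.
  intros Hr Hn. destruct (bessel_pair nu Hn) as (ka & v & v1 & Hv & EJ & EY).
  apply (zero_list r R' nu 0 0 _ v v1 ka); auto.
  intros y Hy. exists 1. split; [lra|]. unfold frak_f, bform. rewrite cos_0, sin_0.
  have J : forall z, 0 < z -> besselJ nu z = ka * U nu (ln z) /\ besselY nu z = v (ln z) by (intros z Hz; rewrite <- EJ, <- EY, exp_ln; auto).
  destruct (J (R' * y)) as [a b]; [nra|]. destruct (J (r * y)) as [a' b']; [nra|]. obv.
Qed.

(** Since [(z^(-delta) w(ln z))' = z^(-delta-1) (w' - delta w)], the factor [x^(-delta)] turns the
    Neumann condition into [w' = delta w], that is, into the angle with cotangent [delta]. *)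
Lemma zero_list_h r R' nu delta A x : 0 < r < R' -> Rabs delta <= nu -> 0 < A < PI -> cos A = delta * sin A ->
  lists_positive_zeros (frak_h r R' nu delta) (h_first_index nu delta) x ->
  forall k, (h_first_index nu delta <= k)%nat -> zero_at r R' nu A k (x k).
Proof.
  intros Hr Hd HA EA. have Hn : 0 <= nu.
  destruct (bessel_pair nu Hn) as (ka & v & v1 & Hv & EJ & EY).
  apply (zero_list r R' nu A delta _ v v1 ka); auto.
  - intros y Hy. have sA : 0 < sin A by (apply sin_gt_0; lra).
    assert (D : forall (B w w1 : R -> R) c z, 0 < z -> (forall t, is_derive w t (w1 t)) -> (forall t, B (exp t) = c * w t) ->
      Derive (fun z => Rpower z (- delta) * B z) z = exp (- delta * ln z)/z * (c * (w1 (ln z) - delta * w (ln z)))).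
    { intros B w w1 c z Hz Hw HB. apply is_derive_unique. apply is_derive_ext_loc with (fun z => exp (- delta * ln z) * (c * w (ln z))).
      - apply (locally_interval _ z 0 p_infty); simpl; auto. intros t Ht _. rewrite <- HB, exp_ln by auto. reflexivity.
      - have h := Hw (ln z). derive_tac; lra. }
    have DJ := D _ _ _ _ (R' * y) ok (fun t => proj1 (U_sol nu ok t)) EJ. have DJ' := D _ _ _ _ (r * y) ok (fun t => proj1 (U_sol nu ok t)) EJ.
    have EY1 : forall t, besselY nu (exp t) = 1 * v t by (intros t; rewrite EY; ring).
    have DY := D _ _ _ _ (R' * y) ok (fun t => proj1 (Hv t)) EY1. have DY' := D _ _ _ _ (r * y) ok (fun t => proj1 (Hv t)) EY1.
    have q1 : 0 < exp (- delta * ln (R' * y))/(R' * y).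
    have q2 : 0 < exp (- delta * ln (r * y))/(r * y).
    unfold frak_h. change (small_j nu delta) with (fun z => Rpower z (- delta) * besselJ nu z). change (small_y nu delta) with (fun z => Rpower z (- delta) * besselY nu z).
    rewrite DJ, DJ', DY, DY'. clear DJ DJ' DY DY'. unfold bform. rewrite EA.
    set (a := exp (- delta * ln (R' * y))/(R' * y)) in *. set (b := exp (- delta * ln (r * y))/(r * y)) in *.
    exists (sin A^2/(a * b)). split; [pos|]. field. lra.
  - unfold h_first_index. destruct (Req_EM_T nu (Rabs delta)); [left|right]; splits; auto; lra.
Qed.

Lemma Rpower_small eps ka : eps < 1/3 -> 0 < ka -> exists V, 1 <= V /\ forall nu, V < nu -> Rpower nu eps <= ka * Rpower nu (1/3).
Proof.
  intros He Hk. set (e := 1/3 - eps). have He' : 0 < e.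
  destruct (Rpower_dominates e (1 + / ka) He') as (V & HV & H); [pos|].
  exists V. split; auto. intros nu Hn. specialize (H nu Hn). have l : 0 <= ln nu by (rewrite <- ln_1; apply Rlt_le, ln_increasing; lra).
  have i := Rinv_0_lt_compat _ Hk. turn (1/3) into (eps + e). rewrite Rpower_plus.
  have p : 0 < Rpower nu eps. assert (1 <= ka * Rpower nu e); [|nra].
  turn 1 into (ka * / ka). apply Rmult_le_compat_l; nra.
Qed.

(* The scales of the transition region in terms of [n3 = nu^(1/3)]. *)
Lemma scales nu : 0 < nu -> let n3 := Rpower nu (1/3) in 0 < n3 /\ nu = n3^3 /\ Nof nu = cbrt2 * n3^2 /\
  (forall eps, Rpower nu (1/3 + eps) = n3 * Rpower nu eps /\ Rpower nu (- (2/3) + 3 * eps) = Rpower nu eps^3/n3^2).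
Proof.
  intros Hn n3. have p : 0 < n3.
  assert (E : nu = n3^3).
  { rewrite <- Rpower_pow by auto. unfold n3. rewrite Rpower_mult. replace (1/3 * INR 3) with 1 by (simpl; field). symmetry; now apply Rpower_1. }
  splits; auto.
  - unfold Nof, cbrt2. rewrite <- (Rpower_mult_distr 2 (nu^2)) by nra. f_equal.
    rewrite <- Rpower_pow, Rpower_mult by auto. unfold n3. rewrite <- Rpower_pow, Rpower_mult by pos. f_equal. simpl; field.
  - intros eps. split; [unfold n3; now rewrite Rpower_plus|]. rewrite Rpower_plus.
    replace (Rpower nu (3 * eps)) with (Rpower nu eps^3) by (rewrite <- Rpower_pow, Rpower_mult by pos; f_equal; simpl; ring).
    replace (- (2/3)) with (- (1/3 * INR 2)) by (simpl; field). rewrite Rpower_Ropp, <- Rpower_mult, Rpower_pow by auto. obv.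
Qed.

Lemma cbrt2_spec : cbrt2^3 = 2 /\ 1 < cbrt2 < 2.
Proof.
  have p := cbrt2_pos. assert (E : cbrt2^3 = 2).
  { rewrite <- Rpower_pow by auto. unfold cbrt2. rewrite Rpower_mult. replace (1/3 * INR 3) with 1 by (simpl; field). apply Rpower_1; lra. }
  obv.
Qed.

Lemma wkb_le_bxi nu t : 0 < nu -> 0 < bq nu t -> wkb_size nu t * bxi nu t <= 4/3 /\ 0 < bxi nu t.
Proof.
  intros Hn H. have s := bs_pos _ _ H. have x0 := bxi_pos nu t Hn H. destruct (bxi_cubic nu t Hn) as [_ x1].
  assert (x2 : bxi nu t <= bs nu t). { unfold bxi, Xi. assert (0 <= nu * atan (bs nu t/nu)); [|lra]. apply Rmult_le_pos; [lra|].
    rewrite <- atan_0. left. apply atan_increasing. obv. }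
  split; auto. unfold wkb_size. set (b := bs nu t) in *. set (x := bxi nu t) in *.
  have : / b * x <= 1 by (apply Rmult_le_reg_l with b; auto; rewrite <- Rmult_assoc, Rinv_r; lra).
  assert (nu^2/b^3 * x <= 1/3).
  { apply Rle_trans with (nu^2/b^3 * (b^3/(3 * nu^2))); [pos|].
    right. obv. }
  lra.
Qed.

Lemma tcond_bcond A sg d : tcond A sg d -> bcond A d.
Proof. intros [(a & b & c)|(a & b & c)]; [left|right]; auto. Qed.

Lemma zero_bwkb nu al A sg d t k : 0 < bq nu t -> tcond A sg d -> al t = A + INR k * PI ->
  Rabs (bwkb nu al t - (INR k * PI + sg)) <= (1 + Rabs d) * wkb_size nu t.
Proof.
  intros Hq HA E. destruct (bwkb_bc nu t d Hq) as [a0 _]. have B := bwkb_bc_le nu t d Hq.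
  unfold bwkb, wkb. rewrite E, INR_IZR_INZ, Sh_shift. destruct HA as [(a & b & c)|(a & b & c)]; subst sg.
  - subst. rewrite Sh_0. turn (0 + IZR (Z.of_nat k) * PI - (IZR (Z.of_nat k) * PI + 0)) into 0. rewrite Rabs_R0 at 1. eapply Rle_trans; [apply Rabs_pos|exact B].
  - eapply Rle_trans; [|exact B]. replace (Sh (wkb_a (bq nu) t) (wkb_b (bq nu) bq1 t) A + IZR (Z.of_nat k) * PI - (IZR (Z.of_nat k) * PI + PI/2)) with
      (Sh (wkb_a (bq nu) t) (wkb_b (bq nu) bq1 t) A - PI/2) by ring. now apply Sh_near_half.
Qed.

(** * Phase estimates at a zero right of and around the turning point *)

Section Phase.
Context (r R' : R) (hr : 0 < r) (hrR : r < R').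

Lemma ratio_lt_1 : 0 < r/R' < 1.
Proof. split; [pos|]. apply Rmult_lt_reg_r with R'; [lra|]. unfold Rdiv. rewrite Rmult_assoc, Rinv_l; lra. Qed.

Lemma ln_rx x : 0 < x -> ln (r * x) < ln (R' * x).
Proof. obv. Qed.

(* With [p = w1 - d w] one has [(w p)' = p^2 + (-q - d^2) w^2], while [w p] vanishes at both ends. *)
Lemma zero_beyond nu A d k x : bcond A d -> zero_at r R' nu A k x -> nu^2 - d^2 < (R' * x)^2.
Proof.
  intros HA (Hx & al & w & w1 & _ & Hw & Tr & E0 & E1). apply Rnot_le_lt; intro c. have L := ln_rx x Hx.
  set (t0 := ln (r * x)) in *. set (t1 := ln (R' * x)) in *.
  assert (Q : forall t, t < t1 -> 0 < - bq nu t - d^2).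
  { intros t Ht. have e : exp (2 * t) < exp (2 * t1). have b := bq_exp nu (R' * x) ok. fold t1 in b. unfold bq in *. lra. }
  have Q1 : 0 <= - bq nu t1 - d^2 by (unfold t1; rewrite bq_exp by nra; lra).
  set (P := fun t => w t * (w1 t - d * w t)).
  assert (D : forall t, is_derive P t ((w1 t - d * w t)^2 + (- bq nu t - d^2) * w t^2)).
  { intros t. destruct (Hw t) as [a b]. unfold P, Rminus. derive_tac. Rring. }
  assert (Z : forall t j, al t = A + INR j * PI -> P t = 0).
  { intros t j E. destruct (Tr t) as (n & _ & e1 & e2). unfold P. rewrite e1, e2, E, sin_plus, cos_plus, sin_int, !Rmult_0_r.
    destruct HA as [[-> ->]|[_ ->]]; rewrite ?sin_0; ring. }
  assert (P t0 < P ((t0 + t1)/2)).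
  { apply deriv_pos_lt; [lra|]. intros t Ht. eexists; split; [apply D|]. specialize (Q t ok). destruct (Tr t) as (n & n0 & e1 & e2).
    destruct (Req_dec (w t) 0) as [z|z].
    - rewrite z. assert (w1 t <> 0); [|obv]. intro z1.
      have h := sin2_cos2 (al t). unfold Rsqr in h. nra.
    - have : 0 < w t^2. obv. }
  assert (P ((t0 + t1)/2) <= P t1).
  { apply deriv_nonneg_le; [lra|]. intros t Ht. eexists; split; [apply D|]. have g := pow2_ge_0 (w1 t - d * w t).
    destruct (Rle_lt_or_eq_dec t t1 ok) as [h|h]; [specialize (Q t h)|rewrite h in *]; nra. }
  rewrite (Z t0 0%nat) in H by (rewrite E0; simpl; ring). rewrite (Z t1 k E1) in H0. lra.
Qed.

(** The Prüfer velocity is at most [1 + (R' x)^2] on an interval of length [ln (R'/r)]. For bounded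
    orders this forces the zeros to be large when [k] is. *)
Lemma zero_count nu A k x : zero_at r R' nu A k x -> INR k * PI <= (1 + (R' * x)^2) * (ln R' - ln r).
Proof.
  intros (Hx & al & w & w1 & Hal & _ & _ & E0 & E1). have L := ln_rx x Hx.
  set (K := 1 + (R' * x)^2). assert (K * ln (r * x) - al (ln (r * x)) <= K * ln (R' * x) - al (ln (R' * x))).
  { apply (deriv_nonneg_le (fun t => K * t - al t)); [lra|]. intros t Ht. eexists; split; [apply (is_derive_minus (fun t => K * t) al); [derive_tac; reflexivity|apply Hal]|].
    have b := bq_mono nu t _ (proj2 Ht). rewrite bq_exp in b by nra. have c := cs1 (al t). have s := pow2_ge_0 (sin (al t)). have s' := pow2_ge_0 (cos (al t)). have n2 := pow2_ge_0 nu.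
    have : bq nu t * sin (al t)^2 <= (R' * x)^2 * sin (al t)^2.
    unfold minus, plus, opp; simpl. obv. }
  rewrite E0, E1, !ln_mult in H by lra. nra.
Qed.

(* The scale-invariant lower bound: HH at the middle of [nu/R', nu/r] is a multiple of [nu]. *)
Lemma HH_linear : exists a, 0 < a /\ forall nu x, 0 < nu -> (1 + r/R')/2 * nu <= r * x -> 2 * a * nu <= HH r R' nu x.
Proof.
  set (rho := r/R'). have Hrho : 0 < rho < 1 by exact ratio_lt_1.
  set (la := (1 + rho)/(2 * rho)). have Hla : 1 < la by (apply Rmult_lt_reg_r with (2 * rho); [lra|]; unfold la; turn ((1 + rho)/(2 * rho) * (2 * rho)) into (1 + rho); lra).
  set (q := sqrt (la^2 - 1)). have q2 : q^2 = la^2 - 1 by (unfold q; apply pow2_sqrt; nra).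
  have q0 : 0 < q by (apply sqrt_lt_R0; nra).
  exists (q^3/(3 * la^2)/2). split; [pos|].
  intros nu x Hn H. set (x0 := la * nu/R'). have E : R' * x0 = la * nu.
  have Er : r * x0 = (1 + rho)/2 * nu.
  have p0 : 0 < x0.
  apply Rle_trans with (HH r R' nu x0); [|apply HH_mono; try lra; apply Rmult_le_reg_l with r; lra].
  unfold HH. rewrite (proj2 (bs_neg_ln nu (r * x0) ok)), Rminus_0_r. unfold bxi.
  assert (Es : bs nu (ln (R' * x0)) = q * nu).
  { unfold bs. rewrite bq_exp, E by nra. turn ((la * nu)^2 - nu^2) into ((q * nu)^2). apply sqrt_pow2; nra. }
  rewrite Es. eapply Rle_trans; [|apply Xi_cubic; nra]. right. turn (nu^2 + (q * nu)^2) into (la^2 * nu^2).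
  field. lra.
Qed.

Lemma right_phase nu A d k x : 0 <= nu -> bcond A d -> zero_at r R' nu A k x -> nu < r * x ->
  Rabs (HH r R' nu x - INR k * PI) <= (3 + 2 * Rabs d) * wkb_size nu (ln (r * x)).
Proof.
  intros Hn HA (Hx & al & w & w1 & Hal & _ & _ & E0 & E1) H. rewrite Rabs_minus_sym.
  apply (wkb_region nu al A d); auto; [rewrite bq_exp; nra|left; now apply ln_rx].
Qed.

Lemma Xi_transition nu N Y w : 100 <= N -> N^3 = 2 * nu^2 -> 0 < nu -> 1 <= Y -> Y^2 <= N -> 0 < w <= Y ->
  Rabs (bxi nu (ln (nu * (1 + w/N))) - 2/3 * (w * sqrt w)) <= 2 * (Y^3/N).
Proof.
  intros HN HE Hn HY HYN Hw. set (q := sqrt w). have qq : q * q = w by (apply sqrt_sqrt; lra). have q0 : 0 < q.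
  set (u := w/N). have uN : u * N = w. have u0 : 0 < u. have YN : Y <= N/10.
  have u1 : u <= 1/10.
  set (f := sqrt (1 + u/2)). have f2 : f * f = 1 + u/2 by (apply sqrt_sqrt; lra). have f0 : 0 <= f.
  set (s := bs nu (ln (nu * (1 + u)))).
  assert (Es : s = N * (q * f)).
  { unfold s, bs. rewrite bq_exp by nra. replace ((nu * (1 + u))^2 - nu^2) with ((N * (q * f))^2).
    - apply sqrt_pow2. apply Rmult_le_pos; [lra|pos].
    - turn ((N * (q * f))^2) into (N^2 * (q * q) * (f * f)). rewrite qq, f2, <- uN.
      obv. }
  have s0 : 0 < s by (rewrite Es; apply Rmult_lt_0_compat; [lra|nra]).
  destruct (Xi_cubic nu s Hn s0) as [x1 x2]. change (bxi nu (ln (nu * (1 + u)))) with (Xi nu s).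
  have e1 : s^3/(3 * nu^2) = 2/3 * (w * q) * (f * f * f) by (rewrite Es, <- qq; turn (nu^2) into (N^3/2); field; lra).
  assert (e2 : s^3/(3 * (nu^2 + s^2)) = 2/3 * (w * q) * (f * f * f)/(1 + 2 * u * (f * f))).
  { turn (s^2) into (N^2 * w * (f * f)). turn (s^3) into (N^3 * (w * q) * (f * f * f)).
    rewrite <- uN at 2. turn (nu^2) into (N^3/2). obv. }
  rewrite e1 in x2. rewrite e2 in x1. have wq : 0 < w * q.
  have g1 : f * f * f <= 1 + 2 * u. assert (g2 : 1 - 3 * u <= f * f * f/(1 + 2 * u * (f * f))).
  { apply Rmult_le_reg_r with (1 + 2 * u * (f * f)); [nra|].
    turn (f * f * f/(1 + 2 * u * (f * f)) * (1 + 2 * u * (f * f))) into (f * f * f). obv. }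
  assert (y3 : w * q * u <= Y^3/N).
  { unfold u, Rdiv. rewrite <- Rmult_assoc. apply Rmult_le_compat_r; [pos|]. have : q <= Y.
    have : w * w <= Y * Y. obv. }
  apply Rabs_le. split.
  - assert (2/3 * (w * q) * (1 - 3 * u) <= Xi nu s); [|nra]. eapply Rle_trans; [|exact x1]. turn (2/3 * (w * q) * (f * f * f)/(1 + 2 * u * (f * f))) into (2/3 * (w * q) * (f * f * f/(1 + 2 * u * (f * f)))).
    apply Rmult_le_compat_l; [lra|pos].
  - nra.
Qed.

(** At [R' x] the WKB angle is [k PI + sg] by the boundary condition and [xi + L] by the Airy
    comparison, so [xi] there is [k PI + sg - L]. Subtracting the phase at [r x], which is
    [(2 sqrt 2/3) z_+^(3/2)] to leading order, gives [HH]. All errors are of the size [Y^3/N] with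
    [Y] of order [nu^eps]. *)
Lemma transition_phase sg d eps : 0 < eps < 1/3 -> exists V C, 1 <= V /\ 0 < C /\ forall nu A k x b L, V < nu -> tcond A sg d -> zero_at r R' nu A k x ->
  nu - Rpower nu (1/3 + eps) <= r * x <= nu + Rpower nu (1/3 + eps) ->
  let z := (r * x - nu)/Rpower nu (1/3) in prufer aq b -> b (cbrt2 * z) = sg -> aout b L ->
  Rabs (HH r R' nu x - (INR k * PI + (sg - L - 2 * sqrt 2/3 * pos_pow_3_2 z))) <= C * Rpower nu (- (2/3) + 3 * eps).
Proof.
  intros He. destruct (transition d) as (C & HC & HT). destruct HH_linear as (a & a0 & Ha).
  set (rho := r/R'). have Hrho : 0 < rho < 1 by exact ratio_lt_1.
  destruct (Rpower_small eps (1/2 * (1 - rho)) ok ok) as (V1 & HV1 & HP).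
  destruct (Nof_large (100 + 144 * d^2 + 4/(1 - rho))) as (V2 & HV2 & HN).
  exists (Rmax V1 V2), (2 * C + 8 + 2 * (2 + 2 * Rabs d)/a). have dp := Rabs_pos d.
  have K0 : 0 < 2 * (2 + 2 * Rabs d)/a.
  splits; [eapply Rle_trans; [exact HV1|apply Rmax_l]|lra|].
  intros nu A k x b L HV HA (Hx & al & w & w1 & Hal & _ & _ & E0 & E1) Hrx z Hb Hbz HL.
  have v1 : V1 < nu by (eapply Rle_lt_trans; [apply Rmax_l|exact HV]). have v2 : V2 < nu by (eapply Rle_lt_trans; [apply Rmax_r|exact HV]).
  specialize (HP nu v1). specialize (HN nu v2). have Hn : 1 < nu.
  destruct (scales nu ok) as (n0 & En & EN & Es). destruct (Es eps) as [e1 e2]. rewrite e1 in Hrx. rewrite e2. clear Es e1 e2.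
  destruct (Nof_spec nu ok) as [Np NE]. set (N := Nof nu) in *. set (n3 := Rpower nu (1/3)) in *.
  have P1 : 1 <= Rpower nu eps by (rewrite <- (Rpower_O nu) by lra; apply Rle_Rpower; lra). set (P := Rpower nu eps) in *.
  destruct cbrt2_spec as [c3 c12]. have i4 : 0 < 4/(1 - rho). have d2 := pow2_ge_0 d.
  have n1 : 1 <= n3.
  have Pn : P <= n3/2.
  have zE : r * x = nu + z * n3.
  have zP : - P <= z <= P.
  have wE : r * x = nu * (1 + cbrt2 * z/N) by (rewrite zE, EN, En; field; lra).
  set (Y := cbrt2 * P). have HY : 1 <= Y by (unfold Y; nra).
  assert (YN : Y^2 <= N).
  { unfold Y. rewrite EN. turn ((cbrt2 * P)^2) into (cbrt2 * (cbrt2 * P^2)). apply Rmult_le_compat_l; [lra|].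
    have : P^2 <= (n3/2)^2. nra. }
  assert (YE : Y^3/N <= 2 * (P^3/n3^2)).
  { unfold Y. rewrite EN. turn ((cbrt2 * P)^3/(cbrt2 * n3^2)) into (cbrt2^2 * (P^3/n3^2)).
    have : 0 < P^3/n3^2. have : cbrt2^2 <= 2. nra. }
  assert (Rx : (1 + rho)/2 * nu <= r * x).
  { have : n3 * P <= n3 * (1/2 * (1 - rho) * n3). have : n3 * n3 <= nu by (rewrite En; nra). nra. }
  specialize (Ha nu x ok Rx).
  have RR : R' * x = r * x/rho.
  assert (Rbig : nu * (1 + 1/N) <= R' * x).
  { rewrite RR. apply Rmult_le_reg_r with rho; [lra|]. turn (r * x/rho * rho) into (r * x).
    assert (iN : 1/N <= (1 - rho)/4).
    { apply Rmult_le_reg_r with (N * (4/(1 - rho))); [nra|]. turn (1/N * (N * (4/(1 - rho)))) into (4/(1 - rho)).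
      turn ((1 - rho)/4 * (N * (4/(1 - rho)))) into N. lra. }
    have : 0 < 1/N. have : (1 + 1/N) * rho <= (1 + rho)/2 by nra. nra. }
  have Rnu : nu < R' * x by (have : 0 < nu * (1/N); lra).
  have W0 : wtime nu N (cbrt2 * z) = ln (r * x) by (unfold wtime; now rewrite wE).
  set (t1 := ln (R' * x)) in *. have q1 : 0 < bq nu t1 by (unfold t1; rewrite bq_exp by nra; nra).
  have l1 := ln_rx x Hx. fold t1 in l1.
  have T := HT nu N Y (cbrt2 * z) al b A sg t1 ok ok NE HY YN ltac:(unfold Y; split; nra) Hal Hb ltac:(rewrite W0; exact E0) Hbz HA ok
    ltac:(unfold wtime, t1; destruct Rbig as [h|h]; [left; apply ln_increasing; auto; have : 0 < 1/N; nra|rewrite h; lra]).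
  have Z1 := zero_bwkb nu al A sg d t1 k q1 HA E1. destruct (wkb_le_bxi nu t1 ok q1) as [s1 s2].
  have O := aout_at_xi b L (bxi nu t1) HL s2.
  have bt : HH r R' nu x <= bxi nu t1 by (unfold HH; fold t1; have : 0 <= bxi nu (ln (r * x)) by (apply bxi_cubic; lra); lra).
  (* both WKB errors at R' x are O(1/nu) *)
  set (xi := bxi nu t1) in *. have xn : 2 * a * nu <= xi.
  assert (Pq : / nu <= P^3/n3^2).
  { rewrite En. apply Rmult_le_reg_r with (n3^3); [pos|]. rewrite Rinv_l by pos. turn (P^3/n3^2 * n3^3) into (P^3 * n3).
    have : 1 <= P^3 by (apply pow_R1_Rle; lra). nra. }
  set (er := P^3/n3^2) in *. assert (ix : / xi <= er/(2 * a)).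
  { apply Rle_trans with (/ (2 * a * nu)); [pos|]. rewrite Rinv_mult. unfold Rdiv. rewrite Rmult_comm. obv. }
  have ws : wkb_size nu t1 <= 4/3 * / xi by (apply Rmult_le_reg_r with xi; auto; rewrite Rmult_assoc, Rinv_l; lra).
  assert (X : Rabs (bxi nu (ln (r * x)) - 2 * sqrt 2/3 * pos_pow_3_2 z) <= 2 * (Y^3/N)).
  { have y0 : 0 < Y^3/N. unfold pos_pow_3_2. destruct (Rle_dec z 0) as [c|c].
    - have zn : z * n3 <= 0 by (clear - c n0; nra). rewrite (proj2 (bs_neg_ln nu (r * x) ok)). rewrite Rmax_right by lra. rewrite Rmult_0_l, Rmult_0_r, Rminus_0_r, Rabs_R0. lra.
    - rewrite Rmax_left by lra. replace (2 * sqrt 2/3 * (z * sqrt z)) with (2/3 * (cbrt2 * z * sqrt (cbrt2 * z))).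
      + rewrite wE. apply Xi_transition; auto; try lra. clear - c zP c12. unfold Y; split; nra.
      + rewrite sqrt_mult by lra. replace (sqrt 2) with (cbrt2 * sqrt cbrt2); [pos|]. symmetry. apply sqrt_lem_1; [lra|pos|].
        turn (cbrt2 * sqrt cbrt2 * (cbrt2 * sqrt cbrt2)) into (cbrt2^2 * (sqrt cbrt2 * sqrt cbrt2)). rewrite sqrt_sqrt by lra. obv. }
  unfold HH. fold t1 xi. apply Rabs_le_between in X. apply Rabs_le_between in T. apply Rabs_le_between in Z1.
  have b1 : (1 + Rabs d) * wkb_size nu t1 <= (1 + Rabs d) * (4/3 * / xi).
  have b2 : (2 + 2 * Rabs d) * / xi <= (2 + 2 * Rabs d) * (er/(2 * a)).
  have b3 : C * (Y^3/N) <= C * (2 * er).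
  turn ((2 * C + 8 + 2 * (2 + 2 * Rabs d)/a) * er) into (2 * C * er + 8 * er + 4 * ((2 + 2 * Rabs d) * (er/(2 * a)))).
  have ixp : 0 < / xi. turn (5/36/xi) into (5/36 * / xi) in O.
  have : 0 <= Rabs d * / xi. obv.
Qed.
End Phase.

(** * Phase estimates below the window, and their inversion to estimates of the zero *)

Section Assembly.
Context (r R' : R) (hr : 0 < r) (hrR : r < R').

(** Here [HH] is the outer phase alone, and the WKB angle at [R' x] is both [k PI + sg] and
    [xi + PI/4] up to [O(1/xi)]. For [HH] below 2 the WKB expansion says nothing, and only a bounded
    error is claimed. *)
Lemma below_phase sg d eps : 0 < eps < 1/3 -> exists V C, 1 <= V /\ 0 < C /\ forall nu A k x, V < nu -> tcond A sg d -> zero_at r R' nu A k x ->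
  r * x <= nu - Rpower nu (1/3 + eps) -> Rabs (HH r R' nu x - INR k * PI) <= C /\
  (2 <= HH r R' nu x -> Rabs (HH r R' nu x - (INR k * PI + (sg - PI/4))) <= C/HH r R' nu x).
Proof.
  intros He. set (L := R'/r). have HL : 1 < L by (apply Rmult_lt_reg_r with r; auto; unfold L; turn (R'/r * r) into R'; lra).
  destruct (below_turning d L eps) as (V1 & HV1 & HB); [lra|lra|]. destruct (Rpower_small eps (1/8)) as (V2 & HV2 & HP); [lra|lra|].
  destruct (HH_linear r R' hr hrR) as (a & a0 & Ha). have ia := Rinv_0_lt_compat a a0.
  set (C := (2 + Rabs d) * (4/3) + L). have dp := Rabs_pos d. have HC : 2 < C by (unfold C; lra). exists (Rmax V1 (V2 + / a)), (C + 9).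
  splits; [eapply Rle_trans; [exact HV1|apply Rmax_l]|lra|]. intros nu A k x HV HA Hz Hrx. have P := PI_RGT_0. have P4 := PI_4.
  have v1 : V1 < nu by (eapply Rle_lt_trans; [apply Rmax_l|exact HV]). have v2 : V2 + / a < nu by (eapply Rle_lt_trans; [apply Rmax_r|exact HV]).
  specialize (HP nu ok). destruct (scales nu ok) as (n0 & En & EN & Es). destruct (Es eps) as [e1 _]. rewrite e1 in Hrx. clear Es e1.
  destruct (Nof_spec nu ok) as [Np NE]. set (n3 := Rpower nu (1/3)) in *. set (p := Rpower nu eps) in *. have p0 : 0 < p.
  destruct cbrt2_spec as [_ c12]. destruct Hz as (Hx & al & w & w1 & Hal & Hw & Tr & E0 & E1). set (t1 := ln (R' * x)) in *.
  have rx : 0 < r * x. have Rx : 0 < R' * x. have np : 0 < n3 * p.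
  have sg4 : Rabs (sg - PI/4) <= 1 by (destruct HA as [(_ & -> & _)|(_ & _ & ->)]; apply Rabs_le; lra).
  assert (G : forall t, t <= ln (L * nu) -> 1 <= bq nu t -> Rabs (bwkb nu al t - (bxi nu t + PI/4)) <= bB nu t + / nu).
  { intros t Ht Hq. apply (HB nu (cbrt2 * p) al w w1 A (ln (r * x)) t v1); auto.
    - fold p. clear - c12 p0. nra.
    - rewrite EN. have : 8 * p <= n3 * n3. clear - c12 H p0. nra.
    - now apply (tcond_bcond A sg).
    - unfold wtime. have E : nu * (1 + - (cbrt2 * p)/Nof nu) = nu - n3 * p by (rewrite EN, En; field; lra). rewrite E.
      destruct Hrx as [h|h]; [left; apply ln_increasing; lra|rewrite h; lra]. }
  have EL : R' * x = L * (r * x).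
  have Hh : HH r R' nu x = bxi nu t1 by (unfold HH; fold t1; rewrite (proj2 (bs_neg_ln nu (r * x) ok)); ring).
  have t1L : t1 <= ln (L * nu) by (apply Rlt_le, ln_increasing; auto; rewrite EL; apply Rmult_lt_compat_l; lra).
  assert (q2 : forall t, 2 <= bxi nu t -> 1 <= bq nu t).
  { intros t ht. apply Rnot_lt_le; intro c. destruct (Rle_dec (bq nu t) 0) as [h|h]; [rewrite (proj2 (bs_neg _ _ h)) in ht; lra|].
    have s := bs_sqr nu t ok. have s0 := bs_nonneg nu t. assert (bxi nu t <= bs nu t); [|obv].
    unfold bxi, Xi. assert (0 <= nu * atan (bs nu t/nu)); [|lra]. apply Rmult_le_pos; [lra|]. rewrite <- atan_0.
    destruct (Rle_lt_or_eq_dec _ _ s0) as [g|g]; [left; apply atan_increasing, Rdiv_lt_0_compat; lra|obv]. }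
  assert (Part2 : 2 <= HH r R' nu x -> Rabs (HH r R' nu x - (INR k * PI + (sg - PI/4))) <= C/HH r R' nu x).
  { intros H2. rewrite Hh in *. have q1 := q2 t1 H2. specialize (G t1 t1L q1).
    have Z1 := zero_bwkb nu al A sg d t1 k ok HA E1. destruct (wkb_le_bxi nu t1 ok ok) as [s1 s2]. have b1 := bB_le_size nu t1 ok.
    set (h := bxi nu t1) in *. set (ws := wkb_size nu t1) in *.
    assert (hn : / nu <= L/h).
    { assert (h <= L * nu); [|apply Rmult_le_reg_r with (h * nu); [pos|]; turn (/ nu * (h * nu)) into h; turn (L/h * (h * nu)) into (L * nu); auto].
      apply Rle_trans with (R' * x); [|obv]. destruct (bs_ln nu (R' * x) ok Rx) as [g _]. fold t1 in g. eapply Rle_trans; [|exact g].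
      unfold h, bxi, Xi. assert (0 <= nu * atan (bs nu t1/nu)); [|lra]. apply Rmult_le_pos; [lra|]. rewrite <- atan_0. left. apply atan_increasing, Rdiv_lt_0_compat; [|lra]. apply sqrt_lt_R0; lra. }
    have wh : ws <= 4/3/h by (apply Rmult_le_reg_r with h; auto; unfold Rdiv; rewrite Rmult_assoc, Rinv_l; lra).
    have m : (2 + Rabs d) * ws <= (2 + Rabs d) * (4/3/h).
    turn (C/h) into ((2 + Rabs d) * (4/3/h) + L/h). obv. }
  split.
  2: { intros H2. eapply Rle_trans; [now apply Part2|]. obv. }
  destruct (Rle_dec 2 (HH r R' nu x)) as [H2|H2].
  - specialize (Part2 H2). have : C/HH r R' nu x <= C by (apply Rmult_le_reg_r with (HH r R' nu x); [lra|]; unfold Rdiv; rewrite Rmult_assoc, Rinv_l by lra; clear - HC H2; nra).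
    apply Rabs_le_between in Part2. apply Rabs_le_between in sg4. apply Rabs_le. lra.
  - (* compare with the point x2 where the phase is 2 *)
    destruct (HH_surj r R' hr hrR nu 2) as (x2 & x20 & _ & X2); [lra|lra|lra|].
    assert (rx2 : r * x2 < nu).
    { apply Rnot_le_lt; intro c. destruct (ratio_lt_1 r R' hr hrR) as [g1 g2]. specialize (Ha nu x2 ok ok). rewrite X2 in Ha.
      have : a * / a = 1. obv. }
    have xx : x < x2 by (apply Rnot_le_lt; intro c; have h := HH_mono r R' hr hrR nu x2 x ok x20 c; lra).
    set (t2 := ln (R' * x2)). assert (h2 : bxi nu t2 = 2).
    { rewrite <- X2. unfold HH. fold t2. rewrite (proj2 (bs_neg_ln nu (r * x2) ok)). ring. }
    have q := q2 t2 ok. have t12 : t1 <= t2 by (apply Rlt_le, ln_increasing; auto; apply Rmult_lt_compat_l; lra).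
    specialize (G t2 ltac:(unfold t2; apply Rlt_le, ln_increasing; [pos|turn (R' * x2) into (L * (r * x2)); apply Rmult_lt_compat_l; lra]) q).
    destruct (wkb_le_bxi nu t2 ok ok) as [s1 _]. have b1 := bB_le_size nu t2 ok. rewrite h2 in *.
    have A0 : 0 <= A by (destruct HA as [(a1 & _)|(a1 & _)]; lra).
    assert (K : INR k * PI <= al t2).
    { have S := prufer_shift _ _ (- Z.of_nat k) Hal. have N := prufer_nonneg _ _ t1 t2 (exp (2 * t2) + nu^2) S t12. cbv beta in N.
      rewrite opp_IZR, <- INR_IZR_INZ, E1 in N. assert (0 <= al t2 + - INR k * PI); [|lra]. apply N; [|lra].
      intros t Ht. have m1 := bq_mono nu t t2 ok. have e := exp_pos (2 * t). have n2 := pow2_ge_0 nu. apply Rabs_le. unfold bq in *. obv. }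
    assert (K2 : INR k * PI <= bwkb nu al t2).
    { rewrite INR_IZR_INZ, <- (Sh_kPI (wkb_a (bq nu) t2) (wkb_b (bq nu) bq1 t2)), <- INR_IZR_INZ. apply Sh_le; auto. apply Rinv_0_lt_compat, sqrt_lt_R0; lra. }
    have inu : / nu <= 1 by (rewrite <- Rinv_1; apply Rinv_le_contravar; lra).
    have h0 : 0 <= HH r R' nu x by (rewrite Hh; apply bxi_cubic; lra). have kp : 0 <= INR k * PI.
    obv.
Qed.

Notation FF nu Phi := (F r R' nu (Phi/PI)).

Lemma inv_F nu x Phi mu : 0 <= nu -> 0 < x -> 0 < Phi -> 0 < mu <= 1 -> mu^3 * nu <= HH r R' nu x -> mu^3 * nu <= Phi ->
  hc r R' * mu * Rabs (x - FF nu Phi) <= Rabs (HH r R' nu x - Phi).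
Proof.
  intros Hn Hx HP Hm h1 h2. destruct (HH_surj r R' hr hrR nu Phi) as (y & y0 & y1 & y2); auto; [lra|].
  rewrite (F_spec r R' hr hrR nu (Phi/PI) y Hn y0 y1) by (rewrite y2; field; apply PI_neq0). rewrite <- y2.
  apply HH_inv; auto. obv.
Qed.

Lemma inv_regular : exists a C, 0 < a /\ 0 < C /\ forall nu x Phi, 0 < nu -> 0 < x -> (1 + r/R')/2 * nu <= r * x ->
  Rabs (HH r R' nu x - Phi) <= a * nu -> Rabs (x - FF nu Phi) <= C * Rabs (HH r R' nu x - Phi).
Proof.
  destruct (HH_linear r R' hr hrR) as (a & a0 & Ha). have c := hc_pos r R' hr hrR. set (mu := Rmin 1 a). have m0 : 0 < mu by (apply Rmin_pos; lra).
  have m1 : mu <= 1 by apply Rmin_l. have m2 : mu <= a by apply Rmin_r. have m3 : mu^3 <= a.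
  have hm : 0 < hc r R' * mu.
  exists a, (/ (hc r R' * mu)). splits; auto; [pos|]. intros nu x Phi Hn Hx H E. specialize (Ha nu x Hn H).
  have b := E. apply Rabs_le_between in b.
  have I := inv_F nu x Phi mu ok Hx ok ok ok ok.
  apply Rmult_le_reg_l with (hc r R' * mu); auto. rewrite <- Rmult_assoc, Rinv_r, Rmult_1_l; lra.
Qed.

(** If one of the two phases is large, both are at least 1, and the slope is at least
    [hc nu^(-1/3)]. Otherwise both points lie within [O(nu^(1/3))] of [nu/R'], by [HH_crude] and,
    should [x] fall short of [nu/R'], by the bound on [(R' x)^2]. *)
Lemma inv_crude C d : 0 < C -> exists D V, 0 < D /\ 1 <= V /\ forall nu x Phi, V < nu -> 0 < x -> nu^2 - d^2 < (R' * x)^2 -> 0 <= Phi ->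
  Rabs (HH r R' nu x - Phi) <= C -> Rabs (x - FF nu Phi) <= D * Rpower nu (1/3).
Proof.
  intros HC. destruct (HH_crude r R' hr hrR (2 * C + 2) ok) as (D & V & HD & HV & H). have c := hc_pos r R' hr hrR.
  have D0 : 0 < (D + d^2)/R'. have D1 : 0 < C/hc r R'.
  exists ((D + d^2)/R' + C/hc r R'), (Rmax 1 V). splits; [lra|apply Rmax_l|]. intros nu x Phi Hnu Hx Hb HP E.
  have v0 : 1 < nu by (eapply Rle_lt_trans; [apply Rmax_l|exact Hnu]). have v1 : V < nu by (eapply Rle_lt_trans; [apply Rmax_r|exact Hnu]).
  destruct (scales nu ok) as (n0 & En & _). set (n3 := Rpower nu (1/3)) in *. apply Rabs_le_between in E.
  have n1 : 1 <= n3.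
  have Rx : 0 < R' * x.
  destruct (Rle_dec (Rmax (HH r R' nu x) Phi) (2 * C + 2)) as [g|g].
  - have g1 := Rmax_l (HH r R' nu x) Phi. have g2 := Rmax_r (HH r R' nu x) Phi.
    destruct (HH_surj r R' hr hrR nu Phi) as (y & y0 & y1 & y2); auto; [lra|lra|].
    rewrite (F_spec r R' hr hrR nu (Phi/PI) y ok y0 y1) by (rewrite y2; field; apply PI_neq0).
    have hy := H nu n3 y n0 En v1 y0 y1 ok.
    assert (hx : - (d^2) * n3 <= R' * x - nu <= D * n3).
    { destruct (Rle_dec nu (R' * x)) as [q|q].
      - split; [obv|]. apply (H nu n3 x n0 En v1 Hx q). lra.
      - obv. }
    apply Rle_trans with ((D + d^2)/R' * n3); [|pos].
    apply Rmult_le_reg_l with R'; [lra|]. turn (R' * ((D + d^2)/R' * n3)) into ((D + d^2) * n3).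
    rewrite <- (Rabs_pos_eq R') at 1 by lra. rewrite <- Rabs_mult. apply Rabs_le. have : 0 <= d^2 * n3. lra.
  - have g1 : C + 2 <= HH r R' nu x /\ C + 2 <= Phi by (unfold Rmax in g; destruct (Rle_dec (HH r R' nu x) Phi); lra).
    have i : / n3 <= 1 by (rewrite <- Rinv_1; apply Rinv_le_contravar; lra).
    have i3 : (/ n3)^3 * nu = 1 by (rewrite En; field; lra).
    have I := inv_F nu x Phi (/ n3) ok Hx ok ok ok ok.
    apply Rle_trans with (C/hc r R' * n3); [|pos].
    apply Rmult_le_reg_l with (hc r R' * / n3); [pos|]. eapply Rle_trans; [exact I|].
    turn (hc r R' * / n3 * (C/hc r R' * n3)) into C. obv.
Qed.

(* Below the turning point the derivative of the phase is only of order (k/nu)^(1/3). *)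
Lemma inv_below C L d : 0 < C -> 1 <= L -> exists D V, 0 < D /\ 1 <= V /\ forall nu x k s, V < nu -> 0 < x -> nu^2 - d^2 < (R' * x)^2 -> HH r R' nu x <= L * nu ->
  Rabs s <= 1 -> 0 <= INR k * PI + s -> Rabs (HH r R' nu x - INR k * PI) <= C -> (2 <= HH r R' nu x -> Rabs (HH r R' nu x - (INR k * PI + s)) <= C/HH r R' nu x) ->
  Rabs (x - FF nu (INR k * PI + s)) * Rpower (INR k + 1) (4/3) <= D * Rpower nu (1/3).
Proof.
  intros HC HL. destruct (inv_crude (C + 1) d ok) as (D & V & HD & HV & H). have c := hc_pos r R' hr hrR.
  set (K := 3 * C + 3). set (B := Rpower (2 * K) (4/3)). have B0 : 0 < B.
  set (l := Rpower (2 * L) (1/3)). set (B2 := Rpower 2 (4/3)).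
  set (D2 := C/hc r R' * l * B2). have D20 : 0 < D2.
  exists (D * B + D2), V. splits; auto; [pos|].
  intros nu x k s Hnu Hx Hb Hup Hs Hp E1 E2. set (n3 := Rpower nu (1/3)). set (h := HH r R' nu x) in *.
  have P2 := PI2_1. have k0 := pos_INR k. have b1 := E1. apply Rabs_le_between in b1. have bs := Hs. apply Rabs_le_between in bs.
  have kP : INR k * 2 <= INR k * PI.
  have DB : 0 < D * B * n3. have DB2 : 0 < D2 * n3.
  destruct (Rle_dec h K) as [g|g].
  - have X : Rabs (x - FF nu (INR k * PI + s)) <= D * n3 by (apply H; auto; fold h; apply Rabs_le; lra).
    have Y : Rpower (INR k + 1) (4/3) <= B by (apply Rle_Rpower_l; [lra|]; unfold K in *; lra).
    apply Rle_trans with (D * n3 * B); [pos|lra].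
  - specialize (E2 ltac:(unfold K in g; lra)). have hp : 3 < h by (unfold K in g; lra).
    have Ch : C/h <= 1/2 by (apply Rmult_le_reg_r with h; [lra|]; unfold Rdiv; rewrite Rmult_assoc, Rinv_l by lra; unfold K in g; lra).
    have b2 := E2. apply Rabs_le_between in b2. have Ln : 0 < 2 * L * nu.
    set (mu := Rpower (h/(2 * L * nu)) (1/3)). have m0 : 0 < mu. have hq : 0 < h/(2 * L * nu).
    have m3 : mu^3 = h/(2 * L * nu) by (unfold mu; rewrite <- Rpower_pow, Rpower_mult by pos; replace (1/3 * INR 3) with 1 by (simpl; field); now apply Rpower_1).
    assert (m4 : mu^3 * nu <= h/2).
    { rewrite m3. turn (h/(2 * L * nu) * nu) into (h/2 * / L). have : / L <= 1 by (rewrite <- Rinv_1; apply Rinv_le_contravar; lra). clear - H0 hp. nra. }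
    assert (m1 : mu <= 1).
    { apply Rnot_lt_le; intro q. apply cube_lt in q; [|lra]. rewrite m3 in q. assert (h/(2 * L * nu) <= 1); [|lra]. apply Rmult_le_reg_r with (2 * L * nu); auto.
      unfold Rdiv; rewrite Rmult_assoc, Rinv_l by lra. lra. }
    have I := inv_F nu x (INR k * PI + s) mu ok Hx ok ok ltac:(fold h; lra) ok.
    have kh : Rpower (INR k + 1) (4/3) <= B2 * Rpower h (4/3) by (unfold B2; rewrite Rpower_mult_distr by lra; apply Rle_Rpower_l; lra).
    have hh : Rpower h (4/3) = h * Rpower h (1/3) by (rewrite <- (Rpower_1 h) at 2 by lra; rewrite <- Rpower_plus; f_equal; field).
    assert (mh : Rpower h (1/3) = mu * (l * n3)).
    { turn h into (h/(2 * L * nu) * (2 * L * nu)) at 1. rewrite <- Rpower_mult_distr by auto. f_equal. unfold l, n3. rewrite Rpower_mult_distr by lra. reflexivity. }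
    apply Rle_trans with (C/h/(hc r R' * mu) * (B2 * Rpower h (4/3))).
    + apply Rmult_le_compat; auto; [pos|pos|]. apply Rmult_le_reg_l with (hc r R' * mu); [pos|].
      eapply Rle_trans; [exact I|]. eapply Rle_trans; [exact E2|]. right. field. lra.
    + rewrite hh, mh. replace (C/h/(hc r R' * mu) * (B2 * (h * (mu * (l * n3))))) with (D2 * n3) by (unfold D2; field; lra). lra.
Qed.

Lemma wkb_far nu y : 0 <= nu -> 0 < y -> nu <= 2/3 * y -> wkb_size nu (ln y) <= 6/y.
Proof.
  intros Hn Hy H. destruct (bs_ln nu y Hn Hy) as [_ b]. set (s := bs nu (ln y)) in *.
  have s0 : 0 <= s by apply bs_nonneg. have n2 : nu^2 <= 4/9 * y^2.
  have s1 : y/2 <= s.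
  have i : / s <= 2 * / y by (turn (2 * / y) into (/ (y/2)); apply Rinv_le_contravar; lra). have i0 : 0 < / y.
  unfold wkb_size. fold s. turn (nu^2/s^3) into (nu^2 * (/ s)^2 * / s).
  assert (nu^2 * (/ s)^2 <= 16/9).
  { turn (16/9) into (4/9 * y^2 * (2 * / y)^2). obv. }
  obv.
Qed.

(** Just right of the turning point [s^2] is comparable with [nu (y - nu)], so [nu^2/s^3] becomes
    [nu^(1/2) (y - nu)^(-3/2)]: the shape of the error in the second zone. *)
Lemma wkb_mid nu y : 0 < nu -> nu < y <= 3/2 * nu -> wkb_size nu (ln y) <= 3 * (Rpower nu (1/2) * Rpower (y - nu) (- (3/2))).
Proof.
  intros Hn Hy. destruct (bs_ln nu y ok ok) as [_ b]. set (s := bs nu (ln y)) in *.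
  set (q := sqrt nu). have qq : q * q = nu by (apply sqrt_sqrt; lra).
  set (e := sqrt (y - nu)). have ee : e * e = y - nu by (apply sqrt_sqrt; lra). have e0 : 0 < e.
  have E1 : Rpower nu (1/2) = q by (turn (1/2) into (/ 2); now apply Rpower_sqrt).
  assert (E2 : Rpower (y - nu) (- (3/2)) = / e^3).
  { rewrite Rpower_Ropp. f_equal. replace (3/2) with (/ 2 * INR 3) by (simpl; field). rewrite <- Rpower_mult, Rpower_sqrt by lra. now apply Rpower_pow. }
  rewrite E1, E2. have s0 : 0 <= s by apply bs_nonneg.
  have s1 : (q * e)^2 * 2 <= s^2 <= 5/4 * nu^2.
  have qe : 0 < q * e. have s2 : q * e <= s.
  unfold wkb_size. fold s. have s3 : 0 < s^3.
  have qe3 : (q * e)^3 * (4/3) <= s^3.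
  apply Rmult_le_reg_r with (s^3); auto. turn ((/ s + nu^2/s^3) * s^3) into (s^2 + nu^2).
  apply Rle_trans with (9/4 * nu^2); [lra|]. rewrite <- qq. apply Rmult_le_reg_r with (e^3); [pos|].
  turn (3 * (q * / e^3) * s^3 * e^3) into (3 * q * s^3). obv.
Qed.
End Assembly.

(* [outcomes sg be]: the Airy solution with angle [sg] at [cbrt2 * z] comes out with phase shift [PI be z - PI/4]. *)
Definition outcomes (sg : R) (be : R -> R) := forall z, exists b, prufer aq b /\ b (cbrt2 * z) = sg /\ aout b (- (PI/4) + PI * be z).

(** The phase shift [T] in the transition window: [- PI psi_1] for [sg = 0] and [PI psi_2] for
    [sg = PI/2]. *)
Definition Tz sg (be : R -> R) z := sg - (- (PI/4) + PI * be z) - 2 * sqrt 2/3 * pos_pow_3_2 z.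

Section Shift.
Context (b1 b2 be : R -> R) (sg : R) (H1 : outcomes 0 b1) (H2 : outcomes (PI/2) b2) (e1 : b1 0 = 1/3) (e2 : b2 0 = 2/3)
  (Hsg : sg = 0 \/ sg = PI/2) (Hbe : outcomes sg be).

(** An Airy angle that starts at 0 or [PI/2] left of 0 is still in [[0, PI/2]] at 0. Comparison with
    the solutions that start at 0 with these two angles bounds the outcome by [PI/12] and [5 PI/12],
    the values for [beta1 0] and [beta2 0]; this stands in for the monotonicity of the [psi_i]. *)
Lemma Tz_neg z : z <= 0 -> sg - 5 * PI/12 <= Tz sg be z <= sg - PI/12.
Proof.
  intros Hz. destruct (Hbe z) as (b & Hb & Eb & Ob). destruct (H1 0) as (c & Hc & Ec & Oc). destruct (H2 0) as (c' & Hc' & Ec' & Oc').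
  rewrite Rmult_0_r in Ec, Ec'. rewrite e1 in Oc. rewrite e2 in Oc'. have P := PI_RGT_0. have C := cbrt2_pos.
  set (y := cbrt2 * z) in *. have Hy : y <= 0.
  have B0 : 0 <= b 0 by (apply (prufer_nonneg aq b y 0 (- y)); auto; [intros t Ht; unfold aq; apply Rabs_le; lra|lra]).
  have B1 : b 0 <= PI/2 + 2 * 0 by (apply (prufer_le_half aq b y 0 0); auto; try lra; intros t Ht; unfold aq; lra).
  assert (mono : forall f h, prufer aq f -> prufer aq h -> f 0 <= h 0 -> forall t, 0 < t -> f t <= h t).
  { intros f h Hf Hh fh t Ht. apply (prufer_le aq aq f h 0 t (t + 1)); auto; [lra|]. intros s Hs. split; [lra|]. unfold aq. obv. }
  have l1 := aout_le c b _ _ Hc Hb Oc Ob (mono c b Hc Hb ok). have l2 := aout_le b c' _ _ Hb Hc' Ob Oc' (mono b c' Hb Hc' ok).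
  unfold Tz, pos_pow_3_2. rewrite Rmax_right by auto. lra.
Qed.

Lemma axi_z z : 0 < z -> 2 * sqrt 2/3 * pos_pow_3_2 z = axi (cbrt2 * z).
Proof.
  intros Hz. unfold pos_pow_3_2, axi. destruct cbrt2_spec as [c3 c12]. rewrite Rmax_left by lra. rewrite sqrt_mult by lra.
  replace (sqrt 2) with (cbrt2 * sqrt cbrt2); [pos|]. symmetry. apply sqrt_lem_1; [lra|pos|].
  turn (cbrt2 * sqrt cbrt2 * (cbrt2 * sqrt cbrt2)) into (cbrt2^2 * (sqrt cbrt2 * sqrt cbrt2)). rewrite sqrt_sqrt by lra. obv.
Qed.

(** The boundary angle is off by at most [(1/4) y^(-3/2)] and the outcome by [(5/24) y^(-3/2)],
    together less than half of [y^(-3/2)]. For [y < 1] the angle is followed up to 1 instead, which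
    gives the absolute bound. *)
Lemma Tz_pos z : 0 < z -> Rabs (Tz sg be z) <= / (2 * (z * sqrt z)) /\ Rabs (Tz sg be z) <= 8.
Proof.
  intros Hz. destruct (Hbe z) as (b & Hb & Eb & Ob). destruct cbrt2_spec as [c3 c12]. have P := PI_RGT_0. have P4 := PI_4.
  unfold Tz. rewrite axi_z by auto. set (y := cbrt2 * z) in *. have Hy : 0 < y. set (L := - (PI/4) + PI * be z) in *.
  have X : forall t, 0 < t -> t <= y -> 0 < t * sqrt t /\ t * sqrt t <= y * sqrt y.
  assert (S : Rabs (awkb b y - sg) <= 1/(4 * (y * sqrt y))).
  { rewrite awkb_at, Eb. have : 0 < 1/(4 * (y * sqrt y)). destruct Hsg as [-> | ->].
    - rewrite Sh_0, Rminus_0_r, Rabs_R0. lra.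
    - eapply Rle_trans; [apply (Sh_near_half _ _ (PI/2) 0); [pos|lra|rewrite cos_PI2; ring]|].
      rewrite Rmult_0_r, Rplus_0_l, Rmult_assoc, Rabs_pos_eq; lra. }
  have O := Ob y Hy. destruct (X z Hz ok) as [z0 zy].
  assert (Q : Rabs (sg - L - axi y) <= / (2 * (y * sqrt y))).
  { unfold aB in O. apply Rabs_le_between in S. apply Rabs_le. set (u := y * sqrt y) in *. turn (1/(4 * u)) into (1/4 * / u) in S.
    turn (5/24/u) into (5/24 * / u) in O. turn (/ (2 * u)) into (1/2 * / u). obv. }
  split; [eapply Rle_trans; [exact Q|]; apply Rinv_le_contravar; lra|]. destruct (Rle_dec 1 y) as [c|c].
  - eapply Rle_trans; [exact Q|]. have : 1 <= sqrt y by (rewrite <- sqrt_1; apply sqrt_le_1_alt; auto).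
    apply Rle_trans with (/ 1); [apply Rinv_le_contravar; nra|lra].
  - assert (g0 : sg <= b 1).
    { rewrite <- Eb. apply deriv_nonneg_le; [lra|]. intros t Ht. eexists; split; [apply Hb|]. unfold aq. obv. }
    assert (g1 : y - b y <= 1 - b 1).
    { apply (deriv_nonneg_le (fun t => t - b t)); [lra|]. intros t Ht. exists (1 - (cos (b t)^2 + aq t * sin (b t)^2)). split.
      - apply (is_derive_minus (fun t => t) b); [apply (is_derive_id t)|obv].
      - unfold aq. have a := cs1 (b t). obv. }
    rewrite Eb in g1. have O1 := Ob 1 ok. unfold aB, axi in O1. rewrite sqrt_1 in O1.
    have N := Sh_near (/ sqrt 1) (1/(4 * 1 * sqrt 1)) (b 1). rewrite <- awkb_at in N. apply Rabs_def2 in N.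
    have A : 0 <= axi y <= 2/3 by (unfold axi; have : sqrt y <= 1 by (rewrite <- sqrt_1; apply sqrt_le_1_alt; lra); split; nra).
    obv.
Qed.

Lemma Tz_bound z : Rabs (Tz sg be z) <= 8.
Proof.
  have P := PI_RGT_0. have P4 := PI_4. destruct (Rle_dec z 0) as [c|c]; [|apply Tz_pos; lra].
  destruct (Tz_neg z c). obv.
Qed.
End Shift.

(** * The asymptotic formula for both boundary conditions *)

Section Main.
Context (r R' : R) (hr : 0 < r) (hrR : r < R').

Lemma G_HH nu : 0 < nu -> PI * (G r R' r/r * nu) = HH r R' nu (nu/r).
Proof.
  intros Hn. have e : r * (nu/r) = nu.
  unfold HH. rewrite <- !(g_bxi nu) by obv.
  unfold G. destruct (Rle_dec r r); [|lra]. turn (nu/(nu/r)) into r. field. lra.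
Qed.

Lemma HH_le nu x : 0 <= nu -> 0 < x -> HH r R' nu x <= R' * x.
Proof.
  intros Hn Hx. have a1 := proj1 (bs_ln nu (R' * x) Hn ok). unfold HH, bxi, Xi.
  destruct Hn as [n0|n0].
  - have b := proj1 (bxi_cubic nu (ln (r * x)) n0). unfold bxi, Xi in b. assert (0 <= nu * atan (bs nu (ln (R' * x))/nu)); [|lra].
    apply Rmult_le_pos; [lra|]. rewrite <- atan_0. destruct (Rle_lt_or_eq_dec _ _ (bs_nonneg nu (ln (R' * x)))) as [g|g]; [left; apply atan_increasing, Rdiv_lt_0_compat; lra|].
    rewrite <- g. unfold Rdiv. rewrite Rmult_0_l. lra.
  - have g := bs_nonneg nu (ln (r * x)). obv.
Qed.

(** The threshold [K] absorbs all dependence on [nu]: beyond it [zero_count] pushes [r x] past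
    [2 V + W + 2], where the far WKB bound holds, the phase error is at most 1, and the slope of
    [HH] is bounded below. *)
Lemma asymptotics_bounded V d : exists M, 0 < M /\ forall nu A, 0 <= nu <= INR V -> bcond A d -> exists K, (0 < K)%nat /\
  forall k x, zero_at r R' nu A k x -> (K < k)%nat -> Rabs (x - F r R' nu (INR k)) <= M * / (nu + INR k).
Proof.
  have c := hc_pos r R' hr hrR. have dp := Rabs_pos d. have P2 := PI2_1.
  set (W := 6 * (3 + 2 * Rabs d)). have HW : 18 <= W. set (B := 2 * r + R').
  exists (W/hc r R'/r * B). split; [obv|].
  intros nu A Hn HA. set (X := (2 * INR V + W + 2)/r). have rX : r * X = 2 * INR V + W + 2.
  set (Z := (1 + (R' * X)^2) * (ln R' - ln r) + W + nu + 1). destruct (INR_unbounded Z) as [K HK]. exists (S K). split; [lia|]. intros k x Hz Hk.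
  have Hk' : Z < INR k by (apply Rlt_trans with (INR K); auto; apply lt_INR; lia). have Hx := proj1 Hz.
  have kc := zero_count r R' hr hrR nu A k x Hz. have lnp : 0 < ln R' - ln r by (have h := ln_increasing r R' hr hrR; lra).
  have kP : INR k * 2 <= INR k * PI.
  have zp : 0 <= (1 + (R' * X)^2) * (ln R' - ln r). unfold Z in Hk'.
  assert (XX : X <= x).
  { apply Rnot_lt_le; intro q. have : (R' * x)^2 <= (R' * X)^2.
    obv. }
  have rx : r * X <= r * x. have rp : 0 < r * x.
  have E := right_phase r R' hr hrR nu A d k x ok HA Hz ok. have w := wkb_far nu (r * x) ok rp ok.
  have E' : Rabs (HH r R' nu x - INR k * PI) <= W/(r * x).
  have E1 : W/(r * x) <= 1 by (apply Rmult_le_reg_r with (r * x); auto; unfold Rdiv; rewrite Rmult_assoc, Rinv_l; lra).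
  have b := E'. apply Rabs_le_between in b.
  have I := inv_F r R' hr hrR nu x (INR k * PI) 1 ok Hx ok ok ok ok.
  turn (INR k * PI/PI) into (INR k) in I. rewrite Rmult_1_r in I. have up := HH_le nu x ok Hx.
  have nk : nu + INR k <= B * x. apply Rmult_le_reg_l with (hc r R'); auto. eapply Rle_trans; [exact I|]. eapply Rle_trans; [exact E'|].
  turn (hc r R' * (W/hc r R'/r * B * / (nu + INR k))) into (W/r * (B * / (nu + INR k))).
  turn (W/(r * x)) into (W/r * / x). apply Rmult_le_compat_l; [pos|].
  apply Rmult_le_reg_r with (x * (nu + INR k)); [pos|]. turn (/ x * (x * (nu + INR k))) into (nu + INR k).
  turn (B * / (nu + INR k) * (x * (nu + INR k))) into (B * x). auto.
Qed.

Lemma asymptotics b1 b2 be sg d : outcomes 0 b1 -> outcomes (PI/2) b2 -> b1 0 = 1/3 -> b2 0 = 2/3 -> sg = 0 \/ sg = PI/2 -> outcomes sg be ->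
  forall eps, 0 < eps -> exists V M, 1 <= V /\ 0 < M /\ forall nu A k x, V < nu -> tcond A sg d -> zero_at r R' nu A k x -> (1 <= k)%nat \/ sg = PI/2 ->
  let T := if Rle_dec (nu + Rpower nu (1/3 + eps)) (r * x) then 0 else if Rle_dec (r * x) (nu - Rpower nu (1/3 + eps)) then sg - PI/4
    else Tz sg be ((r * x - nu)/Rpower nu (1/3)) in
  let e := Rabs (x - F r R' nu ((INR k * PI + T)/PI)) in
  ((1 + 1/2) * nu <= r * x -> e <= M * / (nu + INR k)) /\
  (nu + Rpower nu (1/3 + eps) <= r * x < (1 + 1/2) * nu -> 0 < INR k - G r R' r/r * nu /\
     e <= M * (Rpower nu (1/2) * Rpower (INR k - G r R' r/r * nu) (- (3/2)))) /\
  (nu - Rpower nu (1/3 + eps) < r * x < nu + Rpower nu (1/3 + eps) -> e <= M * Rpower nu (- (2/3) + 3 * eps)) /\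
  (r * x <= nu - Rpower nu (1/3 + eps) -> e * Rpower (INR k + 1) (4/3) <= M * Rpower nu (1/3)).
Proof.
  intros H1 H2 e1 e2 Hsg Hbe eps Heps. set (ep := if Rlt_dec eps (1/3) then eps else 1/4).
  have Hep : 0 < ep < 1/3 /\ ep <= eps by (unfold ep; destruct (Rlt_dec eps (1/3)); lra).
  destruct (transition_phase r R' hr hrR sg d ep (proj1 Hep)) as (Vt & Ct & HVt & HCt & HT). destruct (below_phase r R' hr hrR sg d ep (proj1 Hep)) as (Vb & Cb & HVb & HCb & HB).
  destruct (inv_regular r R' hr hrR) as (a & Ci & a0 & HCi & HI). destruct (inv_crude r R' hr hrR (Cb + 8) d ok) as (Dc & Vc & HDc & HVc & HIc).
  set (L := R'/r). have HL : 1 < L by (apply Rmult_lt_reg_r with r; auto; unfold L; turn (R'/r * r) into R'; lra).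
  destruct (inv_below r R' hr hrR Cb L d HCb ok) as (Dl & Vl & HDl & HVl & HIl). destruct (HH_linear r R' hr hrR) as (a' & a'0 & Ha').
  destruct (ratio_lt_1 r R' hr hrR) as [rho0 rho1]. destruct (Rpower_small ep ((1 - r/R')/2)) as (Vp & HVp & HP); [lra|lra|].
  have dp := Rabs_pos d. set (D3 := 3 + 2 * Rabs d). have HD3 : 3 <= D3. set (W := 6 * D3 + 8).
  set (mu := Rmin 1 a'). have m0 : 0 < mu by (apply Rmin_pos; lra). have m1 : mu <= 1 by apply Rmin_l. have m2 : mu <= a' by apply Rmin_r.
  have c := hc_pos r R' hr hrR. set (c1 := hc r R' * mu/r). have c10 : 0 < c1.
  (* Requiring [nu^(1/3) >= K] keeps every phase error below [a nu], as [inv_regular] demands, and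
     makes [c1 (r x - nu)] at least twice the phase error in the second zone. *)
  set (K := 2 + (W + Ct)/a + 2 * W/c1). have k1 : 0 < (W + Ct)/a. have k2 : 0 < 2 * W/c1.
  destruct (Rpower_dominates (1/3) K ok ok) as (Vk & HVk & HK).
  set (c2 := L + c1). set (M1 := Ci * W * (r + R' + a * r)/r). set (M2 := Ci * D3 * 3 * Rpower c2 (3/2)). set (M3 := Ci * (Ct + W) + Dc).
  have P1 : 0 < M1.
  have P2 : 0 < M2.
  have P3 : 0 < M3.
  exists (Vt + Vb + Vc + Vl + Vp + Vk), (M1 + M2 + M3 + Dl). splits; [lra|lra|]. intros nu A k x HV HA Hz Hk T e.
  have P := PI_RGT_0. have P4 := PI_4. have PP := PI2_1. have Hx := proj1 Hz. have HBc := tcond_bcond _ _ _ HA. have k0 := pos_INR k.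
  specialize (HP nu ok). specialize (HK nu ok). destruct (scales nu ok) as (n0 & En & _ & Es). have Sc := proj1 (Es eps). have Sp := proj1 (Es ep). have Sq := proj2 (Es ep). clear Es.
  have lnn : 0 <= ln nu by (rewrite <- ln_1; apply Rlt_le, ln_increasing; lra). set (n3 := Rpower nu (1/3)) in *.
  have nK : K <= n3 by (have : 0 <= K * ln nu; lra). have n1 : 1 <= n3 by (unfold K in nK; lra).
  set (p := Rpower nu eps) in *. set (p1 := Rpower nu ep) in *. have p10 : 1 <= p1 by (unfold p1; rewrite <- (Rpower_O nu) by lra; apply Rle_Rpower; lra).
  have pp : p1 <= p by (apply Rle_Rpower; lra). have np1 : n3 <= n3 * p1 by (rewrite <- (Rmult_1_r n3) at 1; apply Rmult_le_compat_l; lra).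
  have npp : n3 * p1 <= n3 * p.
  have nn : n3 <= nu by (rewrite En; have : 1 <= n3 * n3 by (clear - n1; nra); clear - H n1; nra).
  assert (an : W + Ct <= a * nu /\ (W + Ct) * n3 <= a * nu).
  { have : (W + Ct)/a <= n3 by (unfold K in nK; lra). have q : W + Ct <= a * n3 by (apply Rmult_le_reg_r with (/ a); [pos|]; turn (a * n3 * / a) into n3; exact H).
    split; [apply Rle_trans with (a * n3); auto; apply Rmult_le_compat_l; lra|]. rewrite En. apply Rle_trans with (a * n3 * n3); [pos|]. clear - a0 n1. have : 1 <= n3. have : n3 * n3 <= n3^3. nra. }
  assert (Reg : forall Phi E, nu - n3 * p1 <= r * x -> Rabs (HH r R' nu x - Phi) <= E -> E <= a * nu -> Rabs (x - F r R' nu (Phi/PI)) <= Ci * E).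
  { intros Phi E h1 h2 h3. apply Rle_trans with (Ci * Rabs (HH r R' nu x - Phi)); [|pos]. apply HI; auto; try lra.
    have : n3 * p1 <= n3 * ((1 - r/R')/2 * n3). have : n3 * n3 <= nu by (rewrite En; clear - n1; nra).
    have : (1 - r/R')/2 * (n3 * n3) <= (1 - r/R')/2 * nu. lra. }
  have HHx := HH_le nu x ok Hx.
  have Tb : Rabs (Tz sg be ((r * x - nu)/n3)) <= 8 by (apply (Tz_bound b1 b2); auto).
  have rp : 0 < r * x.
  have n2 : n3 <= nu/2 by (have : 2 <= K by (unfold K; lra); rewrite En; clear - n1 nK H; have : 4 <= n3 * n3; nra).
  assert (Rt : nu + n3 <= r * x -> wkb_size nu (ln (r * x)) <= 3 /\ Rabs (HH r R' nu x - INR k * PI) <= D3 * wkb_size nu (ln (r * x))).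
  { intros h. split; [|apply (right_phase r R' hr hrR nu A d k x); auto; lra].
    apply Rle_trans with (wkb_size nu (ln (nu + n3))).
    - apply wkb_size_mono; [rewrite bq_exp by lra; clear - n0 nn n1; nra|]. destruct h as [h|h]; [left; apply ln_increasing; lra|rewrite h; lra].
    - eapply Rle_trans; [apply wkb_mid; lra|]. turn (nu + n3 - nu) into n3. unfold n3. rewrite Rpower_mult, <- Rpower_plus. turn (1/2 + 1/3 * - (3/2)) into 0. rewrite Rpower_O by lra. lra. }
  have Mn : 0 < n3.
  splits.
  - intros h. have w := wkb_far nu (r * x) ok rp ok.
    destruct (Rt ok) as [_ E].
    have ir : 0 < / (r * x).
    (* For large [eps] the transition window reaches into this zone, where [T] is then [Tz] instead
       of 0; but [z nu^(1/3) >= r x/3] makes it [O(1/(r x))]. *)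
    assert (TT : Rabs T <= 8/(r * x)).
    { unfold T. have p8 : 0 <= 8/(r * x). destruct (Rle_dec (nu + Rpower nu (1/3 + eps)) (r * x)); [pos|].
      destruct (Rle_dec (r * x) (nu - Rpower nu (1/3 + eps))) as [q|q]; [pos|]. set (z := (r * x - nu)/n3) in *.
      have z3 : r * x/3 <= z * n3 by (unfold z; turn ((r * x - nu)/n3 * n3) into (r * x - nu); lra).
      have z0 : 0 < z. eapply Rle_trans; [refine (proj1 (Tz_pos _ _ _ _ z z0)); auto|].
      have sz := sqrt_lt_R0 z z0. have sz2 := sqrt_sqrt z (Rlt_le _ _ z0). set (s := sqrt z) in *.
      assert (g : r * x/8 <= z * s).
      { apply Rnot_lt_le; intro g. have g2 : (z * s)^2 < (r * x/8)^2 by (have : 0 < z * s; clear - g H; nra).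
        replace ((z * s)^2) with (z^3) in g2 by (rewrite <- sz2; ring). have g3 : (r * x/3)^3 <= z^3 * nu by (rewrite En, <- Rpow_mult_distr; apply pow_incr; lra).
        have : z^3 * nu <= z^3 * (r * x). clear - g2 g3 H rp. obv. }
      turn (8/(r * x)) into (/ (r * x/8)). obv. }
    assert (EE : Rabs (HH r R' nu x - (INR k * PI + T)) <= W/(r * x)).
    { turn (W/(r * x)) into (D3 * (6/(r * x)) + 8/(r * x)). have : D3 * wkb_size nu (ln (r * x)) <= D3 * (6/(r * x)).
      obv. }
    have Wx : W/(r * x) <= W by (apply Rmult_le_reg_r with (r * x); auto; unfold Rdiv; rewrite Rmult_assoc, Rinv_l by lra; have : 1 <= r * x; unfold W; clear - H HD3; nra).
    have X := Reg _ _ ok EE ok. fold e in X.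
    assert (kx : INR k <= (R' + a * r) * x).
    { have : INR k * 2 <= INR k * PI. apply Rabs_le_between in E. assert (D3 * wkb_size nu (ln (r * x)) <= W).
      { apply Rle_trans with (D3 * (6/(r * x))); [pos|]. turn (D3 * (6/(r * x))) into (W/(r * x) - 8/(r * x)). obv. }
      have : a * nu <= a * (r * x). lra. }
    apply Rle_trans with (M1 * / (nu + INR k)); [|pos]. eapply Rle_trans; [exact X|].
    turn (Ci * (W/(r * x))) into (Ci * W/r * / x). turn (M1 * / (nu + INR k)) into (Ci * W/r * ((r + R' + a * r) * / (nu + INR k))).
    apply Rmult_le_compat_l; [obv|].
    apply Rmult_le_reg_r with (x * (nu + INR k)); [pos|]. turn (/ x * (x * (nu + INR k))) into (nu + INR k).
    turn ((r + R' + a * r) * / (nu + INR k) * (x * (nu + INR k))) into ((r + R' + a * r) * x). lra.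
  - intros [h h']. have ET : T = 0 by (unfold T; destruct (Rle_dec (nu + Rpower nu (1/3 + eps)) (r * x)); [auto|lra]). rewrite Sc in h. set (De := r * x - nu).
    have De0 : n3 <= De by (unfold De; lra). destruct (Rt ok) as [w3 E]. have w := wkb_mid nu (r * x) ok ok. fold De in w.
    have ws : 0 < wkb_size nu (ln (r * x)) by (refine (proj1 (wkb_size_mono nu _ _ _ (Rle_refl _))); rewrite bq_exp by lra; unfold De in De0; have : 0 < nu; clear - De0 H n1; nra).
    set (wz := wkb_size nu (ln (r * x))) in *. have Ew : D3 * wz <= W by (unfold W; have : D3 * wz <= D3 * 3; lra).
    have X := Reg (INR k * PI + T) (D3 * wz) ok ok ok. fold e in X.
    have np : 0 < nu/r. have rn : r * (nu/r) = nu. have xr : x - nu/r = De/r.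
    have xp : 0 < De/r.
    (* [D PI] is [k PI] minus the phase at the inner turning point [nu/r]. It is comparable with
       [De], since the slope of [HH] lies between two constants from [nu/r] on and the phase error
       is at most half of [c1 De]. *)
    set (D := INR k - G r R' r/r * nu). have DE : D * PI = INR k * PI - HH r R' nu (nu/r) by (rewrite <- G_HH by lra; unfold D; ring).
    have Up := HH_upper r R' hr hrR nu (nu/r) x ok np ok. rewrite xr in Up. turn (R' * (De/r)) into (L * De) in Up.
    assert (Lo : c1 * De <= HH r R' nu x - HH r R' nu (nu/r)).
    { have hm := HH_mono r R' hr hrR nu (nu/r) x ok np ok. have ha := Ha' nu (nu/r) ok ltac:(rewrite rn; have : (1 + r/R')/2 * nu <= 1 * nu; lra).
      have m3 : mu^3 * nu <= 2 * a' * nu by (apply Rmult_le_compat_r; [lra|]; clear - m0 m1 m2; nra).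
      have I := HH_inv r R' hr hrR nu x (nu/r) mu ok Hx np ok ok ok. rewrite xr, !Rabs_pos_eq in I by lra.
      turn (c1 * De) into (hc r R' * mu * (De/r)). exact I. }
    assert (W2 : 2 * W <= c1 * De).
    { have : 2 * W/c1 <= De by (unfold K in nK; lra). apply Rmult_le_reg_r with (/ c1); [pos|]. turn (c1 * De * / c1) into De. exact H. }
    apply Rabs_le_between in E. have Wp : 0 < W. have Dp : 0 < D by (apply Rmult_lt_reg_r with PI; lra). split; auto.
    have Dc2 : D <= c2 * De by (have : D * 1 <= D * PI; unfold c2; lra).
    have c20 : 0 < c2.
    assert (RR : Rpower De (- (3/2)) <= Rpower c2 (3/2) * Rpower D (- (3/2))).
    { rewrite !Rpower_Ropp. have g : Rpower D (3/2) <= Rpower c2 (3/2) * Rpower De (3/2) by (rewrite Rpower_mult_distr by lra; apply Rle_Rpower_l; lra).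
      set (u := Rpower D (3/2)) in *. set (v := Rpower De (3/2)) in *. have : 0 < u. have : 0 < v.
      apply Rmult_le_reg_r with (u * v); [pos|]. turn (/ v * (u * v)) into u. turn (Rpower c2 (3/2) * / u * (u * v)) into (Rpower c2 (3/2) * v). auto. }
    have nh : 0 < Rpower nu (1/2). have Dh : 0 < Rpower D (- (3/2)).
    apply Rle_trans with (M2 * (Rpower nu (1/2) * Rpower D (- (3/2)))); [|pos].
    eapply Rle_trans; [exact X|]. apply Rle_trans with (Ci * (D3 * (3 * (Rpower nu (1/2) * (Rpower c2 (3/2) * Rpower D (- (3/2))))))); [|obv].
    apply Rmult_le_compat_l; [lra|]. apply Rmult_le_compat_l; [lra|]. eapply Rle_trans; [exact w|]. apply Rmult_le_compat_l; [lra|]. apply Rmult_le_compat_l; lra.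
  - intros [h h']. set (z := (r * x - nu)/n3) in *.
    have ET : T = Tz sg be z by (unfold T; destruct (Rle_dec (nu + Rpower nu (1/3 + eps)) (r * x)); [lra|]; destruct (Rle_dec (r * x) (nu - Rpower nu (1/3 + eps))); [lra|auto]).
    assert (Mid : nu - n3 * p1 <= r * x <= nu + n3 * p1 -> Rabs (HH r R' nu x - (INR k * PI + T)) <= Ct * (p1^3/n3^2)).
    { intros q. destruct (Hbe z) as (b & Hb & Eb & Ob). rewrite ET, <- Sq. apply (HT nu A k x b); auto; [lra|pos]. }
    assert (p3 : p1^3/n3^2 <= n3).
    { apply Rmult_le_reg_r with (n3^2); [pos|]. unfold Rdiv. rewrite Rmult_assoc, Rinv_l by pos. turn (n3 * n3^2) into (n3^3). rewrite Rmult_1_r.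
      apply pow_incr. split; [lra|]. eapply Rle_trans; [exact HP|]. rewrite <- (Rmult_1_l n3) at 2. obv. }
    have Wp : 0 < W.
    assert (Mid2 : nu - n3 * p1 <= r * x <= nu + n3 * p1 -> e <= Ci * (Ct * (p1^3/n3^2))).
    { intros q. apply Reg; auto; [lra|]. eapply Rle_trans; [apply Rmult_le_compat_l; [lra|exact p3]|]. have : 0 < W * n3. lra. }
    set (tg := Rpower nu (- (2/3) + 3 * eps)). have tg0 : 0 < tg. have : M3 * tg <= (M1 + M2 + M3 + Dl) * tg.
    have CW : 0 < Ci * W. have CC : 0 < Ci * Ct.
    destruct (Rlt_dec eps (1/3)) as [q|q].
    + have Eq : ep = eps. have Y := Mid2 ltac:(unfold p1; rewrite Eq; fold p; rewrite <- Sc; lra).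
      rewrite <- Sq, Eq in Y. fold tg in Y. eapply Rle_trans; [exact Y|]. eapply Rle_trans; [|exact H]. rewrite <- Rmult_assoc. apply Rmult_le_compat_r; [lra|]. unfold M3. lra.
    + have nt : n3 <= tg. eapply Rle_trans; [|exact H]. apply Rle_trans with (M3 * n3); [|pos].
      have CWn : 0 < Ci * W * n3. have CCn : 0 < Ci * Ct * n3. have Dcn : 0 < Dc * n3.
      destruct (Rle_dec (nu + n3 * p1) (r * x)) as [g|g]; [|destruct (Rle_dec (nu - n3 * p1) (r * x)) as [g'|g']].
      * destruct (Rt ok) as [w3 E]. assert (Y : e <= Ci * W).
        { apply Reg; [lra| |lra]. rewrite ET. have : D3 * wkb_size nu (ln (r * x)) <= D3 * 3. apply Rabs_le_between in E. apply Rabs_le_between in Tb. unfold W. obv. }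
        have : Ci * W * 1 <= Ci * W * n3. unfold M3. lra.
      * have Y := Mid2 ok. have : Ci * Ct * (p1^3/n3^2) <= Ci * Ct * n3. unfold M3. lra.
      * destruct (HB nu A k x ok HA Hz ok) as [E _]. assert (Y : e <= Dc * n3).
        { apply HIc; auto; [lra|now apply (zero_beyond r R' hr hrR nu A d k)| |].
          (* The target phase must be nonnegative to lie in the range of [HH]: [T] is at least
             [sg - 5 PI/12], and [k >= 1] when [sg = 0]. *)
          - destruct (Tz_neg b1 b2 be sg H1 H2 e1 e2 Hsg Hbe z) as [t1 t2]; [unfold z; apply Rmult_le_reg_r with n3; [lra|]; turn ((r * x - nu)/n3 * n3) into (r * x - nu); lra|]. rewrite ET.
            have kp : 0 <= INR k * PI. destruct Hk as [Hk|Hk]; [|lra]. have h1 := le_INR _ _ Hk. simpl in h1. have : 1 * PI <= INR k * PI. destruct Hsg; lra.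
          - rewrite ET. obv. }
        unfold M3. lra.
  - intros h. have n3p : 0 < n3 * p.
    have ET : T = sg - PI/4 by (unfold T; destruct (Rle_dec (nu + Rpower nu (1/3 + eps)) (r * x)); [lra|]; destruct (Rle_dec (r * x) (nu - Rpower nu (1/3 + eps))); [auto|lra]).
    rewrite Sc in h. destruct (HB nu A k x ok HA Hz ok) as [E E'].
    apply Rle_trans with (Dl * n3); [|pos]. unfold e. rewrite ET. apply HIl; auto; try lra.
    + now apply (zero_beyond r R' hr hrR nu A d k).
    + apply Rle_trans with (L * (r * x)); [unfold L; turn (R'/r * (r * x)) into (R' * x); auto|pos].
    + apply Rabs_le. destruct Hsg; lra.
    + destruct Hk as [Hk|Hk]; [have h1 := le_INR _ _ Hk; simpl in h1; have : 1 * PI <= INR k * PI; destruct Hsg; lra|].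
      obv.
Qed.
End Main.

(** * Translation into the functions [psi_1], [psi_2] and the theorem *)

Lemma Tz_psi1 beta1 z : Tz 0 beta1 z = - (PI * psi1 beta1 z).
Proof. have P := PI_RGT_0. unfold Tz, psi1. field. lra. Qed.

Lemma Tz_psi2 beta2 z : Tz (PI/2) beta2 z = PI * psi2 beta2 z.
Proof. have P := PI_RGT_0. unfold Tz, psi2. field. lra. Qed.

Theorem theorem2p20 (r R' : R) (hr : 0 < r) (hrR : r < R')
    (beta1 beta2 : R -> R) (hbeta1 : is_beta1 beta1) (hbeta2 : is_beta2 beta2) :
  (* (I) *)
  (exists c : R, 0 < c < 1 /\
    forall eps : R, 0 < eps ->
    exists V : nat, (0 < V)%nat /\
    exists M : R, 0 < M /\
      (forall nu : R, INR V < nu ->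
       forall x : nat -> R, lists_positive_zeros (frak_f r R' nu) 1 x ->
       forall k : nat, (1 <= k)%nat ->
       exists Rem : R,
         x k = F r R' nu (INR k - tau (psi1 beta1) r nu eps (x k)) + Rem /\
         ((1 + c) * nu <= r * x k ->
            Rabs Rem <= M * / (nu + INR k)) /\
         (nu + Rpower nu (1/3 + eps) <= r * x k < (1 + c) * nu ->
            0 < INR k - G r R' r / r * nu /\
            Rabs Rem <= M * (Rpower nu (1/2)
                             * Rpower (INR k - G r R' r / r * nu) (- (3/2)))) /\
         (nu - Rpower nu (1/3 + eps) < r * x k < nu + Rpower nu (1/3 + eps) ->
            Rabs Rem <= M * Rpower nu (- (2/3) + 3 * eps)) /\
         (r * x k <= nu - Rpower nu (1/3 + eps) ->
            Rabs Rem <= M * (Rpower nu (1/3) * Rpower (INR k) (- (4/3))))) /\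
      (forall nu : R, 0 <= nu <= INR V ->
       exists K : nat, (0 < K)%nat /\
       forall x : nat -> R, lists_positive_zeros (frak_f r R' nu) 1 x ->
       forall k : nat, (K < k)%nat ->
       exists Rem : R,
         x k = F r R' nu (INR k) + Rem /\
         Rabs Rem <= M * / (nu + INR k)))
  /\
  (* (II) *)
  (forall delta : R,
   exists c : R, 0 < c < 1 /\
    forall eps : R, 0 < eps ->
    exists V : nat, Rabs delta < INR V /\
    exists M : R, 0 < M /\
      (forall nu : R, INR V < nu ->
       forall x : nat -> R,
       lists_positive_zeros (frak_h r R' nu delta) (h_first_index nu delta) x ->
       forall k : nat, (h_first_index nu delta <= k)%nat ->
       exists Rem : R,
         x k = F r R' nu (INR k + tau (psi2 beta2) r nu eps (x k)) + Rem /\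
         ((1 + c) * nu <= r * x k ->
            Rabs Rem <= M * / (nu + INR k)) /\
         (nu + Rpower nu (1/3 + eps) <= r * x k < (1 + c) * nu ->
            0 < INR k - G r R' r / r * nu /\
            Rabs Rem <= M * (Rpower nu (1/2)
                             * Rpower (INR k - G r R' r / r * nu) (- (3/2)))) /\
         (nu - Rpower nu (1/3 + eps) < r * x k < nu + Rpower nu (1/3 + eps) ->
            Rabs Rem <= M * Rpower nu (- (2/3) + 3 * eps)) /\
         (r * x k <= nu - Rpower nu (1/3 + eps) ->
            Rabs Rem <= M * (Rpower nu (1/3) / Rpower (INR k + 1) (4/3)
                             + Rpower nu (- (1/3) - eps / 2)
                               / Rpower (INR k + 1) (1/3)))) /\
      (forall nu : R, Rabs delta <= nu <= INR V ->
       exists K : nat, (0 < K)%nat /\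
       forall x : nat -> R,
       lists_positive_zeros (frak_h r R' nu delta) (h_first_index nu delta) x ->
       forall k : nat, (K < k)%nat ->
       exists Rem : R,
         x k = F r R' nu (INR k) + Rem /\
         Rabs Rem <= M * / (nu + INR k))).
Proof.
  have P := PI_RGT_0. have O1 := beta1_outcome beta1 hbeta1. have O2 := beta2_outcome beta2 hbeta2.
  have As := asymptotics r R' hr hrR beta1 beta2. specialize (fun be sg d => As be sg d O1 O2 (proj1 (proj2 hbeta1)) (proj1 (proj2 hbeta2))) as As.
  split.
  - exists (1/2). split; [lra|]. intros eps Heps.
    destruct (As beta1 0 0 ok O1 eps Heps) as (V & M & HV & HM & H). destruct (INR_unbounded V) as [N HN].
    destruct (asymptotics_bounded r R' hr hrR N 0) as (M' & HM' & HK).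
    exists N. split; [apply INR_lt; simpl; lra|]. exists (M + M'). split; [lra|].
    have up : forall t, 0 <= t -> M * t <= (M + M') * t /\ M' * t <= (M + M') * t.
    have bc0 : tcond 0 0 0 by (left; auto). split.
    + intros nu Hnu x Hx k Hk. have Hz := zero_list_f r R' nu x (conj hr hrR) ok Hx k Hk.
      destruct (H nu 0 k (x k) ok bc0 Hz (or_introl Hk)) as (h1 & h2 & h3 & h4).
      (* [T/PI] is [- tau] branch by branch; with [sg = 0] the recessive shift [sg - PI/4] gives
         [- 1/4]. *)
      match type of h1 with context [F r R' nu ?t] => replace t with (INR k - tau (psi1 beta1) r nu eps (x k)) in * by
        (unfold tau; destruct (Rle_dec _ _); [|destruct (Rle_dec _ _)]; rewrite ?Tz_psi1; field; lra) end.
      exists (x k - F r R' nu (INR k - tau (psi1 beta1) r nu eps (x k))). have k1 := le_INR _ _ Hk. simpl in k1.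
      repeat split.
      * ring.
      * intros q. eapply Rle_trans; [exact (h1 q)|]. apply up. left; apply Rinv_0_lt_compat; lra.
      * now apply h2.
      * eapply Rle_trans; [exact (proj2 (h2 H0))|]. apply up. left; apply Rmult_lt_0_compat; apply exp_pos.
      * intros q. eapply Rle_trans; [exact (h3 q)|]. apply up. left; apply exp_pos.
      (* The common estimate carries [k + 1] so that it includes [k = 0]; for [k >= 1] it is
         weakened to [k]. *)
      * intros q. have h := h4 q. eapply Rle_trans; [|apply (fun t h => proj1 (up t h)); left; apply Rmult_lt_0_compat; apply exp_pos].
        rewrite Rpower_Ropp. have p : 0 < Rpower (INR k) (4/3).
        have pk : Rpower (INR k) (4/3) <= Rpower (INR k + 1) (4/3).
        apply Rmult_le_reg_r with (Rpower (INR k) (4/3)); auto. rewrite <- !Rmult_assoc, (Rmult_assoc _ (/ _)), Rinv_l, Rmult_1_r by lra.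
        eapply Rle_trans; [|exact h]. apply Rmult_le_compat_l; [pos|auto].
    + intros nu Hnu. destruct (HK nu 0 Hnu (tcond_bcond _ _ _ bc0)) as (K & HK0 & HKx). exists K. split; auto. intros x Hx k Hk.
      exists (x k - F r R' nu (INR k)). split; [ring|]. have Hz := zero_list_f r R' nu x (conj hr hrR) ok Hx k ok.
      eapply Rle_trans; [exact (HKx k (x k) Hz Hk)|]. apply up. left; apply Rinv_0_lt_compat.
      have : 0 < INR k. lra.
  - intros delta. exists (1/2). split; [lra|]. intros eps Heps. destruct (arccot_exists delta) as (A & HA & A0 & HA').
    destruct (As beta2 (PI/2) delta ok O2 eps Heps) as (V & M & HV & HM & H). have dp := Rabs_pos delta. destruct (INR_unbounded (V + Rabs delta)) as [N HN].
    destruct (asymptotics_bounded r R' hr hrR N delta) as (M' & HM' & HK).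
    exists N. split; [lra|]. exists (M + M'). split; [lra|].
    have up : forall t, 0 <= t -> M * t <= (M + M') * t /\ M' * t <= (M + M') * t.
    have bc0 : tcond A (PI/2) delta by (right; auto). split.
    + intros nu Hnu x Hx k Hk. have Hz := zero_list_h r R' nu delta A x (conj hr hrR) ok A0 HA' Hx k Hk.
      destruct (H nu A k (x k) ok bc0 Hz (or_intror eq_refl)) as (h1 & h2 & h3 & h4).
      (* With [sg = PI/2] the recessive shift is [PI/2 - PI/4], which is where [+ 1/4] comes
         from. *)
      match type of h1 with context [F r R' nu ?t] => replace t with (INR k + tau (psi2 beta2) r nu eps (x k)) in * by
        (unfold tau; destruct (Rle_dec _ _); [|destruct (Rle_dec _ _)]; rewrite ?Tz_psi2; field; lra) end.
      exists (x k - F r R' nu (INR k + tau (psi2 beta2) r nu eps (x k))). have k0 := pos_INR k.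
      repeat split.
      * ring.
      * intros q. eapply Rle_trans; [exact (h1 q)|]. apply up. left; apply Rinv_0_lt_compat; lra.
      * now apply h2.
      * eapply Rle_trans; [exact (proj2 (h2 H0))|]. apply up. left; apply Rmult_lt_0_compat; apply exp_pos.
      * intros q. eapply Rle_trans; [exact (h3 q)|]. apply up. left; apply exp_pos.
      * intros q. have h := h4 q. have p : 0 < Rpower (INR k + 1) (4/3).
        apply Rle_trans with (M * (Rpower nu (1/3)/Rpower (INR k + 1) (4/3))).
        { apply Rmult_le_reg_r with (Rpower (INR k + 1) (4/3)); auto. unfold Rdiv. rewrite <- !Rmult_assoc, (Rmult_assoc _ (/ _)), Rinv_l, Rmult_1_r by lra. exact h. }
        have s1 : 0 < Rpower nu (1/3)/Rpower (INR k + 1) (4/3).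
        have s2 : 0 < Rpower nu (- (1/3) - eps/2)/Rpower (INR k + 1) (1/3).
        apply Rmult_le_compat; lra.
    + intros nu Hnu. destruct (HK nu A ok HA) as (K & HK0 & HKx). exists K. split; auto. intros x Hx k Hk.
      exists (x k - F r R' nu (INR k)). split; [ring|].
      have Hk' : (h_first_index nu delta <= k)%nat by (unfold h_first_index; destruct (Req_EM_T _ _); lia).
      have Hz := zero_list_h r R' nu delta A x (conj hr hrR) ok A0 HA' Hx k Hk'.
      eapply Rle_trans; [exact (HKx k (x k) Hz Hk)|]. obv.
Qed.
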